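(* Let $\omega>0$, $l\in\mathbb Z_{\ge0}$, and for $\mu>0$ set $(B,A)=(\omega l,2\omega\mu)$. Let $Q=\hat W_-^{-1}W_+M_N=\begin{pmatrix}-a&b\\-c&a\end{pmatrix}$ be the transition matrix. Then for every $\mu>0$ one has $b=b(B,A)\in i\mathbb R$, and $c=c(B,A)\in i\mathbb R$ whenever $(B,A)$ is a constriction. Moreover, for $l\in\mathbb N$ the set of $\mu>0$ for which $c(B,A)\in i\mathbb R$ is discrete.
   Context: System (L): $u'=z^{-2}\big(-(lz+\mu(1+z^2))u+\frac{z}{2i\omega}v\big)$, $v'=\frac{1}{2i\omega z}u$, with $l=B/\omega$, $\mu=A/(2\omega)$. $F(z)=\operatorname{diag}(z^{-l}e^{\mu(1/z-z)},1)$; $S_\pm$ sectors with vertex $0$ containing the closed upper/lower half-plane minus $0$, closures avoiding $i\mathbb R_\mp$, $S_-=\overline{S_+}$; $H_\pm$ the unique invertible matrix functions holomorphic on $S_\pm$, $C^\infty$ on $\overline{S_\pm}\setminus\{\infty\}$, $H_\pm(0)=\mathrm{Id}$, transforming (L) into $\tilde u'=-z^{-2}(lz+\mu(1+z^2))\tilde u$, $\tilde v'=0$; $W_+=H_+F$. $\Sigma_1$ is the component of $S_+\cap S_-$ containing $\mathbb R_+$; $M_N=\operatorname{diag}(e^{-2\pi il},1)$ (equal to $\mathrm{Id}$ for $l\in\mathbb Z$); $\mathbb I:(u,v)(z)\mapsto -iz^{-l}e^{\mu(1/z-z)}(-v(z^{-1}),u(z^{-1}))$; $\hat W_-=\mathbb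 I(W_+M_N)$ columnwise; $Q$ is the constant matrix with $W_+M_N=\hat W_-Q$ on $\Sigma_1$ (known to have the displayed form). Constriction: for $\frac{d\phi}{dt}=-\sin\phi+B+A\cos\omega t$ with rotation number $\rho$, the phase-lock areas $L_r=\{\rho=r\}$ (nonempty interior) are chains of bounded domains going to infinity vertically, consecutive domains separated by single points; such points off $\{A=0\}$ are constrictions. *)

(* Defs.v *)
From Stdlib Require Import Reals Lra.
From Coquelicot Require Import Coquelicot.
Open Scope R_scope.

Definition cexp (z : C) : C := (exp (fst z) * cos (snd z), exp (fst z) * sin (snd z)).
Definition polar (r th : R) : C := (r * cos th, r * sin th).

Record mat2 := Mat2 { m11 : C; m12 : C; m21 : C; m22 : C }.
Definition mmul (M N : mat2) : mat2 :=
  Mat2 (Cplus (Cmult (m11 M) (m11 N)) (Cmult (m12 M) (m21 N)))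
       (Cplus (Cmult (m11 M) (m12 N)) (Cmult (m12 M) (m22 N)))
       (Cplus (Cmult (m21 M) (m11 N)) (Cmult (m22 M) (m21 N)))
       (Cplus (Cmult (m21 M) (m12 N)) (Cmult (m22 M) (m22 N))).
Definition msub (M N : mat2) : mat2 :=
  Mat2 (Cminus (m11 M) (m11 N)) (Cminus (m12 M) (m12 N))
       (Cminus (m21 M) (m21 N)) (Cminus (m22 M) (m22 N)).
Definition mdet (M : mat2) : C := Cminus (Cmult (m11 M) (m22 M)) (Cmult (m12 M) (m21 M)).
Definition mId : mat2 := Mat2 (RtoC 1) (RtoC 0) (RtoC 0) (RtoC 1).

Definition mat_is_derive (H : C -> mat2) (z : C) (D : mat2) : Prop :=
  @is_derive C_AbsRing C_NormedModule (fun w => m11 (H w)) z (m11 D) /\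
  @is_derive C_AbsRing C_NormedModule (fun w => m12 (H w)) z (m12 D) /\
  @is_derive C_AbsRing C_NormedModule (fun w => m21 (H w)) z (m21 D) /\
  @is_derive C_AbsRing C_NormedModule (fun w => m22 (H w)) z (m22 D).

Definition mat_continuous_within (S : C -> Prop) (H : C -> mat2) (z : C) : Prop :=
  filterlim (fun w => m11 (H w)) (within S (locally z)) (locally (m11 (H z))) /\
  filterlim (fun w => m12 (H w)) (within S (locally z)) (locally (m12 (H z))) /\
  filterlim (fun w => m21 (H w)) (within S (locally z)) (locally (m21 (H z))) /\
  filterlim (fun w => m22 (H w)) (within S (locally z)) (locally (m22 (H z))).

(* ---------- the sector S_+ and Sigma_1 ----------
   A sector with vertex 0 containing the closed upper half-plane minus 0 and
   whose closure avoids the negative imaginary axis is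
   S_+ = { r e^{i th} : r > 0, alpha < th < beta } with
   -pi/2 < alpha < 0 and pi < beta < 3pi/2.  S_- is its complex conjugate. *)
Definition sector_params (alpha beta : R) : Prop :=
  - (PI / 2) < alpha < 0 /\ PI < beta < 3 * PI / 2.
Definition Splus (alpha beta : R) (z : C) : Prop :=
  exists r th, 0 < r /\ alpha < th < beta /\ z = polar r th.
Definition Splus_closure (alpha beta : R) (z : C) : Prop :=
  z = RtoC 0 \/ exists r th, 0 < r /\ alpha <= th <= beta /\ z = polar r th.
(* Sigma_1: the component of S_+ ∩ S_- containing R_+ *)
Definition Sigma1 (alpha : R) (z : C) : Prop :=
  exists r th, 0 < r /\ alpha < th < - alpha /\ z = polar r th.

Definition Cl (l : nat) : C := RtoC (INR l).
Definition Cmu (mu : R) : C := RtoC mu.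
Definition diag_coef (l : nat) (mu : R) (z : C) : C :=
  Cmult (Copp (Cplus (Cmult (Cl l) z) (Cmult (Cmu mu) (Cplus (RtoC 1) (Cmult z z)))))
        (Cinv (Cmult z z)).
Definition AL (omega : R) (l : nat) (mu : R) (z : C) : mat2 :=
  Mat2 (diag_coef l mu z)
       (Cmult (Cinv (Cmult z z)) (Cmult z (Cinv (Cmult (RtoC 2) (Cmult Ci (RtoC omega))))))
       (Cinv (Cmult (Cmult (RtoC 2) (Cmult Ci (RtoC omega))) z))
       (RtoC 0).
Definition AD (l : nat) (mu : R) (z : C) : mat2 :=
  Mat2 (diag_coef l mu z) (RtoC 0) (RtoC 0) (RtoC 0).
Definition fsc (l : nat) (mu : R) (z : C) : C :=
  Cmult (Cinv (Cpow z l)) (cexp (Cmult (Cmu mu) (Cminus (Cinv z) z))).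
Definition Fmat (l : nat) (mu : R) (z : C) : mat2 :=
  Mat2 (fsc l mu z) (RtoC 0) (RtoC 0) (RtoC 1).

(* H is the sectorial normalization H_+ on S_+ :
   holomorphic on S_+, C^infty on closure(S_+)\{infinity} (all complex
   derivatives extend continuously to the closure), H(0) = Id, invertible,
   and transforms (L) into the diagonal system: H' = AL H - H AD. *)
Definition Hplus (omega : R) (l : nat) (mu alpha beta : R) (H : C -> mat2) : Prop :=
  (exists Dk : nat -> C -> mat2,
      (forall z, Splus_closure alpha beta z -> Dk O z = H z) /\
      (forall k z, Splus alpha beta z -> mat_is_derive (Dk k) z (Dk (S k) z)) /\
      (forall k z, Splus_closure alpha beta z ->
         mat_continuous_within (Splus_closure alpha beta) (Dk k) z)) /\
  H (RtoC 0) = mId /\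
  (forall z, Splus_closure alpha beta z -> mdet (H z) <> RtoC 0) /\
  (forall z, Splus alpha beta z ->
     mat_is_derive H z (msub (mmul (AL omega l mu z) (H z)) (mmul (H z) (AD l mu z)))).

(* W_+ = H_+ F  (M_N = Id since l is an integer) *)
Definition Wplus (l : nat) (mu : R) (H : C -> mat2) (z : C) : mat2 :=
  mmul (H z) (Fmat l mu z).
(* the involution I applied columnwise:
   (u,v)(z) |-> -i z^{-l} e^{mu(1/z - z)} (-v(1/z), u(1/z)) *)
Definition Iop (l : nat) (mu : R) (W : C -> mat2) (z : C) : mat2 :=
  let k := Cmult (Copp Ci) (fsc l mu z) in
  let W' := W (Cinv z) in
  Mat2 (Cmult k (Copp (m21 W'))) (Cmult k (Copp (m22 W')))
       (Cmult k (m11 W')) (Cmult k (m12 W')).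
Definition What_minus (l : nat) (mu : R) (H : C -> mat2) : C -> mat2 :=
  Iop l mu (Wplus l mu H).
Definition transition (l : nat) (mu alpha : R) (H : C -> mat2) (Q : mat2) : Prop :=
  forall z, Sigma1 alpha z -> Wplus l mu H z = mmul (What_minus l mu H z) Q.

(* rho(B,A) = r : the solution phi of dphi/dt = -sin phi + B + A cos(omega t)
   has phi(t)/(omega t) -> r (rotation number of the period-2pi/omega
   Poincare map, normalized by 2pi). *)
Definition rotation_number (omega B A r : R) : Prop :=
  exists phi : R -> R,
    (forall t, is_derive phi t (- sin (phi t) + B + A * cos (omega * t))) /\
    is_lim (fun t => phi t / (omega * t)) p_infty r.
Definition phase_lock (omega r : R) (p : R * R) : Prop :=
  rotation_number omega (fst p) (snd p) r.

Definition near2 (p q : R * R) (e : R) : Prop :=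
  Rabs (fst q - fst p) < e /\ Rabs (snd q - snd p) < e.
Definition interior2 (S : R * R -> Prop) (p : R * R) : Prop :=
  exists e, 0 < e /\ forall q, near2 p q e -> S q.
Definition closure2 (S : R * R -> Prop) (p : R * R) : Prop :=
  forall e, 0 < e -> exists q, S q /\ near2 p q e.
Definition open2 (U : R * R -> Prop) : Prop := forall p, U p -> interior2 U p.
Definition connected2 (S : R * R -> Prop) : Prop :=
  (exists p, S p) /\
  forall U V, open2 U -> open2 V -> (forall p, S p -> U p \/ V p) ->
    (exists p, S p /\ U p) -> (exists p, S p /\ V p) ->
    exists p, S p /\ U p /\ V p.
Definition component2 (S D : R * R -> Prop) : Prop :=
  connected2 D /\ (forall p, D p -> S p) /\
  forall D', connected2 D' -> (forall p, D' p -> S p) ->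
    (forall p, D p -> D' p) -> forall p, D' p -> D p.

(* (B,A) is a constriction: A <> 0, and for some phase-lock area L_r with
   nonempty interior, (B,A) in L_r is the separation point of two distinct
   domains (connected components of the interior of L_r). *)
Definition constriction (omega B A : R) : Prop :=
  A <> 0 /\ exists r,
    (exists p, interior2 (phase_lock omega r) p) /\
    phase_lock omega r (B, A) /\
    exists D1 D2,
      component2 (interior2 (phase_lock omega r)) D1 /\
      component2 (interior2 (phase_lock omega r)) D2 /\
      (exists p, D1 p /\ ~ D2 p) /\
      (forall p, closure2 D1 p /\ closure2 D2 p -> p = (B, A)) /\
      closure2 D1 (B, A) /\ closure2 D2 (B, A).

Definition discrete_pos (X : R -> Prop) : Prop :=
  forall m0, 0 < m0 -> exists e, 0 < e /\
    forall m, X m -> Rabs (m - m0) < e -> m = m0.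

(* Main.v *)
(** Write [h = H_+(1)]. Since the inversion fixes 1 and [det H_+ = 1], the transition matrix is read off
    there: [b = i (h12^2 + h22^2)] and [c = i (h11^2 + h21^2)].

    On the positive axis the second column of [H_+] is [(i * real, real)]: the other components satisfy a
    linear system with decreasing energy and start from 0. Hence [b] is imaginary.

    At a constriction the Poincare map of the Josephson equation is a translation by [2 pi k]. Indeed, if
    it moved some phase differently, monotonicity in [B] would describe the interior of the phase-lock area
    near that point by one inequality, a connected set, and the two domains would coincide; that [r] is an
    integer follows because an elliptic monodromy lets the rotation number strictly increase with [B].
    Lifting phases to the linear system on the unit circle makes its monodromy a scalar with square 1,
    which carries the reality of the first column from the negative axis to 1, so [h11^2 + h21^2] is real.

    For the discreteness, [H_+(1)] depends analytically on [mu] by a Volterra equation along a curve on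
    which [exp (mu / z)] is flat at 0. It remains to see that [Im (h11^2 + h21^2)] is nonzero for
    arbitrarily large [mu]. Stationary phase on the unit circle at [z = i] gives, up to [O(1 / mu)], that
    [h21] is a Fresnel integral times a constant times [exp (- i (l pi / 2 + 2 mu)) / sqrt mu]; a Wronskian
    relation between the columns forces its square to be almost real when [Im (h11^2 + h21^2) = 0],
    which cannot hold both at [mu] and at [mu + pi / 8]. *)

Require Import Defs.
From Stdlib Require Import ZArith Reals Lra Lia Psatz Classical ClassicalEpsilon.
From Coquelicot Require Import Coquelicot.
Open Scope R_scope.

(** * Calculus along a real variable *)

(** The point 0 is an irregular singularity, so [H (RtoC 0) = mId] is no ordinary initial condition.
    Along a path into 0 the diagonal coefficient damps one off-diagonal entry and amplifies the
    other, and only the damped column is pinned down by its limit. On the positive axis this is the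
    second column, hence the direct argument for b. The first column is damped on the negative axis,
    so what is known of it at -1 has to be carried to 1 along the upper half circle. This is how the
    Josephson flow enters, and why the statement on c involves the monodromy.

    In the elliptic case the disc automorphism that sends the Floquet ratio v/u to 0 turns the phase
    flow into a rotation whose speed does not depend on the phase; raising B adds a term bounded
    below.

    For large mu the argument compares sizes. The entry h21 is of order mu^(-1/2), while the
    Wronskian relation makes Im h11 of order mu^(-3/2). If the sum of squares is real, Im (h21^2) is
    therefore smaller than the scale 1/mu of h21^2 by a factor sqrt mu. The shift pi/8 is a quarter
    turn of the squared phase exp (- 4 i mu). *)

Lemma is_derive_eps (f : R -> R) (x d : R) :
  (forall e, 0 < e -> exists del, 0 < del /\ forall y, Rabs (y - x) < del ->
     Rabs (f y - f x - (y - x) * d) <= e * Rabs (y - x)) ->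
  is_derive f x d.
Proof.
  intros Hf. apply is_derive_Reals. intros eps Heps.
  destruct (Hf (eps / 2)) as [del [Hdel Hb]]; [lra|].
  exists (mkposreal del Hdel). intros h Hh Hlt. simpl in Hlt.
  specialize (Hb (x + h)).
  replace (x + h - x) with h in Hb by ring. specialize (Hb Hlt).
  assert (Hp : 0 < Rabs h) by (apply Rabs_pos_lt; exact Hh).
  replace ((f (x + h) - f x) / h - d) with ((f (x + h) - f x - h * d) / h)
    by (field; exact Hh).
  unfold Rdiv. rewrite Rabs_mult, Rabs_inv.
  apply Rle_lt_trans with (eps / 2 * Rabs h * / Rabs h).
  - apply Rmult_le_compat_r; [left; apply Rinv_0_lt_compat, Hp|exact Hb].
  - rewrite Rmult_assoc, Rinv_r by lra. lra.
Qed.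

Lemma derive_eps (f : R -> R) (x d : R) :
  is_derive f x d ->
  forall e, 0 < e -> exists del, 0 < del /\ forall y, Rabs (y - x) < del ->
     Rabs (f y - f x - (y - x) * d) <= e * Rabs (y - x).
Proof.
  intros Hf e He. apply is_derive_Reals in Hf. destruct (Hf e He) as [del Hdel].
  exists del. split; [apply cond_pos|]. intros y Hy.
  destruct (Req_dec y x) as [->|Hne].
  - replace (f x - f x - (x - x) * d) with 0 by ring.
    replace (x - x) with 0 by ring. rewrite Rabs_R0. lra.
  - assert (Hh : y - x <> 0) by lra.
    specialize (Hdel _ Hh Hy). replace (x + (y - x)) with y in Hdel by ring.
    assert (Hp : 0 < Rabs (y - x)) by (apply Rabs_pos_lt; exact Hh).
    replace (f y - f x - (y - x) * d) with (((f y - f x) / (y - x) - d) * (y - x))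
      by (field; exact Hh).
    rewrite Rabs_mult. apply Rmult_le_compat_r; lra.
Qed.

Lemma is_derive_Rplus (f g : R -> R) (x a b : R) :
  is_derive f x a -> is_derive g x b -> is_derive (fun t => f t + g t) x (a + b).
Proof. exact (is_derive_plus f g x a b). Qed.

Lemma is_derive_Rminus (f g : R -> R) (x a b : R) :
  is_derive f x a -> is_derive g x b -> is_derive (fun t => f t - g t) x (a - b).
Proof. exact (is_derive_minus f g x a b). Qed.

Lemma is_derive_Ropp (f : R -> R) (x a : R) :
  is_derive f x a -> is_derive (fun t => - f t) x (- a).
Proof. exact (is_derive_opp f x a). Qed.

Lemma is_derive_Rconst (c x : R) : is_derive (fun _ => c) x 0.
Proof. exact (is_derive_const c x). Qed.

Lemma is_derive_Rmult (f g : R -> R) (x a b : R) :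
  is_derive f x a -> is_derive g x b ->
  is_derive (fun t => f t * g t) x (a * g x + f x * b).
Proof. intros F G. apply (is_derive_mult f g x a b F G). intros; apply Rmult_comm. Qed.

Lemma is_derive_Rcomp (f g : R -> R) (x a b : R) :
  is_derive f (g x) a -> is_derive g x b -> is_derive (fun t => f (g t)) x (a * b).
Proof.
  intros F G. rewrite Rmult_comm. exact (is_derive_comp f g x a b F G).
Qed.

Lemma is_derive_eq (f : R -> R) (x a b : R) : is_derive f x a -> a = b -> is_derive f x b.
Proof. intros H <-. exact H. Qed.

Lemma derive_nonneg_incr (f df : R -> R) (a b : R) : a <= b ->
  (forall x, a <= x <= b -> is_derive f x (df x)) ->
  (forall x, a <= x <= b -> 0 <= df x) -> f a <= f b.
Proof.
  intros Hab Hd Hp.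
  destruct (MVT_gen f a b df) as [c [Hc Heq]].
  - intros x Hx. apply Hd. rewrite Rmin_left, Rmax_right in Hx; lra.
  - intros x Hx. rewrite Rmin_left, Rmax_right in Hx by lra.
    apply derivable_continuous_pt. exists (df x). apply is_derive_Reals, Hd, Hx.
  - rewrite Rmin_left, Rmax_right in Hc by lra.
    specialize (Hp c Hc). nra.
Qed.

Lemma derive_nonpos_decr (f df : R -> R) (a b : R) : a <= b ->
  (forall x, a <= x <= b -> is_derive f x (df x)) ->
  (forall x, a <= x <= b -> df x <= 0) -> f b <= f a.
Proof.
  intros Hab Hd Hp.
  enough (- f a <= - f b) by lra.
  apply (derive_nonneg_incr (fun x => - f x) (fun x => - df x)); [exact Hab| |].
  - intros x Hx. apply is_derive_Ropp. apply Hd, Hx.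
  - intros x Hx. specialize (Hp x Hx). lra.
Qed.

Lemma derive_zero_const (f df : R -> R) (a b : R) : a <= b ->
  (forall x, a <= x <= b -> is_derive f x (df x)) ->
  (forall x, a <= x <= b -> df x = 0) -> f a = f b.
Proof.
  intros Hab Hd Hp. apply Rle_antisym.
  - apply (derive_nonneg_incr f df); trivial. intros x Hx. rewrite Hp; lra.
  - apply (derive_nonpos_decr f df); trivial. intros x Hx. rewrite Hp; lra.
Qed.

Lemma derive_le_compare (f g df dg : R -> R) (a b : R) : a <= b ->
  (forall x, a <= x <= b -> is_derive f x (df x)) ->
  (forall x, a <= x <= b -> is_derive g x (dg x)) ->
  (forall x, a <= x <= b -> df x <= dg x) -> f b - f a <= g b - g a.
Proof.
  intros Hab Hf Hg Hle.
  enough (g a - f a <= g b - f b) by lra.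
  apply (derive_nonneg_incr (fun x => g x - f x) (fun x => dg x - df x)); [exact Hab| |].
  - intros x Hx. apply is_derive_Rminus; [apply Hg|apply Hf]; exact Hx.
  - intros x Hx. specialize (Hle x Hx). lra.
Qed.

(** The product of [f] with exp (- k (x - a)) is nonincreasing. The sign of [k] is free, so the same
    lemma serves for growth bounds and for decay. *)
Lemma gronwall_decay (f df : R -> R) (k a b : R) : a <= b ->
  (forall x, a <= x <= b -> is_derive f x (df x)) ->
  (forall x, a <= x <= b -> df x <= k * f x) -> f b <= f a * exp (k * (b - a)).
Proof.
  intros Hab Hd Hle.
  assert (H : f b * exp (- k * (b - a)) <= f a * exp (- k * (a - a))).
  { apply (derive_nonpos_decr (fun x => f x * exp (- k * (x - a)))
      (fun x => (df x - k * f x) * exp (- k * (x - a)))); [exact Hab| |].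
    - intros x Hx. specialize (Hd x Hx).
      assert (He : is_derive (fun x => exp (- k * (x - a))) x (- k * exp (- k * (x - a)))).
      { auto_derive; [trivial|unfold Rminus; ring]. }
      eapply is_derive_eq; [apply (is_derive_Rmult _ _ _ _ _ Hd He)|]. simpl. ring.
    - intros x Hx. specialize (Hle x Hx).
      assert (0 < exp (- k * (x - a))) by apply exp_pos. nra. }
  replace (- k * (a - a)) with 0 in H by ring. rewrite exp_0, Rmult_1_r in H.
  apply (Rmult_le_compat_r (exp (k * (b - a)))) in H; [|left; apply exp_pos].
  rewrite Rmult_assoc, <- exp_plus in H.
  replace (- k * (b - a) + k * (b - a)) with 0 in H by ring.
  rewrite exp_0, Rmult_1_r in H. exact H.
Qed.

(** * One-sided limits at 0 and estimates started from the singular point *)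

Definition lim0 (f : R -> R) (l : R) : Prop :=
  forall e, 0 < e -> exists d, 0 < d /\ forall x, 0 < x < d -> Rabs (f x - l) < e.

Lemma lim0_le (f : R -> R) (l c b : R) : 0 < b -> lim0 f l ->
  (forall x, 0 < x < b -> c <= f x) -> c <= l.
Proof.
  intros Hb Hl Hle. destruct (Rle_lt_dec c l) as [|Hlt]; [assumption|exfalso].
  destruct (Hl (c - l)) as [d [Hd Hx]]; [lra|].
  assert (Hm : 0 < Rmin b d) by (apply Rmin_glb_lt; assumption).
  assert (H1 := Rmin_l b d). assert (H2 := Rmin_r b d).
  specialize (Hx (Rmin b d / 2)). specialize (Hle (Rmin b d / 2)).
  assert (H3 := Hx ltac:(lra)). assert (H4 := Hle ltac:(lra)).
  apply Rabs_def2 in H3. lra.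
Qed.

Lemma lim0_ge (f : R -> R) (l c b : R) : 0 < b -> lim0 f l ->
  (forall x, 0 < x < b -> f x <= c) -> l <= c.
Proof.
  intros Hb Hl Hle. enough (- c <= - l) by lra.
  apply (lim0_le (fun x => - f x) (- l) (- c) b Hb).
  - intros e He. destruct (Hl e He) as [d [Hd Hx]]. exists d. split; [exact Hd|].
    intros x Hxd. replace (- f x - - l) with (- (f x - l)) by ring.
    rewrite Rabs_Ropp. apply Hx, Hxd.
  - intros x Hx. specialize (Hle x Hx). lra.
Qed.

Lemma lim0_bound (f g : R -> R) (l : R) : lim0 g 0 ->
  (exists b, 0 < b /\ forall x, 0 < x < b -> Rabs (f x - l) <= g x) -> lim0 f l.
Proof.
  intros Hg [b [Hb Hle]] e He. destruct (Hg e He) as [d [Hd Hx]].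
  exists (Rmin b d). split; [apply Rmin_glb_lt; assumption|].
  intros x Hx'. assert (H1 := Rmin_l b d). assert (H2 := Rmin_r b d).
  specialize (Hx x ltac:(lra)). specialize (Hle x ltac:(lra)).
  apply Rabs_def2 in Hx. lra.
Qed.

Lemma lim0_ext (f g : R -> R) (l : R) :
  (forall x, 0 < x -> f x = g x) -> lim0 f l -> lim0 g l.
Proof.
  intros He Hf e Hep. destruct (Hf e Hep) as [d [Hd Hx]]. exists d. split; [exact Hd|].
  intros x Hxd. rewrite <- He by lra. apply Hx, Hxd.
Qed.

Lemma lim0_eq (f : R -> R) (l m : R) : lim0 f l -> l = m -> lim0 f m.
Proof. intros H <-. exact H. Qed.

Lemma lim0_const (c : R) : lim0 (fun _ => c) c.
Proof.
  intros e He. exists 1. split; [lra|]. intros x _.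
  replace (c - c) with 0 by ring. rewrite Rabs_R0. exact He.
Qed.

Lemma lim0_plus (f g : R -> R) (l m : R) :
  lim0 f l -> lim0 g m -> lim0 (fun x => f x + g x) (l + m).
Proof.
  intros Hf Hg e He.
  destruct (Hf (e / 2)) as [d1 [H1 Hx1]]; [lra|].
  destruct (Hg (e / 2)) as [d2 [H2 Hx2]]; [lra|].
  exists (Rmin d1 d2). split; [apply Rmin_glb_lt; assumption|].
  intros x Hx. assert (H3 := Rmin_l d1 d2). assert (H4 := Rmin_r d1 d2).
  specialize (Hx1 x ltac:(lra)). specialize (Hx2 x ltac:(lra)).
  apply Rabs_def2 in Hx1. apply Rabs_def2 in Hx2. apply Rabs_def1; lra.
Qed.

Lemma lim0_mult (f g : R -> R) (l m : R) :
  lim0 f l -> lim0 g m -> lim0 (fun x => f x * g x) (l * m).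
Proof.
  intros Hf Hg e He.
  set (K := Rabs l + Rabs m + 1).
  assert (HK : 0 < K) by (unfold K; assert (H1 := Rabs_pos l); assert (H2 := Rabs_pos m); lra).
  set (e' := Rmin 1 (e / (2 * K))).
  assert (He' : 0 < e') by (apply Rmin_glb_lt; [lra|apply Rdiv_lt_0_compat; lra]).
  destruct (Hf e' He') as [d1 [H1 Hx1]]. destruct (Hg e' He') as [d2 [H2 Hx2]].
  exists (Rmin d1 d2). split; [apply Rmin_glb_lt; assumption|].
  intros x Hx. assert (H3 := Rmin_l d1 d2). assert (H4 := Rmin_r d1 d2).
  specialize (Hx1 x ltac:(lra)). specialize (Hx2 x ltac:(lra)).
  replace (f x * g x - l * m) with
    ((f x - l) * (g x - m) + (f x - l) * m + l * (g x - m)) by ring.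
  assert (Hl1 : e' <= 1) by apply Rmin_l.
  assert (Hl2 : e' * (2 * K) <= e).
  { apply Rle_trans with (e / (2 * K) * (2 * K)).
    - apply Rmult_le_compat_r; [lra|apply Rmin_r].
    - right; field; lra. }
  eapply Rle_lt_trans; [apply Rabs_triang|].
  eapply Rle_lt_trans; [apply Rplus_le_compat_r, Rabs_triang|].
  rewrite !Rabs_mult.
  assert (P1 := Rabs_pos (f x - l)). assert (P2 := Rabs_pos (g x - m)).
  assert (P3 := Rabs_pos l). assert (P4 := Rabs_pos m).
  unfold K in Hl2. nra.
Qed.

Lemma lim0_scal (c : R) (f : R -> R) (l : R) :
  lim0 f l -> lim0 (fun x => c * f x) (c * l).
Proof. intros Hf. apply lim0_mult; [apply lim0_const|exact Hf]. Qed.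

Lemma lim0_sq_sum (f g : R -> R) :
  lim0 f 0 -> lim0 g 0 -> lim0 (fun x => f x * f x + g x * g x) 0.
Proof.
  intros Hf Hg. replace 0 with (0 * 0 + 0 * 0) by ring.
  apply lim0_plus; apply lim0_mult; assumption.
Qed.

Lemma lim0_id : lim0 (fun x => x) 0.
Proof.
  intros e He. exists e. split; [exact He|]. intros x Hx.
  rewrite Rminus_0_r, Rabs_pos_eq; lra.
Qed.

Lemma lim0_derive_bound (f df B dB : R -> R) (b : R) : 0 < b ->
  lim0 f 0 ->
  (forall x, 0 < x <= b -> is_derive f x (df x)) ->
  (forall x, 0 < x <= b -> is_derive B x (dB x)) ->
  (forall x, 0 < x <= b -> 0 <= B x) ->
  (forall x, 0 < x <= b -> Rabs (df x) <= dB x) -> Rabs (f b) <= B b.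
Proof.
  intros Hb H0 Hf HB Hpos Hle.
  assert (Hx : forall x, 0 < x < b -> - (B b) <= f b - f x <= B b).
  { intros x Hx.
    assert (H1 : f b - f x <= B b - B x).
    { apply (derive_le_compare f B df dB); [lra| | |].
      - intros t Ht; apply Hf; lra.
      - intros t Ht; apply HB; lra.
      - intros t Ht. specialize (Hle t ltac:(lra)). apply Rabs_le_between in Hle. lra. }
    assert (H2 : (- f b) - (- f x) <= B b - B x).
    { apply (derive_le_compare (fun t => - f t) B (fun t => - df t) dB); [lra| | |].
      - intros t Ht. apply is_derive_Ropp. apply Hf; lra.
      - intros t Ht; apply HB; lra.
      - intros t Ht. specialize (Hle t ltac:(lra)). apply Rabs_le_between in Hle. lra. }
    assert (H3 := Hpos x ltac:(lra)). lra. }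
  assert (Hl : lim0 (fun x => f b - f x) (f b)).
  { apply lim0_ext with (fun x => f b + (-1) * f x); [intros; ring|].
    apply (lim0_eq _ (f b + (-1) * 0)); [|ring].
    apply lim0_plus; [apply lim0_const|apply lim0_scal, H0]. }
  apply Rabs_le. split.
  - apply (lim0_le _ _ _ b Hb Hl). intros x Hx'. apply Hx, Hx'.
  - apply (lim0_ge _ _ _ b Hb Hl). intros x Hx'. apply Hx, Hx'.
Qed.

(** Uniqueness when the initial value 0 is only a limit: the Gronwall factor from t to x is at most
    exp (|k| x), uniformly in t, so letting t tend to 0 leaves nothing. *)
Lemma lim0_gronwall_zero (f df : R -> R) (k : R) :
  lim0 f 0 -> (forall x, 0 < x -> is_derive f x (df x)) ->
  (forall x, 0 < x -> 0 <= f x) ->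
  (forall x, 0 < x -> df x <= k * f x) -> forall x, 0 < x -> f x = 0.
Proof.
  intros H0 Hd Hp Hle x Hx. apply Rle_antisym; [|apply Hp, Hx].
  assert (Hk : forall t, 0 < t < x -> f x <= f t * exp (Rabs k * x)).
  { intros t Ht. eapply Rle_trans.
    - apply (gronwall_decay f df k t x); [lra| |]; intros s Hs; [apply Hd|apply Hle]; lra.
    - apply Rmult_le_compat_l; [apply Hp; lra|].
      assert (Hm : k * (x - t) <= Rabs k * x).
      { assert (H1 := Rle_abs k). assert (H2 := Rabs_pos k). nra. }
      destruct Hm as [Hm|Hm]; [left; apply exp_increasing, Hm|right; rewrite Hm; reflexivity]. }
  apply (lim0_le (fun t => f t * exp (Rabs k * x)) 0 (f x) x Hx); [|exact Hk].
  replace 0 with (0 * exp (Rabs k * x)) by ring.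
  apply lim0_mult; [exact H0|apply lim0_const].
Qed.

(** * Complex-valued functions of a real variable *)

Definition is_cderive (f : R -> C) (x : R) (d : C) : Prop :=
  is_derive (fun t => Re (f t)) x (Re d) /\ is_derive (fun t => Im (f t)) x (Im d).

Lemma is_cderive_const (c : C) (x : R) : is_cderive (fun _ => c) x (RtoC 0).
Proof. split; [exact (is_derive_Rconst (Re c) x)|exact (is_derive_Rconst (Im c) x)]. Qed.

Lemma is_cderive_plus (f g : R -> C) (x : R) (a b : C) :
  is_cderive f x a -> is_cderive g x b ->
  is_cderive (fun t => Cplus (f t) (g t)) x (Cplus a b).
Proof.
  intros [F1 F2] [G1 G2].
  split; [exact (is_derive_plus _ _ _ _ _ F1 G1)|exact (is_derive_plus _ _ _ _ _ F2 G2)].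
Qed.

Lemma is_cderive_opp (f : R -> C) (x : R) (a : C) :
  is_cderive f x a -> is_cderive (fun t => Copp (f t)) x (Copp a).
Proof.
  intros [F1 F2].
  split; [exact (is_derive_opp _ _ _ F1)|exact (is_derive_opp _ _ _ F2)].
Qed.

Lemma is_cderive_minus (f g : R -> C) (x : R) (a b : C) :
  is_cderive f x a -> is_cderive g x b ->
  is_cderive (fun t => Cminus (f t) (g t)) x (Cminus a b).
Proof. intros F G. apply is_cderive_plus; [exact F|apply is_cderive_opp, G]. Qed.

Lemma is_cderive_mult (f g : R -> C) (x : R) (a b : C) :
  is_cderive f x a -> is_cderive g x b ->
  is_cderive (fun t => Cmult (f t) (g t)) x (Cplus (Cmult a (g x)) (Cmult (f x) b)).
Proof.
  intros [F1 F2] [G1 G2]. split; simpl.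
  - evar_last.
    + apply is_derive_Rminus; apply is_derive_Rmult; eassumption.
    + unfold minus, plus, opp, Re, Im; simpl. ring.
  - evar_last.
    + apply is_derive_Rplus; apply is_derive_Rmult; eassumption.
    + unfold plus, Re, Im; simpl. ring.
Qed.

Lemma is_cderive_ext (f g : R -> C) (x : R) (a b : C) :
  (forall t, f t = g t) -> a = b -> is_cderive f x a -> is_cderive g x b.
Proof.
  intros Hfg <- [F1 F2].
  split; eapply is_derive_ext; try eassumption; intros t; simpl; rewrite Hfg; reflexivity.
Qed.

Lemma is_cderive_eq (f : R -> C) (x : R) (a b : C) :
  is_cderive f x a -> a = b -> is_cderive f x b.
Proof. intros H <-. exact H. Qed.

Lemma is_cderive_conj (f : R -> C) (x : R) (a : C) :
  is_cderive f x a -> is_cderive (fun t => Cconj (f t)) x (Cconj a).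
Proof. intros [F1 F2]. split; [exact F1|exact (is_derive_opp _ _ _ F2)]. Qed.

Lemma is_cderive_comp (f : R -> C) (g : R -> R) (x b : R) (a : C) :
  is_cderive f (g x) a -> is_derive g x b ->
  is_cderive (fun t => f (g t)) x (Cmult (RtoC b) a).
Proof.
  intros [F1 F2] G. split.
  - evar_last; [apply (is_derive_comp (fun t => Re (f t)) g); eassumption|].
    unfold scal, Re; simpl. unfold mult; simpl. ring.
  - evar_last; [apply (is_derive_comp (fun t => Im (f t)) g); eassumption|].
    unfold scal, Im; simpl. unfold mult; simpl. ring.
Qed.

Lemma is_cderive_RtoC (g : R -> R) (x b : R) :
  is_derive g x b -> is_cderive (fun t => RtoC (g t)) x (RtoC b).
Proof. intros G. split; [exact G|exact (is_derive_Rconst 0 x)]. Qed.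

Lemma is_cderive_cexp (f : R -> C) (x : R) (a : C) :
  is_cderive f x a -> is_cderive (fun t => cexp (f t)) x (Cmult a (cexp (f x))).
Proof.
  intros [F1 F2]. unfold cexp. split; simpl.
  - evar_last.
    + apply is_derive_Rmult.
      * apply (is_derive_comp exp (fun t => Re (f t))); [apply is_derive_exp|exact F1].
      * apply (is_derive_comp cos (fun t => Im (f t))); [apply is_derive_cos|exact F2].
    + unfold scal, Re, Im; simpl. unfold mult; simpl. ring.
  - evar_last.
    + apply is_derive_Rmult.
      * apply (is_derive_comp exp (fun t => Re (f t))); [apply is_derive_exp|exact F1].
      * apply (is_derive_comp sin (fun t => Im (f t))); [apply is_derive_sin|exact F2].
    + unfold scal, Re, Im; simpl. unfold mult; simpl. ring.
Qed.

Lemma Cmod_le_sum (z : C) : Cmod z <= Rabs (Re z) + Rabs (Im z).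
Proof.
  unfold Cmod, Re, Im.
  assert (H1 := Rabs_pos (fst z)). assert (H2 := Rabs_pos (snd z)).
  apply Rsqr_incr_0_var; [|lra]. rewrite Rsqr_sqrt by nra.
  rewrite <- (pow2_abs (fst z)), <- (pow2_abs (snd z)). unfold Rsqr. nra.
Qed.

Lemma Re_le_Cmod (z : C) : Rabs (Re z) <= Cmod z.
Proof. apply Rle_trans with (2 := Rmax_Cmod z). apply Rmax_l. Qed.

Lemma Im_le_Cmod (z : C) : Rabs (Im z) <= Cmod z.
Proof. apply Rle_trans with (2 := Rmax_Cmod z). apply Rmax_r. Qed.

Lemma Cmod_sqr (z : C) : Cmod z * Cmod z = Re z * Re z + Im z * Im z.
Proof.
  unfold Cmod, Re, Im. rewrite sqrt_sqrt; [ring|nra].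
Qed.

Lemma cderive_zero_const (f df : R -> C) (a b : R) : a <= b ->
  (forall x, a <= x <= b -> is_cderive f x (df x)) ->
  (forall x, a <= x <= b -> df x = RtoC 0) -> f a = f b.
Proof.
  intros Hab Hd Hz. apply injective_projections.
  - apply (derive_zero_const (fun t => Re (f t)) (fun t => Re (df t))); [exact Hab| |].
    + intros x Hx. apply Hd, Hx.
    + intros x Hx. rewrite Hz by exact Hx. reflexivity.
  - apply (derive_zero_const (fun t => Im (f t)) (fun t => Im (df t))); [exact Hab| |].
    + intros x Hx. apply Hd, Hx.
    + intros x Hx. rewrite Hz by exact Hx. reflexivity.
Qed.

(** Real and imaginary parts are estimated separately; the resulting factor 2 recurs in the later
    constants. *)
Lemma cderive_bound (f df : R -> C) (K a b : R) : a <= b ->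
  (forall x, a <= x <= b -> is_cderive f x (df x)) ->
  (forall x, a <= x <= b -> Cmod (df x) <= K) ->
  Cmod (Cminus (f b) (f a)) <= 2 * K * (b - a).
Proof.
  intros Hab Hd Hb.
  assert (Hlin : forall k x, is_derive (fun t => k * t) x k).
  { intros k x. auto_derive; [trivial|ring]. }
  assert (H1 : forall p dp : R -> R,
    (forall x, a <= x <= b -> is_derive p x (dp x)) ->
    (forall x, a <= x <= b -> Rabs (dp x) <= K) -> Rabs (p b - p a) <= K * (b - a)).
  { intros p dp Hp Hk.
    assert (A1 : p b - p a <= K * b - K * a).
    { apply (derive_le_compare p (fun t => K * t) dp (fun _ => K)); [exact Hab|exact Hp| |].
      - intros x _; apply Hlin.
      - intros x Hx. specialize (Hk x Hx). apply Rabs_le_between in Hk. lra. }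
    assert (A2 : - p b - - p a <= K * b - K * a).
    { apply (derive_le_compare (fun t => - p t) (fun t => K * t) (fun t => - dp t) (fun _ => K));
        [exact Hab| | |].
      - intros x Hx. apply is_derive_Ropp. apply Hp, Hx.
      - intros x _; apply Hlin.
      - intros x Hx. specialize (Hk x Hx). apply Rabs_le_between in Hk. lra. }
    apply Rabs_le. lra. }
  eapply Rle_trans; [apply Cmod_le_sum|].
  assert (R1 := H1 (fun t => Re (f t)) (fun t => Re (df t)) (fun x Hx => proj1 (Hd x Hx))
    (fun x Hx => Rle_trans _ _ _ (Re_le_Cmod _) (Hb x Hx))).
  assert (R2 := H1 (fun t => Im (f t)) (fun t => Im (df t)) (fun x Hx => proj2 (Hd x Hx))
    (fun x Hx => Rle_trans _ _ _ (Im_le_Cmod _) (Hb x Hx))).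
  unfold Re, Im in *. simpl. simpl in R1, R2. unfold Rminus in *. lra.
Qed.

Lemma cexp_plus (a b : C) : cexp (Cplus a b) = Cmult (cexp a) (cexp b).
Proof.
  unfold cexp, Cmult, Cplus; simpl. rewrite exp_plus, cos_plus, sin_plus.
  apply injective_projections; simpl; ring.
Qed.

Lemma Cmod_cexp (z : C) : Cmod (cexp z) = exp (Re z).
Proof.
  unfold Cmod, cexp, Re; simpl.
  replace (exp (fst z) * cos (snd z) * (exp (fst z) * cos (snd z) * 1) +
    exp (fst z) * sin (snd z) * (exp (fst z) * sin (snd z) * 1))
    with (exp (fst z) * exp (fst z) * (Rsqr (sin (snd z)) + Rsqr (cos (snd z))))
    by (unfold Rsqr; ring).
  rewrite sin2_cos2, Rmult_1_r. apply sqrt_square. left; apply exp_pos.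
Qed.

Lemma cexp_0 : cexp (RtoC 0) = RtoC 1.
Proof. unfold cexp; simpl. rewrite exp_0, cos_0, sin_0. unfold RtoC. f_equal; ring. Qed.

Lemma cexp_neq_0 (z : C) : cexp z <> RtoC 0.
Proof.
  intros H. assert (H1 := Cmod_cexp z). rewrite H, Cmod_0 in H1.
  assert (H2 := exp_pos (Re z)). lra.
Qed.

(** The bridge from complex differentiability to curves: through it the equation in z becomes an
    ordinary differential equation along any path in the upper half-plane. *)
Lemma is_cderive_chain (f : C -> C) (g : R -> C) (x : R) (D d : C) :
  @is_derive C_AbsRing C_NormedModule f (g x) D -> is_cderive g x d ->
  is_cderive (fun t => f (g t)) x (Cmult D d).
Proof.
  intros [_ Hf] [G1 G2].
  specialize (Hf (g x) (fun P HP => HP)).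
  assert (Hg : forall e, 0 < e -> exists del, 0 < del /\ forall y, Rabs (y - x) < del ->
     Cmod (Cminus (Cminus (g y) (g x)) (Cmult (RtoC (y - x)) d)) <= e * Rabs (y - x)).
  { intros e He.
    destruct (derive_eps _ _ _ G1 (e / 2)) as [d1 [Hd1 K1]]; [lra|].
    destruct (derive_eps _ _ _ G2 (e / 2)) as [d2 [Hd2 K2]]; [lra|].
    exists (Rmin d1 d2). split; [apply Rmin_glb_lt; assumption|].
    intros y Hy. specialize (K1 y ltac:(eapply Rlt_le_trans; [exact Hy|apply Rmin_l])).
    specialize (K2 y ltac:(eapply Rlt_le_trans; [exact Hy|apply Rmin_r])).
    eapply Rle_trans; [apply Cmod_le_sum|].
    unfold Re, Im in *. simpl.
    match goal with |- Rabs ?a + Rabs ?b <= _ =>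
      replace a with (fst (g y) - fst (g x) - (y - x) * fst d) by ring;
      replace b with (snd (g y) - snd (g x) - (y - x) * snd d) by ring end.
    lra. }
  assert (Hdom : forall e : posreal, exists r, 0 < r /\ forall w : C, Cmod (Cminus w (g x)) < r ->
     Cmod (Cminus (Cminus (f w) (f (g x))) (Cmult (Cminus w (g x)) D)) <= e * Cmod (Cminus w (g x))).
  { intros e. specialize (Hf e). destruct Hf as [r Hr].
    exists r. split; [apply cond_pos|]. intros w Hw. apply (Hr w).
    exact Hw. }
  assert (Hall : forall e, 0 < e -> exists del, 0 < del /\ forall y, Rabs (y - x) < del ->
     Cmod (Cminus (Cminus (f (g y)) (f (g x))) (Cmult (RtoC (y - x)) (Cmult D d)))
       <= e * Rabs (y - x)).
  { intros e He.
    assert (Pd := Cmod_ge_0 d). assert (PD := Cmod_ge_0 D).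
    (* The error splits in two halves: the remainder of [f], taken at a displacement of size at most
       |y - x| (|d| + 1), and |D| times the remainder of [g]. *)
    set (e1 := e / (2 * (Cmod d + 1))).
    assert (He1 : 0 < e1) by (apply Rdiv_lt_0_compat; lra).
    assert (He1' : e1 * (Cmod d + 1) = e / 2) by (unfold e1; field; lra).
    destruct (Hdom (mkposreal e1 He1)) as [r [Hr Hw]]. simpl in Hw.
    set (e2 := Rmin 1 (e / (2 * (Cmod D + 1)))).
    assert (He2 : 0 < e2) by (apply Rmin_glb_lt; [lra|apply Rdiv_lt_0_compat; lra]).
    assert (He2' : e2 * (Cmod D + 1) <= e / 2).
    { apply Rle_trans with (e / (2 * (Cmod D + 1)) * (Cmod D + 1)).
      - apply Rmult_le_compat_r; [lra|apply Rmin_r].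
      - right; field; lra. }
    assert (He21 : e2 <= 1) by apply Rmin_l.
    destruct (Hg e2 He2) as [del [Hdel Hy]].
    exists (Rmin del (r / (Cmod d + 1))).
    split; [apply Rmin_glb_lt; [exact Hdel|apply Rdiv_lt_0_compat; lra]|].
    intros y Hyx.
    assert (Hy1 := Hy y ltac:(eapply Rlt_le_trans; [exact Hyx|apply Rmin_l])).
    assert (Hy2 : Rabs (y - x) * (Cmod d + 1) < r).
    { apply Rlt_le_trans with (r / (Cmod d + 1) * (Cmod d + 1)).
      - apply Rmult_lt_compat_r; [lra|]. eapply Rlt_le_trans; [exact Hyx|apply Rmin_r].
      - right; field; lra. }
    assert (Pa := Rabs_pos (y - x)).
    assert (Hgy : Cmod (Cminus (g y) (g x)) <= Rabs (y - x) * (Cmod d + 1)).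
    { replace (Cminus (g y) (g x)) with
        (Cplus (Cminus (Cminus (g y) (g x)) (Cmult (RtoC (y - x)) d)) (Cmult (RtoC (y - x)) d))
        by ring.
      eapply Rle_trans; [apply Cmod_triangle|]. rewrite Cmod_mult, Cmod_R. nra. }
    specialize (Hw (g y) ltac:(lra)).
    replace (Cminus (Cminus (f (g y)) (f (g x))) (Cmult (RtoC (y - x)) (Cmult D d))) with
      (Cplus (Cminus (Cminus (f (g y)) (f (g x))) (Cmult (Cminus (g y) (g x)) D))
         (Cmult D (Cminus (Cminus (g y) (g x)) (Cmult (RtoC (y - x)) d)))) by ring.
    eapply Rle_trans; [apply Cmod_triangle|]. rewrite Cmod_mult. nra. }
  split; apply is_derive_eps; intros e He; destruct (Hall e He) as [del [Hdel Hy]];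
    exists del; (split; [exact Hdel|]); intros y Hyx; (eapply Rle_trans; [|apply Hy, Hyx]).
  - eapply Rle_trans; [|apply Re_le_Cmod]. right. f_equal. unfold Re; simpl. ring.
  - eapply Rle_trans; [|apply Im_le_Cmod]. right. f_equal. unfold Im; simpl. ring.
Qed.

(** * The normalization on the closed upper half-plane *)

(** The argument of z is acos (Re z / |z|), which lies in [0, pi] and hence strictly between [alpha]
    and [beta]. *)
Lemma Splus_upper (alpha beta : R) (z : C) : sector_params alpha beta ->
  0 <= Im z -> z <> RtoC 0 -> Splus alpha beta z.
Proof.
  intros [Ha Hb] Him Hz.
  assert (Hr : 0 < Cmod z) by (apply Cmod_gt_0, Hz).
  assert (Hq : -1 <= Re z / Cmod z <= 1).
  { assert (H1 := Re_le_Cmod z). apply Rabs_le_between in H1.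
    split.
    - apply (Rmult_le_reg_r (Cmod z)); [exact Hr|]. field_simplify; lra.
    - apply (Rmult_le_reg_r (Cmod z)); [exact Hr|]. field_simplify; lra. }
  assert (Hac := acos_bound (Re z / Cmod z)).
  exists (Cmod z), (acos (Re z / Cmod z)). split; [exact Hr|]. split; [lra|].
  unfold polar. rewrite cos_acos by exact Hq. rewrite sin_acos by exact Hq.
  apply injective_projections; simpl.
  - unfold Re. field. lra.
  - assert (Hs : Im z = Cmod z * sqrt (1 - (Re z / Cmod z)²)).
    { rewrite <- (sqrt_square (Cmod z)) at 1 by lra.
      rewrite <- sqrt_mult_alt by nra.
      replace (Cmod z * Cmod z * (1 - (Re z / Cmod z)²)) with (Im z * Im z).
      - symmetry. apply sqrt_square, Him.
      - unfold Rsqr. assert (H1 := Cmod_sqr z).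
        replace (Cmod z * Cmod z * (1 - Re z / Cmod z * (Re z / Cmod z)))
          with (Cmod z * Cmod z - Re z * Re z) by (field; lra). lra. }
    exact Hs.
Qed.

Lemma within_eps (S : C -> Prop) (f : C -> C) (z : C) :
  filterlim f (within S (locally z)) (locally (f z)) ->
  forall e, 0 < e -> exists d, 0 < d /\ forall w, S w -> Cmod (Cminus w z) < d ->
    Cmod (Cminus (f w) (f z)) < e.
Proof.
  intros Hf e He.
  assert (HP : locally (f z) (fun w => Cmod (Cminus w (f z)) < e)).
  { assert (He2 : 0 < e / 2) by lra. exists (mkposreal _ He2). intros w [Hw1 Hw2].
    simpl in Hw1, Hw2. unfold ball, AbsRing_ball, abs, minus, plus, opp in Hw1, Hw2.
    simpl in Hw1, Hw2. eapply Rle_lt_trans; [apply Cmod_le_sum|].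
    unfold Re, Im; simpl. unfold AbsRing_ball, abs, minus, plus, opp in *; simpl in *. lra. }
  destruct (Hf _ HP) as [d Hd]. exists d. split; [apply cond_pos|].
  intros w HS Hw. apply (Hd w); [|exact HS].
  split; simpl; unfold ball; simpl; unfold AbsRing_ball, abs, minus, plus, opp; simpl.
  - eapply Rle_lt_trans; [|exact Hw]. exact (Re_le_Cmod (Cminus w z)).
  - eapply Rle_lt_trans; [|exact Hw]. exact (Im_le_Cmod (Cminus w z)).
Qed.

(** Differentiability is available only away from 0. The mean value estimate is used on the segment
    from t z to z, and the limit at 0 absorbs the remaining piece as t tends to 0. *)
Lemma ray_lipschitz (f D : C -> C) (f0 : C) (M d : R) :
  (forall z, 0 <= Im z -> z <> RtoC 0 -> @is_derive C_AbsRing C_NormedModule f z (D z)) ->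
  (forall z, 0 <= Im z -> z <> RtoC 0 -> Cmod z < d -> Cmod (D z) <= M) ->
  (forall e, 0 < e -> exists r, 0 < r /\ forall w, 0 <= Im w -> w <> RtoC 0 -> Cmod w < r ->
     Cmod (Cminus (f w) f0) < e) ->
  forall z, 0 <= Im z -> z <> RtoC 0 -> Cmod z < d -> Cmod (Cminus (f z) f0) <= 2 * M * Cmod z.
Proof.
  intros Hd Hb Hl z Hz Hz0 Hzd.
  assert (Hr : 0 < Cmod z) by (apply Cmod_gt_0, Hz0).
  assert (Hup : forall t, 0 < t -> 0 <= Im (Cmult (RtoC t) z) /\ Cmult (RtoC t) z <> RtoC 0).
  { intros t Ht. split.
    - unfold Im, RtoC; simpl. unfold Im in Hz. nra.
    - apply Cmult_neq_0; [|exact Hz0]. intros H. apply (f_equal fst) in H. simpl in H. lra. }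
  assert (Hm : forall t, 0 < t -> Cmod (Cmult (RtoC t) z) = t * Cmod z).
  { intros t Ht. rewrite Cmod_mult, Cmod_R, Rabs_pos_eq; lra. }
  apply le_epsilon. intros e He.
  destruct (Hl e He) as [r [Hr0 Hw]].
  set (t := Rmin 1 (r / (2 * Cmod z))).
  assert (Ht0 : 0 < t) by (apply Rmin_glb_lt; [lra|apply Rdiv_lt_0_compat; lra]).
  assert (Ht1 : t <= 1) by apply Rmin_l.
  assert (Htr : t * Cmod z < r).
  { apply Rle_lt_trans with (r / (2 * Cmod z) * Cmod z).
    - apply Rmult_le_compat_r; [lra|apply Rmin_r].
    - replace (r / (2 * Cmod z) * Cmod z) with (r / 2) by (field; lra). lra. }
  assert (H1 : Cmod (Cminus (f (Cmult (RtoC 1) z)) (f (Cmult (RtoC t) z)))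
     <= 2 * (M * Cmod z) * (1 - t)).
  { apply (cderive_bound (fun s => f (Cmult (RtoC s) z))
      (fun s => Cmult (D (Cmult (RtoC s) z)) z)); [exact Ht1| |].
    - intros s Hs. destruct (Hup s ltac:(lra)) as [Hs1 Hs2].
      eapply is_cderive_eq.
      + apply (is_cderive_chain f (fun s => Cmult (RtoC s) z)); [apply Hd; assumption|].
        apply is_cderive_mult; [|apply is_cderive_const].
        apply is_cderive_RtoC, (is_derive_id (K := R_AbsRing)).
      + unfold one; simpl. ring.
    - intros s Hs. destruct (Hup s ltac:(lra)) as [Hs1 Hs2].
      rewrite Cmod_mult. apply Rmult_le_compat_r; [lra|]. apply Hb; trivial.
      rewrite Hm by lra. nra. }
  rewrite Cmult_1_l in H1.
  destruct (Hup t Ht0) as [Hu1 Hu2].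
  specialize (Hw _ Hu1 Hu2). rewrite Hm in Hw by exact Ht0. specialize (Hw Htr).
  replace (Cminus (f z) f0) with
    (Cplus (Cminus (f z) (f (Cmult (RtoC t) z))) (Cminus (f (Cmult (RtoC t) z)) f0)) by ring.
  eapply Rle_trans; [apply Cmod_triangle|].
  assert (HM : 0 <= M).
  { eapply Rle_trans; [apply (Cmod_ge_0 (D z))|]. apply Hb; assumption. }
  assert (0 <= M * Cmod z) by nra. nra.
Qed.

(* What survives of the sectorial normalization on the closed upper half-plane, which lies in
   every admissible sector: the gauge equation away from 0 and a first-order expansion at 0. *)
Record gauge_solution (omega : R) (l : nat) (mu : R) (H : C -> mat2) : Prop := {
  gs_derive : forall z, 0 <= Im z -> z <> RtoC 0 ->
    mat_is_derive H z (msub (mmul (AL omega l mu z) (H z)) (mmul (H z) (AD l mu z)));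
  gs_near0 : exists M d, 0 < M /\ 0 < d /\ forall z, 0 <= Im z -> z <> RtoC 0 -> Cmod z < d ->
    Cmod (Cminus (m11 (H z)) (RtoC 1)) <= M * Cmod z /\
    Cmod (m12 (H z)) <= M * Cmod z /\
    Cmod (m21 (H z)) <= M * Cmod z /\
    Cmod (Cminus (m22 (H z)) (RtoC 1)) <= M * Cmod z }.

(** Continuity of the first derivative [Dk 1] on the closed sector at 0 bounds it near 0, and
    integration along rays turns [H 0 = Id] into a first-order expansion of every entry. *)
Lemma Hplus_gauge_solution (omega : R) (l : nat) (mu alpha beta : R) (H : C -> mat2) :
  sector_params alpha beta -> Hplus omega l mu alpha beta H -> gauge_solution omega l mu H.
Proof.
  intros Hs [[Dk [HD0 [HDd HDc]]] [HI [_ Hode]]].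
  assert (HS : forall z, 0 <= Im z -> z <> RtoC 0 -> Splus alpha beta z)
    by (intros; apply Splus_upper; assumption).
  assert (HSc : forall z, 0 <= Im z -> z <> RtoC 0 -> Splus_closure alpha beta z).
  { intros z Hz Hz0. right. destruct (HS z Hz Hz0) as [r [th [Hr [Hth Heq]]]].
    exists r, th. split; [exact Hr|]. split; [lra|exact Heq]. }
  assert (H0c : Splus_closure alpha beta (RtoC 0)) by (left; reflexivity).
  split; [intros z Hz Hz0; apply Hode, HS; assumption|].
  assert (Hentry : forall m : mat2 -> C,
    (forall z, Splus alpha beta z ->
      @is_derive C_AbsRing C_NormedModule (fun w => m (Dk O w)) z (m (Dk 1%nat z))) ->
    (forall k, filterlim (fun w => m (Dk k w)) (within (Splus_closure alpha beta)
       (locally (RtoC 0))) (locally (m (Dk k (RtoC 0))))) ->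
    exists M d, 0 < M /\ 0 < d /\ forall z, 0 <= Im z -> z <> RtoC 0 -> Cmod z < d ->
      Cmod (Cminus (m (H z)) (m mId)) <= M * Cmod z).
  { intros m Hm1 Hm2.
    destruct (within_eps _ _ _ (Hm2 1%nat) 1 Rlt_0_1) as [d [Hd Hw]].
    set (M := Cmod (m (Dk 1%nat (RtoC 0))) + 1).
    assert (HM : 0 < M) by (unfold M; assert (P := Cmod_ge_0 (m (Dk 1%nat (RtoC 0)))); lra).
    exists (2 * M), d. split; [lra|]. split; [exact Hd|]. intros z Hz Hz0 Hzd.
    rewrite <- (HD0 z) by (apply HSc; assumption).
    apply (ray_lipschitz (fun w => m (Dk O w)) (fun w => m (Dk 1%nat w)) _ M d); trivial.
    - intros w Hw1 Hw2. apply Hm1, HS; assumption.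
    - intros w Hw1 Hw2 Hwd. specialize (Hw w (HSc w Hw1 Hw2)).
      replace (Cminus w (RtoC 0)) with w in Hw by ring. specialize (Hw Hwd).
      replace (m (Dk 1%nat w)) with
        (Cplus (m (Dk 1%nat (RtoC 0))) (Cminus (m (Dk 1%nat w)) (m (Dk 1%nat (RtoC 0))))) by ring.
      eapply Rle_trans; [apply Cmod_triangle|]. unfold M. lra.
    - intros e He. destruct (within_eps _ _ _ (Hm2 O) e He) as [r [Hr Hwr]].
      exists r. split; [exact Hr|]. intros w Hw1 Hw2 Hwd.
      specialize (Hwr w (HSc w Hw1 Hw2)).
      replace (Cminus w (RtoC 0)) with w in Hwr by ring.
      rewrite (HD0 (RtoC 0) H0c), HI in Hwr. apply Hwr, Hwd. }
  assert (Hc := fun k => HDc k (RtoC 0) H0c).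
  destruct (Hentry m11) as [M1 [d1 [HM1 [Hd1 K1]]]];
    [intros z Hz; apply (HDd O z Hz)|intros k; apply (Hc k)|].
  destruct (Hentry m12) as [M2 [d2 [HM2 [Hd2 K2]]]];
    [intros z Hz; apply (HDd O z Hz)|intros k; apply (Hc k)|].
  destruct (Hentry m21) as [M3 [d3 [HM3 [Hd3 K3]]]];
    [intros z Hz; apply (HDd O z Hz)|intros k; apply (Hc k)|].
  destruct (Hentry m22) as [M4 [d4 [HM4 [Hd4 K4]]]];
    [intros z Hz; apply (HDd O z Hz)|intros k; apply (Hc k)|].
  exists (M1 + M2 + M3 + M4), (Rmin (Rmin d1 d2) (Rmin d3 d4)).
  split; [lra|]. split; [repeat apply Rmin_glb_lt; assumption|].
  intros z Hz Hz0 Hzd.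
  assert (A1 := Rmin_l (Rmin d1 d2) (Rmin d3 d4)). assert (A2 := Rmin_r (Rmin d1 d2) (Rmin d3 d4)).
  assert (A3 := Rmin_l d1 d2). assert (A4 := Rmin_r d1 d2).
  assert (A5 := Rmin_l d3 d4). assert (A6 := Rmin_r d3 d4).
  specialize (K1 z Hz Hz0 ltac:(lra)). specialize (K2 z Hz Hz0 ltac:(lra)).
  specialize (K3 z Hz Hz0 ltac:(lra)). specialize (K4 z Hz Hz0 ltac:(lra)).
  assert (P := Cmod_ge_0 z). simpl in K1, K2, K3, K4.
  replace (Cminus (m12 (H z)) (RtoC 0)) with (m12 (H z)) in K2 by ring.
  replace (Cminus (m21 (H z)) (RtoC 0)) with (m21 (H z)) in K3 by ring.
  repeat split; nra.
Qed.

Definition kap (omega : R) : R := / (2 * omega).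

Lemma kap_pos (omega : R) : 0 < omega -> 0 < kap omega.
Proof. intros H. apply Rinv_0_lt_compat. lra. Qed.

(** The coupling 1/(2 i omega), written as -i [kap]. It stays imaginary along the real axis, whereas
    on the unit circle dz/z = i dt turns it into the real number [kap]. *)
Definition Ckap (omega : R) : C := (0, - kap omega).

Lemma Cinv_coupling (omega : R) : 0 < omega ->
  Cinv (Cmult (RtoC 2) (Cmult Ci (RtoC omega))) = Ckap omega.
Proof.
  intros H. unfold Ckap, kap, Cinv, Cmult, Ci, RtoC; simpl.
  apply injective_projections; simpl; field; lra.
Qed.

(** In H' = A H - H D the diagonal coefficient cancels on the diagonal entries and appears with
    opposite signs in [m12] and [m21]. Where one of these is damped the other is amplified, which is
    why the two columns are controlled on different half-axes. *)
Lemma gauge_solution_along (omega : R) (l : nat) (mu : R) (H : C -> mat2) (g : R -> C) (x : R) (d : C) :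
  0 < omega -> gauge_solution omega l mu H -> 0 <= Im (g x) -> g x <> RtoC 0 ->
  is_cderive g x d ->
  let e := Cmult (Ckap omega) (Cmult d (Cinv (g x))) in
  let dc := Cmult (diag_coef l mu (g x)) d in
  is_cderive (fun t => m11 (H (g t))) x (Cmult e (m21 (H (g x)))) /\
  is_cderive (fun t => m12 (H (g t))) x
    (Cplus (Cmult dc (m12 (H (g x)))) (Cmult e (m22 (H (g x))))) /\
  is_cderive (fun t => m21 (H (g t))) x
    (Cminus (Cmult e (m11 (H (g x)))) (Cmult dc (m21 (H (g x))))) /\
  is_cderive (fun t => m22 (H (g t))) x (Cmult e (m12 (H (g x)))).
Proof.
  intros Hom HG Him Hz Hg e dc.
  destruct (gs_derive _ _ _ _ HG (g x) Him Hz) as [D1 [D2 [D3 D4]]].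
  unfold e, dc. clear e dc.
  assert (E2 : Cmult (Cinv (Cmult (g x) (g x))) (Cmult (g x) (Ckap omega)) = Cmult (Ckap omega) (Cinv (g x)))
    by (field; exact Hz).
  assert (E3 : Cinv (Cmult (Cmult (RtoC 2) (Cmult Ci (RtoC omega))) (g x)) = Cmult (Ckap omega) (Cinv (g x))).
  { rewrite <- (Cinv_coupling omega Hom). field. split; [exact Hz|].
    split; [|intros HC; apply (f_equal snd) in HC; simpl in HC; lra].
    intros HC; apply (f_equal fst) in HC; simpl in HC; lra. }
  cbn [msub mmul AL AD m11 m12 m21 m22] in D1, D2, D3, D4.
  rewrite (Cinv_coupling omega Hom), E2 in D1. rewrite (Cinv_coupling omega Hom), E2 in D2.
  rewrite E3 in D3. rewrite E3 in D4.
  split; [|split; [|split]]; eapply is_cderive_eq;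
    [exact (is_cderive_chain (fun w => m11 (H w)) g x _ _ D1 Hg)| |
     exact (is_cderive_chain (fun w => m12 (H w)) g x _ _ D2 Hg)| |
     exact (is_cderive_chain (fun w => m21 (H w)) g x _ _ D3 Hg)| |
     exact (is_cderive_chain (fun w => m22 (H w)) g x _ _ D4 Hg)|]; ring.
Qed.

Lemma lim0_Cmod (f : R -> C) (c : C) (K b : R) : 0 < b ->
  (forall x, 0 < x < b -> Cmod (Cminus (f x) c) <= K * x) ->
  lim0 (fun x => Re (f x)) (Re c) /\ lim0 (fun x => Im (f x)) (Im c).
Proof.
  intros Hb Hf.
  assert (HK : lim0 (fun x => K * x) 0).
  { apply (lim0_eq _ (K * 0)); [apply lim0_scal, lim0_id|ring]. }
  split; apply (lim0_bound _ _ _ HK); exists b; (split; [exact Hb|]); intros x Hx;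
    (eapply Rle_trans; [|apply Hf, Hx]).
  - eapply Rle_trans; [|apply Re_le_Cmod]. right. reflexivity.
  - eapply Rle_trans; [|apply Im_le_Cmod]. right. reflexivity.
Qed.

(** A path that leaves 0 inside the closed upper half-plane. The linear bound on its modulus
    converts the expansion of [H] at 0 into one-sided limits in the parameter. *)
Definition upper_curve (g dg : R -> C) : Prop :=
  (forall x, 0 < x -> 0 <= Im (g x) /\ g x <> RtoC 0 /\ is_cderive g x (dg x)) /\
  exists K b, 0 < K /\ 0 < b /\ forall x, 0 < x < b -> Cmod (g x) <= K * x.

Lemma gauge_near0_curve (omega : R) (l : nat) (mu : R) (H : C -> mat2) (g dg : R -> C) :
  gauge_solution omega l mu H -> upper_curve g dg ->
  exists K b, 0 < K /\ 0 < b /\ forall x, 0 < x < b ->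
    Cmod (Cminus (m11 (H (g x))) (RtoC 1)) <= K * Cmod (g x) /\
    Cmod (m12 (H (g x))) <= K * Cmod (g x) /\
    Cmod (m21 (H (g x))) <= K * Cmod (g x) /\
    Cmod (Cminus (m22 (H (g x))) (RtoC 1)) <= K * Cmod (g x).
Proof.
  intros HG [Hg [K [b [HK [Hb Hgb]]]]].
  destruct (gs_near0 _ _ _ _ HG) as [M [d [HM [Hd Hn]]]].
  exists M, (Rmin b (d / K)). split; [exact HM|].
  split; [apply Rmin_glb_lt; [exact Hb|apply Rdiv_lt_0_compat; lra]|].
  intros x Hx. assert (A1 := Rmin_l b (d / K)). assert (A2 := Rmin_r b (d / K)).
  destruct (Hg x ltac:(lra)) as [H1 [H2 _]]. specialize (Hgb x ltac:(lra)).
  assert (Hxd : K * x < d).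
  { apply Rlt_le_trans with (K * (d / K)); [apply Rmult_lt_compat_l; lra|].
    right; field; lra. }
  apply Hn; trivial. lra.
Qed.

Lemma gauge_lim0 (omega : R) (l : nat) (mu : R) (H : C -> mat2) (g dg : R -> C) :
  gauge_solution omega l mu H -> upper_curve g dg ->
  (lim0 (fun x => Re (m11 (H (g x)))) 1 /\ lim0 (fun x => Im (m11 (H (g x)))) 0) /\
  (lim0 (fun x => Re (m12 (H (g x)))) 0 /\ lim0 (fun x => Im (m12 (H (g x)))) 0) /\
  (lim0 (fun x => Re (m21 (H (g x)))) 0 /\ lim0 (fun x => Im (m21 (H (g x)))) 0) /\
  (lim0 (fun x => Re (m22 (H (g x)))) 1 /\ lim0 (fun x => Im (m22 (H (g x)))) 0).
Proof.
  intros HG Hc.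
  destruct (gauge_near0_curve _ _ _ _ _ _ HG Hc) as [K [b [HK [Hb Hn]]]].
  destruct Hc as [_ [K' [b' [HK' [Hb' Hgb]]]]].
  assert (Hm : 0 < Rmin b b') by (apply Rmin_glb_lt; assumption).
  assert (A1 := Rmin_l b b'). assert (A2 := Rmin_r b b').
  assert (Hz : forall w : C, Cminus w (RtoC 0) = w) by (intros; ring).
  assert (Hup : forall x r, 0 < x < Rmin b b' -> r <= K * Cmod (g x) -> r <= (K * K') * x).
  { intros x r Hx Hr. specialize (Hgb x ltac:(lra)). nra. }
  split; [|split; [|split]].
  - apply (lim0_Cmod (fun x => m11 (H (g x))) (RtoC 1) (K * K') _ Hm).
    intros x Hx. apply Hup; [exact Hx|]. apply Hn; lra.
  - apply (lim0_Cmod (fun x => m12 (H (g x))) (RtoC 0) (K * K') _ Hm).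
    intros x Hx. apply Hup; [exact Hx|]. rewrite Hz. apply Hn; lra.
  - apply (lim0_Cmod (fun x => m21 (H (g x))) (RtoC 0) (K * K') _ Hm).
    intros x Hx. apply Hup; [exact Hx|]. rewrite Hz. apply Hn; lra.
  - apply (lim0_Cmod (fun x => m22 (H (g x))) (RtoC 1) (K * K') _ Hm).
    intros x Hx. apply Hup; [exact Hx|]. apply Hn; lra.
Qed.

Lemma lim0_const_deriv (f : R -> C) (c : C) :
  lim0 (fun x => Re (f x)) (Re c) -> lim0 (fun x => Im (f x)) (Im c) ->
  (forall x, 0 < x -> is_cderive f x (RtoC 0)) -> forall x, 0 < x -> f x = c.
Proof.
  intros H1 H2 Hd x Hx.
  assert (Hc : forall t, 0 < t < x -> f t = f x).
  { intros t Ht. apply (cderive_zero_const f (fun _ => RtoC 0)); [lra| |reflexivity].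
    intros s Hs; apply Hd; lra. }
  apply injective_projections.
  - apply Rle_antisym.
    + apply (lim0_le _ _ _ x Hx H1). intros t Ht. rewrite (Hc t Ht). right; reflexivity.
    + apply (lim0_ge _ _ _ x Hx H1). intros t Ht. rewrite (Hc t Ht). right; reflexivity.
  - apply Rle_antisym.
    + apply (lim0_le _ _ _ x Hx H2). intros t Ht. rewrite (Hc t Ht). right; reflexivity.
    + apply (lim0_ge _ _ _ x Hx H2). intros t Ht. rewrite (Hc t Ht). right; reflexivity.
Qed.

(** The matrices A and D have the same trace, so the determinant is constant along the curve; its
    value is the limit 1 at 0. *)
Lemma gauge_det (omega : R) (l : nat) (mu : R) (H : C -> mat2) (g dg : R -> C) (x : R) :
  0 < omega -> gauge_solution omega l mu H -> upper_curve g dg -> 0 < x ->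
  mdet (H (g x)) = RtoC 1.
Proof.
  intros Hom HG Hc Hx. revert x Hx.
  destruct (gauge_lim0 _ _ _ _ _ _ HG Hc) as [[L1 L2] [[L3 L4] [[L5 L6] [L7 L8]]]].
  apply (lim0_const_deriv (fun x => mdet (H (g x)))).
  - unfold mdet. simpl.
    apply (lim0_ext (fun x => Re (m11 (H (g x))) * Re (m22 (H (g x)))
       + (-1) * (Im (m11 (H (g x))) * Im (m22 (H (g x))))
       + (-1) * (Re (m12 (H (g x))) * Re (m21 (H (g x)))
       + (-1) * (Im (m12 (H (g x))) * Im (m21 (H (g x))))))).
    + intros x _. unfold Re, Im. ring.
    + eapply lim0_eq; [repeat first [apply lim0_plus|apply lim0_scal|apply lim0_mult]; eassumption|].
      ring.
  - unfold mdet. simpl.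
    apply (lim0_ext (fun x => Re (m11 (H (g x))) * Im (m22 (H (g x)))
       + (Im (m11 (H (g x))) * Re (m22 (H (g x))))
       + (-1) * (Re (m12 (H (g x))) * Im (m21 (H (g x)))
       + (Im (m12 (H (g x))) * Re (m21 (H (g x))))))).
    + intros x _. unfold Re, Im. ring.
    + eapply lim0_eq; [repeat first [apply lim0_plus|apply lim0_scal|apply lim0_mult]; eassumption|].
      ring.
  - intros x Hx. destruct (proj1 Hc x Hx) as [H1 [H2 H3]].
    destruct (gauge_solution_along omega l mu H g x (dg x) Hom HG H1 H2 H3) as [D1 [D2 [D3 D4]]].
    unfold mdet. eapply is_cderive_eq.
    + apply is_cderive_minus; apply is_cderive_mult; eassumption.
    + cbv beta; ring.
Qed.

(** * Reality of one column on each real half-axis *)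

Lemma diag_coef_real (l : nat) (mu x : R) : x <> 0 ->
  diag_coef l mu (RtoC x) = RtoC (- (INR l / x + mu * (1 + / (x * x)))).
Proof.
  intros Hx. unfold diag_coef, Cl, Cmu.
  rewrite <- (RtoC_mult x x), <- RtoC_inv by nra.
  apply injective_projections; simpl; field; exact Hx.
Qed.

Lemma real_upper_curve (s : R) : s * s = 1 ->
  upper_curve (fun t => RtoC (s * t)) (fun _ => RtoC s).
Proof.
  intros Hs. assert (Hs0 : s <> 0) by nra. split.
  - intros x Hx. split; [simpl; lra|]. split.
    + intros HC. apply (f_equal fst) in HC. simpl in HC. nra.
    + apply is_cderive_RtoC. auto_derive; [trivial|ring].
  - exists 1, 1. split; [lra|]. split; [lra|]. intros x Hx.
    rewrite Cmod_R, Rabs_mult, (Rabs_pos_eq x) by lra.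
    assert (Ha : Rabs s = 1).
    { apply Rsqr_inj; [apply Rabs_pos|lra|]. rewrite <- Rsqr_abs. unfold Rsqr. lra. }
    rewrite Ha. lra.
Qed.

Lemma gauge_real_axis (omega : R) (l : nat) (mu : R) (H : C -> mat2) (s x : R) :
  0 < omega -> gauge_solution omega l mu H -> s * s = 1 -> 0 < x ->
  let h := fun t => H (RtoC (s * t)) in
  let e : C := (0, - kap omega / x) in
  let D := RtoC (- (INR l / x + s * mu * (1 + / (x * x)))) in
  is_cderive (fun t => m11 (h t)) x (Cmult e (m21 (h x))) /\
  is_cderive (fun t => m12 (h t)) x (Cplus (Cmult D (m12 (h x))) (Cmult e (m22 (h x)))) /\
  is_cderive (fun t => m21 (h t)) x (Cminus (Cmult e (m11 (h x))) (Cmult D (m21 (h x)))) /\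
  is_cderive (fun t => m22 (h t)) x (Cmult e (m12 (h x))).
Proof.
  intros Hom HG Hs Hx h e D.
  destruct (real_upper_curve s Hs) as [Hc _]. destruct (Hc x Hx) as [H1 [H2 H3]].
  destruct (gauge_solution_along omega l mu H _ x _ Hom HG H1 H2 H3) as [D1 [D2 [D3 D4]]].
  assert (Hsx : s * x <> 0) by (intros HC; apply H2; rewrite HC; reflexivity).
  assert (He : Cmult (Ckap omega) (Cmult (RtoC s) (Cinv (RtoC (s * x)))) = e).
  { rewrite <- RtoC_inv by exact Hsx. rewrite <- RtoC_mult. unfold e, Ckap, Cmult, RtoC; simpl.
    assert (Hs0 : s <> 0) by nra.
    apply injective_projections; simpl; field; lra. }
  assert (HD : Cmult (diag_coef l mu (RtoC (s * x))) (RtoC s) = D).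
  { rewrite diag_coef_real by exact Hsx. rewrite <- RtoC_mult. unfold D. f_equal.
    assert (Hs0 : s <> 0) by nra.
    replace (s * x * (s * x)) with (x * x) by (replace (s * x * (s * x)) with (s * s * (x * x)) by ring; rewrite Hs; ring).
    field. lra. }
  rewrite He, HD in *. repeat split; first [apply D1|apply D2|apply D3|apply D4].
Qed.

(* The two coordinates that should vanish have decreasing energy along the axis. *)
Lemma gauge_pos_axis_reality (omega : R) (l : nat) (mu : R) (H : C -> mat2) (x : R) :
  0 < omega -> 0 < mu -> gauge_solution omega l mu H -> 0 < x ->
  Re (m12 (H (RtoC x))) = 0 /\ Im (m22 (H (RtoC x))) = 0.
Proof.
  intros Hom Hmu HG Hx.
  assert (H11 : 1 * 1 = 1) by ring.
  destruct (gauge_lim0 _ _ _ _ _ _ HG (real_upper_curve 1 H11)) as [_ [[L3 _] [_ [_ L8]]]].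
  set (A := fun t => Re (m12 (H (RtoC (1 * t))))).
  set (B := fun t => Im (m22 (H (RtoC (1 * t))))).
  assert (Hz : A x * A x + B x * B x = 0).
  { apply (lim0_gronwall_zero (fun t => A t * A t + B t * B t)
      (fun t => 2 * - (INR l / t + 1 * mu * (1 + / (t * t))) * (A t * A t)) 0);
      [apply lim0_sq_sum; assumption| | | |exact Hx].
    - intros t Ht. destruct (gauge_real_axis omega l mu H 1 t Hom HG H11 Ht) as [_ [D2 [_ D4]]].
      eapply is_derive_eq.
      + exact (is_derive_Rplus _ _ t _ _ (is_derive_Rmult A A t _ _ (proj1 D2) (proj1 D2))
          (is_derive_Rmult B B t _ _ (proj2 D4) (proj2 D4))).
      + unfold A, B, Re, Im; simpl. field. lra.
    - intros t Ht. nra.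
    - intros t Ht. assert (0 <= INR l) by apply pos_INR.
      assert (0 < / (t * t)) by (apply Rinv_0_lt_compat; nra).
      assert (0 <= INR l / t) by (apply Rdiv_le_0_compat; lra).
      assert (0 <= (INR l / t + 1 * mu * (1 + / (t * t)))) by nra. nra. }
  unfold A, B in Hz. rewrite Rmult_1_l in Hz. split; nra.
Qed.

(** On the negative axis it is the first column that is damped. The term l/t spoils monotonicity of
    the energy, but with u = 1/t completing the square gives l u - mu u^2 <= l^2 / (4 mu). The
    growth rate stays bounded, and this is enough for an energy that tends to 0 at 0. *)
Lemma gauge_neg_axis_reality (omega : R) (l : nat) (mu : R) (H : C -> mat2) (y : R) :
  0 < omega -> 0 < mu -> gauge_solution omega l mu H -> 0 < y ->
  Im (m11 (H (RtoC (-1 * y)))) = 0 /\ Re (m21 (H (RtoC (-1 * y)))) = 0.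
Proof.
  intros Hom Hmu HG Hx.
  assert (H11 : -1 * -1 = 1) by ring.
  destruct (gauge_lim0 _ _ _ _ _ _ HG (real_upper_curve (-1) H11)) as [[_ L2] [_ [[L5 _] _]]].
  set (A := fun t => Im (m11 (H (RtoC (-1 * t))))).
  set (B := fun t => Re (m21 (H (RtoC (-1 * t))))).
  assert (Hz : A y * A y + B y * B y = 0).
  { apply (lim0_gronwall_zero (fun t => A t * A t + B t * B t)
      (fun t => 2 * (INR l / t - mu * (1 + / (t * t))) * (B t * B t)) (INR l * INR l / (2 * mu)));
      [apply lim0_sq_sum; assumption| | | |exact Hx].
    - intros t Ht. destruct (gauge_real_axis omega l mu H (-1) t Hom HG H11 Ht) as [D1 [_ [D3 _]]].
      eapply is_derive_eq.
      + exact (is_derive_Rplus _ _ t _ _ (is_derive_Rmult A A t _ _ (proj2 D1) (proj2 D1))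
          (is_derive_Rmult B B t _ _ (proj1 D3) (proj1 D3))).
      + unfold A, B, Re, Im; simpl. field. lra.
    - intros t Ht. nra.
    - intros t Ht.
      assert (Hd : 2 * (INR l / t - mu * (1 + / (t * t))) <= INR l * INR l / (2 * mu)).
      { rewrite Rinv_mult. unfold Rdiv. rewrite Rinv_mult.
        set (u := / t). set (v := / mu).
        assert (Hv : mu * v = 1) by (apply Rinv_r; lra).
        assert (Hv0 : 0 < v) by (apply Rinv_0_lt_compat; lra).
        assert (Hs : 0 <= mu * (u - INR l * v / 2) * (u - INR l * v / 2)).
        { rewrite Rmult_assoc. apply Rmult_le_pos; [lra|]. apply (Rle_0_sqr (u - INR l * v / 2)). }
        assert (E : mu * (u - INR l * v / 2) * (u - INR l * v / 2) =
          mu * u * u - INR l * u * (mu * v) + INR l * INR l * v * (mu * v) / 4) by field.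
        rewrite E, Hv in Hs. lra. }
      assert (0 <= INR l * INR l / (2 * mu)).
      { apply Rdiv_le_0_compat; [|lra]. apply Rmult_le_pos; apply pos_INR. }
      assert (0 <= A t * A t) by nra. assert (0 <= B t * B t) by nra. nra. }
  unfold A, B in Hz. split; nra.
Qed.

(** * Reading the transition matrix at z = 1 *)

Lemma fsc_1 (l : nat) (mu : R) : fsc l mu (RtoC 1) = RtoC 1.
Proof.
  unfold fsc. rewrite Cpow_1_l.
  replace (Cmult (Cmu mu) (Cminus (Cinv (RtoC 1)) (RtoC 1))) with (RtoC 0).
  - rewrite cexp_0. field. 
  - unfold Cmu. field.
Qed.

Lemma Sigma1_1 (alpha : R) : alpha < 0 -> Sigma1 alpha (RtoC 1).
Proof.
  intros Ha. exists 1, 0. split; [lra|]. split; [lra|].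
  unfold polar. rewrite cos_0, sin_0. unfold RtoC. f_equal; ring.
Qed.

(** At z = 1 the scalar factor is 1, and the relation is a linear system for each column of [Q].
    Weighting its two equations by the entries of the same column of [h] cancels the other unknown
    and leaves the wanted entry times det h = 1, up to a factor i or -i. *)
Lemma transition_entries (omega : R) (l : nat) (mu alpha beta : R) (H : C -> mat2) (Q : mat2) :
  0 < omega -> sector_params alpha beta -> gauge_solution omega l mu H ->
  transition l mu alpha H Q ->
  let h := H (RtoC 1) in
  m12 Q = Cmult Ci (Cplus (Cmult (m12 h) (m12 h)) (Cmult (m22 h) (m22 h))) /\
  Copp (m21 Q) = Cmult Ci (Cplus (Cmult (m11 h) (m11 h)) (Cmult (m21 h) (m21 h))).
Proof.
  intros Hom [Ha _] HG HQ h.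
  assert (Hdet : mdet h = RtoC 1).
  { assert (H11 : 1 * 1 = 1) by ring.
    assert (E := gauge_det omega l mu H _ _ 1 Hom HG (real_upper_curve 1 H11) Rlt_0_1).
    cbv beta in E. rewrite Rmult_1_l in E. exact E. }
  specialize (HQ (RtoC 1) (Sigma1_1 alpha (proj2 Ha))).
  unfold What_minus, Iop, Wplus in HQ.
  replace (Cinv (RtoC 1)) with (RtoC 1) in HQ by (field; apply RtoC_neq; lra).
  unfold Fmat in HQ. rewrite fsc_1 in HQ.
  unfold mmul in HQ. cbn [m11 m12 m21 m22] in HQ. fold h in HQ.
  assert (Q1 := f_equal m11 HQ). assert (Q2 := f_equal m12 HQ).
  assert (Q3 := f_equal m21 HQ). assert (Q4 := f_equal m22 HQ).
  cbn [m11 m12 m21 m22] in Q1, Q2, Q3, Q4. unfold mdet in Hdet.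
  split.
  - assert (E : Cplus (Cmult (m12 h) (m12 h)) (Cmult (m22 h) (m22 h)) =
      Copp (Cmult Ci (Cmult (Cminus (Cmult (m11 h) (m22 h)) (Cmult (m12 h) (m21 h))) (m12 Q)))).
    { transitivity (Cplus (Cmult (m12 h) (Cplus (Cmult (m11 h) (RtoC 0)) (Cmult (m12 h) (RtoC 1))))
        (Cmult (m22 h) (Cplus (Cmult (m21 h) (RtoC 0)) (Cmult (m22 h) (RtoC 1))))); [ring|].
      etransitivity; [exact (f_equal2 Cplus (f_equal (Cmult (m12 h)) Q2) (f_equal (Cmult (m22 h)) Q4))|ring]. }
    rewrite E, Hdet. transitivity (Cmult (Copp (Cmult Ci Ci)) (m12 Q)); [|ring].
    replace (Cmult Ci Ci) with (Copp (RtoC 1)); [ring|].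
    apply injective_projections; simpl; ring.
  - assert (E : Cplus (Cmult (m11 h) (m11 h)) (Cmult (m21 h) (m21 h)) =
      Cmult Ci (Cmult (Cminus (Cmult (m11 h) (m22 h)) (Cmult (m12 h) (m21 h))) (m21 Q))).
    { transitivity (Cplus (Cmult (m11 h) (Cplus (Cmult (m11 h) (RtoC 1)) (Cmult (m12 h) (RtoC 0))))
        (Cmult (m21 h) (Cplus (Cmult (m21 h) (RtoC 1)) (Cmult (m22 h) (RtoC 0))))); [ring|].
      etransitivity; [exact (f_equal2 Cplus (f_equal (Cmult (m11 h)) Q1) (f_equal (Cmult (m21 h)) Q3))|ring]. }
    rewrite E, Hdet. transitivity (Cmult (Cmult Ci Ci) (m21 Q)); [|ring].
    replace (Cmult Ci Ci) with (Copp (RtoC 1)); [ring|].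
    apply injective_projections; simpl; ring.
Qed.

(** * The Josephson equation *)

Lemma derive_exp_bound (d dd : R -> R) (a b : R) : 0 <= a -> 0 < b -> d 0 = 0 ->
  (forall t, is_derive d t (dd t)) -> (forall t, Rabs (dd t) <= a * exp (b * Rabs t)) ->
  forall t, Rabs (d t) <= a / b * exp (b * Rabs t).
Proof.
  intros Ha Hb.
  assert (Hpos : forall d dd : R -> R, d 0 = 0 ->
    (forall t, is_derive d t (dd t)) -> (forall t, Rabs (dd t) <= a * exp (b * Rabs t)) ->
    forall t, 0 <= t -> d t <= a / b * exp (b * t)).
  { intros f df H0 Hd Hle t Ht.
    assert (Hc : f t - f 0 <= a / b * exp (b * t) - a / b * exp (b * 0)).
    { apply (derive_le_compare f (fun t => a / b * exp (b * t)) df (fun t => a * exp (b * t)));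
        [exact Ht|intros; apply Hd| |].
      - intros x _. auto_derive; [trivial|field; lra].
      - intros x Hx. specialize (Hle x). rewrite (Rabs_pos_eq x) in Hle by lra.
        apply Rabs_le_between in Hle. lra. }
    rewrite Rmult_0_r, exp_0 in Hc.
    assert (0 <= a / b) by (apply Rdiv_le_0_compat; lra). lra. }
  intros H0 Hd Hle t. apply Rabs_le.
  destruct (Rle_dec 0 t) as [Ht|Ht].
  - rewrite (Rabs_pos_eq t Ht). split; [|apply (Hpos d dd); assumption].
    enough (- d t <= a / b * exp (b * t)) by lra.
    apply (Hpos (fun t => - d t) (fun t => - dd t)); trivial.
    + rewrite H0; ring.
    + intros x; apply is_derive_Ropp, Hd.
    + intros x. rewrite Rabs_Ropp. apply Hle.
  - rewrite (Rabs_left t) by lra.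
    assert (Hn : forall x, is_derive (fun t => d (- t)) x (- dd (- x))).
    { intros x. eapply is_derive_eq; [apply (is_derive_Rcomp d (fun t => - t) x (dd (- x)) (-1))|ring].
      - apply Hd.
      - auto_derive; [trivial|ring]. }
    replace (d t) with (d (- - t)) by (f_equal; ring).
    split.
    + enough (- d (- - t) <= a / b * exp (b * - t)) by lra.
      apply (Hpos (fun t => - d (- t)) (fun t => - - dd (- t))); [|intros x; apply is_derive_Ropp, Hn| |lra].
      * rewrite Ropp_0, H0; ring.
      * intros x. rewrite !Rabs_Ropp. rewrite <- (Rabs_Ropp x). apply Hle.
    + apply (Hpos (fun t => d (- t)) (fun t => - dd (- t))); [|exact Hn| |lra].
      * rewrite Ropp_0; exact H0.
      * intros x. rewrite Rabs_Ropp. rewrite <- (Rabs_Ropp x). apply Hle.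
Qed.

Lemma derive_lipschitz (f df : R -> R) (B : R) :
  (forall t, is_derive f t (df t)) -> (forall t, Rabs (df t) <= B) ->
  forall x y, Rabs (f y - f x) <= B * Rabs (y - x).
Proof.
  intros Hd Hb x y.
  destruct (MVT_gen f x y df) as [c [_ Hc]].
  - intros t _; apply Hd.
  - intros t _. apply derivable_continuous_pt. exists (df t). apply is_derive_Reals, Hd.
  - rewrite Hc, Rabs_mult. apply Rmult_le_compat_r; [apply Rabs_pos|apply Hb].
Qed.

Lemma lipschitz_continuous (f : R -> R) (B : R) :
  (forall x y, Rabs (f y - f x) <= B * Rabs (y - x)) -> forall x, continuous f x.
Proof.
  intros HB x. apply continuity_pt_filterlim. intros e He.
  assert (HB0 : 0 < Rabs B + 1) by (assert (H := Rabs_pos B); lra).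
  exists (e / (Rabs B + 1)). split; [apply Rdiv_lt_0_compat; lra|].
  intros y [_ Hy]. unfold R_dist in *. simpl in *. unfold R_dist in *.
  eapply Rle_lt_trans; [apply HB|].
  assert (Hp := Rabs_pos (y - x)). assert (H1 := Rle_abs B).
  apply Rle_lt_trans with ((Rabs B + 1) * Rabs (y - x)); [nra|].
  apply Rlt_le_trans with ((Rabs B + 1) * (e / (Rabs B + 1))).
  - apply Rmult_lt_compat_l; assumption.
  - right; field; lra.
Qed.

Lemma primitive_derive (f : R -> R) (x0 : R) : (forall t, continuous f t) ->
  forall t, is_derive (fun t => x0 + RInt f 0 t) t (f t).
Proof.
  intros Hc t. eapply is_derive_eq; [apply is_derive_Rplus; [apply is_derive_Rconst|]|apply Rplus_0_l].
  apply (is_derive_RInt f (fun t => RInt f 0 t) 0 t); [|apply Hc].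
  apply filter_forall. intros b. apply (RInt_correct f). apply ex_RInt_continuous.
  intros z _; apply Hc.
Qed.

Fixpoint picard (F : R -> R -> R) (x0 : R) (n : nat) (t : R) : R :=
  match n with
  | O => x0
  | S k => x0 + RInt (fun s => F s (picard F x0 k s)) 0 t
  end.

Lemma cauchy_lipschitz (F : R -> R -> R) (K B x0 : R) : 0 < K ->
  (forall t x y, Rabs (F t x - F t y) <= K * Rabs (x - y)) ->
  (forall t x, Rabs (F t x) <= B) ->
  (forall phi, (forall t, continuous phi t) -> forall t, continuous (fun s => F s (phi s)) t) ->
  exists phi, phi 0 = x0 /\ forall t, is_derive phi t (F t (phi t)).
Proof.
  intros HK HL HB HF.
  assert (HB0 : 0 <= B) by (eapply Rle_trans; [apply Rabs_pos|apply (HB 0 0)]).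
  assert (Hcont : forall n t, continuous (picard F x0 n) t).
  { induction n as [|n IH]; intros t; [apply continuous_const|].
    apply (ex_derive_continuous (picard F x0 (S n)) t).
    exists (F t (picard F x0 n t)).
    apply (primitive_derive (fun s => F s (picard F x0 n s)) x0). apply HF, IH. }
  assert (Hder : forall n t, is_derive (picard F x0 (S n)) t (F t (picard F x0 n t))).
  { intros n t. apply (primitive_derive (fun s => F s (picard F x0 n s)) x0). apply HF, Hcont. }
  assert (H0 : forall n, picard F x0 n 0 = x0).
  { intros [|n]; [reflexivity|]. simpl. rewrite RInt_point. unfold zero; simpl. ring. }
  (* Bound for the first increment: a derivative of size at most [B] integrates to B/(2K) in the
     weight exp (2 K |t|). *)
  set (D := B / (2 * K)).
  assert (HD : 0 <= D) by (apply Rdiv_le_0_compat; lra).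
  assert (Hdiff : forall n t, Rabs (picard F x0 (S n) t - picard F x0 n t)
     <= D * (/ 2) ^ n * exp (2 * K * Rabs t)).
  { induction n as [|n IH]; intros t.
    - rewrite pow_O, Rmult_1_r.
      apply (derive_exp_bound (fun t => picard F x0 1 t - picard F x0 0 t)
        (fun t => F t x0) B (2 * K)); [exact HB0|lra| | |].
      + rewrite !H0. ring.
      + intros x. eapply is_derive_eq; [apply is_derive_Rminus; [apply Hder|apply is_derive_Rconst]|simpl; ring].
      + intros x. eapply Rle_trans; [apply HB|].
        rewrite <- (Rmult_1_r B) at 1. apply Rmult_le_compat_l; [exact HB0|].
        rewrite <- exp_0. assert (Hx := Rabs_pos x).
        destruct (Req_dec (Rabs x) 0) as [->|Hne]; [rewrite Rmult_0_r; lra|].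
        left. apply exp_increasing. nra.
    - replace (D * (/ 2) ^ S n) with (K * (D * (/ 2) ^ n) / (2 * K)) by (simpl; field; lra).
      apply (derive_exp_bound (fun t => picard F x0 (S (S n)) t - picard F x0 (S n) t)
        (fun t => F t (picard F x0 (S n) t) - F t (picard F x0 n t))); [|lra| | |].
      + apply Rmult_le_pos; [lra|]. apply Rmult_le_pos; [exact HD|]. apply pow_le. lra.
      + rewrite !H0. ring.
      + intros x. apply is_derive_Rminus; apply Hder.
      + intros x. eapply Rle_trans; [apply HL|]. rewrite Rmult_assoc.
        apply Rmult_le_compat_l; [lra|]. apply IH. }
  assert (Hdist : forall k n t, Rabs (picard F x0 (n + k) t - picard F x0 n t)
     <= 2 * D * (/ 2) ^ n * (1 - (/ 2) ^ k) * exp (2 * K * Rabs t)).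
  { induction k as [|k IH]; intros n t.
    - rewrite Nat.add_0_r. unfold Rminus at 1. rewrite Rplus_opp_r, Rabs_R0. simpl. right. ring.
    - rewrite Nat.add_succ_r.
      replace (picard F x0 (S (n + k)) t - picard F x0 n t) with
        ((picard F x0 (S (n + k)) t - picard F x0 (n + k) t) + (picard F x0 (n + k) t - picard F x0 n t)) by ring.
      eapply Rle_trans; [apply Rabs_triang|].
      eapply Rle_trans; [apply Rplus_le_compat; [apply Hdiff|apply IH]|].
      right. rewrite pow_add. simpl. field. }
  assert (Hdist' : forall k n t, Rabs (picard F x0 (n + k) t - picard F x0 n t)
     <= 2 * D * (/ 2) ^ n * exp (2 * K * Rabs t)).
  { intros k n t. eapply Rle_trans; [apply Hdist|].
    apply Rmult_le_compat_r; [left; apply exp_pos|].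
    assert (0 <= (/ 2) ^ k) by (apply pow_le; lra).
    assert (0 <= (/ 2) ^ n) by (apply pow_le; lra).
    assert (0 <= 2 * D * (/ 2) ^ n) by (apply Rmult_le_pos; lra). nra. }
  assert (Hhalf : forall c e, 0 < e -> exists N, forall n, (N <= n)%nat -> c * (/ 2) ^ n < e).
  { intros c e He.
    destruct (pow_lt_1_zero (/ 2) ltac:(rewrite Rabs_pos_eq; lra) (e / (Rabs c + 1))) as [N HN].
    - apply Rdiv_lt_0_compat; [exact He|]. assert (H := Rabs_pos c); lra.
    - exists N. intros n Hn. specialize (HN n Hn).
      assert (Hp : 0 <= (/ 2) ^ n) by (apply pow_le; lra).
      rewrite Rabs_pos_eq in HN by exact Hp.
      assert (Hc := Rle_abs c). assert (Hc0 := Rabs_pos c).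
      apply Rle_lt_trans with ((Rabs c + 1) * (/ 2) ^ n); [nra|].
      apply Rlt_le_trans with ((Rabs c + 1) * (e / (Rabs c + 1))).
      + apply Rmult_lt_compat_l; lra.
      + right; field; lra. }
  assert (Hlim : forall t, exists l : R, is_lim_seq (fun n => picard F x0 n t) l).
  { intros t. apply ex_lim_seq_cauchy_corr. intros e.
    destruct (Hhalf (2 * D * exp (2 * K * Rabs t)) (e / 2)) as [N HN].
    { destruct e as [e He]; simpl; lra. }
    exists N. intros n m Hn Hm.
    assert (Hx : forall n, (N <= n)%nat -> Rabs (picard F x0 n t - picard F x0 N t) < e / 2).
    { intros p Hp. replace p with (N + (p - N))%nat by lia.
      eapply Rle_lt_trans; [apply Hdist'|]. specialize (HN N (Nat.le_refl N)).
      eapply Rle_lt_trans; [|exact HN]. right; ring. }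
    replace (picard F x0 n t - picard F x0 m t) with
      ((picard F x0 n t - picard F x0 N t) - (picard F x0 m t - picard F x0 N t)) by ring.
    assert (A1 := Hx n Hn). assert (A2 := Hx m Hm).
    apply Rabs_def2 in A1. apply Rabs_def2 in A2. apply Rabs_def1; lra. }
  set (phi := fun t => real (Lim_seq (fun n => picard F x0 n t))).
  assert (Hphi : forall t, is_lim_seq (fun n => picard F x0 n t) (phi t)).
  { intros t. destruct (Hlim t) as [l Hl]. unfold phi. rewrite (is_lim_seq_unique _ _ Hl). exact Hl. }
  assert (Herr : forall n t, Rabs (phi t - picard F x0 n t) <= 2 * D * (/ 2) ^ n * exp (2 * K * Rabs t)).
  { intros n t.
    assert (Hl : is_lim_seq (fun k => Rabs (picard F x0 (n + k) t - picard F x0 n t))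
      (Rabs (phi t - picard F x0 n t))).
    { apply (is_lim_seq_abs _ (phi t - picard F x0 n t)).
      apply is_lim_seq_minus'; [|apply is_lim_seq_const].
      apply (is_lim_seq_ext (fun k => picard F x0 (k + n) t)); [intros; f_equal; lia|].
      apply (is_lim_seq_incr_n (fun k => picard F x0 k t)). apply Hphi. }
    exact (is_lim_seq_le _ (fun _ => 2 * D * (/ 2) ^ n * exp (2 * K * Rabs t))
      (Rabs (phi t - picard F x0 n t)) (2 * D * (/ 2) ^ n * exp (2 * K * Rabs t))
      (fun k => Hdist' k n t) Hl (is_lim_seq_const _)). }
  assert (Hlip : forall x y, Rabs (phi y - phi x) <= B * Rabs (y - x)).
  { intros x y.
    assert (Hl : is_lim_seq (fun k => Rabs (picard F x0 k y - picard F x0 k x)) (Rabs (phi y - phi x))).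
    { apply (is_lim_seq_abs _ (phi y - phi x)). apply is_lim_seq_minus'; apply Hphi. }
    apply (is_lim_seq_le (fun k => Rabs (picard F x0 k y - picard F x0 k x)) (fun _ => B * Rabs (y - x))
      (Rabs (phi y - phi x)) (B * Rabs (y - x))); [|exact Hl|apply is_lim_seq_const].
    intros [|k].
    - simpl. unfold Rminus at 1. rewrite Rplus_opp_r, Rabs_R0.
      apply Rmult_le_pos; [exact HB0|apply Rabs_pos].
    - apply (derive_lipschitz _ (fun t => F t (picard F x0 k t))); [apply Hder|intros; apply HB]. }
  assert (Hpc := lipschitz_continuous phi B Hlip).
  assert (HG := primitive_derive (fun s => F s (phi s)) x0 (HF phi Hpc)).
  set (G := fun t => x0 + RInt (fun s => F s (phi s)) 0 t) in HG.
  assert (HG0 : G 0 = x0).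
  { unfold G. rewrite RInt_point. unfold zero; simpl. ring. }
  (* [G] is the Picard image of the limit [phi]. Both are within a multiple of (1/2)^n of the
     iterate n + 1, so they agree and [phi] inherits the derivative of [G]. *)
  assert (HGphi : forall t, G t = phi t).
  { intros t. apply Rminus_diag_uniq. apply cond_eq. intros e He.
    destruct (Hhalf (2 * D * exp (2 * K * Rabs t)) e He) as [n Hn].
    specialize (Hn n (Nat.le_refl n)).
    assert (E1 : Rabs (G t - picard F x0 (S n) t) <= K * (2 * D * (/ 2) ^ n) / (2 * K) * exp (2 * K * Rabs t)).
    { apply (derive_exp_bound (fun t => G t - picard F x0 (S n) t)
        (fun t => F t (phi t) - F t (picard F x0 n t))); [|lra| | |].
      - assert (0 <= (/ 2) ^ n) by (apply pow_le; lra). apply Rmult_le_pos; [lra|].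
        apply Rmult_le_pos; lra.
      - rewrite HG0, H0. ring.
      - intros x. apply is_derive_Rminus; [apply HG|apply Hder].
      - intros x. eapply Rle_trans; [apply HL|]. rewrite Rmult_assoc.
        apply Rmult_le_compat_l; [lra|apply Herr]. }
    assert (E2 := Herr (S n) t).
    replace (G t - phi t - 0) with ((G t - picard F x0 (S n) t) - (phi t - picard F x0 (S n) t)) by ring.
    replace (K * (2 * D * (/ 2) ^ n) / (2 * K)) with (D * (/ 2) ^ n) in E1 by (field; lra).
    simpl pow in E2.
    eapply Rle_lt_trans; [apply Rabs_triang|]. rewrite Rabs_Ropp.
    eapply Rle_lt_trans; [apply Rplus_le_compat; [exact E1|exact E2]|].
    eapply Rle_lt_trans; [|exact Hn]. right; field. }
  exists phi. split; [rewrite <- HGphi; exact HG0|].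
  intros t. eapply is_derive_ext; [exact HGphi|]. apply HG.
Qed.

(* Josephson equation in the rescaled time tau = omega t, with s = 1/omega, L = B/omega, M = A/omega *)
Definition josephson (s L M : R) (phi : R -> R) : Prop :=
  forall t : R, is_derive phi t (- s * sin (phi t) + L + M * cos t).

Lemma sin_lipschitz (x y : R) : Rabs (sin x - sin y) <= Rabs (x - y).
Proof.
  rewrite <- (Rmult_1_l (Rabs (x - y))).
  apply (derive_lipschitz sin cos 1); [apply is_derive_sin|].
  intros t. apply Rabs_le. assert (H := COS_bound t). lra.
Qed.

Lemma josephson_exists (s L M x0 : R) : exists phi, phi 0 = x0 /\ josephson s L M phi.
Proof.
  apply (cauchy_lipschitz (fun t x => - s * sin x + L + M * cos t) (Rabs s + 1)
    (Rabs s + Rabs L + Rabs M)).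
  - assert (H := Rabs_pos s); lra.
  - intros t x y. replace (- s * sin x + L + M * cos t - (- s * sin y + L + M * cos t))
      with (- s * (sin x - sin y)) by ring.
    rewrite Rabs_mult, Rabs_Ropp. assert (H := sin_lipschitz x y).
    assert (H1 := Rabs_pos s). assert (H2 := Rabs_pos (x - y)).
    assert (H3 := Rabs_pos (sin x - sin y)). nra.
  - intros t x. eapply Rle_trans; [apply Rabs_triang|]. apply Rplus_le_compat.
    + eapply Rle_trans; [apply Rabs_triang|]. apply Rplus_le_compat_r.
      rewrite Rabs_mult, Rabs_Ropp. assert (H := SIN_bound x).
      assert (Rabs (sin x) <= 1) by (apply Rabs_le; lra). assert (H1 := Rabs_pos s). nra.
    + rewrite Rabs_mult. assert (H := COS_bound t).
      assert (Rabs (cos t) <= 1) by (apply Rabs_le; lra). assert (H1 := Rabs_pos M). nra.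
  - intros phi Hphi t.
    apply (continuous_plus (fun t => - s * sin (phi t) + L) (fun t => M * cos t)).
    + apply (continuous_plus (fun t => - s * sin (phi t)) (fun _ => L)); [|apply continuous_const].
      apply (continuous_scal_r (- s) (fun t => sin (phi t))).
      apply (continuous_comp phi sin); [apply Hphi|apply continuous_sin].
    + apply (continuous_scal_r M cos). apply continuous_cos.
Qed.

(** Adding the square of the parameter error to the squared difference makes the Gronwall inequality
    homogeneous. The rate 2|s| + 1 comes from the Lipschitz constant of the sine term and from 2 |d|
    eps <= d^2 + eps^2. *)
Lemma josephson_dependence (s L1 M1 L2 M2 : R) (p1 p2 : R -> R) (t : R) :
  josephson s L1 M1 p1 -> josephson s L2 M2 p2 -> 0 <= t ->
  (p1 t - p2 t)^2 <= ((p1 0 - p2 0)^2 + (Rabs (L1 - L2) + Rabs (M1 - M2))^2)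
     * exp ((2 * Rabs s + 1) * t).
Proof.
  intros H1 H2 Ht. set (eps := Rabs (L1 - L2) + Rabs (M1 - M2)).
  assert (He : 0 <= eps).
  { unfold eps. assert (A1 := Rabs_pos (L1 - L2)). assert (A2 := Rabs_pos (M1 - M2)). lra. }
  set (dd := fun x => (- s * sin (p1 x) + L1 + M1 * cos x) - (- s * sin (p2 x) + L2 + M2 * cos x)).
  assert (Hg := gronwall_decay (fun x => (p1 x - p2 x) * (p1 x - p2 x) + eps^2)
    (fun x => 2 * (p1 x - p2 x) * dd x) (2 * Rabs s + 1) 0 t Ht).
  rewrite Rminus_0_r in Hg.
  apply Rle_trans with ((p1 t - p2 t) * (p1 t - p2 t) + eps^2); [nra|].
  replace ((p1 0 - p2 0)^2) with ((p1 0 - p2 0) * (p1 0 - p2 0)) by ring.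
  apply Hg.
  - intros x _. assert (Hd : is_derive (fun x => p1 x - p2 x) x (dd x)).
    { apply is_derive_Rminus; [apply H1|apply H2]. }
    eapply is_derive_eq; [apply is_derive_Rplus; [exact (is_derive_Rmult _ _ _ _ _ Hd Hd)|apply is_derive_Rconst]|].
    cbv beta. ring.
  - intros x _. set (d := p1 x - p2 x).
    assert (Hs : d * dd x <= Rabs s * (d * d) + Rabs d * eps).
    { replace (dd x) with (- s * (sin (p1 x) - sin (p2 x)) + ((L1 - L2) + (M1 - M2) * cos x)) by (unfold dd; ring).
      rewrite Rmult_plus_distr_l. apply Rplus_le_compat.
      - eapply Rle_trans; [apply Rle_abs|]. rewrite !Rabs_mult, Rabs_Ropp.
        assert (A := sin_lipschitz (p1 x) (p2 x)). fold d in A.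
        assert (A1 := Rabs_pos s). assert (A2 := Rabs_pos d).
        replace (d * d) with (Rabs d * Rabs d) by (rewrite <- Rabs_mult; apply Rabs_pos_eq; nra).
        assert (A3 : 0 <= Rabs d * Rabs s) by (apply Rmult_le_pos; assumption).
        nra.
      - eapply Rle_trans; [apply Rle_abs|]. rewrite Rabs_mult.
        apply Rmult_le_compat_l; [apply Rabs_pos|]. unfold eps.
        eapply Rle_trans; [apply Rabs_triang|]. apply Rplus_le_compat_l.
        rewrite Rabs_mult. assert (A := COS_bound x).
        assert (Rabs (cos x) <= 1) by (apply Rabs_le; lra).
        assert (A1 := Rabs_pos (M1 - M2)). nra. }
    assert (Hd2 : Rabs d * Rabs d = d * d) by (rewrite <- Rabs_mult; apply Rabs_pos_eq; nra).
    assert (A2 := Rabs_pos d). assert (A1 := Rabs_pos s).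
    assert (0 <= (Rabs d - eps)^2) by apply pow2_ge_0.
    assert (0 <= Rabs s * eps^2) by (apply Rmult_le_pos; [exact A1|apply pow2_ge_0]).
    nra.
Qed.

Lemma josephson_reverse (s L M : R) (p : R -> R) :
  josephson s L M p -> josephson (- s) (- L) (- M) (fun t => p (- t)).
Proof.
  intros H t. eapply is_derive_eq.
  - apply (is_derive_Rcomp p (fun t => - t) t (- s * sin (p (- t)) + L + M * cos (- t)) (-1)); [apply H|].
    auto_derive; [trivial|ring].
  - cbv beta. rewrite cos_neg. ring.
Qed.

Lemma josephson_unique (s L M : R) (p1 p2 : R -> R) :
  josephson s L M p1 -> josephson s L M p2 -> p1 0 = p2 0 -> forall t, p1 t = p2 t.
Proof.
  assert (Hpos : forall s L M p1 p2, josephson s L M p1 -> josephson s L M p2 -> p1 0 = p2 0 ->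
    forall t, 0 <= t -> p1 t = p2 t).
  { intros s' L' M' q1 q2 H1 H2 H0 t Ht.
    assert (H := josephson_dependence _ _ _ _ _ _ _ t H1 H2 Ht).
    replace ((q1 0 - q2 0) ^ 2 + (Rabs (L' - L') + Rabs (M' - M')) ^ 2) with 0 in H.
    - nra.
    - rewrite H0. replace (L' - L') with 0 by ring. replace (M' - M') with 0 by ring.
      rewrite Rabs_R0. ring. }
  intros H1 H2 H0 t. destruct (Rle_dec 0 t) as [Ht|Ht]; [apply (Hpos s L M); assumption|].
  replace t with (- - t) by ring.
  apply (Hpos _ _ _ _ _ (josephson_reverse _ _ _ _ H1) (josephson_reverse _ _ _ _ H2)); [|lra].
  rewrite Ropp_0. exact H0.
Qed.

(** The squared negative part is differentiable, unlike the negative part itself. Comparison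
    principles then follow from Gronwall, with no discussion of first crossing times. *)
Lemma is_derive_negpart_sq (x : R) : is_derive (fun y => Rmin y 0 * Rmin y 0) x (2 * Rmin x 0).
Proof.
  apply is_derive_eps. intros e He. exists e. split; [exact He|]. intros y Hy.
  apply Rle_trans with (Rabs (y - x) * Rabs (y - x)).
  - rewrite <- Rabs_mult, (Rabs_pos_eq ((y - x) * (y - x))) by apply (Rle_0_sqr (y - x)).
    assert (Hsq := Rle_0_sqr (y - x)). unfold Rsqr in Hsq.
    apply Rabs_le.
    destruct (Rle_lt_dec y 0) as [H1|H1]; destruct (Rle_lt_dec x 0) as [H2|H2];
      [rewrite (Rmin_left y 0), (Rmin_left x 0) by lra
      |rewrite (Rmin_left y 0), (Rmin_right x 0) by lra
      |rewrite (Rmin_right y 0), (Rmin_left x 0) by lra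
      |rewrite (Rmin_right y 0), (Rmin_right x 0) by lra]; split; nra.
  - apply Rmult_le_compat_r; [apply Rabs_pos|lra].
Qed.

Lemma negpart_sq_gronwall (f df : R -> R) (k a b : R) : a <= b ->
  (forall t, a <= t <= b -> is_derive f t (df t)) -> 0 <= f a ->
  (forall t, a <= t <= b -> f t <= 0 -> k * f t <= df t) -> 0 <= f b.
Proof.
  intros Hab Hd Ha Hle.
  assert (H := gronwall_decay (fun t => Rmin (f t) 0 * Rmin (f t) 0)
    (fun t => 2 * Rmin (f t) 0 * df t) (2 * k) a b Hab).
  assert (H' : Rmin (f b) 0 * Rmin (f b) 0 <= Rmin (f a) 0 * Rmin (f a) 0 * exp (2 * k * (b - a))).
  { apply H.
    - intros t Ht. exact (is_derive_Rcomp (fun y => Rmin y 0 * Rmin y 0) f t _ _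
        (is_derive_negpart_sq (f t)) (Hd t Ht)).
    - intros t Ht. destruct (Rle_dec (f t) 0) as [Hf|Hf].
      + rewrite Rmin_left by exact Hf. specialize (Hle t Ht Hf). nra.
      + rewrite Rmin_right by lra. lra. }
  rewrite (Rmin_right (f a) 0) in H' by exact Ha.
  destruct (Rle_dec 0 (f b)) as [|Hf]; [assumption|].
  rewrite Rmin_left in H' by lra. nra.
Qed.

Lemma josephson_compare (s L1 L2 M : R) (p1 p2 : R -> R) (t : R) : 0 < s ->
  josephson s L1 M p1 -> josephson s L2 M p2 -> L1 <= L2 -> p1 0 <= p2 0 -> 0 <= t ->
  p1 t <= p2 t.
Proof.
  intros Hs H1 H2 HL H0 Ht. enough (0 <= p2 t - p1 t) by lra.
  apply (negpart_sq_gronwall (fun x => p2 x - p1 x)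
    (fun x => (- s * sin (p2 x) + L2 + M * cos x) - (- s * sin (p1 x) + L1 + M * cos x)) s 0 t Ht).
  - intros x _. apply is_derive_Rminus; [apply H2|apply H1].
  - lra.
  - intros x _ Hx. assert (A := sin_lipschitz (p2 x) (p1 x)).
    rewrite (Rabs_left1 (p2 x - p1 x)) in A by exact Hx. apply Rabs_le_between in A. nra.
Qed.

(** The difference y = p2 - p1 is nonnegative and satisfies y' >= - s y + (L2 - L1). Hence q - y
    with q = (L2 - L1)/s is contracted by exp (- s t), and y becomes strictly positive. *)
Lemma josephson_compare_strict (s L1 L2 M : R) (p1 p2 : R -> R) (t : R) : 0 < s ->
  josephson s L1 M p1 -> josephson s L2 M p2 -> L1 < L2 -> p1 0 <= p2 0 -> 0 < t ->
  p1 t < p2 t.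
Proof.
  intros Hs H1 H2 HL H0 Ht.
  assert (Hd : forall x, 0 <= x -> p1 x <= p2 x).
  { intros x Hx. apply (josephson_compare s L1 L2 M); trivial. lra. }
  set (q := (L2 - L1) / s).
  assert (Hq : q * s = L2 - L1) by (unfold q; field; lra).
  assert (Hg := gronwall_decay (fun x => q - (p2 x - p1 x))
    (fun x => - ((- s * sin (p2 x) + L2 + M * cos x) - (- s * sin (p1 x) + L1 + M * cos x))) (- s) 0 t ltac:(lra)).
  assert (Hg' : q - (p2 t - p1 t) <= (q - (p2 0 - p1 0)) * exp (- s * (t - 0))).
  { apply Hg.
    - intros x _. eapply is_derive_eq; [apply is_derive_Rminus; [apply is_derive_Rconst|
        apply is_derive_Rminus; [apply H2|apply H1]]|]. ring.
    - intros x Hx. assert (A := sin_lipschitz (p2 x) (p1 x)). specialize (Hd x ltac:(lra)).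
      rewrite (Rabs_pos_eq (p2 x - p1 x)) in A by lra. apply Rabs_le_between in A. nra. }
  assert (Hexp : exp (- s * (t - 0)) < 1).
  { rewrite <- exp_0. apply exp_increasing. nra. }
  assert (Hq0 : 0 < q) by (apply Rdiv_lt_0_compat; lra).
  assert (He0 := exp_pos (- s * (t - 0))). nra.
Qed.

Definition jflow (s L M x : R) : R -> R :=
  proj1_sig (constructive_indefinite_description _ (josephson_exists s L M x)).

Lemma jflow_0 (s L M x : R) : jflow s L M x 0 = x.
Proof. unfold jflow. destruct (constructive_indefinite_description _ _) as [p [H1 H2]]. exact H1. Qed.

Lemma jflow_josephson (s L M x : R) : josephson s L M (jflow s L M x).
Proof. unfold jflow. destruct (constructive_indefinite_description _ _) as [p [H1 H2]]. exact H2. Qed.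

Lemma jflow_unique (s L M : R) (p : R -> R) (t : R) :
  josephson s L M p -> p t = jflow s L M (p 0) t.
Proof.
  intros H. apply (josephson_unique s L M); [exact H|apply jflow_josephson|].
  symmetry; apply jflow_0.
Qed.

(** * The Poincare map and the rotation number *)

Definition poincare (s L M x : R) : R := jflow s L M x (2 * PI).

Lemma cos_periodZ (x : R) (k : Z) : cos (x + 2 * PI * IZR k) = cos x.
Proof.
  assert (Hn : forall n y, cos (y + 2 * PI * INR n) = cos y).
  { intros n y. replace (2 * PI * INR n) with (2 * INR n * PI) by ring. apply cos_period. }
  destruct (Z_le_gt_dec 0 k) as [Hk|Hk].
  - rewrite <- (Z2Nat.id k Hk), <- INR_IZR_INZ. apply Hn.
  - rewrite <- (Hn (Z.to_nat (- k)) (x + 2 * PI * IZR k)). f_equal.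
    rewrite INR_IZR_INZ, Z2Nat.id by lia. rewrite opp_IZR. ring.
Qed.

Lemma sin_periodZ (x : R) (k : Z) : sin (x + 2 * PI * IZR k) = sin x.
Proof.
  rewrite <- (cos_shift x), <- (cos_shift (x + 2 * PI * IZR k)).
  replace (PI / 2 - x) with (PI / 2 - (x + 2 * PI * IZR k) + 2 * PI * IZR k) by ring.
  symmetry. apply cos_periodZ.
Qed.

Lemma josephson_shift_phase (s L M : R) (p : R -> R) (k : Z) :
  josephson s L M p -> josephson s L M (fun t => p t + 2 * PI * IZR k).
Proof.
  intros H t. eapply is_derive_eq; [apply is_derive_Rplus; [apply H|apply is_derive_Rconst]|].
  rewrite sin_periodZ. ring.
Qed.

Lemma josephson_shift_time (s L M : R) (p : R -> R) :
  josephson s L M p -> josephson s L M (fun t => p (t + 2 * PI)).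
Proof.
  intros H t. eapply is_derive_eq.
  - apply (is_derive_Rcomp p (fun t => t + 2 * PI) t
      (- s * sin (p (t + 2 * PI)) + L + M * cos (t + 2 * PI)) 1); [apply H|].
    auto_derive; [trivial|ring].
  - assert (E := cos_periodZ t 1). rewrite Rmult_1_r in E. rewrite E. ring.
Qed.

Lemma poincare_shift (s L M x : R) (k : Z) :
  poincare s L M (x + 2 * PI * IZR k) = poincare s L M x + 2 * PI * IZR k.
Proof.
  unfold poincare.
  assert (H := josephson_shift_phase s L M _ k (jflow_josephson s L M x)).
  rewrite (jflow_unique s L M _ (2 * PI) H). rewrite jflow_0. reflexivity.
Qed.

Lemma josephson_step (s L M : R) (p : R -> R) (t : R) :
  josephson s L M p -> p (t + 2 * PI) = jflow s L M (p (2 * PI)) t.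
Proof.
  intros H. rewrite (jflow_unique s L M _ t (josephson_shift_time s L M p H)).
  rewrite Rplus_0_l. reflexivity.
Qed.

Lemma josephson_iter (s L M : R) (p : R -> R) (n : nat) :
  josephson s L M p -> p (2 * PI * INR (S n)) = poincare s L M (p (2 * PI * INR n)).
Proof.
  revert p. induction n as [|n IH]; intros p H.
  - simpl INR. rewrite Rmult_0_r, Rmult_1_r. apply jflow_unique, H.
  - assert (E := IH _ (josephson_shift_time s L M p H)). cbv beta in E.
    rewrite !S_INR in *.
    replace (2 * PI * (INR n + 1 + 1)) with (2 * PI * (INR n + 1) + 2 * PI) by ring.
    rewrite E. f_equal. f_equal. ring.
Qed.

Lemma fixed_phase_periodic (s L M x : R) (k : Z) :
  poincare s L M x = x + 2 * PI * IZR k ->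
  forall t, jflow s L M x (t + 2 * PI) = jflow s L M x t + 2 * PI * IZR k.
Proof.
  intros H t. rewrite (josephson_step s L M _ t (jflow_josephson s L M x)).
  fold (poincare s L M x). rewrite H.
  assert (H1 := josephson_shift_phase s L M _ k (jflow_josephson s L M x)).
  rewrite (jflow_unique s L M _ t H1). rewrite jflow_0. reflexivity.
Qed.

Lemma pi2_pos : 0 < 2 * PI.
Proof. assert (H := PI_RGT_0). lra. Qed.

Lemma poincare_strict (s L1 L2 M x : R) : 0 < s -> L1 < L2 -> poincare s L1 M x < poincare s L2 M x.
Proof.
  intros Hs HL. apply (josephson_compare_strict s L1 L2 M (jflow s L1 M x) (jflow s L2 M x) (2 * PI) Hs);
    try apply jflow_josephson.
  - exact HL.
  - rewrite !jflow_0. lra.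
  - exact pi2_pos.
Qed.

Lemma poincare_dependence (s : R) : exists E, 0 < E /\ forall L1 M1 L2 M2 x y,
  Rabs (poincare s L1 M1 x - poincare s L2 M2 y) <= E * (Rabs (x - y) + Rabs (L1 - L2) + Rabs (M1 - M2)).
Proof.
  set (E2 := exp ((2 * Rabs s + 1) * (2 * PI))).
  assert (HE2 : 1 <= E2).
  { unfold E2. rewrite <- exp_0 at 1. left. apply exp_increasing.
    assert (H1 := pi2_pos). assert (H2 := Rabs_pos s). apply Rmult_lt_0_compat; lra. }
  exists E2. split; [lra|]. intros L1 M1 L2 M2 x y.
  assert (H := josephson_dependence s L1 M1 L2 M2 _ _ (2 * PI) (jflow_josephson s L1 M1 x)
    (jflow_josephson s L2 M2 y) ltac:(left; exact pi2_pos)).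
  rewrite !jflow_0 in H. fold E2 (poincare s L1 M1 x) (poincare s L2 M2 y) in H.
  assert (A1 := Rabs_pos (x - y)). assert (A2 := Rabs_pos (L1 - L2)). assert (A3 := Rabs_pos (M1 - M2)).
  apply Rsqr_incr_0_var; [|apply Rmult_le_pos; lra]. rewrite <- Rsqr_abs. unfold Rsqr.
  rewrite <- (pow2_abs (x - y)) in H.
  set (u := Rabs (x - y)) in *. set (v := Rabs (L1 - L2)) in *. set (w := Rabs (M1 - M2)) in *.
  assert (Huv : 0 <= u * (v + w)) by (apply Rmult_le_pos; lra).
  assert (Hs : u ^ 2 + (v + w) ^ 2 <= (u + v + w) ^ 2) by lra.
  assert (Hq : 0 <= (u + v + w) ^ 2) by apply pow2_ge_0.
  apply Rle_trans with ((u + v + w) ^ 2 * E2).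
  2: { replace (E2 * (u + v + w) * (E2 * (u + v + w))) with ((u + v + w) ^ 2 * E2 * E2) by ring.
    rewrite <- (Rmult_1_r ((u + v + w) ^ 2 * E2)) at 1. apply Rmult_le_compat_l; [nra|exact HE2]. }
  apply Rle_trans with ((u ^ 2 + (v + w) ^ 2) * E2); [|apply Rmult_le_compat_r; lra].
  eapply Rle_trans; [|exact H]. right; ring.
Qed.

Lemma poincare_continuous (s L M x : R) : continuous (fun y => poincare s L M y) x.
Proof.
  destruct (poincare_dependence s) as [E [HE Hd]].
  apply (lipschitz_continuous _ E). intros a b.
  eapply Rle_trans; [apply Hd|].
  replace (L - L) with 0 by ring. replace (M - M) with 0 by ring. rewrite Rabs_R0. lra.
Qed.

Lemma mod_2pi (x : R) : exists k : Z, 0 <= x + 2 * PI * IZR k <= 2 * PI.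
Proof.
  assert (Hp := pi2_pos). set (y := x / (2 * PI)).
  assert (Hy : y * (2 * PI) = x) by (unfold y; field; lra).
  destruct (archimed y) as [H1 H2]. exists (1 - up y)%Z.
  rewrite minus_IZR. rewrite <- Hy. nra.
Qed.

Lemma periodic_bounded (f : R -> R) : (forall t, continuous f t) ->
  (forall t, f (t + 2 * PI) = f t) -> exists K, forall t, Rabs (f t) <= K.
Proof.
  intros Hc Hp.
  destruct (continuity_ab_maj (fun t => Rabs (f t)) 0 (2 * PI)) as [m [Hm _]].
  - left; exact pi2_pos.
  - intros t _. apply continuity_pt_filterlim.
    apply (continuous_comp f Rabs); [apply Hc|apply continuous_Rabs].
  - exists (Rabs (f m)). intros t. destruct (mod_2pi t) as [k Hk].
    assert (Hper : forall n y, f (y + 2 * PI * INR n) = f y).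
    { induction n as [|n IH]; intros y; [f_equal; simpl; ring|].
      rewrite S_INR. replace (y + 2 * PI * (INR n + 1)) with (y + 2 * PI * INR n + 2 * PI) by ring.
      rewrite Hp. apply IH. }
    assert (HperZ : f (t + 2 * PI * IZR k) = f t).
    { destruct (Z_le_gt_dec 0 k) as [H0|H0].
      - rewrite <- (Z2Nat.id k H0), <- INR_IZR_INZ. apply Hper.
      - rewrite <- (Hper (Z.to_nat (- k)) (t + 2 * PI * IZR k)). f_equal.
        rewrite INR_IZR_INZ, Z2Nat.id by lia. rewrite opp_IZR. ring. }
    rewrite <- HperZ. apply Hm. exact Hk.
Qed.

Definition has_rotation (s L M r : R) : Prop :=
  exists phi, josephson s L M phi /\ is_lim (fun t => phi t / t) p_infty r.

Lemma slope_limit (f : R -> R) (r K : R) :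
  (forall t, 0 <= t -> Rabs (f t - r * t) <= K) -> is_lim (fun t => f t / t) p_infty r.
Proof.
  intros Hf. apply is_lim_spec. intros e.
  assert (HK : 0 <= K) by (eapply Rle_trans; [apply Rabs_pos|apply (Hf 0); lra]).
  exists (K / e + 1). intros t Ht. destruct e as [e He]. simpl in *.
  assert (H0 : 0 <= K / e) by (apply Rdiv_le_0_compat; lra).
  assert (Ht0 : 0 < t) by lra.
  replace (f t / t - r) with ((f t - r * t) / t) by (field; lra).
  unfold Rdiv. rewrite Rabs_mult, (Rabs_pos_eq (/ t)) by (left; apply Rinv_0_lt_compat, Ht0).
  apply (Rmult_lt_reg_r t); [exact Ht0|]. rewrite Rmult_assoc, Rinv_l, Rmult_1_r by lra.
  eapply Rle_lt_trans; [apply Hf; lra|].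
  replace K with (e * (K / e)) by (field; lra). apply Rmult_lt_compat_l; lra.
Qed.

Lemma slope_lower (f : R -> R) (r c d : R) :
  is_lim (fun t => f t / t) p_infty r ->
  (forall n : nat, c + d * (2 * PI * INR n) <= f (2 * PI * INR n)) -> d <= r.
Proof.
  intros Hl Hf. destruct (Rle_lt_dec d r) as [|Hlt]; [assumption|exfalso].
  apply is_lim_spec in Hl.
  assert (He : 0 < (d - r) / 2) by lra.
  destruct (Hl (mkposreal _ He)) as [T HT]. simpl in HT.
  destruct (INR_archimed (2 * PI) (Rmax T 0 + (Rabs c + 1) / ((d - r) / 2)) pi2_pos) as [n Hn].
  assert (H1 := Rmax_l T 0). assert (H2 := Rmax_r T 0).
  assert (H3 : 0 < (Rabs c + 1) / ((d - r) / 2)).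
  { apply Rdiv_lt_0_compat; [|lra]. assert (H := Rabs_pos c); lra. }
  set (t := 2 * PI * INR n). assert (Ht : Rmax T 0 + (Rabs c + 1) / ((d - r) / 2) < t) by (unfold t; lra).
  specialize (HT t ltac:(lra)). specialize (Hf n). fold t in Hf.
  apply Rabs_def2 in HT. destruct HT as [HT _].
  assert (Hft : f t < (r + (d - r) / 2) * t).
  { replace (f t) with (f t / t * t) by (field; lra). apply Rmult_lt_compat_r; lra. }
  assert (Hct : Rabs c + 1 < (d - r) / 2 * t).
  { apply Rle_lt_trans with ((d - r) / 2 * ((Rabs c + 1) / ((d - r) / 2))).
    - right; field; lra.
    - apply Rmult_lt_compat_l; lra. }
  assert (Hc := Rle_abs (- c)). rewrite Rabs_Ropp in Hc. nra.
Qed.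

Lemma slope_upper (f : R -> R) (r c d : R) :
  is_lim (fun t => f t / t) p_infty r ->
  (forall n : nat, f (2 * PI * INR n) <= c + d * (2 * PI * INR n)) -> r <= d.
Proof.
  intros Hl Hf. enough (- d <= - r) by lra.
  apply (slope_lower (fun t => - f t) (- r) (- c) (- d)).
  - apply (is_lim_ext (fun t => - (f t / t))); [intros; unfold Rdiv; ring|].
    apply (is_lim_opp (fun t => f t / t) p_infty r Hl).
  - intros n. specialize (Hf n). lra.
Qed.

(** Two consecutive shifts of [psi] by multiples of 2 pi enclose [phi] at time 0, and comparison
    keeps them so forever. Every solution therefore has the same mean slope. *)
Lemma has_rotation_bounded (s L M r : R) (phi psi : R -> R) : 0 < s ->
  josephson s L M phi -> josephson s L M psi ->
  exists K, forall t, 0 <= t -> Rabs (phi t - psi t) <= K.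
Proof.
  intros Hs H1 H2. destruct (mod_2pi (phi 0 - psi 0)) as [k Hk].
  exists (Rabs (2 * PI * IZR k) + 2 * PI). intros t Ht.
  assert (A1 : psi t + 2 * PI * IZR (- k) <= phi t).
  { apply (josephson_compare s L L M (fun t => psi t + 2 * PI * IZR (- k)) phi t Hs); trivial; try lra.
    - apply josephson_shift_phase, H2.
    - rewrite opp_IZR. lra. }
  assert (A2 : phi t <= psi t + 2 * PI * IZR (1 - k)).
  { apply (josephson_compare s L L M phi (fun t => psi t + 2 * PI * IZR (1 - k)) t Hs); trivial; try lra.
    - apply josephson_shift_phase, H2.
    - rewrite minus_IZR. lra. }
  rewrite opp_IZR in A1. rewrite minus_IZR in A2.
  assert (B1 := Rle_abs (2 * PI * IZR k)). assert (B2 := Rle_abs (- (2 * PI * IZR k))).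
  rewrite Rabs_Ropp in B2. assert (Hp := pi2_pos). apply Rabs_le. lra.
Qed.

Lemma has_rotation_any (s L M r : R) (psi : R -> R) : 0 < s ->
  has_rotation s L M r -> josephson s L M psi -> is_lim (fun t => psi t / t) p_infty r.
Proof.
  intros Hs [phi [H1 Hl]] H2.
  destruct (has_rotation_bounded s L M r psi phi Hs H2 H1) as [K HK].
  apply (is_lim_ext (fun t => phi t / t + (psi t - phi t) / t)).
  { intros t. unfold Rdiv. ring. }
  replace (Finite r) with (Finite (r + 0)) by (f_equal; ring).
  apply (is_lim_plus' _ _ _ r 0); [exact Hl|].
  apply (slope_limit (fun t => psi t - phi t) 0 K). intros t Ht.
  rewrite Rmult_0_l, Rminus_0_r. apply HK, Ht.
Qed.

Lemma fixed_has_rotation (s L M x : R) (k : Z) :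
  poincare s L M x = x + 2 * PI * IZR k -> has_rotation s L M (IZR k).
Proof.
  intros H. exists (jflow s L M x). split; [apply jflow_josephson|].
  assert (Hc : forall t, continuous (fun t => jflow s L M x t - IZR k * t) t).
  { intros t. apply (ex_derive_continuous (fun t => jflow s L M x t - IZR k * t)).
    eexists. apply is_derive_Rminus; [apply jflow_josephson|].
    apply is_derive_Rmult; [apply is_derive_Rconst|apply (is_derive_id (K := R_AbsRing))]. }
  destruct (periodic_bounded (fun t => jflow s L M x t - IZR k * t) Hc) as [K HK].
  - intros t. cbv beta. rewrite (fixed_phase_periodic s L M x k H). ring.
  - apply (slope_limit _ _ K). intros t _. apply HK.
Qed.

Lemma no_fixed_drift (g : R -> R) : (forall x, continuous g x) ->
  (forall x (k : Z), g (x + 2 * PI * IZR k) = g x) -> (forall x, 0 < g x) ->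
  exists e, 0 < e /\ forall x, e <= g x.
Proof.
  intros Hc Hp Hpos.
  destruct (continuity_ab_min g 0 (2 * PI)) as [m [Hm _]].
  - left; exact pi2_pos.
  - intros t _. apply continuity_pt_filterlim, Hc.
  - exists (g m). split; [apply Hpos|]. intros x. destruct (mod_2pi x) as [k Hk].
    rewrite <- (Hp x k). apply Hm, Hk.
Qed.

Lemma const_sign (g : R -> R) : (forall x, continuous g x) -> (forall x, g x <> 0) ->
  (forall x, 0 < g x) \/ (forall x, g x < 0).
Proof.
  intros Hc Hn.
  assert (Hiv : forall x y, g x < 0 -> 0 < g y -> False).
  { intros x y Hx Hy.
    assert (Hcp : continuity g) by (intros t; apply continuity_pt_filterlim, Hc).
    destruct (Rtotal_order x y) as [Hxy|[Hxy|Hxy]].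
    - destruct (IVT g x y Hcp Hxy Hx Hy) as [z [_ Hz]]. exact (Hn z Hz).
    - subst. lra.
    - destruct (IVT (- g)%F y x (continuity_opp g Hcp) Hxy) as [z [_ Hz]];
        unfold opp_fct in *; try lra. apply (Hn z). lra. }
  destruct (Rlt_le_dec 0 (g 0)) as [H0|H0].
  - left. intros x. destruct (Rtotal_order (g x) 0) as [H|[H|H]]; [|destruct (Hn x H)|exact H].
    destruct (Hiv x 0 H H0).
  - right. intros x. destruct (Rtotal_order (g x) 0) as [H|[H|H]]; [exact H|destruct (Hn x H)|].
    destruct (Hiv 0 x); [|exact H]. assert (H1 := Hn 0). lra.
Qed.

(** If no phase advances by exactly 2 pi k, the excess displacement has constant sign. Being
    periodic it is bounded away from 0 by some [e], and the mean slope then differs from k by at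
    least e/(2 pi). *)
Lemma integer_rotation_fixed (s L M : R) (k : Z) :
  has_rotation s L M (IZR k) -> exists x, poincare s L M x = x + 2 * PI * IZR k.
Proof.
  intros [phi [Hphi Hl]]. apply NNPP. intros Hno.
  set (g := fun x => poincare s L M x - x - 2 * PI * IZR k).
  assert (Hc : forall x, continuous g x).
  { intros x. apply (continuous_minus (fun x => poincare s L M x - x) (fun _ => 2 * PI * IZR k));
      [|apply continuous_const].
    apply (continuous_minus (fun x => poincare s L M x) (fun x => x)); [apply poincare_continuous|apply continuous_id]. }
  assert (Hn : forall x, g x <> 0).
  { intros x Hx. apply Hno. exists x. unfold g in Hx. lra. }
  assert (Hp : forall x (j : Z), g (x + 2 * PI * IZR j) = g x).
  { intros x j. unfold g. rewrite poincare_shift. ring. }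
  destruct (const_sign g Hc Hn) as [Hs|Hs].
  - destruct (no_fixed_drift g Hc Hp Hs) as [e [He Hge]].
    assert (Hr : IZR k + e / (2 * PI) <= IZR k).
    { apply (slope_lower phi _ (phi 0) _ Hl). induction n as [|n IH].
      - simpl. rewrite !Rmult_0_r. lra.
      - rewrite (josephson_iter s L M phi n Hphi).
        specialize (Hge (phi (2 * PI * INR n))). unfold g in Hge. rewrite S_INR.
        replace ((IZR k + e / (2 * PI)) * (2 * PI * (INR n + 1))) with
          ((IZR k + e / (2 * PI)) * (2 * PI * INR n) + (2 * PI * IZR k + e)).
        + lra.
        + field. assert (H := PI_RGT_0); lra. }
    assert (0 < e / (2 * PI)) by (apply Rdiv_lt_0_compat; [exact He|exact pi2_pos]). lra.
  - destruct (no_fixed_drift (fun x => - g x)) as [e [He Hge]].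
    + intros x. apply (continuous_opp g), Hc.
    + intros x j. cbv beta. rewrite Hp. reflexivity.
    + intros x. specialize (Hs x). lra.
    + assert (Hr : IZR k <= IZR k - e / (2 * PI)).
      { apply (slope_upper phi _ (phi 0) _ Hl). induction n as [|n IH].
        - simpl. rewrite !Rmult_0_r. lra.
        - rewrite (josephson_iter s L M phi n Hphi).
          specialize (Hge (phi (2 * PI * INR n))). unfold g in Hge. rewrite S_INR.
          replace ((IZR k - e / (2 * PI)) * (2 * PI * (INR n + 1))) with
            ((IZR k - e / (2 * PI)) * (2 * PI * INR n) + (2 * PI * IZR k - e)).
          + lra.
          + field. assert (H := PI_RGT_0); lra. }
      assert (0 < e / (2 * PI)) by (apply Rdiv_lt_0_compat; [exact He|exact pi2_pos]). lra.
Qed.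

Lemma phase_lock_rescaled (omega r B A : R) : 0 < omega ->
  phase_lock omega r (B, A) <-> has_rotation (/ omega) (B / omega) (A / omega) r.
Proof.
  intros Hom. assert (E1 : forall t : R, omega * (t / omega) = t) by (intros; field; lra).
  unfold phase_lock, rotation_number, has_rotation. simpl. split.
  - intros [phi [Hd Hl]]. exists (fun t => phi (t / omega)). split.
    + intros t. eapply is_derive_eq.
      * apply (is_derive_Rcomp phi (fun t => t / omega) t
          (- sin (phi (t / omega)) + B + A * cos (omega * (t / omega))) (/ omega)); [apply Hd|].
        auto_derive; [trivial|field; lra].
      * rewrite E1. field; lra.
    + apply (is_lim_ext (fun t => phi (/ omega * t + 0) / (omega * (/ omega * t + 0)))).
      { intros t. replace (/ omega * t + 0) with (t / omega) by (field; lra).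
        rewrite E1. reflexivity. }
      apply (is_lim_comp_lin (fun u => phi u / (omega * u)) (/ omega) 0 p_infty r).
      * assert (E : Rbar_plus (Rbar_mult (/ omega) p_infty) 0 = p_infty).
        { assert (H0 : 0 < / omega) by (apply Rinv_0_lt_compat, Hom).
          simpl. destruct (Rle_dec 0 (/ omega)) as [H1|H1]; [|lra].
          destruct (Rle_lt_or_eq_dec 0 (/ omega) H1) as [H2|H2]; [reflexivity|lra]. }
        rewrite E. exact Hl.
      * apply Rgt_not_eq, Rinv_0_lt_compat, Hom.
  - intros [phi [Hd Hl]]. exists (fun t => phi (omega * t)). split.
    + intros t. eapply is_derive_eq.
      * apply (is_derive_Rcomp phi (fun t => omega * t) t
          (- / omega * sin (phi (omega * t)) + B / omega + A / omega * cos (omega * t)) omega); [apply Hd|].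
        auto_derive; [trivial|ring].
      * field; lra.
    + apply (is_lim_ext (fun t => phi (omega * t + 0) / (omega * t + 0))).
      { intros t. rewrite Rplus_0_r. reflexivity. }
      apply (is_lim_comp_lin (fun u => phi u / u) omega 0 p_infty r).
      * assert (E : Rbar_plus (Rbar_mult omega p_infty) 0 = p_infty).
        { simpl. destruct (Rle_dec 0 omega) as [H1|H1]; [|lra].
          destruct (Rle_lt_or_eq_dec 0 omega H1) as [H2|H2]; [reflexivity|lra]. }
        rewrite E. exact Hl.
      * lra.
Qed.

(** * The linear system on the unit circle *)

(* The linear system (L) on the unit circle z = exp(i t), with L = l, M = 2 mu and s = 1/omega. *)
Definition linsys (s L M : R) (u v : R -> C) : Prop :=
  forall t : R,
    is_cderive u t (Cplus (Cmult (0, - (L + M * cos t)) (u t)) (Cmult (RtoC (s / 2)) (v t))) /\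
    is_cderive v t (Cmult (RtoC (s / 2)) (u t)).

Lemma linsys_comb (s L M : R) (a b : C) (u1 v1 u2 v2 : R -> C) :
  linsys s L M u1 v1 -> linsys s L M u2 v2 ->
  linsys s L M (fun t => Cplus (Cmult a (u1 t)) (Cmult b (u2 t)))
               (fun t => Cplus (Cmult a (v1 t)) (Cmult b (v2 t))).
Proof.
  intros H1 H2 t. destruct (H1 t) as [A1 A2]. destruct (H2 t) as [B1 B2]. split.
  - eapply is_cderive_eq; [exact (is_cderive_plus _ _ t _ _
      (is_cderive_mult _ _ t _ _ (is_cderive_const a t) A1)
      (is_cderive_mult _ _ t _ _ (is_cderive_const b t) B1))|]. cbv beta. ring.
  - eapply is_cderive_eq; [exact (is_cderive_plus _ _ t _ _
      (is_cderive_mult _ _ t _ _ (is_cderive_const a t) A2)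
      (is_cderive_mult _ _ t _ _ (is_cderive_const b t) B2))|]. cbv beta. ring.
Qed.

Lemma linsys_shift_time (s L M : R) (u v : R -> C) :
  linsys s L M u v -> linsys s L M (fun t => u (t + 2 * PI)) (fun t => v (t + 2 * PI)).
Proof.
  intros H t. destruct (H (t + 2 * PI)) as [A1 A2].
  assert (Hd : is_derive (fun t => t + 2 * PI) t 1) by (auto_derive; [trivial|ring]).
  assert (E := cos_periodZ t 1). rewrite Rmult_1_r in E. rewrite E in A1.
  split.
  - eapply is_cderive_eq; [exact (is_cderive_comp u (fun t => t + 2 * PI) t 1 _ A1 Hd)|]. ring.
  - eapply is_cderive_eq; [exact (is_cderive_comp v (fun t => t + 2 * PI) t 1 _ A2 Hd)|]. ring.
Qed.

Lemma gronwall_zero_line (f df : R -> R) (K : R) :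
  (forall t, is_derive f t (df t)) -> (forall t, 0 <= f t) ->
  (forall t, Rabs (df t) <= K * f t) -> f 0 = 0 -> forall t, f t = 0.
Proof.
  intros Hd Hp Hle H0 t. apply Rle_antisym; [|apply Hp].
  destruct (Rle_lt_dec 0 t) as [Ht|Ht].
  - assert (H := gronwall_decay f df K 0 t Ht (fun x _ => Hd x)). rewrite H0 in H.
    rewrite Rmult_0_l in H. apply H. intros x _. specialize (Hle x).
    apply Rabs_le_between in Hle. lra.
  - assert (H := gronwall_decay (fun x => f (- x)) (fun x => - df (- x)) K 0 (- t) ltac:(lra)).
    cbv beta in H. rewrite Ropp_involutive, Ropp_0, H0, Rmult_0_l in H. apply H.
    + intros x _. eapply is_derive_eq; [apply (is_derive_Rcomp f (fun x => - x) x (df (- x)) (-1)); [apply Hd|]|ring].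
      auto_derive; [trivial|ring].
    + intros x _. specialize (Hle (- x)). apply Rabs_le_between in Hle. lra.
Qed.

(** The imaginary diagonal coefficient does not change |u|^2 + |v|^2, and the real coupling changes
    it at a rate of at most |s| times itself. *)
Lemma linsys_zero (s L M : R) (u v : R -> C) : linsys s L M u v ->
  u 0 = RtoC 0 -> v 0 = RtoC 0 -> forall t, u t = RtoC 0 /\ v t = RtoC 0.
Proof.
  intros H Hu Hv t.
  set (f := fun t => (Re (u t) * Re (u t) + Im (u t) * Im (u t)) + (Re (v t) * Re (v t) + Im (v t) * Im (v t))).
  assert (Hf : f t = 0).
  { apply (gronwall_zero_line f (fun t => 2 * s * (Re (u t) * Re (v t) + Im (u t) * Im (v t))) (Rabs s)).
    - intros x. destruct (H x) as [[A1 A2] [A3 A4]]. eapply is_derive_eq.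
      + exact (is_derive_Rplus _ _ x _ _
          (is_derive_Rplus _ _ x _ _ (is_derive_Rmult _ _ x _ _ A1 A1) (is_derive_Rmult _ _ x _ _ A2 A2))
          (is_derive_Rplus _ _ x _ _ (is_derive_Rmult _ _ x _ _ A3 A3) (is_derive_Rmult _ _ x _ _ A4 A4))).
      + unfold Re, Im; simpl. field.
    - intros x. unfold f. nra.
    - intros x. unfold f. rewrite Rmult_comm, <- Rmult_assoc, Rabs_mult, Rabs_mult.
      rewrite (Rmult_comm (Rabs s)). apply Rmult_le_compat_r; [apply Rabs_pos|].
      rewrite (Rabs_pos_eq 2) by lra. set (a := Re (u x)). set (b := Im (u x)).
      set (c := Re (v x)). set (d := Im (v x)).
      assert (A1 := pow2_ge_0 (a - c)). assert (A2 := pow2_ge_0 (b - d)).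
      assert (A3 := pow2_ge_0 (a + c)). assert (A4 := pow2_ge_0 (b + d)).
      enough (Rabs (a * c + b * d) <= (a * a + b * b + (c * c + d * d)) / 2) by lra.
      apply Rabs_le. lra.
    - unfold f. rewrite Hu, Hv. unfold Re, Im, RtoC; simpl. ring. }
  unfold f, Re, Im in Hf. split; apply injective_projections; simpl; nra.
Qed.

Lemma linsys_unique (s L M : R) (u1 v1 u2 v2 : R -> C) :
  linsys s L M u1 v1 -> linsys s L M u2 v2 -> u1 0 = u2 0 -> v1 0 = v2 0 ->
  forall t, u1 t = u2 t /\ v1 t = v2 t.
Proof.
  intros H1 H2 Hu Hv t.
  assert (H := linsys_comb s L M (RtoC 1) (RtoC (-1)) _ _ _ _ H1 H2).
  assert (Hm : forall x y : C, Cplus (Cmult (RtoC 1) x) (Cmult (RtoC (-1)) y) = RtoC 0 -> x = y).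
  { intros x y E. apply (f_equal (fun z => Cplus z y)) in E.
    transitivity (Cplus (Cplus (Cmult (RtoC 1) x) (Cmult (RtoC (-1)) y)) y).
    - apply injective_projections; simpl; ring.
    - rewrite E. ring. }
  destruct (linsys_zero s L M _ _ H) with (t := t) as [A1 A2].
  - rewrite Hu. apply injective_projections; simpl; ring.
  - rewrite Hv. apply injective_projections; simpl; ring.
  - split; apply Hm; assumption.
Qed.

Lemma josephson_continuous (s L M : R) (p : R -> R) (t : R) : josephson s L M p -> continuous p t.
Proof. intros H. apply (ex_derive_continuous p t). eexists. apply H. Qed.

(* A solution phi lifts to the linear system through exp(i phi) = v/u: put v = exp(s/2 * int exp(-i phi)). *)
Definition lift_v (s : R) (p : R -> R) (t : R) : C :=
  cexp (s / 2 * RInt (fun x => cos (p x)) 0 t, - (s / 2 * RInt (fun x => sin (p x)) 0 t)).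
Definition lift_u (s : R) (p : R -> R) (t : R) : C :=
  Cmult (lift_v s p t) (cexp (0, - p t)).

Lemma lift_v_derive (s L M : R) (p : R -> R) (t : R) : josephson s L M p ->
  is_cderive (lift_v s p) t (Cmult (RtoC (s / 2)) (lift_u s p t)).
Proof.
  intros H. unfold lift_v.
  assert (Hc := fun t => josephson_continuous s L M p t H).
  assert (I1 : is_derive (fun t => RInt (fun x => cos (p x)) 0 t) t (cos (p t))).
  { eapply is_derive_ext; [|apply (primitive_derive (fun x => cos (p x)) 0)].
    - intros x. cbv beta. apply Rplus_0_l.
    - intros x. apply (continuous_comp p cos); [apply Hc|apply continuous_cos]. }
  assert (I2 : is_derive (fun t => RInt (fun x => sin (p x)) 0 t) t (sin (p t))).
  { eapply is_derive_ext; [|apply (primitive_derive (fun x => sin (p x)) 0)].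
    - intros x. cbv beta. apply Rplus_0_l.
    - intros x. apply (continuous_comp p sin); [apply Hc|apply continuous_sin]. }
  eapply is_cderive_eq.
  - apply (is_cderive_cexp (fun t => (s / 2 * RInt (fun x => cos (p x)) 0 t, - (s / 2 * RInt (fun x => sin (p x)) 0 t))) t
      (s / 2 * cos (p t), - (s / 2 * sin (p t)))).
    split.
    + eapply is_derive_eq; [exact (is_derive_Rmult (fun _ => s / 2) _ t _ _ (is_derive_Rconst _ t) I1)|].
      simpl. ring.
    + eapply is_derive_eq; [exact (is_derive_Ropp _ t _ (is_derive_Rmult (fun _ => s / 2) _ t _ _ (is_derive_Rconst _ t) I2))|].
      simpl. ring.
  - unfold lift_u, lift_v. set (g := cexp (s / 2 * RInt (fun x => cos (p x)) 0 t, _)).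
    transitivity (Cmult (Cmult (RtoC (s / 2)) (cexp (0, - p t))) g); [|ring].
    f_equal. unfold cexp; simpl. rewrite exp_0, cos_neg, sin_neg.
    apply injective_projections; simpl; ring.
Qed.

Lemma linsys_lift (s L M : R) (p : R -> R) : josephson s L M p -> linsys s L M (lift_u s p) (lift_v s p).
Proof.
  intros H t. assert (Hv := lift_v_derive s L M p t H). split; [|exact Hv].
  assert (He : is_cderive (fun t => cexp (0, - p t)) t
    (Cmult (0, - (- s * sin (p t) + L + M * cos t)) (cexp (0, - p t)))).
  { apply (is_cderive_cexp (fun t => (0, - p t))). split; [exact (is_derive_Rconst 0 t)|].
    exact (is_derive_Ropp _ t _ (H t)). }
  eapply is_cderive_eq; [exact (is_cderive_mult _ _ t _ _ Hv He)|].
  cbv beta. unfold lift_u. set (g := lift_v s p t).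
  unfold cexp; simpl. rewrite exp_0, cos_neg, sin_neg.
  assert (Hsc := sin2_cos2 (p t)). unfold Rsqr in Hsc.
  destruct g as [g1 g2]. set (c := cos (p t)) in *. set (si := sin (p t)) in *. set (co := cos t).
  assert (Hcc : c * c = 1 - si * si) by lra.
  apply injective_projections; simpl.
  - transitivity (s / 2 * g1 * (c * c + si * si) + (L + M * co) * (g2 * c - g1 * si)); [|rewrite Hcc; ring].
    rewrite Hcc. transitivity (s / 2 * g1 * (c * c) + s/2 * g1 * (si * si) + (L + M * co) * (g2 * c - g1 * si)); [|rewrite Hcc; ring].
    field.
  - transitivity (s / 2 * g2 * (c * c) + s/2 * g2 * (si * si) + (L + M * co) * (- g2 * si - g1 * c)); [field|rewrite Hcc; field].
Qed.

Lemma lift_v_0 (s : R) (p : R -> R) : lift_v s p 0 = RtoC 1.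
Proof.
  unfold lift_v. rewrite !RInt_point. unfold zero; simpl. rewrite Rmult_0_r, Ropp_0. apply cexp_0.
Qed.

Lemma lift_u_0 (s : R) (p : R -> R) : lift_u s p 0 = (cos (p 0), - sin (p 0)).
Proof.
  unfold lift_u. rewrite lift_v_0. unfold cexp; simpl. rewrite exp_0, cos_neg, sin_neg.
  apply injective_projections; simpl; ring.
Qed.

(** The lifts of the phases 0 and pi start at (1, 1) and (-1, 1). These span the space of initial
    values, so existence is inherited from the Josephson equation. *)
Lemma linsys_exists (s L M : R) (a b : C) : exists u v,
  linsys s L M u v /\ u 0 = a /\ v 0 = b.
Proof.
  set (ca := Cmult (RtoC (/ 2)) (Cplus a b)). set (cb := Cmult (RtoC (/ 2)) (Cminus b a)).
  assert (H1 := linsys_lift s L M _ (jflow_josephson s L M 0)).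
  assert (H2 := linsys_lift s L M _ (jflow_josephson s L M PI)).
  eexists. eexists. split; [exact (linsys_comb s L M ca cb _ _ _ _ H1 H2)|].
  cbv beta. rewrite !lift_v_0, !lift_u_0, !jflow_0, cos_0, sin_0, cos_PI, sin_PI. unfold ca, cb.
  split; apply injective_projections; simpl; field.
Qed.

Lemma csqrt (z : C) : exists w : C, Cmult w w = z.
Proof.
  destruct z as [x y]. set (r := Cmod (x, y)).
  assert (Hr : r * r = x * x + y * y) by (apply (Cmod_sqr (x, y))).
  assert (Hx := Re_le_Cmod (x, y)). unfold Re in Hx; simpl in Hx. fold r in Hx.
  apply Rabs_le_between in Hx.
  set (a := sqrt ((r + x) / 2)). set (b := sqrt ((r - x) / 2)).
  assert (Ha : a * a = (r + x) / 2) by (apply sqrt_sqrt; lra).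
  assert (Hb : b * b = (r - x) / 2) by (apply sqrt_sqrt; lra).
  assert (Hab : a * b = Rabs y / 2).
  { unfold a, b. rewrite <- sqrt_mult_alt by lra.
    replace ((r + x) / 2 * ((r - x) / 2)) with ((Rabs y / 2) * (Rabs y / 2)).
    - apply sqrt_square. assert (H := Rabs_pos y). lra.
    - replace (Rabs y / 2 * (Rabs y / 2)) with (Rabs y * Rabs y / 4) by field.
      rewrite <- Rabs_mult, Rabs_pos_eq by apply (Rle_0_sqr y). nra. }
  destruct (Rle_lt_dec 0 y) as [Hy|Hy].
  - rewrite Rabs_pos_eq in Hab by exact Hy. exists (a, b).
    apply injective_projections; simpl; lra.
  - rewrite Rabs_left in Hab by exact Hy. exists (a, - b).
    apply injective_projections; simpl; lra.
Qed.

(** [lam] is a root of the characteristic polynomial. The vector (b, lam - a) works unless b = 0;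
    the triangular case is divided according to the vanishing of lam - a, lam - d and c. *)
Lemma eigenvector2 (a b c d : C) : exists lam w1 w2 : C,
  (w1 <> RtoC 0 \/ w2 <> RtoC 0) /\
  Cplus (Cmult a w1) (Cmult b w2) = Cmult lam w1 /\ Cplus (Cmult c w1) (Cmult d w2) = Cmult lam w2.
Proof.
  destruct (csqrt (Cplus (Cmult (Cminus a d) (Cminus a d)) (Cmult (RtoC 4) (Cmult b c)))) as [q Hq].
  set (lam := Cmult (RtoC (/ 2)) (Cplus (Cplus a d) q)).
  assert (Hl : Cmult (Cminus lam a) (Cminus lam d) = Cmult b c).
  { transitivity (Cmult (RtoC (/ 4)) (Cminus (Cmult q q) (Cmult (Cminus a d) (Cminus a d)))).
    - unfold lam. destruct a, b, c, d, q. apply injective_projections; simpl; field.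
    - rewrite Hq. destruct a, b, c, d. apply injective_projections; simpl; field. }
  destruct (classic (b = RtoC 0)) as [Hb|Hb].
  - destruct (classic (Cminus lam a = RtoC 0)) as [Ha|Ha].
    + assert (Hla : lam = a).
      { transitivity (Cplus (Cminus lam a) a); [ring|rewrite Ha; ring]. }
      destruct (classic (Cminus lam d = RtoC 0 /\ c = RtoC 0)) as [[Hd Hc]|Hn].
      * exists lam, (RtoC 1), (RtoC 0). split; [left; intros E; apply (f_equal fst) in E; simpl in E; lra|].
        rewrite Hla, Hb, Hc. split; ring.
      * exists lam, (Cminus lam d), c. split.
        { destruct (classic (c = RtoC 0)) as [Hc|Hc]; [left; intros E; apply Hn; split; assumption|right; exact Hc]. }
        rewrite Hb. split; [rewrite Hla; ring|ring].
    + assert (Hd : Cminus lam d = RtoC 0).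
      { rewrite Hb, Cmult_0_l in Hl. apply NNPP. intros Hd. exact (Cmult_neq_0 _ _ Ha Hd Hl). }
      assert (Hld : lam = d).
      { transitivity (Cplus (Cminus lam d) d); [ring|rewrite Hd; ring]. }
      exists lam, (RtoC 0), (RtoC 1). split; [right; intros E; apply (f_equal fst) in E; simpl in E; lra|].
      rewrite Hb, Hld. split; ring.
  - exists lam, b, (Cminus lam a). split; [left; exact Hb|]. split; [ring|].
    transitivity (Cplus (Cmult b c) (Cmult d (Cminus lam a))); [ring|]. rewrite <- Hl. ring.
Qed.

Lemma linsys_floquet (s L M : R) : exists (lam : C) (u v : R -> C),
  linsys s L M u v /\ (u 0 <> RtoC 0 \/ v 0 <> RtoC 0) /\
  forall t, u (t + 2 * PI) = Cmult lam (u t) /\ v (t + 2 * PI) = Cmult lam (v t).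
Proof.
  destruct (linsys_exists s L M (RtoC 1) (RtoC 0)) as [u1 [v1 [H1 [U1 V1]]]].
  destruct (linsys_exists s L M (RtoC 0) (RtoC 1)) as [u2 [v2 [H2 [U2 V2]]]].
  destruct (eigenvector2 (u1 (2 * PI)) (u2 (2 * PI)) (v1 (2 * PI)) (v2 (2 * PI)))
    as [lam [w1 [w2 [Hw [E1 E2]]]]].
  assert (H := linsys_comb s L M w1 w2 _ _ _ _ H1 H2).
  exists lam. eexists. eexists. split; [exact H|]. cbv beta.
  assert (Eu : Cplus (Cmult w1 (u1 0)) (Cmult w2 (u2 0)) = w1) by (rewrite U1, U2; ring).
  assert (Ev : Cplus (Cmult w1 (v1 0)) (Cmult w2 (v2 0)) = w2) by (rewrite V1, V2; ring).
  split; [rewrite Eu, Ev; exact Hw|].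
  assert (Hs := linsys_shift_time s L M _ _ H).
  assert (Hl := linsys_comb s L M lam (RtoC 0) _ _ _ _ H H). cbv beta in Hl.
  intros t. destruct (linsys_unique s L M _ _ _ _ Hs Hl) with (t := t) as [A1 A2].
  - cbv beta. rewrite Rplus_0_l, Eu. rewrite (Cmult_comm w1), (Cmult_comm w2), E1. ring.
  - cbv beta. rewrite Rplus_0_l, Ev. rewrite (Cmult_comm w1), (Cmult_comm w2), E2. ring.
  - cbv beta in A1, A2. split; [rewrite A1|rewrite A2]; ring.
Qed.

Definition normsq (z : C) : R := Re z * Re z + Im z * Im z.

(** The flow preserves a Hermitian form of signature (1,1). Lifted phases are isotropic for it; a
    Floquet solution on which it does not vanish corresponds to elliptic monodromy. *)
Lemma linsys_energy (s L M : R) (u v : R -> C) (t : R) : linsys s L M u v ->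
  normsq (u t) - normsq (v t) = normsq (u 0) - normsq (v 0).
Proof.
  intros H.
  assert (Hd : forall x, is_derive (fun t => normsq (u t) - normsq (v t)) x 0).
  { intros x. destruct (H x) as [[A1 A2] [A3 A4]]. unfold normsq. eapply is_derive_eq.
    - exact (is_derive_Rminus _ _ x _ _
          (is_derive_Rplus _ _ x _ _ (is_derive_Rmult _ _ x _ _ A1 A1) (is_derive_Rmult _ _ x _ _ A2 A2))
          (is_derive_Rplus _ _ x _ _ (is_derive_Rmult _ _ x _ _ A3 A3) (is_derive_Rmult _ _ x _ _ A4 A4))).
    - unfold Re, Im; simpl. ring. }
  destruct (Rle_lt_dec 0 t) as [Ht|Ht].
  - symmetry. apply (derive_zero_const (fun t => normsq (u t) - normsq (v t)) (fun _ => 0) 0 t); auto.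
  - apply (derive_zero_const (fun t => normsq (u t) - normsq (v t)) (fun _ => 0) t 0); [lra| |]; auto.
Qed.

Lemma unit_angle (c d : R) : c * c + d * d = 1 -> exists x, c = cos x /\ d = sin x.
Proof.
  intros H. assert (Hc : -1 <= c <= 1) by nra.
  destruct (Rle_lt_dec 0 d) as [Hd|Hd].
  - exists (acos c). rewrite cos_acos, sin_acos by exact Hc. split; [reflexivity|].
    unfold Rsqr. replace (1 - c * c) with (d * d) by lra. symmetry. apply sqrt_square, Hd.
  - exists (- acos c). rewrite cos_neg, sin_neg, cos_acos, sin_acos by exact Hc. split; [reflexivity|].
    unfold Rsqr. replace (1 - c * c) with ((- d) * (- d)) by lra. rewrite sqrt_square; lra.
Qed.

Lemma angle_unique (a b : R) : cos a = cos b -> sin a = sin b -> exists k, a = b + 2 * PI * IZR k.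
Proof.
  intros Hc Hs. destruct (mod_2pi (a - b)) as [k Hk].
  assert (H1 : cos (a - b + 2 * PI * IZR k) = 1).
  { rewrite cos_periodZ, cos_minus, Hc, Hs. assert (H := sin2_cos2 b). unfold Rsqr in H. lra. }
  set (th := a - b + 2 * PI * IZR k) in *.
  assert (H2 : sin (th / 2) = 0).
  { replace th with (2 * (th / 2)) in H1 by field. rewrite cos_2a_sin in H1. nra. }
  assert (Hp := PI_RGT_0).
  destruct (Req_dec th 0) as [H3|H3].
  - exists (- k)%Z. rewrite opp_IZR. unfold th in H3. lra.
  - destruct (Req_dec th (2 * PI)) as [H4|H4].
    + exists (1 - k)%Z. rewrite minus_IZR. unfold th in H4. lra.
    + exfalso. assert (H5 : 0 < sin (th / 2)) by (apply sin_gt_0; lra). lra.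
Qed.

(* An isotropic Floquet solution is the lift of a phase that is fixed modulo 2 pi. *)
Lemma isotropic_floquet_fixed (s L M : R) (lam : C) (u v : R -> C) :
  linsys s L M u v -> (u 0 <> RtoC 0 \/ v 0 <> RtoC 0) ->
  u (2 * PI) = Cmult lam (u 0) -> v (2 * PI) = Cmult lam (v 0) ->
  normsq (u 0) = normsq (v 0) -> exists x k, poincare s L M x = x + 2 * PI * IZR k.
Proof.
  intros H Hnz Eu Ev HJ.
  assert (Hn0 : forall z, normsq z = 0 -> z = RtoC 0).
  { intros [a b] E. unfold normsq, Re, Im in E; simpl in E. apply injective_projections; simpl; nra. }
  assert (Hv : normsq (v 0) <> 0).
  { intros E. destruct Hnz as [Hz|Hz]; apply Hz, Hn0; lra. }
  assert (Hvp : 0 < normsq (v 0)).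
  { assert (0 <= normsq (v 0)) by (unfold normsq; nra). lra. }
  set (q := Cmult (RtoC (/ normsq (v 0))) (Cmult (Cconj (v 0)) (u 0))).
  assert (Hq : Re q * Re q + Im q * Im q = 1).
  { transitivity (normsq (u 0) / normsq (v 0)); [|rewrite HJ; field; exact Hv].
    unfold q. unfold normsq in *. destruct (u 0), (v 0). unfold Re, Im, Cconj in *; simpl in *. field. exact Hv. }
  destruct (unit_angle (Re q) (- Im q)) as [x [Hx1 Hx2]]; [lra|].
  assert (Huq : u 0 = Cmult (v 0) q).
  { unfold q, normsq in *. destruct (u 0), (v 0). unfold Re, Im, Cconj in *; simpl in *.
    apply injective_projections; simpl; field; exact Hv. }
  clearbody q.
  assert (HL := linsys_lift s L M _ (jflow_josephson s L M x)).
  assert (Hc := linsys_comb s L M (v 0) (RtoC 0) _ _ _ _ HL HL).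
  destruct (linsys_unique s L M _ _ _ _ H Hc) with (t := 2 * PI) as [A1 A2].
  - cbv beta. rewrite lift_u_0, jflow_0, <- Hx1, <- Hx2, Huq. unfold Re, Im. destruct q.
    apply injective_projections; simpl; ring.
  - cbv beta. rewrite lift_v_0. ring.
  - set (g := lift_v s (jflow s L M x) (2 * PI)) in *.
    assert (Hv0 : v 0 <> RtoC 0) by (intros E; apply Hv; rewrite E; unfold normsq, Re, Im; simpl; ring).
    assert (Eg : g = lam).
    { transitivity (Cdiv (v (2 * PI)) (v 0)); [rewrite A2; field; exact Hv0|rewrite Ev; field; exact Hv0]. }
    assert (Ee : cexp (0, - poincare s L M x) = q).
    { assert (Hg : g <> RtoC 0) by apply cexp_neq_0.
      transitivity (Cdiv (u (2 * PI)) (Cmult (v 0) g)).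
      - rewrite A1. unfold lift_u. fold g (poincare s L M x). field. split; assumption.
      - rewrite Eu, Huq, Eg in *. field. split; assumption. }
    unfold cexp in Ee; simpl in Ee. rewrite exp_0, cos_neg, sin_neg in Ee.
    assert (E1 := f_equal fst Ee). assert (E2 := f_equal snd Ee). unfold Re, Im in Hx1, Hx2. simpl in E1, E2.
    destruct (angle_unique (poincare s L M x) x) as [k Hk]; [lra|lra|].
    exists x, k. exact Hk.
Qed.

(** * Elliptic monodromy and strict growth of the rotation number *)

Lemma is_derive_atan_ratio (X Y : R -> R) (t dX dY : R) : X t <> 0 ->
  is_derive X t dX -> is_derive Y t dY ->
  is_derive (fun t => atan (Y t / X t)) t ((dY * X t - Y t * dX) / (X t * X t + Y t * Y t)).
Proof.
  intros Hx HX HY.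
  assert (Hn : X t * X t + Y t * Y t <> 0).
  { assert (0 < X t * X t) by (destruct (Rtotal_order (X t) 0) as [H|[H|H]]; nra). nra. }
  eapply is_derive_eq.
  - apply (is_derive_Rcomp atan (fun t => Y t / X t) t (/ (1 + Rsqr (Y t / X t)))
      ((dY * X t - Y t * dX) / (X t)^2)).
    + apply is_derive_atan.
    + exact (is_derive_div Y X t dY dX HY HX Hx).
  - unfold Rsqr. field. split; [|exact Hx]. intros E. apply Hn. rewrite <- E. ring.
Qed.

(** Here p + i q stands for v times the conjugate of u, rho for |u|^2, J for |u|^2 - |v|^2, and (c,
    si) for the cosine and sine of the phase phi. Then X + i Y = rho - (p + i q) exp (- i phi) and n
    = |u - v exp (- i phi)|^2. Both identities lie in the ideal generated by the two hypotheses. *)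
Lemma elliptic_identity (rho p q c si J a s D : R) :
  c * c + si * si = 1 -> p * p + q * q = rho * (rho - J) ->
  let n := 2 * rho - J - 2 * (p * c + q * si) in
  let X := rho - p * c - q * si in
  let Y := p * si - q * c in
  let phi' := - s * si + a + D in
  let rho' := s * p in
  let p' := s / 2 * (2 * rho - J) - a * q in
  let q' := a * p in
  let X' := rho' - p' * c - q' * si + Y * phi' in
  let Y' := p' * si - q' * c + (p * c + q * si) * phi' in
  X * X + Y * Y = rho * n /\
  (phi' - a) * (rho * n) + 2 * (Y' * X - Y * X') = - s * q * n + D * J * rho.
Proof.
  intros Hc Hp. cbv zeta.
  assert (h1 : c * c + si * si - 1 = 0) by lra.
  assert (h2 : p * p + q * q - rho * (rho - J) = 0) by lra.
  split; apply Rminus_diag_uniq.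
  - transitivity ((p * p + q * q) * (c * c + si * si - 1) + (p * p + q * q - rho * (rho - J)));
      [ring|rewrite h1, h2; ring].
  - transitivity (s * (c * c + si * si - 1) * (2 * si * (p * p + q * q) - (2 * rho - J) * q)
      - 2 * D * ((p * p + q * q) * (c * c + si * si - 1) + (p * p + q * q - rho * (rho - J))));
      [field|rewrite h1, h2; ring].
Qed.

(** With a = v/u, which lies in the unit disc because J > 0, [theta] is an argument of (exp (i p) -
    a) / (1 - conj(a) exp (i p)). It equals p + 2 arg (1 - a exp (- i p)), and the last number has
    positive real part, so atan gives a smooth branch. As a itself follows the projectivized linear
    flow, the speed for D = 0 does not depend on p, and D contributes D J / n. *)
Lemma elliptic_phase (s L M D J : R) (u v : R -> C) (p : R -> R) : 0 < J ->
  linsys s L M u v -> (forall t, normsq (u t) - normsq (v t) = J) ->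
  josephson s (L + D) M p ->
  let q t := Im (v t) * Re (u t) - Re (v t) * Im (u t) in
  let w t := (Re (v t) * Re (u t) + Im (v t) * Im (u t)) * cos (p t) + q t * sin (p t) in
  let n t := 2 * normsq (u t) - J - 2 * w t in
  exists theta : R -> R, (forall t, Rabs (theta t - p t) <= PI) /\
    forall t, 0 < n t <= 4 * normsq (u t) /\
      is_derive theta t (L + M * cos t - s * q t / normsq (u t) + D * J / n t).
Proof.
  intros HJ Hl HJt Hp q w n.
  set (pp := fun t => Re (v t) * Re (u t) + Im (v t) * Im (u t)).
  set (X := fun t => normsq (u t) - pp t * cos (p t) - q t * sin (p t)).
  set (Y := fun t => pp t * sin (p t) - q t * cos (p t)).
  assert (Hpq : forall t, pp t * pp t + q t * q t = normsq (u t) * (normsq (u t) - J)).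
  { intros t. rewrite <- (HJt t). unfold pp, q, normsq. ring. }
  assert (Hrho : forall t, J <= normsq (u t)).
  { intros t. rewrite <- (HJt t). unfold normsq.
    assert (A1 := Rle_0_sqr (Re (v t))). assert (A2 := Rle_0_sqr (Im (v t))). unfold Rsqr in *. lra. }
  assert (Hw : forall t, Rabs (w t) < normsq (u t)).
  { intros t. specialize (Hpq t). specialize (Hrho t).
    assert (Hcs := sin2_cos2 (p t)). unfold Rsqr in Hcs.
    set (c := cos (p t)) in *. set (si := sin (p t)) in *.
    assert (Hw2 : w t * w t < normsq (u t) * normsq (u t)).
    { assert (E : w t * w t = (pp t * pp t + q t * q t) * (si * si + c * c) - (pp t * si - q t * c) * (pp t * si - q t * c)).
      { unfold w, pp. fold c si. ring. }
      rewrite E, Hcs, Hpq. assert (A := Rle_0_sqr (pp t * si - q t * c)). unfold Rsqr in A. nra. }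
    apply Rabs_def1; nra. }
  assert (HX : forall t, 0 < X t).
  { intros t. specialize (Hw t). apply Rabs_def2 in Hw. unfold w in Hw. unfold X, pp. lra. }
  assert (HD : forall t,
    let a := L + M * cos t in
    let p' := s / 2 * (2 * normsq (u t) - J) - a * q t in
    let f := - s * sin (p t) + a + D in
    is_derive X t (s * pp t - p' * cos (p t) - a * pp t * sin (p t) + Y t * f) /\
    is_derive Y t (p' * sin (p t) - a * pp t * cos (p t) + (pp t * cos (p t) + q t * sin (p t)) * f)).
  { intros t a p' f. destruct (Hl t) as [[A1 A2] [A3 A4]].
    assert (Df : is_derive p t f).
    { eapply is_derive_eq; [apply Hp|]. unfold f, a. ring. }
    assert (Drho : is_derive (fun t => normsq (u t)) t (s * pp t)).
    { eapply is_derive_eq; [exact (is_derive_Rplus _ _ t _ _ (is_derive_Rmult _ _ t _ _ A1 A1) (is_derive_Rmult _ _ t _ _ A2 A2))|].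
      unfold pp, Re, Im; simpl. field. }
    assert (Dpp : is_derive pp t p').
    { eapply is_derive_eq; [exact (is_derive_Rplus _ _ t _ _ (is_derive_Rmult _ _ t _ _ A3 A1) (is_derive_Rmult _ _ t _ _ A4 A2))|].
      unfold p', a, q. rewrite <- (HJt t). unfold normsq, Re, Im; simpl. field. }
    assert (Dq : is_derive q t (a * pp t)).
    { eapply is_derive_eq; [exact (is_derive_Rminus _ _ t _ _ (is_derive_Rmult _ _ t _ _ A4 A1) (is_derive_Rmult _ _ t _ _ A3 A2))|].
      unfold pp, a, Re, Im; simpl. field. }
    assert (Dc := is_derive_Rcomp cos p t _ _ (is_derive_cos (p t)) Df).
    assert (Ds := is_derive_Rcomp sin p t _ _ (is_derive_sin (p t)) Df).
    split.
    - eapply is_derive_eq; [exact (is_derive_Rminus _ _ t _ _ (is_derive_Rminus _ _ t _ _ Drho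
        (is_derive_Rmult _ _ t _ _ Dpp Dc)) (is_derive_Rmult _ _ t _ _ Dq Ds))|]. unfold Y. cbv beta. ring.
    - eapply is_derive_eq; [exact (is_derive_Rminus _ _ t _ _
        (is_derive_Rmult _ _ t _ _ Dpp Ds) (is_derive_Rmult _ _ t _ _ Dq Dc))|]. cbv beta. ring. }
  exists (fun t => p t + 2 * atan (Y t / X t)). split.
  - intros t. replace (p t + 2 * atan (Y t / X t) - p t) with (2 * atan (Y t / X t)) by ring.
    assert (H := atan_bound (Y t / X t)). apply Rabs_le. lra.
  - intros t. specialize (Hw t). specialize (HX t). specialize (Hrho t). specialize (Hpq t).
    assert (Hcs := sin2_cos2 (p t)). unfold Rsqr in Hcs.
    assert (Hcs' : cos (p t) * cos (p t) + sin (p t) * sin (p t) = 1) by lra.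
    destruct (elliptic_identity (normsq (u t)) (pp t) (q t) (cos (p t)) (sin (p t)) J
      (L + M * cos t) s D Hcs' Hpq) as [I1 I2].
    change (2 * normsq (u t) - J - 2 * (pp t * cos (p t) + q t * sin (p t))) with (n t) in I1, I2.
    fold (X t) in I1, I2. change (pp t * sin (p t) - q t * cos (p t)) with (Y t) in I1, I2.
    assert (Hn : 0 < n t).
    { assert (A := Rle_0_sqr (Y t)). unfold Rsqr in A. assert (0 < X t * X t) by nra. nra. }
    split.
    + split; [exact Hn|]. apply Rabs_def2 in Hw. unfold n. lra.
    + destruct (HD t) as [DX DY]. cbv zeta in DX, DY.
      eapply is_derive_eq.
      * apply is_derive_Rplus; [apply Hp|].
        apply is_derive_Rmult; [apply is_derive_Rconst|].
        apply (is_derive_atan_ratio X Y t _ _ ltac:(lra) DX DY).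
      * cbv beta. rewrite I1.
        match type of I2 with (_ - _) * _ + 2 * ?N = _ => set (NN := N) in * end.
        assert (HN : NN = (- s * q t * n t + D * J * normsq (u t) - (- s * sin (p t) + (L + M * cos t) + D - (L + M * cos t)) * (normsq (u t) * n t)) / 2) by lra.
        rewrite HN. field. split; lra.
Qed.

(** In the rotated phases the common speed cancels, and only the positive term D J / n remains. *)
Lemma elliptic_drift (s L M D J K : R) (u v : R -> C) (p1 p2 : R -> R) : 0 < J -> 0 < D ->
  linsys s L M u v -> (forall t, normsq (u t) - normsq (v t) = J) -> (forall t, normsq (u t) <= K) ->
  josephson s L M p1 -> josephson s (L + D) M p2 ->
  exists c e, 0 < e /\ forall t, 0 <= t -> c + e * t <= p2 t - p1 t.
Proof.
  intros HJ HD Hl HJt HK H1 H2.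
  assert (H1' : josephson s (L + 0) M p1) by (rewrite Rplus_0_r; exact H1).
  destruct (elliptic_phase s L M 0 J u v p1 HJ Hl HJt H1') as [th1 [B1 D1]].
  destruct (elliptic_phase s L M D J u v p2 HJ Hl HJt H2) as [th2 [B2 D2]].
  assert (HKp : 0 < K).
  { specialize (HJt 0). specialize (HK 0). assert (0 <= normsq (v 0)) by (unfold normsq; nra). lra. }
  (* Lower bound of D J / n, from n <= 4 |u|^2 <= 4 K. *)
  set (e := D * J / (4 * K)).
  (* Each rotated phase stays within pi of the true one, which costs 2 pi in the constant. *)
  exists (th2 0 - th1 0 - 2 * PI), e. split.
  { unfold e. apply Rdiv_lt_0_compat; nra. }
  intros t Ht.
  assert (Hc : e * t - e * 0 <= (th2 t - th1 t) - (th2 0 - th1 0)).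
  { eapply (derive_le_compare (fun t => e * t) (fun t => th2 t - th1 t) (fun _ => e) _ 0 t Ht).
    - intros x _. auto_derive; [trivial|ring].
    - intros x _. apply is_derive_Rminus; [apply D2|apply D1].
    - intros x _. cbv beta.
      destruct (D2 x) as [[P1 P2] _]. specialize (HK x).
      set (n2 := 2 * normsq (u x) - J - 2 * _) in P1, P2 |- *.
      assert (Hge : e <= D * J / n2).
      { unfold e, Rdiv. apply Rmult_le_compat_l; [nra|]. apply Rinv_le_contravar; lra. }
      unfold Rdiv in *. rewrite !Rmult_0_l. lra. }
  specialize (B1 t) as B1t. specialize (B2 t) as B2t.
  apply Rabs_le_between in B1t. apply Rabs_le_between in B2t. lra.
Qed.

(** Conjugating and exchanging the components, with a unimodular factor to restore the diagonal
    term, reverses the sign of the invariant form. A Floquet solution with |u| < |v| is thus reduced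
    to the case J > 0. *)
Lemma linsys_swap (s L M : R) (u v : R -> C) : linsys s L M u v ->
  linsys s L M (fun t => Cmult (Cconj (v t)) (cexp (0, - (L * t + M * sin t))))
               (fun t => Cmult (Cconj (u t)) (cexp (0, - (L * t + M * sin t)))).
Proof.
  intros H t. destruct (H t) as [A1 A2].
  assert (He : is_cderive (fun t => cexp (0, - (L * t + M * sin t))) t
    (Cmult (0, - (L + M * cos t)) (cexp (0, - (L * t + M * sin t))))).
  { apply (is_cderive_cexp (fun t => (0, - (L * t + M * sin t)))). split; [exact (is_derive_Rconst 0 t)|].
    simpl. auto_derive; [trivial|ring]. }
  split.
  - eapply is_cderive_eq; [exact (is_cderive_mult _ _ t _ _ (is_cderive_conj _ t _ A2) He)|].
    cbv beta. set (E := cexp _). destruct (u t), (v t), E. apply injective_projections; simpl; ring.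
  - eapply is_cderive_eq; [exact (is_cderive_mult _ _ t _ _ (is_cderive_conj _ t _ A1) He)|].
    cbv beta. set (E := cexp _). destruct (u t), (v t), E. apply injective_projections; simpl; ring.
Qed.

Lemma normsq_mult (a b : C) : normsq (Cmult a b) = normsq a * normsq b.
Proof. unfold normsq, Re, Im. destruct a, b; simpl. ring. Qed.

Lemma normsq_cexp_im (x : R) : normsq (cexp (0, x)) = 1.
Proof.
  unfold normsq, cexp, Re, Im; simpl. rewrite exp_0. assert (H := sin2_cos2 x). unfold Rsqr in H. lra.
Qed.

Lemma normsq_conj (a : C) : normsq (Cconj a) = normsq a.
Proof. unfold normsq, Cconj, Re, Im; simpl. ring. Qed.

Lemma normsq_pos (z : C) : 0 <= normsq z.
Proof. unfold normsq. nra. Qed.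

(** If the Floquet solution is not isotropic, invariance of the form forces |lam| = 1, so the
    solution is bounded and the linear drift contradicts equal rotation numbers. An isotropic one
    yields a phase fixed modulo 2 pi, hence an integer. *)
Lemma rotation_strict (s L M D r : R) : 0 < s -> 0 < D ->
  has_rotation s L M r -> has_rotation s (L + D) M r -> exists k, r = IZR k.
Proof.
  intros Hs HD R1 R2.
  destruct (linsys_floquet s L M) as [lam [u [v [Hl [Hnz Hf]]]]].
  assert (E0 := linsys_energy s L M u v (2 * PI) Hl).
  destruct (Hf 0) as [Eu Ev]. rewrite Rplus_0_l in Eu, Ev.
  destruct (Req_dec (normsq (u 0)) (normsq (v 0))) as [HJ|HJ].
  - destruct (isotropic_floquet_fixed s L M lam u v Hl Hnz Eu Ev HJ) as [x [k Hk]].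
    exists k. assert (Hr := fixed_has_rotation s L M x k Hk).
    destruct R1 as [p [Hp Hlim]].
    assert (Hlim' := has_rotation_any s L M (IZR k) p Hs Hr Hp).
    apply is_lim_unique in Hlim. apply is_lim_unique in Hlim'. rewrite Hlim in Hlim'.
    injection Hlim' as E. exact E.
  - exfalso.
    assert (Hlam : normsq lam = 1).
    { rewrite Eu, Ev, !normsq_mult in E0.
      apply (Rmult_eq_reg_r (normsq (u 0) - normsq (v 0))); [|lra]. lra. }
    assert (Hbd : forall w : R -> C, (forall t, exists d, is_cderive w t d) ->
      (forall t, w (t + 2 * PI) = Cmult lam (w t)) -> exists K, forall t, normsq (w t) <= K).
    { intros w Hd Hw. destruct (periodic_bounded (fun t => normsq (w t))) as [K HK].
      - intros t. apply (ex_derive_continuous (fun t => normsq (w t))). destruct (Hd t) as [d [A1 A2]].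
        eexists. exact (is_derive_Rplus _ _ t _ _ (is_derive_Rmult _ _ t _ _ A1 A1) (is_derive_Rmult _ _ t _ _ A2 A2)).
      - intros t. rewrite Hw, normsq_mult, Hlam. ring.
      - exists K. intros t. eapply Rle_trans; [apply Rle_abs|apply HK]. }
    destruct (Hbd u) as [Ku HKu]; [intros t; exact (ex_intro _ _ (proj1 (Hl t)))|intros t; apply Hf|].
    destruct (Hbd v) as [Kv HKv]; [intros t; exact (ex_intro _ _ (proj2 (Hl t)))|intros t; apply Hf|].
    destruct R1 as [p1 [H1 L1]]. destruct R2 as [p2 [H2 L2]].
    assert (Hdrift : exists c e, 0 < e /\ forall t, 0 <= t -> c + e * t <= p2 t - p1 t).
    { destruct (Rtotal_order (normsq (u 0)) (normsq (v 0))) as [Hlt|[Heq|Hgt]]; [|contradiction|].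
      - apply (elliptic_drift s L M D (normsq (v 0) - normsq (u 0)) Kv _ _ p1 p2 ltac:(lra) HD
          (linsys_swap s L M u v Hl)); [| |exact H1|exact H2].
        + intros t. rewrite !normsq_mult, !normsq_conj, !normsq_cexp_im.
          assert (E := linsys_energy s L M u v t Hl). lra.
        + intros t. rewrite normsq_mult, normsq_conj, normsq_cexp_im, Rmult_1_r. apply HKv.
      - apply (elliptic_drift s L M D (normsq (u 0) - normsq (v 0)) Ku u v p1 p2 ltac:(lra) HD Hl);
          [|exact HKu|exact H1|exact H2].
        intros t. apply (linsys_energy s L M u v t Hl). }
    destruct Hdrift as [c [e [He Hc]]].
    assert (Hle : e <= r - r).
    { apply (slope_lower (fun t => p2 t - p1 t) (r - r) c e).
      - apply (is_lim_ext (fun t => p2 t / t - p1 t / t)); [intros; unfold Rdiv; ring|].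
        apply (is_lim_minus' _ _ _ r r L2 L1).
      - intros n. apply Hc. apply Rmult_le_pos; [left; exact pi2_pos|apply pos_INR]. }
    lra.
Qed.

Lemma interior_integer (omega r : R) : 0 < omega ->
  (exists p, interior2 (phase_lock omega r) p) -> exists k, r = IZR k.
Proof.
  intros Hom [[B A] [e [He Hq]]].
  assert (Hso : 0 < / omega) by (apply Rinv_0_lt_compat, Hom).
  apply (rotation_strict (/ omega) (B / omega) (A / omega) (e / 2 / omega)); [exact Hso| | |].
  - apply Rdiv_lt_0_compat; lra.
  - apply phase_lock_rescaled; [exact Hom|]. apply Hq. unfold near2; simpl.
    rewrite !Rminus_diag, Rabs_R0. lra.
  - replace (B / omega + e / 2 / omega) with ((B + e / 2) / omega) by (field; lra).
    apply phase_lock_rescaled; [exact Hom|]. apply Hq. unfold near2; simpl.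
    rewrite Rminus_diag, Rabs_R0. replace (B + e / 2 - B) with (e / 2) by ring.
    rewrite Rabs_pos_eq; lra.
Qed.

(** * Constrictions *)

Lemma connected2_union (S T : R * R -> Prop) : connected2 S -> connected2 T ->
  (exists p, S p /\ T p) -> connected2 (fun p => S p \/ T p).
Proof.
  intros [[p0 HS0] HS] [_ HT] [m [HmS HmT]]. split; [exists p0; left; exact HS0|].
  intros U V HU HV Hc [a [Ha HaU]] [b [Hb HbV]].
  assert (Hcm : U m \/ V m) by (apply Hc; left; exact HmS).
  assert (KS : (exists p, S p /\ U p) -> (exists p, S p /\ V p) -> exists p, (S p \/ T p) /\ U p /\ V p).
  { intros E1 E2. destruct (HS U V HU HV) as [q [Q1 Q2]]; [intros q Hq; apply Hc; left; exact Hq|exact E1|exact E2|].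
    exists q. split; [left; exact Q1|exact Q2]. }
  assert (KT : (exists p, T p /\ U p) -> (exists p, T p /\ V p) -> exists p, (S p \/ T p) /\ U p /\ V p).
  { intros E1 E2. destruct (HT U V HU HV) as [q [Q1 Q2]]; [intros q Hq; apply Hc; right; exact Hq|exact E1|exact E2|].
    exists q. split; [right; exact Q1|exact Q2]. }
  destruct Hcm as [Hm|Hm].
  - destruct Hb as [Hb|Hb]; [apply KS|apply KT]; [exists m|exists b|exists m|exists b]; tauto.
  - destruct Ha as [Ha|Ha]; [apply KS|apply KT]; [exists a|exists m|exists a|exists m]; tauto.
Qed.

Lemma component2_unique (S D1 D2 T : R * R -> Prop) :
  component2 S D1 -> component2 S D2 -> connected2 T -> (forall p, T p -> S p) ->
  (exists p, D1 p /\ T p) -> (exists p, D2 p /\ T p) -> forall p, D1 p -> D2 p.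
Proof.
  intros [C1 [S1 M1]] [C2 [S2 M2]] CT ST E1 E2 p Hp.
  assert (U1 := connected2_union D1 T C1 CT E1).
  assert (U2 : connected2 (fun p => D2 p \/ (D1 p \/ T p))).
  { apply connected2_union; trivial. destruct E2 as [q [Q1 Q2]]. exists q. tauto. }
  apply (M2 _ U2); [|tauto|tauto].
  intros q [Hq|[Hq|Hq]]; [apply S2|apply S1|apply ST]; exact Hq.
Qed.

Lemma segment_connected (x1 y1 x2 y2 : R) :
  connected2 (fun p => exists t, 0 <= t <= 1 /\ p = (x1 + t * (x2 - x1), y1 + t * (y2 - y1))).
Proof.
  split; [exists (x1 + 0 * (x2 - x1), y1 + 0 * (y2 - y1)), 0; split; [lra|reflexivity]|].
  intros U V HU HV Hc [pa [[ta [Ta Ea]] Ha]] [pb [[tb [Tb Eb]] Hb]]. subst pa pb.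
  set (g := fun t => (x1 + t * (x2 - x1), y1 + t * (y2 - y1))).
  fold (g ta) in Ha. fold (g tb) in Hb.
  apply NNPP. intros Hno.
  assert (Hdis : forall t, 0 <= t <= 1 -> U (g t) -> V (g t) -> False).
  { intros t Ht H1 H2. apply Hno. exists (g t). split; [exists t; split; [exact Ht|reflexivity]|tauto]. }
  assert (Hcov : forall t, 0 <= t <= 1 -> U (g t) \/ V (g t)).
  { intros t Ht. apply Hc. exists t. split; [exact Ht|reflexivity]. }
  set (K := Rabs (x2 - x1) + Rabs (y2 - y1) + 1).
  assert (HK : 0 < K).
  { unfold K. assert (A1 := Rabs_pos (x2 - x1)). assert (A2 := Rabs_pos (y2 - y1)). lra. }
  assert (Hop : forall W t, open2 W -> W (g t) -> exists d, 0 < d /\ forall t', Rabs (t' - t) < d -> W (g t')).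
  { intros W t HW Ht. destruct (HW _ Ht) as [e [He Hq]]. exists (e / K).
    split; [apply Rdiv_lt_0_compat; assumption|]. intros t' Ht'. apply Hq.
    assert (Hk : Rabs (t' - t) * K < e).
    { apply Rlt_le_trans with (e / K * K); [apply Rmult_lt_compat_r; assumption|right; field; lra]. }
    assert (A0 := Rabs_pos (t' - t)). assert (A1 := Rabs_pos (x2 - x1)). assert (A2 := Rabs_pos (y2 - y1)).
    unfold near2, g, K in *; simpl. split.
    - replace (x1 + t' * (x2 - x1) - (x1 + t * (x2 - x1))) with ((t' - t) * (x2 - x1)) by ring.
      rewrite Rabs_mult. nra.
    - replace (y1 + t' * (y2 - y1) - (y1 + t * (y2 - y1))) with ((t' - t) * (y2 - y1)) by ring.
      rewrite Rabs_mult. nra. }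
  (* a locally constant {0,1}-valued function on [0,1] is constant, via the intermediate value theorem *)
  set (clamp := fun t => Rmax 0 (Rmin 1 t)).
  assert (Hcl : forall t, 0 <= clamp t <= 1).
  { intros t. unfold clamp. split; [apply Rmax_l|]. apply Rmax_lub; [lra|apply Rmin_l]. }
  assert (Hclid : forall t, 0 <= t <= 1 -> clamp t = t).
  { intros t Ht. unfold clamp. rewrite Rmin_right, Rmax_right; lra. }
  assert (Hcl1 : forall t t', Rabs (clamp t' - clamp t) <= Rabs (t' - t)).
  { intros t t'.
    assert (Hcc : forall x, (x <= 0 /\ clamp x = 0) \/ (0 <= x <= 1 /\ clamp x = x) \/ (1 <= x /\ clamp x = 1)).
    { intros x. unfold clamp. destruct (Rle_lt_dec x 0); [left|right; destruct (Rle_lt_dec x 1); [left|right]].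
      - rewrite Rmin_right, Rmax_left by lra. lra.
      - rewrite Rmin_right, Rmax_right by lra. lra.
      - rewrite Rmin_left, Rmax_right by lra. lra. }
    apply Rabs_le. assert (A1 := Rle_abs (t' - t)). assert (A2 := Rle_abs (- (t' - t))).
    rewrite Rabs_Ropp in A2. assert (A3 := Rabs_pos (t' - t)).
    destruct (Hcc t) as [[? ->]|[[? ->]|[? ->]]]; destruct (Hcc t') as [[? ->]|[[? ->]|[? ->]]]; lra. }
  set (f := fun t => if excluded_middle_informative (U (g (clamp t))) then 1 else -1).
  assert (Hf : continuity f).
  { intros t e He. unfold f.
    assert (Hd : exists d, 0 < d /\ forall t', Rabs (t' - t) < d -> (U (g (clamp t')) <-> U (g (clamp t)))).
    { destruct (Hcov (clamp t) (Hcl t)) as [H1|H1].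
      - destruct (Hop U _ HU H1) as [d [Hd Hq]]. exists d. split; [exact Hd|].
        intros t' Ht'. split; intros _; [exact H1|]. apply Hq.
        eapply Rle_lt_trans; [apply Hcl1|exact Ht'].
      - destruct (Hop V _ HV H1) as [d [Hd Hq]]. exists d. split; [exact Hd|].
        intros t' Ht'. split; intros H2; exfalso.
        + apply (Hdis (clamp t') (Hcl t') H2). apply Hq. eapply Rle_lt_trans; [apply Hcl1|exact Ht'].
        + exact (Hdis (clamp t) (Hcl t) H2 H1). }
    destruct Hd as [d [Hd Hq]]. exists d. split; [exact Hd|]. intros t' [_ Ht']. simpl in *. unfold R_dist in *.
    specialize (Hq t' Ht').
    destruct (excluded_middle_informative (U (g (clamp t')))); destruct (excluded_middle_informative (U (g (clamp t))));
      try tauto; rewrite Rminus_diag, Rabs_R0; exact He. }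
  assert (Fa : f ta = 1).
  { unfold f. rewrite Hclid by exact Ta. destruct (excluded_middle_informative (U (g ta))); [reflexivity|contradiction]. }
  assert (Fb : f tb = -1).
  { unfold f. rewrite Hclid by exact Tb. destruct (excluded_middle_informative (U (g tb))) as [H|]; [|reflexivity].
    destruct (Hdis tb Tb H Hb). }
  assert (Fz : forall z, f z <> 0).
  { intros z. unfold f. destruct (excluded_middle_informative _); lra. }
  destruct (Rtotal_order ta tb) as [H|[H|H]].
  - destruct (IVT (- f)%F ta tb (continuity_opp f Hf) H) as [z [_ Hz]]; unfold opp_fct in *; try lra.
    apply (Fz z). lra.
  - rewrite H in Fa. lra.
  - destruct (IVT f tb ta Hf H) as [z [_ Hz]]; try lra. exact (Fz z Hz).
Qed.

(** Every point of [T] reaches the vertical spine at abscissa [b] by a horizontal segment inside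
    [T], so any two points are joined by at most three segments. *)
Lemma comb_connected (T : R * R -> Prop) (b a1 a2 : R) : a1 <= a2 ->
  (forall a, a1 < a < a2 -> T (b, a)) ->
  (forall p, T p -> a1 < snd p < a2 /\ forall b', Rmin b (fst p) <= b' <= Rmax b (fst p) -> T (b', snd p)) ->
  (exists p, T p) -> connected2 T.
Proof.
  intros Ha Hspine Hteeth Hne. split; [exact Hne|].
  intros U V HU HV Hc [pa [Ta Ua]] [pb [Tb Vb]].
  apply NNPP. intros Hno.
  assert (Hseg : forall x1 y1 x2 y2, (forall t, 0 <= t <= 1 -> T (x1 + t * (x2 - x1), y1 + t * (y2 - y1))) ->
    U (x1, y1) -> V (x2, y2) -> False).
  { intros x1 y1 x2 y2 Hs H1 H2.
    destruct (segment_connected x1 y1 x2 y2) as [_ Hcs].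
    destruct (Hcs U V HU HV) as [q [[t [Ht Eq]] Hq]].
    - intros p [t [Ht Ep]]. apply Hc. rewrite Ep. apply Hs, Ht.
    - exists (x1, y1). split; [|exact H1]. exists 0. split; [lra|]. f_equal; ring.
    - exists (x2, y2). split; [|exact H2]. exists 1. split; [lra|]. f_equal; ring.
    - apply Hno. exists q. split; [rewrite Eq; apply Hs, Ht|exact Hq]. }
  assert (Htooth : forall p, T p -> forall t, 0 <= t <= 1 -> T (fst p + t * (b - fst p), snd p)).
  { intros p Hp t Ht. apply Hteeth; [exact Hp|]. unfold Rmin, Rmax.
    destruct (Rle_dec b (fst p)); nra. }
  assert (Hroot : forall p, T p -> T (b, snd p)) by (intros p Hp; apply Hspine, Hteeth, Hp).
  assert (Hsp : forall p q t, T p -> T q -> 0 <= t <= 1 ->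
    T (b + t * (b - b), snd p + t * (snd q - snd p))).
  { intros p q t Hp Hq Ht. replace (b + t * (b - b)) with b by ring. apply Hspine.
    destruct (Hteeth p Hp) as [P _]. destruct (Hteeth q Hq) as [Q _].
    split; [destruct (Rle_lt_dec (snd p) (snd q)); nra|destruct (Rle_lt_dec (snd p) (snd q)); nra]. }
  assert (Ur : U (b, snd pa)).
  { destruct (Hc _ (Hroot pa Ta)) as [|HV1]; [assumption|exfalso].
    apply (Hseg (fst pa) (snd pa) b (snd pa)); [|destruct pa; exact Ua|exact HV1].
    intros t Ht. replace (snd pa + t * (snd pa - snd pa)) with (snd pa) by ring. apply Htooth; assumption. }
  assert (Vr : V (b, snd pb)).
  { destruct (Hc _ (Hroot pb Tb)) as [HU1|]; [exfalso|assumption].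
    apply (Hseg b (snd pb) (fst pb) (snd pb)); [|exact HU1|destruct pb; exact Vb].
    intros t Ht. replace (snd pb + t * (snd pb - snd pb)) with (snd pb) by ring.
    replace (b + t * (fst pb - b)) with (fst pb + (1 - t) * (b - fst pb)) by ring.
    apply Htooth; [exact Tb|lra]. }
  apply (Hseg b (snd pa) b (snd pb)); [|exact Ur|exact Vr].
  intros t Ht. apply Hsp; assumption.
Qed.

(** * Phase-lock areas near a point *)

Lemma phase_lock_iff_fixed (omega B A : R) (k : Z) : 0 < omega ->
  phase_lock omega (IZR k) (B, A) <->
  exists x, poincare (/ omega) (B / omega) (A / omega) x = x + 2 * PI * IZR k.
Proof.
  intros Hom. rewrite (phase_lock_rescaled omega (IZR k) B A Hom). split.
  - apply integer_rotation_fixed.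
  - intros [x Hx]. exact (fixed_has_rotation _ _ _ x k Hx).
Qed.

Lemma poincare_fixed_between (s L M x y c : R) :
  poincare s L M x <= x + c -> y + c <= poincare s L M y ->
  exists z, poincare s L M z = z + c.
Proof.
  intros Hx Hy.
  set (g := fun z => poincare s L M z - z - c).
  apply NNPP. intros Hno.
  assert (Hc : forall z, continuous g z).
  { intros z. apply (continuous_minus (fun x => poincare s L M x - x) (fun _ => c));
      [|apply continuous_const].
    apply (continuous_minus (fun x => poincare s L M x) (fun x => x)); [apply poincare_continuous|apply continuous_id]. }
  destruct (const_sign g Hc) as [H|H].
  - intros z Hz. apply Hno. exists z. unfold g in Hz. lra.
  - specialize (H x). unfold g in H. lra.
  - specialize (H y). unfold g in H. lra.
Qed.

(** Displacement of the phase x over one period, minus k full turns. Level k is locked at [p]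
    exactly when this function of x has a zero, and it is strictly increasing in B. *)
Definition gap (omega : R) (k : Z) (p : R * R) (x : R) : R :=
  poincare (/ omega) (fst p / omega) (snd p / omega) x - x - 2 * PI * IZR k.

(** The factor [sg] records the sign of the displacement at the phase that moves, so that the two
    mirror-image situations share one proof. *)
Lemma gap_mono (omega sg : R) (k : Z) (b b' a x : R) : 0 < omega -> sg = 1 \/ sg = -1 ->
  sg * b' <= sg * b -> sg * gap omega k (b', a) x <= sg * gap omega k (b, a) x.
Proof.
  intros Hom Hsg Hb. assert (Hs : 0 < / omega) by (apply Rinv_0_lt_compat, Hom).
  assert (Hlt : forall c c', c < c' -> gap omega k (c, a) x < gap omega k (c', a) x).
  { intros c c' Hc. unfold gap. simpl.
    assert (H := poincare_strict (/ omega) (c / omega) (c' / omega) (a / omega) x Hs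
      (Rmult_lt_compat_r _ _ _ Hs Hc)). lra. }
  destruct (Rtotal_order b b') as [H|[->|H]]; [|lra|].
  - destruct Hsg as [->| ->]; [lra|]. specialize (Hlt b b' H). lra.
  - destruct Hsg as [->| ->]; [|lra]. specialize (Hlt b' b H). lra.
Qed.

Lemma gap_strict (omega sg : R) (k : Z) (b b' a x : R) : 0 < omega -> sg = 1 \/ sg = -1 ->
  sg * b' < sg * b -> sg * gap omega k (b', a) x < sg * gap omega k (b, a) x.
Proof.
  intros Hom Hsg Hb. assert (Hs : 0 < / omega) by (apply Rinv_0_lt_compat, Hom).
  assert (Hlt : forall c c', c < c' -> gap omega k (c, a) x < gap omega k (c', a) x).
  { intros c c' Hc. unfold gap. simpl.
    assert (H := poincare_strict (/ omega) (c / omega) (c' / omega) (a / omega) x Hs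
      (Rmult_lt_compat_r _ _ _ Hs Hc)). lra. }
  destruct Hsg as [->| ->].
  - specialize (Hlt b' b ltac:(lra)). lra.
  - specialize (Hlt b b' ltac:(lra)). lra.
Qed.

Lemma gap_open (omega sg : R) (k : Z) (p : R * R) (x : R) : 0 < omega -> sg = 1 \/ sg = -1 ->
  0 < sg * gap omega k p x ->
  exists d, 0 < d /\ forall q, near2 p q d -> 0 < sg * gap omega k q x.
Proof.
  intros Hom Hsg Hp. destruct (poincare_dependence (/ omega)) as [E [HE Hd]].
  set (m := sg * gap omega k p x) in *.
  exists (m * omega / (4 * E)). split; [apply Rdiv_lt_0_compat; nra|].
  intros q [Hq1 Hq2].
  specialize (Hd (fst q / omega) (snd q / omega) (fst p / omega) (snd p / omega) x x).
  rewrite Rminus_diag, Rabs_R0 in Hd.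
  assert (Hdiv : forall a b, Rabs (a / omega - b / omega) = Rabs (a - b) / omega).
  { intros a b. replace (a / omega - b / omega) with ((a - b) * / omega) by (field; lra).
    rewrite Rabs_mult, (Rabs_pos_eq (/ omega)); [reflexivity|]. left; apply Rinv_0_lt_compat, Hom. }
  rewrite !Hdiv in Hd.
  assert (Hb : E * (0 + Rabs (fst q - fst p) / omega + Rabs (snd q - snd p) / omega) < m).
  { apply Rlt_le_trans with (E * (0 + m / (4 * E) + m / (4 * E))).
    - apply Rmult_lt_compat_l; [exact HE|].
      assert (Hx : forall y, y < m * omega / (4 * E) -> y / omega < m / (4 * E)).
      { intros y Hy. apply (Rmult_lt_reg_r omega); [exact Hom|].
        replace (y / omega * omega) with y by (field; lra).
        replace (m / (4 * E) * omega) with (m * omega / (4 * E)) by (field; lra). exact Hy. }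
      apply Hx in Hq1. apply Hx in Hq2. lra.
    - replace (E * (0 + m / (4 * E) + m / (4 * E))) with (m / 2) by (field; lra). lra. }
  assert (Hlt : Rabs (gap omega k q x - gap omega k p x) < m).
  { unfold gap. match goal with |- Rabs ?z < _ => replace z with
      (poincare (/ omega) (fst q / omega) (snd q / omega) x - poincare (/ omega) (fst p / omega) (snd p / omega) x) by ring end.
    lra. }
  apply Rabs_def2 in Hlt. unfold m in Hlt. destruct Hsg as [->| ->]; lra.
Qed.

(* Near a point where the Poincare map is not a translation, the interior of the phase-lock area
   is cut out by a single inequality that is monotone in B. *)
Lemma phase_lock_interior_local (omega sg B A x0 x1 : R) (k : Z) : 0 < omega -> sg = 1 \/ sg = -1 ->
  gap omega k (B, A) x0 = 0 -> 0 < sg * gap omega k (B, A) x1 ->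
  exists (T : R * R -> Prop) d, 0 < d /\ connected2 T /\
    (forall p, T p -> interior2 (phase_lock omega (IZR k)) p) /\
    (forall p, near2 (B, A) p d -> interior2 (phase_lock omega (IZR k)) p -> T p).
Proof.
  intros Hom Hsg H0 H1.
  assert (Hsg2 : sg * sg = 1) by (destruct Hsg as [->| ->]; ring).
  assert (Hsa : Rabs sg = 1).
  { destruct Hsg as [->| ->]; [apply Rabs_pos_eq; lra|rewrite Rabs_left; lra]. }
  destruct (gap_open omega sg k (B, A) x1 Hom Hsg H1) as [d1 [Hd1 Hq1]].
  (* Moving B against [sg] gives the displacement at [x0], which is zero at (B, A), the sign
     opposite to [sg]. The vertical line through [b] will be the spine of the comb. *)
  set (b := B - sg * (d1 / 2)).
  assert (Hb0 : 0 < - sg * gap omega k (b, A) x0).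
  { assert (H := gap_strict omega sg k B b A x0 Hom Hsg ltac:(unfold b; nra)). rewrite H0 in H. lra. }
  assert (Hnsg : - sg = 1 \/ - sg = -1) by (destruct Hsg as [->| ->]; lra).
  destruct (gap_open omega (- sg) k (b, A) x0 Hom Hnsg Hb0) as [d2 [Hd2 Hq2]].
  set (d := Rmin d1 d2).
  assert (Hd : 0 < d) by (apply Rmin_glb_lt; assumption).
  assert (Hdd1 : d <= d1) by apply Rmin_l. assert (Hdd2 : d <= d2) by apply Rmin_r.
  (* In this box the displacement at [x1] keeps the sign [sg]. One phase with a strictly opposite
     displacement therefore forces a fixed phase, and the condition is open and monotone in B. *)
  set (T := fun p : R * R => Rabs (fst p - B) < d1 /\ Rabs (snd p - A) < d /\ exists x, sg * gap omega k p x < 0).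
  assert (Hspine : forall a, Rabs (a - A) < d -> sg * gap omega k (b, a) x0 < 0).
  { intros a Ha. assert (H := Hq2 (b, a)). unfold near2 in H; simpl in H.
    rewrite Rminus_diag, Rabs_R0 in H. specialize (H ltac:(split; lra)). lra. }
  assert (HbB : Rabs (b - B) < d1).
  { replace (b - B) with (- (sg * (d1 / 2))) by (unfold b; ring).
    rewrite Rabs_Ropp, Rabs_mult, Hsa, Rabs_pos_eq; lra. }
  assert (HTlock : forall p, T p -> phase_lock omega (IZR k) p).
  { intros [b' a'] [Hp1 [Hp2 [x Hx]]]. simpl in Hp1, Hp2.
    apply phase_lock_iff_fixed; [exact Hom|].
    assert (Hy := Hq1 (b', a')). unfold near2 in Hy; simpl in Hy. specialize (Hy ltac:(split; lra)).
    unfold gap in Hx, Hy; simpl in Hx, Hy.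
    destruct Hsg as [->| ->].
    - apply (poincare_fixed_between _ _ _ x x1); lra.
    - apply (poincare_fixed_between _ _ _ x1 x); lra. }
  assert (HTopen : forall p, T p -> interior2 T p).
  { intros p [Hp1 [Hp2 [x Hx]]].
    destruct (gap_open omega (- sg) k p x Hom Hnsg ltac:(lra)) as [r [Hr Hq]].
    exists (Rmin r (Rmin (d1 - Rabs (fst p - B)) (d - Rabs (snd p - A)))).
    split; [repeat apply Rmin_glb_lt; lra|]. intros q [Hn1 Hn2].
    assert (R1 := Rmin_l r (Rmin (d1 - Rabs (fst p - B)) (d - Rabs (snd p - A)))).
    assert (R2 := Rmin_r r (Rmin (d1 - Rabs (fst p - B)) (d - Rabs (snd p - A)))).
    assert (R3 := Rmin_l (d1 - Rabs (fst p - B)) (d - Rabs (snd p - A))).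
    assert (R4 := Rmin_r (d1 - Rabs (fst p - B)) (d - Rabs (snd p - A))).
    unfold T. split; [|split].
    - replace (fst q - B) with ((fst q - fst p) + (fst p - B)) by ring.
      eapply Rle_lt_trans; [apply Rabs_triang|]. lra.
    - replace (snd q - A) with ((snd q - snd p) + (snd p - A)) by ring.
      eapply Rle_lt_trans; [apply Rabs_triang|]. lra.
    - exists x. specialize (Hq q). unfold near2 in Hq. specialize (Hq ltac:(split; lra)). lra. }
  exists T, d. split; [exact Hd|]. split; [|split].
  - apply (comb_connected T b (A - d) (A + d)); [lra| | |].
    + intros a Ha. split; [exact HbB|]. simpl. split; [apply Rabs_def1; lra|].
      exists x0. apply Hspine. apply Rabs_def1; lra.
    + intros [b1 a] [Hp1 [Hp2 [x Hx]]]. simpl in *.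
      split; [apply Rabs_def2 in Hp2; lra|].
      intros b' Hb'. unfold T; simpl.
      assert (Hb'B : Rabs (b' - B) < d1).
      { apply Rabs_def2 in Hp1. apply Rabs_def2 in HbB. unfold Rmin, Rmax in Hb'.
        destruct (Rle_dec b b1); apply Rabs_def1; lra. }
      split; [exact Hb'B|]. split; [exact Hp2|].
      destruct (Rle_lt_dec (sg * b') (sg * b1)) as [Hc|Hc].
      * exists x. assert (H := gap_mono omega sg k b1 b' a x Hom Hsg Hc). lra.
      * assert (Hc2 : sg * b' <= sg * b).
        { unfold Rmin, Rmax in Hb'. destruct (Rle_dec b b1); destruct Hsg as [->| ->]; lra. }
        exists x0. assert (H := gap_mono omega sg k b b' a x0 Hom Hsg Hc2).
        specialize (Hspine a Hp2). lra.
    + exists (b, A). split; [exact HbB|]. simpl. rewrite Rminus_diag, Rabs_R0. split; [exact Hd|].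
      exists x0. apply Hspine. rewrite Rminus_diag, Rabs_R0. exact Hd.
  - intros p Hp. destruct (HTopen p Hp) as [e [He Hq]]. exists e. split; [exact He|].
    intros q Hnq. apply HTlock, Hq, Hnq.
  - intros [b1 a] [Hp1 Hp2] [e [He Hq]]. simpl in Hp1, Hp2. unfold T; simpl.
    split; [lra|]. split; [exact Hp2|].
    (* An interior point stays locked after B is pushed by sg e/2. Returning to [b1], strict
       monotonicity makes the displacement at that fixed phase strictly opposite to [sg]. *)
    assert (Hl : phase_lock omega (IZR k) (b1 + sg * (e / 2), a)).
    { apply Hq. unfold near2; simpl. rewrite Rminus_diag, Rabs_R0.
      replace (b1 + sg * (e / 2) - b1) with (sg * (e / 2)) by ring.
      rewrite Rabs_mult, Hsa, Rabs_pos_eq; lra. }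
    apply phase_lock_iff_fixed in Hl; [|exact Hom]. destruct Hl as [x Hx].
    exists x.
    assert (H := gap_strict omega sg k (b1 + sg * (e / 2)) b1 a x Hom Hsg ltac:(nra)).
    unfold gap at 2 in H. simpl in H. rewrite Hx in H. ring_simplify (x + 2 * PI * IZR k - x - 2 * PI * IZR k) in H. lra.
Qed.

Lemma constriction_translation (omega B A : R) : 0 < omega -> constriction omega B A ->
  exists k, forall x, poincare (/ omega) (B / omega) (A / omega) x = x + 2 * PI * IZR k.
Proof.
  intros Hom [_ [r [Hint [Hlock [D1 [D2 [C1 [C2 [[p0 [Hp1 Hp2]] [_ [K1 K2]]]]]]]]]]].
  destruct (interior_integer omega r Hom Hint) as [k ->]. exists k.
  apply phase_lock_iff_fixed in Hlock; [|exact Hom]. destruct Hlock as [x0 Hx0].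
  intros x1. apply NNPP. intros Hne.
  assert (Hg0 : gap omega k (B, A) x0 = 0) by (unfold gap; simpl; lra).
  assert (Hsg : exists sg, (sg = 1 \/ sg = -1) /\ 0 < sg * gap omega k (B, A) x1).
  { unfold gap; simpl. set (P := poincare _ _ _ x1) in *.
    destruct (Rtotal_order P (x1 + 2 * PI * IZR k)) as [H|[H|H]]; [|contradiction|].
    - exists (-1). split; [right; reflexivity|lra].
    - exists 1. split; [left; reflexivity|lra]. }
  destruct Hsg as [sg [Hsg Hg1]].
  destruct (phase_lock_interior_local omega sg B A x0 x1 k Hom Hsg Hg0 Hg1) as [T [d [Hd [CT [TS TD]]]]].
  apply Hp2. apply (component2_unique (interior2 (phase_lock omega (IZR k))) D1 D2 T); trivial.
  - destruct (K1 d Hd) as [q [Q1 Q2]]. exists q. split; [exact Q1|]. apply TD; [exact Q2|apply C1, Q1].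
  - destruct (K2 d Hd) as [q [Q1 Q2]]. exists q. split; [exact Q1|]. apply TD; [exact Q2|apply C2, Q1].
Qed.

(** * Trivial monodromy *)

Definition circ (t : R) : C := (cos t, sin t).

Lemma circ_neq_0 (t : R) : circ t <> RtoC 0.
Proof.
  intros E. assert (H := sin2_cos2 t). unfold Rsqr in H.
  assert (E1 := f_equal fst E). assert (E2 := f_equal snd E). simpl in E1, E2. rewrite E1, E2 in H. lra.
Qed.

Lemma circ_derive (t : R) : is_cderive circ t (Cmult Ci (circ t)).
Proof.
  split; simpl; [eapply is_derive_eq; [apply is_derive_cos|ring]|eapply is_derive_eq; [apply is_derive_sin|ring]].
Qed.

Lemma circ_inv (t : R) : Cinv (circ t) = (cos t, - sin t).
Proof.
  assert (H := sin2_cos2 t). unfold Rsqr in H.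
  assert (Hz := circ_neq_0 t).
  transitivity (Cmult (Cmult (cos t, - sin t) (circ t)) (Cinv (circ t))).
  - replace (Cmult (cos t, - sin t) (circ t)) with (RtoC 1); [ring|].
    unfold circ. apply injective_projections; simpl; lra.
  - field. exact Hz.
Qed.

Lemma gauge_on_circle (omega : R) (l : nat) (mu : R) (H : C -> mat2) (t : R) :
  0 < omega -> gauge_solution omega l mu H -> 0 <= t <= PI ->
  let a : C := (0, - (INR l + 2 * mu * cos t)) in
  is_cderive (fun t => m11 (H (circ t))) t (Cmult (RtoC (kap omega)) (m21 (H (circ t)))) /\
  is_cderive (fun t => m21 (H (circ t))) t
    (Cminus (Cmult (RtoC (kap omega)) (m11 (H (circ t)))) (Cmult a (m21 (H (circ t))))).
Proof.
  intros Hom HG Ht a.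
  assert (Him : 0 <= Im (circ t)) by (apply sin_ge_0; lra).
  destruct (gauge_solution_along omega l mu H circ t _ Hom HG Him (circ_neq_0 t) (circ_derive t))
    as [D1 [_ [D3 _]]].
  assert (He : Cmult (Ckap omega) (Cmult (Cmult Ci (circ t)) (Cinv (circ t))) = RtoC (kap omega)).
  { transitivity (Cmult (Ckap omega) Ci); [field; apply circ_neq_0|].
    unfold Ckap. apply injective_projections; simpl; ring. }
  assert (Hd : Cmult (diag_coef l mu (circ t)) (Cmult Ci (circ t)) = a).
  { unfold diag_coef.
    transitivity (Copp (Cmult Ci (Cplus (Cl l) (Cmult (Cmu mu) (Cplus (Cinv (circ t)) (circ t)))))).
    - field. apply circ_neq_0.
    - rewrite circ_inv. unfold a, circ, Cl, Cmu. apply injective_projections; simpl; ring. }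
  rewrite He, Hd in *. split; assumption.
Qed.

(** A version at a single time, because the column of [H] is available only on the closed upper half
    circle. *)
Definition linsys_at (s L M : R) (u v : R -> C) (t : R) : Prop :=
  is_cderive u t (Cplus (Cmult (0, - (L + M * cos t)) (u t)) (Cmult (RtoC (s / 2)) (v t))) /\
  is_cderive v t (Cmult (RtoC (s / 2)) (u t)).

(** The trace of the system is - i (L + M cos t), and the exponential prefactor compensates for
    it. *)
Lemma wronskian_const (s L M a b : R) (u1 v1 u2 v2 : R -> C) : a <= b ->
  (forall t, a <= t <= b -> linsys_at s L M u1 v1 t) ->
  (forall t, a <= t <= b -> linsys_at s L M u2 v2 t) ->
  Cmult (cexp (0, L * a + M * sin a)) (Cminus (Cmult (u1 a) (v2 a)) (Cmult (u2 a) (v1 a))) =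
  Cmult (cexp (0, L * b + M * sin b)) (Cminus (Cmult (u1 b) (v2 b)) (Cmult (u2 b) (v1 b))).
Proof.
  intros Hab H1 H2.
  apply (cderive_zero_const (fun t => Cmult (cexp (0, L * t + M * sin t))
    (Cminus (Cmult (u1 t) (v2 t)) (Cmult (u2 t) (v1 t)))) (fun _ => RtoC 0) a b Hab); [|reflexivity].
  intros t Ht. destruct (H1 t Ht) as [A1 A2]. destruct (H2 t Ht) as [B1 B2].
  assert (He : is_cderive (fun t => cexp (0, L * t + M * sin t)) t
    (Cmult (0, L + M * cos t) (cexp (0, L * t + M * sin t)))).
  { apply (is_cderive_cexp (fun t => (0, L * t + M * sin t))). split; [exact (is_derive_Rconst 0 t)|].
    simpl. auto_derive; [trivial|ring]. }
  eapply is_cderive_eq; [exact (is_cderive_mult _ _ t _ _ He (is_cderive_minus _ _ t _ _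
    (is_cderive_mult _ _ t _ _ A1 B2) (is_cderive_mult _ _ t _ _ B1 A2)))|].
  cbv beta.
  replace ((0, - (L + M * cos t)) : C) with (Copp ((0, L + M * cos t) : C))
    by (apply injective_projections; simpl; ring).
  ring.
Qed.

Lemma cexp_im (x : R) : cexp (0, x) = (cos x, sin x).
Proof. unfold cexp; simpl. rewrite exp_0. apply injective_projections; simpl; ring. Qed.

Lemma sin_INR_PI (l : nat) : sin (INR l * PI) = 0.
Proof.
  assert (H := sin_periodZ (- (INR l * PI)) (Z.of_nat l)). rewrite <- INR_IZR_INZ in H.
  replace (- (INR l * PI) + 2 * PI * INR l) with (INR l * PI) in H by ring.
  rewrite sin_neg in H. lra.
Qed.

Lemma lift_floquet (s L M x : R) (k : Z) : poincare s L M x = x + 2 * PI * IZR k ->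
  exists lam : C, forall t,
    lift_u s (jflow s L M x) (t + 2 * PI) = Cmult lam (lift_u s (jflow s L M x) t) /\
    lift_v s (jflow s L M x) (t + 2 * PI) = Cmult lam (lift_v s (jflow s L M x) t).
Proof.
  intros Hx. set (u := lift_u s (jflow s L M x)). set (v := lift_v s (jflow s L M x)).
  assert (H : linsys s L M u v) by (apply linsys_lift, jflow_josephson).
  exists (v (2 * PI)). intros t.
  assert (Hs := linsys_shift_time s L M _ _ H).
  assert (Hl := linsys_comb s L M (v (2 * PI)) (RtoC 0) _ _ _ _ H H).
  destruct (linsys_unique s L M _ _ _ _ Hs Hl) with (t := t) as [A1 A2].
  - assert (Hu0 : u 0 = (cos x, - sin x)) by (unfold u; rewrite lift_u_0, jflow_0; reflexivity).
    assert (Hu2 : u (2 * PI) = Cmult (v (2 * PI)) (cos x, - sin x)).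
    { unfold u, lift_u. fold v (poincare s L M x).
      rewrite Hx, cexp_im, cos_neg, sin_neg, cos_periodZ, sin_periodZ. reflexivity. }
    cbv beta. rewrite Rplus_0_l, Hu0, Hu2. ring.
  - assert (Hv0 : v 0 = RtoC 1) by apply lift_v_0.
    cbv beta. rewrite Rplus_0_l, Hv0. ring.
  - cbv beta in A1, A2. split; [rewrite A1|rewrite A2]; ring.
Qed.

Lemma Cmult_eq_1_reg (a b c : C) : Cmult a b = RtoC 1 -> Cmult a c = RtoC 1 -> b = c.
Proof.
  intros H1 H2. transitivity (Cmult (Cmult a b) c).
  - transitivity (Cmult (Cmult a c) b); [rewrite H2|]; ring.
  - rewrite H1. ring.
Qed.

Lemma Cconj_real_mult (f h : C) : Im f = 0 -> Im h = 0 -> Cconj (Cmult f h) = Cmult f h.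
Proof.
  intros Hf Hh. destruct f, h. unfold Im in *. simpl in *. rewrite Hf, Hh.
  apply injective_projections; simpl; ring.
Qed.

Lemma Cconj_imag_mult (f h : C) : Im f = 0 -> Re h = 0 -> Copp (Cconj (Cmult f h)) = Cmult f h.
Proof.
  intros Hf Hh. destruct f, h. unfold Im, Re in *. simpl in *. rewrite Hf, Hh.
  apply injective_projections; simpl; ring.
Qed.

(** If every phase is fixed modulo 2 pi, each lift is a Floquet solution. Since l is an integer the
    Wronskian of two lifts is periodic, so the multipliers of two independent lifts have product 1.
    The phase pi/2 serves as a third lift: it makes the multipliers at 0 and pi both inverse to its
    own, hence equal with square 1. *)
Lemma scalar_monodromy (s M : R) (l : nat) (k : Z) :
  (forall x, poincare s (INR l) M x = x + 2 * PI * IZR k) ->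
  exists lam : C, Cmult lam lam = RtoC 1 /\ forall x t, x = 0 \/ x = PI ->
    lift_u s (jflow s (INR l) M x) (t + 2 * PI) = Cmult lam (lift_u s (jflow s (INR l) M x) t) /\
    lift_v s (jflow s (INR l) M x) (t + 2 * PI) = Cmult lam (lift_v s (jflow s (INR l) M x) t).
Proof.
  intros HP.
  assert (HW : forall x y lx ly, cos x <> cos y ->
    (forall t, lift_u s (jflow s (INR l) M x) (t + 2 * PI) = Cmult lx (lift_u s (jflow s (INR l) M x) t) /\
      lift_v s (jflow s (INR l) M x) (t + 2 * PI) = Cmult lx (lift_v s (jflow s (INR l) M x) t)) ->
    (forall t, lift_u s (jflow s (INR l) M y) (t + 2 * PI) = Cmult ly (lift_u s (jflow s (INR l) M y) t) /\
      lift_v s (jflow s (INR l) M y) (t + 2 * PI) = Cmult ly (lift_v s (jflow s (INR l) M y) t)) ->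
    Cmult lx ly = RtoC 1).
  { intros x y lx ly Hxy Fx Fy.
    assert (Lx := linsys_lift s (INR l) M _ (jflow_josephson s (INR l) M x)).
    assert (Ly := linsys_lift s (INR l) M _ (jflow_josephson s (INR l) M y)).
    assert (E := wronskian_const s (INR l) M 0 (2 * PI) _ _ _ _ ltac:(left; exact pi2_pos)
      (fun t _ => Lx t) (fun t _ => Ly t)).
    destruct (Fx 0) as [Fx1 Fx2]. destruct (Fy 0) as [Fy1 Fy2]. rewrite Rplus_0_l in Fx1, Fx2, Fy1, Fy2.
    rewrite Fx1, Fx2, Fy1, Fy2, !lift_u_0, !lift_v_0, !jflow_0 in E.
    rewrite !cexp_im in E.
    assert (S2 : sin (2 * PI) = 0) by (rewrite <- (Rplus_0_l (2 * PI)), <- (Rmult_1_r (2 * PI)), (sin_periodZ 0 1); apply sin_0).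
    rewrite S2, sin_0 in E.
    replace (INR l * (2 * PI) + M * 0) with (0 + 2 * PI * IZR (Z.of_nat l)) in E by (rewrite <- INR_IZR_INZ; ring).
    rewrite cos_periodZ, sin_periodZ in E.
    replace (INR l * 0 + M * 0) with 0 in E by ring. rewrite cos_0, sin_0 in E.
    set (w := Cminus ((cos x, - sin x) : C) ((cos y, - sin y) : C)).
    assert (Hw : w <> RtoC 0).
    { intros E0. apply (f_equal fst) in E0. unfold w in E0. simpl in E0. lra. }
    assert (E' : w = Cmult (Cmult lx ly) w).
    { transitivity (Cmult ((1, 0) : C) (Cminus (Cmult ((cos x, - sin x) : C) (RtoC 1)) (Cmult ((cos y, - sin y) : C) (RtoC 1)))).
      - unfold w. apply injective_projections; simpl; ring.
      - rewrite E. unfold w. replace ((1, 0) : C) with (RtoC 1) by reflexivity. ring. }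
    transitivity (Cmult (Cmult (Cmult lx ly) w) (Cinv w)); [field; exact Hw|].
    rewrite <- E'. field. exact Hw. }
  destruct (lift_floquet s (INR l) M 0 k (HP 0)) as [l0 F0].
  destruct (lift_floquet s (INR l) M PI k (HP PI)) as [l1 F1].
  destruct (lift_floquet s (INR l) M (PI / 2) k (HP (PI / 2))) as [l2 F2].
  assert (E01 := HW 0 PI l0 l1 ltac:(rewrite cos_0, cos_PI; lra) F0 F1).
  assert (E02 := HW (PI / 2) 0 l2 l0 ltac:(rewrite cos_0, cos_PI2; lra) F2 F0).
  assert (E12 := HW (PI / 2) PI l2 l1 ltac:(rewrite cos_PI, cos_PI2; lra) F2 F1).
  assert (Hl : l0 = l1) by exact (Cmult_eq_1_reg l2 l0 l1 E02 E12).
  exists l0. split; [rewrite Hl at 2; exact E01|].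
  intros x t [->| ->]; [apply F0|]. rewrite Hl. apply F1.
Qed.

(** The first column and its mirror image under complex conjugation meet at -1, where reality makes
    them coincide. At 1 they then differ by the scalar monodromy [lam]: conj h11 = lam h11 and -
    conj h21 = lam h21. Squaring removes [lam]. *)
Lemma trivial_monodromy_real (omega : R) (l : nat) (mu : R) (H : C -> mat2) (k : Z) :
  0 < omega -> 0 < mu -> gauge_solution omega l mu H ->
  (forall x, poincare (/ omega) (INR l) (2 * mu) x = x + 2 * PI * IZR k) ->
  let h := H (RtoC 1) in
  Im (Cplus (Cmult (m11 h) (m11 h)) (Cmult (m21 h) (m21 h))) = 0.
Proof.
  intros Hom Hmu HG HP h.
  set (s := / omega). set (L := INR l). set (M := 2 * mu).
  assert (Hk : s / 2 = kap omega) by (unfold s, kap; field; lra).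
  set (F := fun t => cexp (0, - (L * t + M * sin t))).
  set (U := fun t => Cmult (F t) (m11 (H (circ t)))). set (V := fun t => Cmult (F t) (m21 (H (circ t)))).
  assert (HF : forall t, is_cderive F t (Cmult (0, - (L + M * cos t)) (F t))).
  { intros t. apply (is_cderive_cexp (fun t => (0, - (L * t + M * sin t)))).
    split; [exact (is_derive_Rconst 0 t)|]. simpl. auto_derive; [trivial|ring]. }
  assert (HUV : forall t, 0 <= t <= PI -> linsys_at s L M U V t).
  { intros t Ht. destruct (gauge_on_circle omega l mu H t Hom HG Ht) as [D1 D3].
    unfold linsys_at. rewrite Hk. split.
    - eapply is_cderive_eq; [exact (is_cderive_mult _ _ t _ _ (HF t) D1)|]. unfold U, V. ring.
    - eapply is_cderive_eq; [exact (is_cderive_mult _ _ t _ _ (HF t) D3)|]. unfold U.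
      fold L M. ring. }
  (* Reflection in the real axis carries solutions on the upper half circle to solutions on the
     lower one; the minus sign in [Vs] keeps the coupling coefficient positive under time
     reversal. *)
  set (Us := fun t => Cconj (U (- t))). set (Vs := fun t => Copp (Cconj (V (- t)))).
  assert (HUVs : forall t, - PI <= t <= 0 -> linsys_at s L M Us Vs t).
  { intros t Ht. destruct (HUV (- t) ltac:(lra)) as [A1 A2]. rewrite cos_neg in A1.
    assert (Hn : is_derive (fun t => - t) t (-1)) by (auto_derive; [trivial|ring]).
    split.
    - eapply is_cderive_eq; [exact (is_cderive_conj _ t _ (is_cderive_comp U (fun t => - t) t (-1) _ A1 Hn))|].
      unfold Us, Vs. destruct (U (- t)), (V (- t)). apply injective_projections; simpl; ring.
    - eapply is_cderive_eq; [exact (is_cderive_opp _ t _ (is_cderive_conj _ t _ (is_cderive_comp V (fun t => - t) t (-1) _ A2 Hn)))|].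
      unfold Us. destruct (U (- t)). apply injective_projections; simpl; ring. }
  assert (Hc1 : circ 0 = RtoC 1) by (unfold circ; rewrite cos_0, sin_0; reflexivity).
  assert (HcPI : circ PI = RtoC (-1 * 1)).
  { unfold circ. rewrite cos_PI, sin_PI. apply injective_projections; simpl; ring. }
  assert (HF0 : F 0 = RtoC 1).
  { unfold F. rewrite sin_0, !Rmult_0_r, Rplus_0_l, Ropp_0. apply cexp_0. }
  assert (HFPI : Im (F PI) = 0).
  { unfold F. rewrite cexp_im, sin_PI. simpl. rewrite Rmult_0_r, Rplus_0_r, sin_neg.
    unfold L. rewrite sin_INR_PI. ring. }
  destruct (gauge_neg_axis_reality omega l mu H 1 Hom Hmu HG Rlt_0_1) as [Y1 Y2].
  rewrite <- HcPI in Y1, Y2.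
  assert (HUs : Us (- PI) = U PI).
  { unfold Us. rewrite Ropp_involutive. apply Cconj_real_mult; assumption. }
  assert (HVs : Vs (- PI) = V PI).
  { unfold Vs. rewrite Ropp_involutive. apply Cconj_imag_mult; assumption. }
  destruct (scalar_monodromy s M l k HP) as [lam [Hlam HFl]]. fold L in HFl.
  (* The two half-circle solutions are compared through their Wronskians with the lifts of 0 and pi,
     which are defined on the whole line. Two independent test solutions suffice to recover both
     components at time 0. *)
  assert (Hdet : forall x, x = 0 \/ x = PI ->
    Cminus (Cmult (Us 0) (lift_v s (jflow s L M x) 0)) (Cmult (lift_u s (jflow s L M x) 0) (Vs 0)) =
    Cmult lam (Cminus (Cmult (U 0) (lift_v s (jflow s L M x) 0)) (Cmult (lift_u s (jflow s L M x) 0) (V 0)))).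
  { intros x Hx.
    assert (Lx := linsys_lift s L M _ (jflow_josephson s L M x)).
    assert (HPI := PI_RGT_0).
    assert (E1 := wronskian_const s L M (- PI) 0 _ _ _ _ ltac:(lra) HUVs (fun t _ => Lx t)).
    assert (E2 := wronskian_const s L M 0 PI _ _ _ _ ltac:(lra) HUV (fun t _ => Lx t)).
    rewrite HUs, HVs in E1.
    destruct (HFl x (- PI) Hx) as [G1 G2].
    replace (- PI + 2 * PI) with PI in G1, G2 by ring. rewrite G1, G2 in E2.
    rewrite sin_0, sin_PI in E2. rewrite sin_neg, sin_0, sin_PI in E1.
    replace (L * - PI + M * - 0) with (- (L * PI)) in E1 by ring.
    replace (L * PI + M * 0) with (L * PI) in E2 by ring.
    replace (L * 0 + M * 0) with 0 in E1, E2 by ring.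
    rewrite !cexp_im, cos_0, sin_0 in E1, E2.
    rewrite cos_neg, sin_neg in E1. unfold L in E1, E2 at 1. rewrite sin_INR_PI, Ropp_0 in E1.
    unfold L in E2. rewrite sin_INR_PI in E2. fold L in E1, E2.
    assert (One : ((1, 0) : C) = RtoC 1) by reflexivity. rewrite One in E1, E2.
    rewrite Cmult_1_l in E1, E2. rewrite <- E1, E2.
    transitivity (Cmult (RtoC 1) (Cmult ((cos (L * PI), 0) : C) (Cminus (Cmult (U PI) (lift_v s (jflow s L M x) (- PI)))
      (Cmult (lift_u s (jflow s L M x) (- PI)) (V PI))))); [ring|].
    rewrite <- Hlam. ring. }
  assert (HD0 := Hdet 0 (or_introl eq_refl)). assert (HD1 := Hdet PI (or_intror eq_refl)).
  rewrite !lift_v_0, !lift_u_0, !jflow_0 in HD0, HD1.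
  rewrite cos_0, sin_0 in HD0. rewrite cos_PI, sin_PI in HD1.
  assert (EU : Us 0 = Cmult lam (U 0)).
  { assert (E : Cplus (Cminus (Cmult (Us 0) (RtoC 1)) (Cmult ((1, - 0) : C) (Vs 0)))
      (Cminus (Cmult (Us 0) (RtoC 1)) (Cmult ((-1, - 0) : C) (Vs 0))) = Cmult (RtoC 2) (Us 0)).
    { destruct (Us 0), (Vs 0). apply injective_projections; simpl; ring. }
    rewrite HD0, HD1 in E.
    assert (E2 : Cmult (RtoC (/ 2)) (Cmult (RtoC 2) (Us 0)) = Us 0).
    { destruct (Us 0). apply injective_projections; simpl; field. }
    rewrite <- E2, <- E. destruct (U 0), (V 0), lam. apply injective_projections; simpl; field. }
  assert (EV : Vs 0 = Cmult lam (V 0)).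
  { assert (E : Cminus (Cminus (Cmult (Us 0) (RtoC 1)) (Cmult ((-1, - 0) : C) (Vs 0)))
      (Cminus (Cmult (Us 0) (RtoC 1)) (Cmult ((1, - 0) : C) (Vs 0))) = Cmult (RtoC 2) (Vs 0)).
    { destruct (Us 0), (Vs 0). apply injective_projections; simpl; ring. }
    rewrite HD0, HD1 in E.
    assert (E2 : Cmult (RtoC (/ 2)) (Cmult (RtoC 2) (Vs 0)) = Vs 0).
    { destruct (Vs 0). apply injective_projections; simpl; field. }
    rewrite <- E2, <- E. destruct (U 0), (V 0), lam. apply injective_projections; simpl; field. }
  assert (HU0 : U 0 = m11 h) by (unfold U; rewrite HF0, Hc1; unfold h; ring).
  assert (HV0 : V 0 = m21 h) by (unfold V; rewrite HF0, Hc1; unfold h; ring).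
  unfold Us in EU. unfold Vs in EV. rewrite Ropp_0, HU0 in EU. rewrite Ropp_0, HV0 in EV.
  assert (Econj : Cconj (Cplus (Cmult (m11 h) (m11 h)) (Cmult (m21 h) (m21 h))) =
    Cplus (Cmult (m11 h) (m11 h)) (Cmult (m21 h) (m21 h))).
  { transitivity (Cplus (Cmult (Cconj (m11 h)) (Cconj (m11 h)))
      (Cmult (Copp (Cconj (m21 h))) (Copp (Cconj (m21 h))))).
    - destruct (m11 h), (m21 h). apply injective_projections; simpl; ring.
    - rewrite EU, EV. transitivity (Cmult (Cmult lam lam) (Cplus (Cmult (m11 h) (m11 h)) (Cmult (m21 h) (m21 h)))); [ring|].
      rewrite Hlam. ring. }
  apply (f_equal snd) in Econj. unfold Cconj in Econj. simpl in Econj. unfold Im. simpl. lra.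
Qed.

(** * Analytic dependence on the parameter *)

Definition analytic_at (g : R -> R) (m0 : R) : Prop :=
  exists (a : nat -> R) (r : R), 0 < r /\ forall d, Rabs d < r -> is_pseries a d (g (m0 + d)).

(** Convergence at a point [e] strictly between |d| and r bounds the terms there, so the radius is
    at least [e] and exceeds |d|. *)
Lemma analytic_CV (a : nat -> R) (r : R) (f : R -> R) :
  (forall d, Rabs d < r -> is_pseries a d (f d)) ->
  forall d, Rabs d < r -> Rbar_lt (Rabs d) (CV_radius a).
Proof.
  intros H d Hd. assert (Hp := Rabs_pos d). set (e := (Rabs d + r) / 2).
  assert (He : Rabs e < r) by (rewrite Rabs_pos_eq; unfold e; lra).
  assert (Hl := H e He). apply is_pseries_R in Hl.
  assert (H0 : is_lim_seq (fun n => a n * e ^ n) 0).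
  { apply ex_series_lim_0. exists (f e). exact Hl. }
  assert (Hle : Rbar_le e (CV_radius a)).
  { apply (CV_radius_bounded a). apply is_lim_seq_spec in H0.
    destruct (H0 (mkposreal 1 Rlt_0_1)) as [N HN]. simpl in HN.
    assert (Hfin : forall K, exists M, forall n, (n < K)%nat -> Rabs (a n * e ^ n) <= M).
    { induction K as [|K [M HM]]; [exists 0; intros; lia|].
      exists (Rmax M (Rabs (a K * e ^ K))). intros n Hn.
      destruct (Nat.eq_dec n K) as [->|Hne]; [apply Rmax_r|].
      eapply Rle_trans; [apply HM; lia|apply Rmax_l]. }
    destruct (Hfin N) as [M HM]. exists (Rmax M 1). intros n.
    destruct (Nat.lt_ge_cases n N) as [Hn|Hn].
    - eapply Rle_trans; [apply HM, Hn|apply Rmax_l].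
    - eapply Rle_trans; [|apply Rmax_r]. specialize (HN n Hn). rewrite Rminus_0_r in HN. lra. }
  eapply Rbar_lt_le_trans; [|exact Hle]. simpl. unfold e. lra.
Qed.

Lemma analytic_plus (f g : R -> R) (m : R) :
  analytic_at f m -> analytic_at g m -> analytic_at (fun x => f x + g x) m.
Proof.
  intros [a [r [Hr Ha]]] [b [s [Hs Hb]]]. exists (PS_plus a b), (Rmin r s).
  split; [apply Rmin_glb_lt; assumption|]. intros d Hd.
  assert (H1 := Rmin_l r s). assert (H2 := Rmin_r r s).
  apply (is_pseries_plus a b d _ _ (Ha d ltac:(lra)) (Hb d ltac:(lra))).
Qed.

Lemma analytic_mult (f g : R -> R) (m : R) :
  analytic_at f m -> analytic_at g m -> analytic_at (fun x => f x * g x) m.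
Proof.
  intros [a [r [Hr Ha]]] [b [s [Hs Hb]]]. exists (PS_mult a b), (Rmin r s).
  split; [apply Rmin_glb_lt; assumption|]. intros d Hd.
  assert (H1 := Rmin_l r s). assert (H2 := Rmin_r r s).
  apply is_pseries_mult; [apply Ha; lra|apply Hb; lra| |].
  - apply (analytic_CV a r (fun d => f (m + d)) Ha). lra.
  - apply (analytic_CV b s (fun d => g (m + d)) Hb). lra.
Qed.

(* A power series with infinitely many small zeros has no first nonzero coefficient. *)
Lemma analytic_infinite_zeros (g : R -> R) (m : R) : analytic_at g m ->
  (forall e, 0 < e -> exists x, x <> m /\ Rabs (x - m) < e /\ g x = 0) ->
  exists r, 0 < r /\ forall x, Rabs (x - m) < r -> g x = 0.
Proof.
  intros [a [r [Hr Ha]]] Hacc.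
  assert (Hcv := analytic_CV a r _ Ha).
  assert (Hps : forall d, Rabs d < r -> g (m + d) = PSeries a d).
  { intros d Hd. symmetry. apply is_pseries_unique, Ha, Hd. }
  assert (Hcoef : forall n, a n = 0).
  { intros n. induction n as [n IH] using (well_founded_induction Wf_nat.lt_wf).
    apply NNPP. intros Hn.
    set (h := PSeries (PS_decr_n a n)).
    assert (Hh : forall d, Rabs d < r -> g (m + d) = d ^ n * h d).
    { intros d Hd. rewrite (Hps d Hd). apply PSeries_decr_n_aux. exact IH. }
    assert (H0 : h 0 = a n).
    { unfold h. rewrite PSeries_0. unfold PS_decr_n. f_equal. lia. }
    assert (Hc : continuity_pt h 0).
    { apply PSeries_continuity. apply (analytic_CV _ r h); [|rewrite Rabs_R0; exact Hr].
      intros d Hd. apply PSeries_correct, ex_pseries_decr_n; [|exists (g (m + d)); apply Ha, Hd].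
      destruct (Req_dec d 0) as [Hd0|Hd0]; [left; exact Hd0|right; exists (/ d)].
      unfold mult, one; simpl. field. exact Hd0. }
    destruct (Hc (Rabs (a n)) (Rabs_pos_lt _ Hn)) as [al [Hal Hx]].
    destruct (Hacc (Rmin al r)) as [x [Hxm [Hxd Hx0]]]; [apply Rmin_glb_lt; [exact Hal|exact Hr]|].
    assert (M1 := Rmin_l al r). assert (M2 := Rmin_r al r).
    assert (Hd0 : x - m <> 0) by lra.
    assert (Hxx : g x = (x - m) ^ n * h (x - m)).
    { rewrite <- Hh by lra. f_equal. ring. }
    rewrite Hx0 in Hxx. symmetry in Hxx. apply Rmult_integral in Hxx.
    destruct Hxx as [Hxx|Hxx]; [exact (pow_nonzero _ n Hd0 Hxx)|].
    assert (Hb : R_dist (h (x - m)) (h 0) < Rabs (a n)).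
    { apply Hx. split; [split; [exact I|lra]|]. simpl. unfold R_dist. rewrite Rminus_0_r. lra. }
    unfold R_dist in Hb. rewrite Hxx, H0 in Hb. rewrite Rminus_0_l, Rabs_Ropp in Hb. lra. }
  exists r. split; [exact Hr|]. intros x Hx.
  replace x with (m + (x - m)) by ring. rewrite (Hps _ Hx).
  rewrite (PSeries_ext a (fun _ => 0)) by (intros n; apply Hcoef). apply PSeries_const_0.
Qed.

(** Identity theorem on [m, M]: the supremum of the points up to which [g] vanishes is itself an
    accumulation point of zeros, so the zero interval would extend beyond it. *)
Lemma analytic_vanish_upward (g : R -> R) (m M : R) : (forall x, m <= x -> analytic_at g x) -> m <= M ->
  (forall e, 0 < e -> exists x, x <> m /\ Rabs (x - m) < e /\ g x = 0) -> g M = 0.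
Proof.
  intros Han HM Hacc. apply NNPP. intros HgM.
  set (E := fun x => m <= x <= M /\ forall y, m <= y <= x -> g y = 0).
  destruct (analytic_infinite_zeros g m (Han m ltac:(lra)) Hacc) as [r [Hr Hz]].
  assert (Hm0 : g m = 0).
  { apply Hz. rewrite Rminus_diag, Rabs_R0. exact Hr. }
  destruct (completeness E) as [s [Hub Hlub]].
  - exists M. intros x [Hx _]. lra.
  - exists m. split; [lra|]. intros y Hy. replace y with m by lra. exact Hm0.
  - assert (Hms : m < s).
    { assert (Hlt : m < M).
      { destruct HM as [HM|HM]; [exact HM|]. exfalso. apply HgM. rewrite <- HM. exact Hm0. }
      assert (Hin : E (m + Rmin (r / 2) (M - m))).
      { assert (H1 := Rmin_l (r / 2) (M - m)). assert (H2 := Rmin_r (r / 2) (M - m)).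
        assert (H3 : 0 < Rmin (r / 2) (M - m)) by (apply Rmin_glb_lt; lra).
        split; [lra|]. intros y Hy. apply Hz. apply Rabs_def1; lra. }
      assert (H3 : 0 < Rmin (r / 2) (M - m)) by (apply Rmin_glb_lt; lra).
      specialize (Hub _ Hin). lra. }
    assert (HsM : s <= M) by (apply Hlub; intros x [Hx _]; lra).
    assert (Hbelow : forall y, m <= y < s -> g y = 0).
    { intros y Hy. apply NNPP. intros Hgy.
      assert (Hs : s <= y); [|lra]. apply Hlub. intros x [Hx Hxz].
      destruct (Rle_lt_dec x y) as [|Hyx]; [assumption|]. exfalso. apply Hgy, Hxz. lra. }
    destruct (analytic_infinite_zeros g s (Han s ltac:(lra))) as [q [Hq Hqz]].
    { intros e He. assert (H1 := Rmin_l (e / 2) ((s - m) / 2)). assert (H2 := Rmin_r (e / 2) ((s - m) / 2)).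
      assert (H3 : 0 < Rmin (e / 2) ((s - m) / 2)) by (apply Rmin_glb_lt; lra).
      exists (s - Rmin (e / 2) ((s - m) / 2)). split; [lra|]. split; [apply Rabs_def1; lra|].
      apply Hbelow. lra. }
    assert (Hin : E (Rmin (s + q / 2) M)).
    { assert (H1 := Rmin_l (s + q / 2) M). assert (H2 := Rmin_r (s + q / 2) M).
      split; [split; [apply Rmin_glb; lra|lra]|].
      intros y Hy. destruct (Rlt_le_dec y s) as [Hys|Hys]; [apply Hbelow; lra|].
      apply Hqz. apply Rabs_def1; lra. }
    specialize (Hub _ Hin). unfold Rmin in Hub. destruct (Rle_dec (s + q / 2) M); [lra|].
    apply HgM. assert (s = M) by lra. subst s.
    apply Hqz. rewrite Rminus_diag, Rabs_R0. exact Hq.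
Qed.

Lemma analytic_discrete (g : R -> R) : (forall x, 0 < x -> analytic_at g x) ->
  (forall N, exists M, N < M /\ g M <> 0) -> discrete_pos (fun m => 0 < m /\ g m = 0).
Proof.
  intros Han Hne m0 Hm0. apply NNPP. intros Hno.
  destruct (Hne m0) as [M [HM HgM]]. apply HgM.
  apply (analytic_vanish_upward g m0 M); [intros x Hx; apply Han; lra|lra|].
  intros e He. apply NNPP. intros Hnx. apply Hno. exists e. split; [exact He|].
  intros m [Hm Hgm] Hd. apply NNPP. intros Hmm. apply Hnx. exists m. tauto.
Qed.

Lemma pos_part_bounded (f : R -> R) (M b : R) : 0 < b ->
  (forall x, 0 < x -> continuous f x) -> (forall x, 0 < x < b -> Rabs (f x) <= M) ->
  exists K, 0 < K /\ forall x, 0 < x <= 1 -> Rabs (f x) <= K.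
Proof.
  intros Hb Hc HM.
  assert (Hm : 0 < Rmin (b / 2) 1) by (apply Rmin_glb_lt; lra).
  destruct (continuity_ab_maj (fun x => Rabs (f x)) (Rmin (b / 2) 1) 1 (Rmin_r _ _)) as [m [Hmax _]].
  - intros x Hx. apply continuity_pt_filterlim.
    apply (continuous_comp f Rabs); [apply Hc; lra|apply continuous_Rabs].
  - assert (P1 := Rabs_pos (f m)). assert (P2 := Rabs_pos M). assert (P3 := Rle_abs M).
    exists (Rabs (f m) + Rabs M + 1). split; [lra|]. intros x Hx.
    destruct (Rlt_le_dec x (Rmin (b / 2) 1)) as [H|H].
    + assert (H1 := Rmin_l (b / 2) 1). specialize (HM x ltac:(lra)). lra.
    + specialize (Hmax x ltac:(lra)). lra.
Qed.

Lemma neumann_pseries (a : nat -> R) (w d C M : R) (Rn : nat -> R) : 0 <= C -> Rabs d * C < 1 ->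
  (forall n, w = sum_n (fun k => a k * d ^ k) n + d ^ S n * Rn n) ->
  (forall n, Rabs (Rn n) <= M * C ^ S n) -> is_pseries a d w.
Proof.
  intros HC Hd Hw HR. apply is_pseries_R. 
  change (is_lim_seq (sum_n (fun k => a k * d ^ k)) w).
  apply (is_lim_seq_ext (fun n => w - d ^ S n * Rn n)); [intros n; rewrite (Hw n) at 1; ring|].
  replace (Finite w) with (Finite (w - 0)) by (f_equal; ring).
  apply is_lim_seq_minus'; [apply is_lim_seq_const|].
  apply is_lim_seq_abs_0.
  apply (is_lim_seq_le_le (fun _ => 0) _ (fun n => M * (Rabs d * C) ^ S n)).
  - intros n. split; [apply Rabs_pos|]. rewrite Rabs_mult, <- RPow_abs, Rpow_mult_distr.
    assert (0 <= Rabs d ^ S n) by (apply pow_le, Rabs_pos). specialize (HR n). nra.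
  - apply is_lim_seq_const.
  - replace (Finite 0) with (Finite (M * 0)) by (f_equal; ring).
    apply (is_lim_seq_scal_l (fun n => (Rabs d * C) ^ S n) M 0).
    apply (is_lim_seq_incr_1 (fun n => (Rabs d * C) ^ n)). apply is_lim_seq_geom.
    rewrite Rabs_pos_eq; [exact Hd|]. apply Rmult_le_pos; [apply Rabs_pos|exact HC].
Qed.

(** * Volterra operators with a singular kernel at 0 *)

Definition prim (psi : R -> R) (x : R) : R :=
  RInt (fun s => if Rlt_dec 0 s then psi s else 0) 0 x.

(** The linear bound makes the extension by 0 to the nonpositive reals continuous at 0, so ordinary
    Riemann integrals and the fundamental theorem of calculus apply up to the singular point. *)
Lemma prim_extension_continuous (psi : R -> R) (M : R) :
  (forall x, 0 < x -> continuous psi x) -> (forall s, 0 < s <= 1 -> Rabs (psi s) <= M * s) ->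
  forall x, continuous (fun s => if Rlt_dec 0 s then psi s else 0) x.
Proof.
  intros Hc HM x. destruct (Rtotal_order x 0) as [Hx|[Hx|Hx]].
  - apply (continuous_ext_loc _ (fun _ => 0)); [|apply continuous_const].
    exists (mkposreal (- x) ltac:(lra)). intros y Hy.
    unfold ball in Hy; simpl in Hy; unfold AbsRing_ball, abs, minus, plus, opp in Hy; simpl in Hy.
    apply Rabs_def2 in Hy. destruct (Rlt_dec 0 y); [lra|reflexivity].
  - subst x. apply continuity_pt_filterlim. intros e He.
    set (K := Rabs M + 1). assert (HK : 0 < K) by (unfold K; assert (H := Rabs_pos M); lra).
    exists (Rmin 1 (e / K)). split; [apply Rmin_glb_lt; [lra|apply Rdiv_lt_0_compat; assumption]|].
    intros y [_ Hy]. simpl in *. unfold R_dist in *. rewrite Rminus_0_r in Hy.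
    assert (R1 := Rmin_l 1 (e / K)). assert (R2 := Rmin_r 1 (e / K)).
    destruct (Rlt_dec 0 0) as [H0|H0]; [lra|]. rewrite Rminus_0_r.
    destruct (Rlt_dec 0 y) as [Hy0|Hy0]; [|rewrite Rabs_R0; exact He].
    rewrite Rabs_pos_eq in Hy by lra. specialize (HM y ltac:(lra)).
    assert (H1 := Rle_abs M). apply Rle_lt_trans with (K * y); [unfold K; nra|].
    apply Rlt_le_trans with (K * (e / K)); [apply Rmult_lt_compat_l; lra|right; field; lra].
  - apply (continuous_ext_loc _ psi); [|apply Hc, Hx].
    exists (mkposreal x Hx). intros y Hy.
    unfold ball in Hy; simpl in Hy; unfold AbsRing_ball, abs, minus, plus, opp in Hy; simpl in Hy.
    apply Rabs_def2 in Hy. destruct (Rlt_dec 0 y); [reflexivity|lra].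
Qed.

Lemma prim_spec (psi : R -> R) (M : R) :
  (forall x, 0 < x -> continuous psi x) -> (forall s, 0 < s <= 1 -> Rabs (psi s) <= M * s) ->
  lim0 (prim psi) 0 /\ forall x, 0 < x -> is_derive (prim psi) x (psi x).
Proof.
  intros Hc HM.
  assert (He := prim_extension_continuous psi M Hc HM).
  assert (Hd : forall t, is_derive (prim psi) t (if Rlt_dec 0 t then psi t else 0)).
  { intros t. eapply is_derive_ext; [|apply (primitive_derive (fun s => if Rlt_dec 0 s then psi s else 0) 0 He)].
    intros y. apply Rplus_0_l. }
  split.
  - intros e Hep.
    assert (Hcp : continuity_pt (prim psi) 0).
    { apply derivable_continuous_pt. eexists. apply is_derive_Reals, Hd. }
    destruct (Hcp e Hep) as [al [Hal Hx]]. exists al. split; [exact Hal|].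
    intros x Hxa. assert (H := Hx x). simpl in H. unfold R_dist in H.
    unfold prim at 2 in H. rewrite RInt_point in H. unfold zero in H; simpl in H. apply H.
    split; [split; [exact I|lra]|]. rewrite Rminus_0_r, Rabs_pos_eq; lra.
  - intros x Hx. eapply is_derive_eq; [apply Hd|]. destruct (Rlt_dec 0 x); [reflexivity|contradiction].
Qed.

Definition ccont (f : R -> C) : Prop :=
  forall x, 0 < x -> continuous (fun t => Re (f t)) x /\ continuous (fun t => Im (f t)) x.

Lemma ccont_mult (f g : R -> C) : ccont f -> ccont g -> ccont (fun t => Cmult (f t) (g t)).
Proof.
  intros F G x Hx. destruct (F x Hx) as [F1 F2]. destruct (G x Hx) as [G1 G2]. split; simpl.
  - apply (continuous_minus (fun t => Re (f t) * Re (g t)) (fun t => Im (f t) * Im (g t)));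
      [exact (continuous_mult (fun t => Re (f t)) (fun t => Re (g t)) x F1 G1)
      |exact (continuous_mult (fun t => Im (f t)) (fun t => Im (g t)) x F2 G2)].
  - apply (continuous_plus (fun t => Re (f t) * Im (g t)) (fun t => Im (f t) * Re (g t)));
      [exact (continuous_mult (fun t => Re (f t)) (fun t => Im (g t)) x F1 G2)
      |exact (continuous_mult (fun t => Im (f t)) (fun t => Re (g t)) x F2 G1)].
Qed.

Lemma ccont_plus (f g : R -> C) : ccont f -> ccont g -> ccont (fun t => Cplus (f t) (g t)).
Proof.
  intros F G x Hx. destruct (F x Hx) as [F1 F2]. destruct (G x Hx) as [G1 G2]. split; simpl.
  - exact (continuous_plus (fun t => Re (f t)) (fun t => Re (g t)) x F1 G1).
  - exact (continuous_plus (fun t => Im (f t)) (fun t => Im (g t)) x F2 G2).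
Qed.

Lemma ccont_opp (f : R -> C) : ccont f -> ccont (fun t => Copp (f t)).
Proof.
  intros F x Hx. destruct (F x Hx) as [F1 F2]. split; simpl.
  - exact (continuous_opp (fun t => Re (f t)) x F1).
  - exact (continuous_opp (fun t => Im (f t)) x F2).
Qed.

Lemma ccont_const (c : C) : ccont (fun _ => c).
Proof. intros x _. split; apply continuous_const. Qed.

Lemma cderive_ccont (f df : R -> C) : (forall x, 0 < x -> is_cderive f x (df x)) -> ccont f.
Proof.
  intros H x Hx. destruct (H x Hx) as [H1 H2]. split.
  - apply (ex_derive_continuous (fun t => Re (f t))). eexists. exact H1.
  - apply (ex_derive_continuous (fun t => Im (f t))). eexists. exact H2.
Qed.

Lemma ccont_Cmod (f : R -> C) (x : R) : ccont f -> 0 < x -> continuous (fun t => Cmod (f t)) x.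
Proof.
  intros F Hx. destruct (F x Hx) as [F1 F2]. unfold Cmod.
  apply (continuous_comp (fun t => fst (f t) ^ 2 + snd (f t) ^ 2) sqrt); [|apply continuous_sqrt].
  apply (continuous_ext (fun t => Re (f t) * Re (f t) + Im (f t) * Im (f t))).
  { intros t. unfold Re, Im. simpl. ring. }
  apply (continuous_plus (fun t => Re (f t) * Re (f t)) (fun t => Im (f t) * Im (f t)));
    [exact (continuous_mult (fun t => Re (f t)) (fun t => Re (f t)) x F1 F1)
    |exact (continuous_mult (fun t => Im (f t)) (fun t => Im (f t)) x F2 F2)].
Qed.

Definition cprim (psi : R -> C) (x : R) : C :=
  (prim (fun s => Re (psi s)) x, prim (fun s => Im (psi s)) x).

Definition clim0 (f : R -> C) (c : C) : Prop :=
  lim0 (fun x => Re (f x)) (Re c) /\ lim0 (fun x => Im (f x)) (Im c).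

Definition integrand (psi : R -> C) : Prop :=
  ccont psi /\ exists M, forall s, 0 < s <= 1 -> Cmod (psi s) <= M * s.

Lemma cprim_spec (psi : R -> C) : integrand psi ->
  clim0 (cprim psi) (RtoC 0) /\ forall x, 0 < x -> is_cderive (cprim psi) x (psi x).
Proof.
  intros [Hc [M HM]].
  destruct (prim_spec (fun s => Re (psi s)) M) as [A1 A2].
  - intros x Hx. exact (proj1 (Hc x Hx)).
  - intros s Hs. eapply Rle_trans; [apply Re_le_Cmod|apply HM, Hs].
  - destruct (prim_spec (fun s => Im (psi s)) M) as [B1 B2].
    + intros x Hx. exact (proj2 (Hc x Hx)).
    + intros s Hs. eapply Rle_trans; [apply Im_le_Cmod|apply HM, Hs].
    + split; [split; [exact A1|exact B1]|]. intros x Hx. split; [apply A2, Hx|apply B2, Hx].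
Qed.

Lemma clim0_plus (f g : R -> C) (a b : C) : clim0 f a -> clim0 g b ->
  clim0 (fun x => Cplus (f x) (g x)) (Cplus a b).
Proof. intros [F1 F2] [G1 G2]. split; [exact (lim0_plus _ _ _ _ F1 G1)|exact (lim0_plus _ _ _ _ F2 G2)]. Qed.

Lemma clim0_mult (f g : R -> C) (a b : C) : clim0 f a -> clim0 g b ->
  clim0 (fun x => Cmult (f x) (g x)) (Cmult a b).
Proof.
  intros [F1 F2] [G1 G2]. split.
  - apply (lim0_ext (fun x => Re (f x) * Re (g x) + (-1) * (Im (f x) * Im (g x)))).
    + intros x _. unfold Re, Im; simpl. ring.
    + apply (lim0_eq _ (Re a * Re b + (-1) * (Im a * Im b))); [|unfold Re, Im; simpl; ring].
      apply lim0_plus; [apply lim0_mult; assumption|apply lim0_scal, lim0_mult; assumption].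
  - apply (lim0_plus (fun x => Re (f x) * Im (g x)) (fun x => Im (f x) * Re (g x)));
      apply lim0_mult; assumption.
Qed.

Lemma clim0_const (c : C) : clim0 (fun _ => c) c.
Proof. split; apply lim0_const. Qed.

Lemma clim0_eq (f : R -> C) (a b : C) : clim0 f a -> a = b -> clim0 f b.
Proof. intros H <-. exact H. Qed.

Lemma clim0_opp (f : R -> C) (a : C) : clim0 f a -> clim0 (fun x => Copp (f x)) (Copp a).
Proof.
  intros [F1 F2]. split.
  - apply (lim0_ext (fun x => (-1) * Re (f x))); [intros; unfold Re; simpl; ring|].
    apply (lim0_eq _ ((-1) * Re a)); [apply lim0_scal, F1|unfold Re; simpl; ring].
  - apply (lim0_ext (fun x => (-1) * Im (f x))); [intros; unfold Im; simpl; ring|].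
    apply (lim0_eq _ ((-1) * Im a)); [apply lim0_scal, F2|unfold Im; simpl; ring].
Qed.

Lemma cprim_unique (psi F : R -> C) : integrand psi -> clim0 F (RtoC 0) ->
  (forall x, 0 < x -> is_cderive F x (psi x)) -> forall x, 0 < x -> cprim psi x = F x.
Proof.
  intros Hi HF Hd x Hx. destruct (cprim_spec psi Hi) as [Hl Hp].
  assert (Hz : Cplus (cprim psi x) (Copp (F x)) = RtoC 0).
  { assert (Hlz := clim0_plus _ _ _ _ Hl (clim0_opp _ _ HF)).
    apply (lim0_const_deriv (fun t => Cplus (cprim psi t) (Copp (F t))) (RtoC 0)); [| | |exact Hx].
    - eapply lim0_eq; [exact (proj1 Hlz)|]. simpl. ring.
    - eapply lim0_eq; [exact (proj2 Hlz)|]. simpl. ring.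
    - intros t Ht. eapply is_cderive_eq; [exact (is_cderive_plus _ _ t _ _ (Hp t Ht) (is_cderive_opp _ t _ (Hd t Ht)))|].
      ring. }
  transitivity (Cplus (Cplus (cprim psi x) (Copp (F x))) (F x)); [ring|rewrite Hz; ring].
Qed.

Lemma integrand_comb (c : C) (p1 p2 : R -> C) : integrand p1 -> integrand p2 ->
  integrand (fun s => Cplus (p1 s) (Cmult c (p2 s))).
Proof.
  intros [C1 [M1 H1]] [C2 [M2 H2]]. split.
  - apply ccont_plus; [exact C1|]. apply ccont_mult; [apply ccont_const|exact C2].
  - exists (M1 + Cmod c * M2). intros s Hs. eapply Rle_trans; [apply Cmod_triangle|].
    rewrite Cmod_mult. specialize (H1 s Hs). specialize (H2 s Hs).
    assert (P := Cmod_ge_0 c). nra.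
Qed.

Lemma cprim_comb (c : C) (p p1 p2 : R -> C) (x : R) : integrand p1 -> integrand p2 ->
  (forall s, 0 < s -> p s = Cplus (p1 s) (Cmult c (p2 s))) -> 0 < x ->
  cprim p x = Cplus (cprim p1 x) (Cmult c (cprim p2 x)).
Proof.
  intros I1 I2 Hp Hx.
  transitivity (cprim (fun s => Cplus (p1 s) (Cmult c (p2 s))) x).
  - unfold cprim, prim. f_equal; apply RInt_ext; intros s _; destruct (Rlt_dec 0 s) as [Hs|Hs];
      try reflexivity; rewrite Hp by exact Hs; reflexivity.
  - destruct (cprim_spec p1 I1) as [L1 D1]. destruct (cprim_spec p2 I2) as [L2 D2].
    apply (cprim_unique _ (fun x => Cplus (cprim p1 x) (Cmult c (cprim p2 x)))); [apply integrand_comb; assumption| | |exact Hx].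
    + eapply clim0_eq; [exact (clim0_plus _ _ _ _ L1 (clim0_mult _ _ _ _ (clim0_const c) L2))|]. ring.
    + intros t Ht. eapply is_cderive_eq; [exact (is_cderive_plus _ _ t _ _ (D1 t Ht)
        (is_cderive_mult _ _ t _ _ (is_cderive_const c t) (D2 t Ht)))|]. cbv beta. ring.
Qed.

(** The constant [c] stands for a coefficient frozen at the upper endpoint. It stays inside the
    modulus because in the second part of the kernel only the product of the two factors is suitably
    small. *)
Lemma cprim_bound (psi : R -> C) (B dB : R -> R) (b : R) (c : C) : integrand psi -> 0 < b ->
  (forall x, 0 < x <= b -> is_derive B x (dB x)) -> (forall x, 0 < x <= b -> 0 <= B x) ->
  (forall x, 0 < x <= b -> Cmod (Cmult c (psi x)) <= dB x) -> Cmod (Cmult c (cprim psi b)) <= 2 * B b.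
Proof.
  intros Hi Hb HB Hpos Hle. destruct (cprim_spec psi Hi) as [L D].
  assert (Lc := clim0_mult _ _ _ _ (clim0_const c) L).
  assert (Dc : forall x, 0 < x -> is_cderive (fun t => Cmult c (cprim psi t)) x (Cmult c (psi x))).
  { intros x Hx. eapply is_cderive_eq; [exact (is_cderive_mult _ _ x _ _ (is_cderive_const c x) (D x Hx))|]. cbv beta. ring. }
  eapply Rle_trans; [apply Cmod_le_sum|].
  assert (A1 := lim0_derive_bound (fun t => Re (Cmult c (cprim psi t))) (fun t => Re (Cmult c (psi t))) B dB b Hb).
  assert (A2 := lim0_derive_bound (fun t => Im (Cmult c (cprim psi t))) (fun t => Im (Cmult c (psi t))) B dB b Hb).
  assert (E1 : Rabs (Re (Cmult c (cprim psi b))) <= B b).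
  { apply A1; trivial.
    - eapply lim0_eq; [exact (proj1 Lc)|]. simpl. ring.
    - intros x Hx. apply (proj1 (Dc x ltac:(lra))).
    - intros x Hx. eapply Rle_trans; [apply Re_le_Cmod|apply Hle, Hx]. }
  assert (E2 : Rabs (Im (Cmult c (cprim psi b))) <= B b).
  { apply A2; trivial.
    - eapply lim0_eq; [exact (proj2 Lc)|]. simpl. ring.
    - intros x Hx. apply (proj2 (Dc x ltac:(lra))).
    - intros x Hx. eapply Rle_trans; [apply Im_le_Cmod|apply Hle, Hx]. }
  lra.
Qed.

(** Kernel a(x) p(s) + b(x) r(s). The factor b may blow up at 0, so it is controlled only together
    with r(s) for s <= x; the exponential there is the decay of the scalar solution between s and
    x. *)
Record volterra (c K : R) (a b p r : R -> C) : Prop := {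
  vo_c : 0 < c;
  vo_K : 0 < K;
  vo_cont_a : ccont a;
  vo_cont_b : ccont b;
  vo_cont_p : ccont p;
  vo_cont_r : ccont r;
  vo_a : forall x, 0 < x <= 1 -> Cmod (a x) <= K;
  vo_p : forall x, 0 < x <= 1 -> Cmod (p x) <= K / x;
  vo_r : forall x, 0 < x <= 1 -> Cmod (r x) <= K / x;
  vo_br : forall s x, 0 < s <= x -> x <= 1 ->
    Cmod (Cmult (b x) (r s)) <= K * exp (- c * (/ (s * s) - / (x * x))) / (s * s * s) }.

Definition vop (a b p r eta : R -> C) (x : R) : C :=
  Cplus (Cmult (a x) (cprim (fun s => Cmult (p s) (eta s)) x))
        (Cmult (b x) (cprim (fun s => Cmult (r s) (eta s)) x)).

Definition adm (eta : R -> C) (M : R) : Prop :=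
  ccont eta /\ forall x, 0 < x <= 1 -> Cmod (eta x) <= M * (x * x).

Lemma adm_nonneg (eta : R -> C) (M : R) : adm eta M -> 0 <= M.
Proof.
  intros [_ H]. specialize (H 1 ltac:(lra)). assert (P := Cmod_ge_0 (eta 1)). lra.
Qed.

Lemma adm_integrand (p eta : R -> C) (K M : R) : ccont p -> adm eta M ->
  (forall x, 0 < x <= 1 -> Cmod (p x) <= K / x) -> integrand (fun s => Cmult (p s) (eta s)).
Proof.
  intros Hp [He HM] HK. split; [apply ccont_mult; assumption|]. exists (K * M).
  intros s Hs. rewrite Cmod_mult. specialize (HK s Hs). specialize (HM s Hs).
  apply Rle_trans with (K / s * (M * (s * s))).
  - apply Rmult_le_compat; try apply Cmod_ge_0; assumption.
  - right. field. lra.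
Qed.

(** The weight x^2 compensates for the singularity of the kernel. The first part integrates K^2 M s
    to K^2 M x^2, including the factor 2 of [cprim_bound], and the second gives (K/c) M x^2. *)
Lemma vop_bound (c K : R) (a b p r eta : R -> C) (M x : R) : volterra c K a b p r -> adm eta M ->
  0 < x <= 1 -> Cmod (vop a b p r eta x) <= (K * K + K / c) * M * (x * x).
Proof.
  intros V Ha Hx. assert (HM := adm_nonneg eta M Ha).
  assert (Hc := vo_c _ _ _ _ _ _ V). assert (HK := vo_K _ _ _ _ _ _ V).
  assert (I1 := adm_integrand p eta K M (vo_cont_p _ _ _ _ _ _ V) Ha (vo_p _ _ _ _ _ _ V)).
  assert (I2 := adm_integrand r eta K M (vo_cont_r _ _ _ _ _ _ V) Ha (vo_r _ _ _ _ _ _ V)).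
  destruct Ha as [Hcont He].
  assert (B1 : Cmod (Cmult (a x) (cprim (fun s => Cmult (p s) (eta s)) x)) <= 2 * (K * K * M * (x * x) / 2)).
  { apply (cprim_bound _ (fun s => K * K * M * (s * s) / 2) (fun s => K * K * M * s) x (a x) I1); [lra| | |].
    - intros s Hs. auto_derive; [trivial|field].
    - intros s Hs. assert (0 <= K * K * M) by (apply Rmult_le_pos; nra). nra.
    - intros s Hs. rewrite !Cmod_mult.
      assert (A1 := vo_a _ _ _ _ _ _ V x Hx). assert (A2 := vo_p _ _ _ _ _ _ V s ltac:(lra)).
      specialize (He s ltac:(lra)).
      apply Rle_trans with (K * (K / s * (M * (s * s)))); [|right; field; lra].
      apply Rmult_le_compat; try apply Cmod_ge_0; trivial.
      + apply Rmult_le_pos; apply Cmod_ge_0.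
      + apply Rmult_le_compat; try apply Cmod_ge_0; assumption. }
  (* The majorant is s^2 times the exponential: differentiating exp (- c / s^2) produces 2 c / s^3,
     and the result dominates the integrand K M exp(...) / s. *)
  assert (B2 : Cmod (Cmult (b x) (cprim (fun s => Cmult (r s) (eta s)) x)) <=
    2 * (K * M / (2 * c) * (x * x) * exp (- c * (/ (x * x) - / (x * x))))).
  { apply (cprim_bound _ (fun s => K * M / (2 * c) * (s * s) * exp (- c * (/ (s * s) - / (x * x))))
      (fun s => K * M / (2 * c) * (2 * s + 2 * c / s) * exp (- c * (/ (s * s) - / (x * x)))) x (b x) I2); [lra| | |].
    - intros s Hs. auto_derive; [nra|]. unfold Rminus. field. lra.
    - intros s Hs. assert (0 <= K * M / (2 * c)).
      { apply Rdiv_le_0_compat; [nra|lra]. }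
      apply Rmult_le_pos; [nra|]. left; apply exp_pos.
    - intros s Hs. specialize (He s ltac:(lra)).
      replace (Cmult (b x) (Cmult (r s) (eta s))) with (Cmult (Cmult (b x) (r s)) (eta s)) by ring.
      rewrite Cmod_mult. assert (A := vo_br _ _ _ _ _ _ V s x ltac:(lra) ltac:(lra)).
      set (E := exp (- c * (/ (s * s) - / (x * x)))) in *. assert (HE : 0 < E) by apply exp_pos.
      apply Rle_trans with (K * E / (s * s * s) * (M * (s * s))).
      + apply Rmult_le_compat; try apply Cmod_ge_0; assumption.
      + replace (K * E / (s * s * s) * (M * (s * s))) with (K * M / (2 * c) * (2 * c / s) * E) by (field; lra).
        apply Rmult_le_compat_r; [lra|]. apply Rmult_le_compat_l; [|lra].
        apply Rdiv_le_0_compat; [nra|lra]. }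
  rewrite Rminus_diag, Rmult_0_r, exp_0 in B2.
  unfold vop. eapply Rle_trans; [apply Cmod_triangle|].
  eapply Rle_trans; [apply Rplus_le_compat; [exact B1|exact B2]|].
  assert (Hxx : 0 < x * x <= 1) by nra.
  right. field. lra.
Qed.

Lemma vop_adm (c K : R) (a b p r eta : R -> C) (M : R) : volterra c K a b p r -> adm eta M ->
  adm (vop a b p r eta) ((K * K + K / c) * M).
Proof.
  intros V Ha. split; [|intros x Hx; apply (vop_bound c K); assumption].
  assert (I1 := adm_integrand p eta K M (vo_cont_p _ _ _ _ _ _ V) Ha (vo_p _ _ _ _ _ _ V)).
  assert (I2 := adm_integrand r eta K M (vo_cont_r _ _ _ _ _ _ V) Ha (vo_r _ _ _ _ _ _ V)).
  apply ccont_plus; apply ccont_mult.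
  - apply (vo_cont_a _ _ _ _ _ _ V).
  - exact (cderive_ccont _ _ (proj2 (cprim_spec _ I1))).
  - apply (vo_cont_b _ _ _ _ _ _ V).
  - exact (cderive_ccont _ _ (proj2 (cprim_spec _ I2))).
Qed.

Lemma vop_comb (c K d M1 M2 : R) (a b p r e e1 e2 : R -> C) (x : R) : volterra c K a b p r ->
  adm e1 M1 -> adm e2 M2 -> (forall s, 0 < s -> e s = Cplus (e1 s) (Cmult (RtoC d) (e2 s))) -> 0 < x ->
  vop a b p r e x = Cplus (vop a b p r e1 x) (Cmult (RtoC d) (vop a b p r e2 x)).
Proof.
  intros V A1 A2 He Hx. unfold vop.
  rewrite (cprim_comb (RtoC d) (fun s => Cmult (p s) (e s)) (fun s => Cmult (p s) (e1 s)) (fun s => Cmult (p s) (e2 s)) x).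
  - rewrite (cprim_comb (RtoC d) (fun s => Cmult (r s) (e s)) (fun s => Cmult (r s) (e1 s)) (fun s => Cmult (r s) (e2 s)) x).
    + ring.
    + exact (adm_integrand r e1 K M1 (vo_cont_r _ _ _ _ _ _ V) A1 (vo_r _ _ _ _ _ _ V)).
    + exact (adm_integrand r e2 K M2 (vo_cont_r _ _ _ _ _ _ V) A2 (vo_r _ _ _ _ _ _ V)).
    + intros s Hs. rewrite He by exact Hs. ring.
    + exact Hx.
  - exact (adm_integrand p e1 K M1 (vo_cont_p _ _ _ _ _ _ V) A1 (vo_p _ _ _ _ _ _ V)).
  - exact (adm_integrand p e2 K M2 (vo_cont_p _ _ _ _ _ _ V) A2 (vo_p _ _ _ _ _ _ V)).
  - intros s Hs. rewrite He by exact Hs. ring.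
  - exact Hx.
Qed.

Definition viter (a b p r : R -> C) (n : nat) (eta : R -> C) : R -> C :=
  Nat.iter n (vop a b p r) eta.

Lemma viter_adm (c K : R) (a b p r eta : R -> C) (M : R) (n : nat) : volterra c K a b p r -> adm eta M ->
  adm (viter a b p r n eta) ((K * K + K / c) ^ n * M).
Proof.
  intros V Ha. induction n as [|n IH].
  - rewrite pow_O, Rmult_1_l. exact Ha.
  - assert (H := vop_adm c K a b p r _ _ V IH). rewrite <- Rmult_assoc in H. exact H.
Qed.

Lemma viter_step (c K d M M0 : R) (a b p r eta eta0 : R -> C) (n : nat) : volterra c K a b p r ->
  adm eta M -> adm eta0 M0 ->
  (forall x, 0 < x -> eta x = Cplus (eta0 x) (Cmult (RtoC d) (vop a b p r eta x))) ->
  forall x, 0 < x -> viter a b p r n eta x =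
    Cplus (viter a b p r n eta0 x) (Cmult (RtoC d) (viter a b p r (S n) eta x)).
Proof.
  intros V A A0 He. induction n as [|n IH]; [exact He|].
  intros x Hx.
  exact (vop_comb c K d _ _ a b p r _ _ _ x V (viter_adm c K a b p r eta0 M0 n V A0)
    (viter_adm c K a b p r eta M (S n) V A) IH Hx).
Qed.

Lemma sum_n_Re (f : nat -> C) (n : nat) : Re (sum_n f n) = sum_n (fun k => Re (f k)) n.
Proof. induction n as [|n IH]; [rewrite !sum_O; reflexivity|]. rewrite !sum_Sn, <- IH. reflexivity. Qed.

Lemma sum_n_Im (f : nat -> C) (n : nat) : Im (sum_n f n) = sum_n (fun k => Im (f k)) n.
Proof. induction n as [|n IH]; [rewrite !sum_O; reflexivity|]. rewrite !sum_Sn, <- IH. reflexivity. Qed.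

Lemma neumann_analytic (w : R -> C) (al : nat -> C) (m0 C1 r : R) : 0 < r -> 0 < C1 ->
  (forall d, Rabs d < r -> exists (Rn : nat -> C) (M : R), (forall n, Cmod (Rn n) <= M * C1 ^ S n) /\
    forall n, w (m0 + d) = Cplus (sum_n (fun k => Cmult (RtoC (d ^ k)) (al k)) n) (Cmult (RtoC (d ^ S n)) (Rn n))) ->
  analytic_at (fun m => Re (w m)) m0 /\ analytic_at (fun m => Im (w m)) m0.
Proof.
  intros Hr HC H.
  assert (Hm : 0 < Rmin r (/ C1)) by (apply Rmin_glb_lt; [exact Hr|apply Rinv_0_lt_compat, HC]).
  assert (Hd : forall d, Rabs d < Rmin r (/ C1) -> Rabs d * C1 < 1).
  { intros d Hd. assert (R2 := Rmin_r r (/ C1)).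
    apply Rlt_le_trans with (/ C1 * C1); [apply Rmult_lt_compat_r; lra|right; field; lra]. }
  assert (Hd' : forall d, Rabs d < Rmin r (/ C1) -> Rabs d < r).
  { intros d Hx. assert (R1 := Rmin_l r (/ C1)). lra. }
  split.
  - exists (fun k => Re (al k)), (Rmin r (/ C1)). split; [exact Hm|]. intros d Hdm.
    destruct (H d (Hd' d Hdm)) as [Rn [M [HR Hw]]].
    apply (neumann_pseries _ _ d C1 M (fun n => Re (Rn n))); [lra|apply Hd, Hdm| |].
    + intros n. rewrite (Hw n).
      transitivity (Re (sum_n (fun k => Cmult (RtoC (d ^ k)) (al k)) n) + d ^ S n * Re (Rn n)).
      * unfold Re; simpl. ring.
      * f_equal. rewrite sum_n_Re. apply sum_n_ext. intros k. unfold Re; simpl. ring.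
    + intros n. eapply Rle_trans; [apply Re_le_Cmod|apply HR].
  - exists (fun k => Im (al k)), (Rmin r (/ C1)). split; [exact Hm|]. intros d Hdm.
    destruct (H d (Hd' d Hdm)) as [Rn [M [HR Hw]]].
    apply (neumann_pseries _ _ d C1 M (fun n => Im (Rn n))); [lra|apply Hd, Hdm| |].
    + intros n. rewrite (Hw n).
      transitivity (Im (sum_n (fun k => Cmult (RtoC (d ^ k)) (al k)) n) + d ^ S n * Im (Rn n)).
      * unfold Im; simpl. ring.
      * f_equal. rewrite sum_n_Im. apply sum_n_ext. intros k. unfold Im; simpl. ring.
    + intros n. eapply Rle_trans; [apply Im_le_Cmod|apply HR].
Qed.

(* The Neumann series of [eta = eta0 + d K eta] is a power series in d. *)
Lemma volterra_analytic (c K M0 m0 r0 : R) (a b a1 b1 p r eta0 : R -> C) (h0 : C)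
    (eta : R -> R -> C) (h : R -> C) :
  volterra c K a b p r -> volterra c K a1 b1 p r -> adm eta0 M0 -> 0 < r0 ->
  (forall d, Rabs d < r0 -> exists M, adm (eta (m0 + d)) M /\
    (forall x, 0 < x -> eta (m0 + d) x = Cplus (eta0 x) (Cmult (RtoC d) (vop a b p r (eta (m0 + d)) x))) /\
    h (m0 + d) = Cplus h0 (Cmult (RtoC d) (vop a1 b1 p r (eta (m0 + d)) 1))) ->
  (analytic_at (fun m => Re (eta m 1)) m0 /\ analytic_at (fun m => Im (eta m 1)) m0) /\
  (analytic_at (fun m => Re (h m)) m0 /\ analytic_at (fun m => Im (h m)) m0).
Proof.
  intros V V1 A0 Hr H. set (C1 := K * K + K / c).
  assert (HC1 : 0 < C1).
  { unfold C1. assert (Hc := vo_c _ _ _ _ _ _ V). assert (HK := vo_K _ _ _ _ _ _ V).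
    assert (0 < K / c) by (apply Rdiv_lt_0_compat; assumption). nra. }
  split.
  - apply (neumann_analytic (fun m => eta m 1) (fun k => viter a b p r k eta0 1) m0 C1 r0 Hr HC1).
    intros d Hd. destruct (H d Hd) as [M [A [He _]]].
    exists (fun n => viter a b p r (S n) (eta (m0 + d)) 1), M. split.
    + intros n. assert (Av := proj2 (viter_adm c K a b p r _ M (S n) V A) 1 ltac:(lra)).
      fold C1 in Av. eapply Rle_trans; [exact Av|]. right; ring.
    + induction n as [|n IH].
      * rewrite sum_O. simpl pow. rewrite (He 1 Rlt_0_1) at 1. rewrite Rmult_1_r. simpl. ring.
      * rewrite sum_Sn. rewrite IH.
        assert (Hs := viter_step c K d M M0 a b p r _ eta0 (S n) V A A0 He 1 Rlt_0_1).
        rewrite Hs.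
        replace (RtoC (d ^ S (S n))) with (Cmult (RtoC (d ^ S n)) (RtoC d))
          by (rewrite <- RtoC_mult; f_equal; simpl; ring).
        change (@plus C_AbelianMonoid) with Cplus. ring.
  (* The quantity [h] is one operator application behind [eta]: its coefficient of index j + 1 is
     the second operator applied to the j-th iterate, and index 0 is [h0]. *)
  - apply (neumann_analytic h (fun k => match k with O => h0 | S j => vop a1 b1 p r (viter a b p r j eta0) 1 end) m0 C1 r0 Hr HC1).
    intros d Hd. destruct (H d Hd) as [M [A [He Hh]]].
    exists (fun n => vop a1 b1 p r (viter a b p r n (eta (m0 + d))) 1), M. split.
    + intros n. assert (Av := vop_bound c K a1 b1 p r _ _ 1 V1 (viter_adm c K a b p r _ M n V A) ltac:(lra)).
      fold C1 in Av. eapply Rle_trans; [exact Av|]. right. simpl. ring.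
    + induction n as [|n IH].
      * rewrite sum_O. simpl pow. rewrite Hh, Rmult_1_r. simpl. ring.
      * rewrite sum_Sn. rewrite IH.
        assert (Hs := viter_step c K d M M0 a b p r _ eta0 n V A A0 He).
        assert (Hv := vop_comb c K d _ _ a1 b1 p r _ _ _ 1 V1 (viter_adm c K a b p r eta0 M0 n V A0)
          (viter_adm c K a b p r (eta (m0 + d)) M (S n) V A) Hs Rlt_0_1).
        rewrite Hv.
        replace (RtoC (d ^ S (S n))) with (Cmult (RtoC (d ^ S n)) (RtoC d))
          by (rewrite <- RtoC_mult; f_equal; simpl; ring).
        change (@plus C_AbelianMonoid) with Cplus. ring.
Qed.

(* A curve from 0 to 1 in the closed upper half-plane, parametrised through 1/z, tangent at 0 to a
   direction where exp(mu/z) is flat; the growth 1/x^2 of 1/z makes all Volterra kernels O(x). *)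
Definition zeta (x : R) : C := (2 - / (x * x), - ((/ x - 1) * (/ x - 1))).
Definition dzeta (x : R) : C := (2 / (x * x * x), 2 * (/ x - 1) / (x * x)).
Definition zc (x : R) : C := Cinv (zeta x).
Definition dzc (x : R) : C := Copp (Cmult (dzeta x) (Cmult (zc x) (zc x))).

Lemma zeta_derive (x : R) : 0 < x -> is_cderive zeta x (dzeta x).
Proof.
  intros Hx. assert (x * x <> 0) by nra. split; simpl; auto_derive; try lra; field; lra.
Qed.

Lemma zeta_neq_0 (x : R) : 0 < x -> zeta x <> RtoC 0.
Proof.
  intros Hx E. assert (E1 := f_equal fst E). assert (E2 := f_equal snd E). simpl in E1, E2.
  assert (H1 : / x = 1) by nra.
  rewrite Rinv_mult, H1 in E1. lra.
Qed.

Lemma is_cderive_inv (f : R -> C) (x : R) (d : C) : f x <> RtoC 0 -> is_cderive f x d ->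
  is_cderive (fun t => Cinv (f t)) x (Copp (Cmult d (Cmult (Cinv (f x)) (Cinv (f x))))).
Proof.
  intros Hn [D1 D2].
  set (N := fun t => fst (f t) ^ 2 + snd (f t) ^ 2).
  assert (HN : N x <> 0).
  { intros E. apply Hn. unfold N in E.
    assert (A1 := pow2_ge_0 (fst (f x))). assert (A2 := pow2_ge_0 (snd (f x))).
    apply injective_projections; simpl; nra. }
  assert (DN : is_derive N x (2 * fst (f x) * Re d + 2 * snd (f x) * Im d)).
  { apply (is_derive_ext (fun t => Re (f t) * Re (f t) + Im (f t) * Im (f t))).
    - intros t. unfold N, Re, Im. simpl. ring.
    - eapply is_derive_eq; [exact (is_derive_Rplus _ _ x _ _ (is_derive_Rmult _ _ x _ _ D1 D1) (is_derive_Rmult _ _ x _ _ D2 D2))|].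
      unfold Re, Im. ring. }
  assert (EN : N x = fst (f x) * fst (f x) + snd (f x) * snd (f x)) by (unfold N; ring).
  split; simpl.
  - eapply is_derive_eq; [exact (is_derive_div (fun t => Re (f t)) N x _ _ D1 DN HN)|].
    fold (N x). unfold Re, Im in *. rewrite EN in *. simpl. field. exact HN.
  - eapply is_derive_eq; [exact (is_derive_div (fun t => - Im (f t)) N x _ _ (is_derive_Ropp _ x _ D2) DN HN)|].
    fold (N x). unfold Re, Im in *. rewrite EN in *. simpl. field. exact HN.
Qed.

Lemma zc_derive (x : R) : 0 < x -> is_cderive zc x (dzc x).
Proof. intros Hx. exact (is_cderive_inv zeta x _ (zeta_neq_0 x Hx) (zeta_derive x Hx)). Qed.

Lemma zc_neq_0 (x : R) : 0 < x -> zc x <> RtoC 0.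
Proof.
  intros Hx E. assert (Hz := zeta_neq_0 x Hx).
  assert (H : Cmult (zeta x) (zc x) = RtoC 1) by (unfold zc; field; exact Hz).
  rewrite E in H. apply (f_equal fst) in H. simpl in H. lra.
Qed.

Lemma zc_upper (x : R) : 0 < x -> 0 <= Im (zc x).
Proof.
  intros Hx. unfold zc, Cinv, Im, zeta; simpl.
  apply Rdiv_le_0_compat.
  - rewrite Ropp_involutive. apply (Rle_0_sqr (/ x - 1)).
  - assert (Hz := zeta_neq_0 x Hx).
    destruct (Rle_lt_dec ((2 - / (x * x)) * ((2 - / (x * x)) * 1) +
      - ((/ x - 1) * (/ x - 1)) * (- ((/ x - 1) * (/ x - 1)) * 1)) 0) as [H|H]; [|exact H].
    exfalso. apply Hz. unfold zeta.
    assert (A1 := Rle_0_sqr (2 - / (x * x))). assert (A2 := Rle_0_sqr ((/ x - 1) * (/ x - 1))).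
    unfold Rsqr in A1, A2.
    assert (E1 : (2 - / (x * x)) * (2 - / (x * x)) = 0) by lra.
    assert (E2 : (/ x - 1) * (/ x - 1) * ((/ x - 1) * (/ x - 1)) = 0) by lra.
    apply Rmult_integral in E1. apply Rmult_integral in E2.
    apply injective_projections; simpl; [destruct E1; assumption|].
    destruct E2 as [E2|E2]; rewrite E2; ring.
Qed.

(** For x <= 4/5 the imaginary part of [zeta] times x^2 is (1 - x)^2 >= 1/25 in modulus; beyond 4/5
    the real part times x^2 is 2 x^2 - 1, which exceeds 1/25. Hence the constant 25. *)
Lemma zc_bound (x : R) : 0 < x <= 1 -> Cmod (zc x) <= 25 * (x * x).
Proof.
  intros Hx. unfold zc. rewrite Cmod_inv by (apply zeta_neq_0; lra).
  assert (Hxx : 0 < x * x) by nra.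
  assert (Hc : / 25 <= Cmod (zeta x) * (x * x)).
  { destruct (Rle_lt_dec x (4 / 5)) as [H|H].
    - assert (A := Im_le_Cmod (zeta x)). unfold Im in A; simpl in A. rewrite Rabs_Ropp in A.
      rewrite Rabs_pos_eq in A by apply (Rle_0_sqr (/ x - 1)).
      apply Rle_trans with ((/ x - 1) * (/ x - 1) * (x * x)); [|apply Rmult_le_compat_r; lra].
      replace ((/ x - 1) * (/ x - 1) * (x * x)) with ((1 - x) * (1 - x)) by (field; lra). nra.
    - assert (A := Re_le_Cmod (zeta x)). unfold Re in A; simpl in A.
      assert (A' : 2 - / (x * x) <= Cmod (zeta x)) by (eapply Rle_trans; [apply Rle_abs|exact A]).
      apply Rle_trans with ((2 - / (x * x)) * (x * x)); [|apply Rmult_le_compat_r; lra].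
      replace ((2 - / (x * x)) * (x * x)) with (2 * (x * x) - 1) by (field; lra). nra. }
  assert (Hp : 0 < Cmod (zeta x)) by (apply Cmod_gt_0, zeta_neq_0; lra).
  apply (Rmult_le_reg_l (Cmod (zeta x))); [exact Hp|]. rewrite Rinv_r by lra. nra.
Qed.

Lemma dzeta_bound (x : R) : 0 < x <= 1 -> Cmod (dzeta x) <= 4 / (x * x * x).
Proof.
  intros Hx. assert (Hx3 : 0 < x * x * x) by (apply Rmult_lt_0_compat; nra).
  eapply Rle_trans; [apply Cmod_le_sum|]. unfold Re, Im, dzeta; simpl.
  assert (Hi : 1 <= / x) by (rewrite <- Rinv_1; apply Rinv_le_contravar; lra).
  rewrite (Rabs_pos_eq (2 / (x * x * x))) by (apply Rdiv_le_0_compat; lra).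
  rewrite Rabs_pos_eq by (apply Rdiv_le_0_compat; nra).
  replace (2 * (/ x - 1) / (x * x)) with (2 / (x * x * x) - 2 / (x * x)) by (field; lra).
  assert (0 < 2 / (x * x)) by (apply Rdiv_lt_0_compat; nra).
  replace (4 / (x * x * x)) with (2 / (x * x * x) + 2 / (x * x * x)) by (field; lra). lra.
Qed.

Lemma zc_upper_curve : upper_curve zc dzc.
Proof.
  split.
  - intros x Hx. split; [apply zc_upper, Hx|]. split; [apply zc_neq_0, Hx|apply zc_derive, Hx].
  - exists 25, 1. split; [lra|]. split; [lra|]. intros x Hx.
    eapply Rle_trans; [apply zc_bound; lra|]. nra.
Qed.

Lemma zc_1 : zc 1 = RtoC 1.
Proof. unfold zc, zeta. apply injective_projections; simpl; field. Qed.

(** The scalar solution z^(-l) exp (mu (1/z - z)) along the curve, written with zeta = 1/z. Its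
    logarithmic derivative is [dlog]. *)
Definition fz (l : nat) (mu : R) (x : R) : C :=
  Cmult (Cpow (zeta x) l) (cexp (Cmult (RtoC mu) (Cminus (zeta x) (zc x)))).

Definition dlog (l : nat) (mu : R) (x : R) : C := Cmult (diag_coef l mu (zc x)) (dzc x).

Lemma dlog_eq (l : nat) (mu x : R) : 0 < x -> dlog l mu x =
  Cplus (Cmult (RtoC (INR l)) (Cmult (dzeta x) (zc x)))
    (Cmult (RtoC mu) (Cplus (dzeta x) (Cmult (dzeta x) (Cmult (zc x) (zc x))))).
Proof.
  intros Hx. unfold dlog, dzc, diag_coef, Cl, Cmu. field. apply zc_neq_0, Hx.
Qed.

Lemma Cpow_derive (f : R -> C) (x : R) (d : C) (l : nat) : f x <> RtoC 0 -> is_cderive f x d ->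
  is_cderive (fun t => Cpow (f t) l) x (Cmult (Cmult (RtoC (INR l)) (Cmult d (Cinv (f x)))) (Cpow (f x) l)).
Proof.
  intros Hn Hd. induction l as [|l IH].
  - eapply is_cderive_ext; [intros t; reflexivity| |exact (is_cderive_const (RtoC 1) x)]. simpl. ring.
  - eapply is_cderive_ext; [intros t; symmetry; apply Cpow_S| |exact (is_cderive_mult _ _ x _ _ Hd IH)].
    rewrite Cpow_S, S_INR, RtoC_plus. cbv beta. field. exact Hn.
Qed.

Lemma fz_derive (l : nat) (mu x : R) : 0 < x -> is_cderive (fz l mu) x (Cmult (dlog l mu x) (fz l mu x)).
Proof.
  intros Hx. unfold fz.
  assert (Hz := zeta_neq_0 x Hx).
  eapply is_cderive_eq.
  - exact (is_cderive_mult _ _ x _ _ (Cpow_derive zeta x _ l Hz (zeta_derive x Hx))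
      (is_cderive_cexp _ x _ (is_cderive_mult _ _ x _ _ (is_cderive_const (RtoC mu) x)
        (is_cderive_minus _ _ x _ _ (zeta_derive x Hx) (zc_derive x Hx))))).
  - cbv beta. rewrite dlog_eq by exact Hx. unfold dzc, zc. ring.
Qed.

Lemma fz_neq_0 (l : nat) (mu x : R) : 0 < x -> fz l mu x <> RtoC 0.
Proof.
  intros Hx. apply Cmult_neq_0; [apply Cpow_nz, zeta_neq_0, Hx|apply cexp_neq_0].
Qed.

(** The leading term is 2 mu / x^3, from mu times Re [dzeta]. Half of it absorbs the contribution of
    l, at most 100 l / x, by completing the square. The part with [zc] squared is bounded by 2500
    mu. *)
Lemma dlog_lower (l : nat) (mu : R) : 0 < mu -> exists C0, 0 < C0 /\ forall x, 0 < x <= 1 ->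
  mu / (x * x * x) - C0 <= Re (dlog l mu x).
Proof.
  intros Hmu. set (L := 100 * INR l). exists (L * L / (4 * mu) + 2500 * mu + 1).
  assert (HL : 0 <= L) by (unfold L; assert (H := pos_INR l); lra).
  assert (HLL : 0 <= L * L / (4 * mu)) by (apply Rdiv_le_0_compat; nra).
  split; [nra|]. intros x Hx.
  rewrite dlog_eq by lra.
  assert (Hx3 : 0 < x * x * x) by (apply Rmult_lt_0_compat; nra).
  assert (B1 := zc_bound x Hx). assert (B2 := dzeta_bound x Hx).
  assert (P1 := Cmod_ge_0 (zc x)). assert (P2 := Cmod_ge_0 (dzeta x)).
  assert (A1 : - (100 / x) <= Re (Cmult (dzeta x) (zc x))).
  { assert (A : Cmod (Cmult (dzeta x) (zc x)) <= 4 / (x * x * x) * (25 * (x * x))).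
    { rewrite Cmod_mult. apply Rmult_le_compat; assumption. }
    replace (4 / (x * x * x) * (25 * (x * x))) with (100 / x) in A by (field; lra).
    assert (R := Re_le_Cmod (Cmult (dzeta x) (zc x))). apply Rabs_le_between in R. lra. }
  assert (A2 : - 2500 <= Re (Cmult (dzeta x) (Cmult (zc x) (zc x)))).
  { assert (A : Cmod (Cmult (dzeta x) (Cmult (zc x) (zc x))) <= 4 / (x * x * x) * (25 * (x * x) * (25 * (x * x)))).
    { rewrite !Cmod_mult. apply Rmult_le_compat; try assumption; [apply Rmult_le_pos; assumption|].
      apply Rmult_le_compat; assumption. }
    replace (4 / (x * x * x) * (25 * (x * x) * (25 * (x * x)))) with (2500 * x) in A by (field; lra).
    assert (R := Re_le_Cmod (Cmult (dzeta x) (Cmult (zc x) (zc x)))). apply Rabs_le_between in R. lra. }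
  assert (E : forall a b : C, Re (Cplus (Cmult (RtoC (INR l)) a) (Cmult (RtoC mu) b)) = INR l * Re a + mu * Re b).
  { intros a b. unfold Re; simpl. ring. }
  rewrite E. clear E.
  replace (Re (Cplus (dzeta x) (Cmult (dzeta x) (Cmult (zc x) (zc x))))) with
    (2 / (x * x * x) + Re (Cmult (dzeta x) (Cmult (zc x) (zc x)))) by (unfold Re; simpl; ring).
  assert (A3 : - (L / x) <= INR l * Re (Cmult (dzeta x) (zc x))).
  { unfold L. replace (- (100 * INR l / x)) with (INR l * - (100 / x)) by (field; lra).
    apply Rmult_le_compat_l; [apply pos_INR|exact A1]. }
  assert (A4 : L / x <= mu / (x * x * x) + L * L / (4 * mu)).
  { set (u := / x). assert (Hu : 1 <= u) by (unfold u; rewrite <- Rinv_1; apply Rinv_le_contravar; lra).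
    replace (L / x) with (L * u) by (unfold u; field; lra).
    replace (mu / (x * x * x)) with (mu * (u * u * u)) by (unfold u; field; lra).
    assert (S : 0 <= mu * ((u - L / (2 * mu)) * (u - L / (2 * mu)))).
    { apply Rmult_le_pos; [lra|]. apply (Rle_0_sqr (u - L / (2 * mu))). }
    replace (mu * ((u - L / (2 * mu)) * (u - L / (2 * mu)))) with (mu * (u * u) - L * u + L * L / (4 * mu)) in S by (field; lra).
    assert (mu * (u * u) <= mu * (u * u * u)) by (apply Rmult_le_compat_l; nra). lra. }
  assert (A5 : mu * -2500 <= mu * Re (Cmult (dzeta x) (Cmult (zc x) (zc x)))) by (apply Rmult_le_compat_l; lra).
  replace (mu * (2 / (x * x * x) + Re (Cmult (dzeta x) (Cmult (zc x) (zc x))))) with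
    (mu / (x * x * x) + mu / (x * x * x) + mu * Re (Cmult (dzeta x) (Cmult (zc x) (zc x)))) by (field; lra).
  lra.
Qed.

Lemma fz_growth (l : nat) (mu : R) : 0 < mu -> exists E, 0 < E /\ forall s x, 0 < s <= x -> x <= 1 ->
  Cmod (fz l mu s) <= E * exp (- (mu / 2) * (/ (s * s) - / (x * x))) * Cmod (fz l mu x).
Proof.
  intros Hmu. destruct (dlog_lower l mu Hmu) as [C0 [HC0 Hlow]].
  exists (exp C0). split; [apply exp_pos|]. intros s x Hs Hx.
  set (N := fun t => Re (fz l mu t) * Re (fz l mu t) + Im (fz l mu t) * Im (fz l mu t)).
  (* With this weight the logarithmic derivative of N g is 2 (Re dlog - mu / t^3 + C0), which is
     nonnegative by the lower bound. Taking square roots of N produces the rate mu/2. *)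
  set (g := fun t => exp (mu / (t * t) + 2 * C0 * t)).
  assert (Hmono : N s * g s <= N x * g x).
  { apply (derive_nonneg_incr (fun t => N t * g t)
      (fun t => 2 * (Re (dlog l mu t) - mu / (t * t * t) + C0) * N t * g t)); [lra| |].
    - intros t Ht. destruct (fz_derive l mu t ltac:(lra)) as [D1 D2].
      assert (DN : is_derive N t (2 * Re (dlog l mu t) * N t)).
      { eapply is_derive_eq; [exact (is_derive_Rplus _ _ t _ _ (is_derive_Rmult _ _ t _ _ D1 D1) (is_derive_Rmult _ _ t _ _ D2 D2))|].
        unfold N, Re, Im. simpl. ring. }
      assert (Dg : is_derive g t ((- 2 * mu / (t * t * t) + 2 * C0) * g t)).
      { unfold g. auto_derive; [nra|]. unfold Rdiv. field. lra. }
      eapply is_derive_eq; [exact (is_derive_Rmult _ _ t _ _ DN Dg)|]. field. lra.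
    - intros t Ht. specialize (Hlow t ltac:(lra)).
      assert (0 <= N t) by (unfold N; assert (A1 := Rle_0_sqr (Re (fz l mu t))); assert (A2 := Rle_0_sqr (Im (fz l mu t))); unfold Rsqr in *; lra).
      assert (0 < g t) by apply exp_pos.
      apply Rmult_le_pos; [|lra]. apply Rmult_le_pos; lra. }
  assert (Hns : N s = Cmod (fz l mu s) * Cmod (fz l mu s)) by (symmetry; apply Cmod_sqr).
  assert (Hnx : N x = Cmod (fz l mu x) * Cmod (fz l mu x)) by (symmetry; apply Cmod_sqr).
  assert (P1 := Cmod_ge_0 (fz l mu s)). assert (P2 := Cmod_ge_0 (fz l mu x)).
  apply Rsqr_incr_0_var; [|apply Rmult_le_pos; [|exact P2]; apply Rmult_le_pos; left; apply exp_pos].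
  unfold Rsqr. rewrite <- Hns.
  set (y := / (s * s) - / (x * x)).
  replace (exp C0 * exp (- (mu / 2) * y) * Cmod (fz l mu x) * (exp C0 * exp (- (mu / 2) * y) * Cmod (fz l mu x)))
    with (N x * exp (2 * C0 - mu * y)).
  2: { rewrite Hnx. replace (2 * C0 - mu * y) with ((C0 + - (mu / 2) * y) + (C0 + - (mu / 2) * y)) by field.
    rewrite !exp_plus. ring. }
  assert (Hg : 0 < g s) by apply exp_pos.
  apply (Rmult_le_reg_r (g s)); [exact Hg|].
  eapply Rle_trans; [exact Hmono|]. rewrite Rmult_assoc.
  apply Rmult_le_compat_l; [rewrite Hnx; nra|].
  unfold g. rewrite <- exp_plus.
  assert (Hle : mu / (x * x) + 2 * C0 * x <= 2 * C0 - mu * y + (mu / (s * s) + 2 * C0 * s)).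
  { unfold y. replace (2 * C0 - mu * (/ (s * s) - / (x * x)) + (mu / (s * s) + 2 * C0 * s))
      with (2 * C0 + mu / (x * x) + 2 * C0 * s) by (field; split; lra). nra. }
  destruct Hle as [Hle|Hle]; [left; apply exp_increasing, Hle|right; rewrite Hle; reflexivity].
Qed.

(** Minus the derivative of [dlog] with respect to mu, that is (1 + 1/z^2) dz along the curve. *)
Definition qz (x : R) : C := Cmult (Cplus (RtoC 1) (Cmult (zeta x) (zeta x))) (dzc x).

Lemma zeta_zc (x : R) : 0 < x -> Cmult (zeta x) (zc x) = RtoC 1.
Proof. intros Hx. unfold zc. field. apply zeta_neq_0, Hx. Qed.

Lemma qz_eq (x : R) : 0 < x -> qz x = Copp (Cplus (dzeta x) (Cmult (dzeta x) (Cmult (zc x) (zc x)))).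
Proof. intros Hx. unfold qz, dzc, zc. field. apply zeta_neq_0, Hx. Qed.

Lemma qz_bound (x : R) : 0 < x <= 1 -> Cmod (qz x) <= 2504 / (x * x * x).
Proof.
  intros Hx. rewrite qz_eq by lra. rewrite Cmod_opp.
  assert (Hx3 : 0 < x * x * x) by (apply Rmult_lt_0_compat; nra).
  assert (B1 := zc_bound x Hx). assert (B2 := dzeta_bound x Hx).
  assert (P1 := Cmod_ge_0 (zc x)). assert (P2 := Cmod_ge_0 (dzeta x)).
  eapply Rle_trans; [apply Cmod_triangle|]. rewrite !Cmod_mult.
  assert (A : Cmod (zc x) * Cmod (zc x) <= 625).
  { apply Rle_trans with (25 * 25); [|lra]. apply Rmult_le_compat; nra. }
  apply Rle_trans with (4 / (x * x * x) + 4 / (x * x * x) * 625).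
  - apply Rplus_le_compat; [exact B2|]. apply Rmult_le_compat; trivial. apply Rmult_le_pos; assumption.
  - right. field. lra.
Qed.

Lemma qz_ccont : ccont qz.
Proof.
  assert (Hz : ccont zeta) by exact (cderive_ccont _ _ zeta_derive).
  assert (Hc : ccont zc) by exact (cderive_ccont _ _ zc_derive).
  assert (Hd : ccont dzeta).
  { intros x Hx. assert (x * x <> 0) by nra. assert (x * x * x <> 0) by nra.
    split; simpl; apply (ex_derive_continuous (V := R_NormedModule)); auto_derive; repeat split; trivial; lra. }
  unfold qz, dzc. apply ccont_mult.
  - apply ccont_plus; [apply ccont_const|apply ccont_mult; exact Hz].
  - apply ccont_opp, ccont_mult; [exact Hd|apply ccont_mult; exact Hc].
Qed.

Lemma diag_coef_shift (l : nat) (mu d : R) (z : C) : z <> RtoC 0 ->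
  diag_coef l (mu + d) z =
  Cminus (diag_coef l mu z) (Cmult (RtoC d) (Cplus (RtoC 1) (Cmult (Cinv z) (Cinv z)))).
Proof.
  intros Hz. unfold diag_coef, Cmu. rewrite RtoC_plus. field. exact Hz.
Qed.

Lemma dlog_shift (l : nat) (mu d x : R) : 0 < x ->
  dlog l (mu + d) x = Cminus (dlog l mu x) (Cmult (RtoC d) (qz x)).
Proof.
  intros Hx. unfold dlog. rewrite diag_coef_shift by apply zc_neq_0, Hx.
  assert (E : Cinv (zc x) = zeta x).
  { transitivity (Cmult (Cmult (zeta x) (zc x)) (Cinv (zc x))).
    - rewrite zeta_zc by exact Hx. ring.
    - field. apply zc_neq_0, Hx. }
  rewrite E. unfold qz. ring.
Qed.

(** * Variation of the parameter mu along the curve *)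

Lemma gauge_on_zc (omega : R) (l : nat) (mu : R) (H : C -> mat2) (x : R) :
  0 < omega -> gauge_solution omega l mu H -> 0 < x ->
  let e := Cmult (Ckap omega) (Cmult (dzc x) (Cinv (zc x))) in
  is_cderive (fun t => m11 (H (zc t))) x (Cmult e (m21 (H (zc x)))) /\
  is_cderive (fun t => m12 (H (zc t))) x (Cplus (Cmult (dlog l mu x) (m12 (H (zc x)))) (Cmult e (m22 (H (zc x))))) /\
  is_cderive (fun t => m21 (H (zc t))) x (Cminus (Cmult e (m11 (H (zc x)))) (Cmult (dlog l mu x) (m21 (H (zc x))))) /\
  is_cderive (fun t => m22 (H (zc t))) x (Cmult e (m12 (H (zc x)))).
Proof.
  intros Hom HG Hx. apply (gauge_solution_along omega l mu H zc x (dzc x) Hom HG).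
  - apply zc_upper, Hx.
  - apply zc_neq_0, Hx.
  - apply zc_derive, Hx.
Qed.

Lemma gauge_zc_ccont (omega : R) (l : nat) (mu : R) (H : C -> mat2) :
  0 < omega -> gauge_solution omega l mu H ->
  ccont (fun x => m11 (H (zc x))) /\ ccont (fun x => m12 (H (zc x))) /\
  ccont (fun x => m21 (H (zc x))) /\ ccont (fun x => m22 (H (zc x))).
Proof.
  intros Hom HG. assert (D := fun x Hx => gauge_on_zc omega l mu H x Hom HG Hx).
  split; [|split; [|split]].
  - exact (cderive_ccont _ _ (fun x Hx => proj1 (D x Hx))).
  - exact (cderive_ccont _ _ (fun x Hx => proj1 (proj2 (D x Hx)))).
  - exact (cderive_ccont _ _ (fun x Hx => proj1 (proj2 (proj2 (D x Hx))))).
  - exact (cderive_ccont _ _ (fun x Hx => proj2 (proj2 (proj2 (D x Hx))))).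
Qed.

Lemma ccont_bounded_unit (f : R -> C) (M b : R) : 0 < b -> ccont f ->
  (forall x, 0 < x < b -> Cmod (f x) <= M) -> exists K, 0 < K /\ forall x, 0 < x <= 1 -> Cmod (f x) <= K.
Proof.
  intros Hb Hf HM.
  destruct (pos_part_bounded (fun x => Cmod (f x)) M b Hb) as [K [HK HB]].
  - intros x Hx. apply ccont_Cmod; assumption.
  - intros x Hx. rewrite Rabs_pos_eq by apply Cmod_ge_0. apply HM, Hx.
  - exists K. split; [exact HK|]. intros x Hx. specialize (HB x Hx).
    rewrite Rabs_pos_eq in HB by apply Cmod_ge_0. exact HB.
Qed.

Lemma ccont_quadratic_unit (f : R -> C) (M b : R) : 0 < b -> ccont f ->
  (forall x, 0 < x < b -> Cmod (f x) <= M * Cmod (zc x)) -> 0 <= M ->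
  exists K, 0 < K /\ forall x, 0 < x <= 1 -> Cmod (f x) <= K * (x * x).
Proof.
  intros Hb Hf HM HM0.
  assert (Hg : ccont (fun x => Cmult (RtoC (/ (x * x))) (f x))).
  { apply ccont_mult; [|exact Hf]. intros x Hx. assert (x * x <> 0) by nra.
    split; [|apply continuous_const]. simpl.
    apply (ex_derive_continuous (V := R_NormedModule)). auto_derive. exact H. }
  assert (Hmod : forall x, 0 < x -> Cmod (Cmult (RtoC (/ (x * x))) (f x)) = Cmod (f x) / (x * x)).
  { intros x Hx. assert (0 < x * x) by nra.
    rewrite Cmod_mult, Cmod_R, Rabs_pos_eq by (left; apply Rinv_0_lt_compat; assumption).
    unfold Rdiv. ring. }
  destruct (ccont_bounded_unit _ (M * 25) (Rmin b 1) ltac:(apply Rmin_glb_lt; lra) Hg) as [K [HK HB]].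
  - intros x Hx. assert (R1 := Rmin_l b 1). assert (R2 := Rmin_r b 1).
    rewrite Hmod by lra. assert (Hxx : 0 < x * x) by nra.
    specialize (HM x ltac:(lra)). assert (B := zc_bound x ltac:(lra)).
    apply (Rmult_le_reg_r (x * x)); [exact Hxx|].
    replace (Cmod (f x) / (x * x) * (x * x)) with (Cmod (f x)) by (field; lra).
    eapply Rle_trans; [exact HM|]. rewrite Rmult_assoc. apply Rmult_le_compat_l; assumption.
  - exists K. split; [exact HK|]. intros x Hx. specialize (HB x Hx). rewrite Hmod in HB by lra.
    assert (Hxx : 0 < x * x) by nra.
    replace (Cmod (f x)) with (Cmod (f x) / (x * x) * (x * x)) by (field; lra).
    apply Rmult_le_compat_r; lra.
Qed.

Lemma gauge_zc_bounds (omega : R) (l : nat) (mu : R) (H : C -> mat2) :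
  0 < omega -> gauge_solution omega l mu H -> exists K, 0 < K /\ forall x, 0 < x <= 1 ->
  Cmod (m11 (H (zc x))) <= K /\ Cmod (m22 (H (zc x))) <= K /\
  Cmod (m12 (H (zc x))) <= K * (x * x) /\ Cmod (m21 (H (zc x))) <= K * (x * x).
Proof.
  intros Hom HG.
  destruct (gauge_zc_ccont omega l mu H Hom HG) as [C11 [C12 [C21 C22]]].
  destruct (gauge_near0_curve _ _ _ _ _ _ HG zc_upper_curve) as [M [b [HM [Hb Hn]]]].
  assert (Hb1 : 0 < Rmin b 1) by (apply Rmin_glb_lt; lra).
  assert (Hone : forall f : R -> C, (forall x, 0 < x < b -> Cmod (Cminus (f x) (RtoC 1)) <= M * Cmod (zc x)) ->
    forall x, 0 < x < Rmin b 1 -> Cmod (f x) <= 1 + M * 25).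
  { intros f Hf x Hx. assert (R1 := Rmin_l b 1). assert (R2 := Rmin_r b 1).
    replace (f x) with (Cplus (RtoC 1) (Cminus (f x) (RtoC 1))) by ring.
    eapply Rle_trans; [apply Cmod_triangle|]. rewrite Cmod_1.
    specialize (Hf x ltac:(lra)). assert (B := zc_bound x ltac:(lra)).
    assert (B' : Cmod (zc x) <= 25) by nra. nra. }
  destruct (ccont_bounded_unit _ _ _ Hb1 C11 (Hone _ (fun x Hx => proj1 (Hn x Hx)))) as [K1 [HK1 B1]].
  destruct (ccont_bounded_unit _ _ _ Hb1 C22 (Hone _ (fun x Hx => proj2 (proj2 (proj2 (Hn x Hx)))))) as [K2 [HK2 B2]].
  destruct (ccont_quadratic_unit _ M b Hb C12 (fun x Hx => proj1 (proj2 (Hn x Hx))) ltac:(lra)) as [K3 [HK3 B3]].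
  destruct (ccont_quadratic_unit _ M b Hb C21 (fun x Hx => proj1 (proj2 (proj2 (Hn x Hx)))) ltac:(lra)) as [K4 [HK4 B4]].
  exists (K1 + K2 + K3 + K4). split; [lra|]. intros x Hx.
  specialize (B1 x Hx). specialize (B2 x Hx). specialize (B3 x Hx). specialize (B4 x Hx).
  cbv beta in *. assert (0 < x * x) by nra. repeat split; nra.
Qed.

Lemma fz_quadratic (l : nat) (mu : R) : 0 < mu -> exists F, 0 < F /\ forall s, 0 < s <= 1 ->
  Cmod (fz l mu s) <= F * (s * s).
Proof.
  intros Hmu. destruct (fz_growth l mu Hmu) as [E [HE Hg]].
  set (c := mu / 2). assert (Hc : 0 < c) by (unfold c; lra).
  exists (E * exp c * / c * (Cmod (fz l mu 1) + 1)).
  assert (P := Cmod_ge_0 (fz l mu 1)). assert (Hec := exp_pos c).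
  assert (Hic : 0 < / c) by (apply Rinv_0_lt_compat, Hc).
  assert (HF0 : 0 < E * exp c * / c) by (apply Rmult_lt_0_compat; [apply Rmult_lt_0_compat; assumption|exact Hic]).
  split; [apply Rmult_lt_0_compat; lra|].
  intros s Hs. specialize (Hg s 1 ltac:(lra) ltac:(lra)). fold c in Hg.
  eapply Rle_trans; [exact Hg|].
  assert (Hss : 0 < s * s) by nra.
  assert (Hexp : exp (- c * (/ (s * s) - / (1 * 1))) <= exp c * (/ c * (s * s))).
  { replace (- c * (/ (s * s) - / (1 * 1))) with (c + - (c / (s * s))) by (field; lra).
    rewrite exp_plus, exp_Ropp. apply Rmult_le_compat_l; [lra|].
    assert (Hy : 0 < c / (s * s)) by (apply Rdiv_lt_0_compat; assumption).
    replace (/ c * (s * s)) with (/ (c / (s * s))) by (field; lra).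
    apply Rinv_le_contravar; [exact Hy|]. left. apply Rlt_trans with (1 + c / (s * s)); [lra|].
    apply exp_ineq1. lra. }
  apply Rle_trans with (E * (exp c * (/ c * (s * s))) * (Cmod (fz l mu 1) + 1)).
  - apply Rmult_le_compat; [apply Rmult_le_pos; [lra|left; apply exp_pos]|exact P| |lra].
    apply Rmult_le_compat_l; lra.
  - right. ring.
Qed.

(** These coefficients come from inverting the normalization at mu, whose determinant is 1. The
    scalar solution enters as the quotient of its values at s and at x, which decays exponentially
    for s < x. [K] is a sum of the separate bounds. *)
Lemma gauge_volterra (omega : R) (l : nat) (mu : R) (H : C -> mat2) :
  0 < omega -> 0 < mu -> gauge_solution omega l mu H -> exists K,
  let p x := Cmult (qz x) (m12 (H (zc x))) in
  let r x := Cmult (qz x) (Cmult (fz l mu x) (m11 (H (zc x)))) in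
  volterra (mu / 2) K (fun x => Copp (m21 (H (zc x))))
    (fun x => Cmult (m22 (H (zc x))) (Cinv (fz l mu x))) p r /\
  volterra (mu / 2) K (fun x => Copp (m11 (H (zc x))))
    (fun x => Cmult (m12 (H (zc x))) (Cinv (fz l mu x))) p r.
Proof.
  intros Hom Hmu HG.
  destruct (gauge_zc_ccont omega l mu H Hom HG) as [C11 [C12 [C21 C22]]].
  destruct (gauge_zc_bounds omega l mu H Hom HG) as [k [Hk B]].
  destruct (fz_growth l mu Hmu) as [E [HE Hg]].
  destruct (fz_quadratic l mu Hmu) as [F [HF Hq]].
  set (K := k + 2504 * k + 2504 * (F * k) + k * k * 2504 * E).
  assert (Q1 : 0 < F * k) by (apply Rmult_lt_0_compat; assumption).
  assert (Q2 : 0 < k * k * 2504 * E) by (apply Rmult_lt_0_compat; [nra|exact HE]).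
  exists K. intros p r.
  assert (Cf : ccont (fz l mu)) by exact (cderive_ccont _ _ (fz_derive l mu)).
  assert (Cfi : ccont (fun x => Cinv (fz l mu x))).
  { exact (cderive_ccont _ _ (fun x Hx => is_cderive_inv (fz l mu) x _ (fz_neq_0 l mu x Hx) (fz_derive l mu x Hx))). }
  assert (Cp : ccont p) by (apply ccont_mult; [apply qz_ccont|exact C12]).
  assert (Cr : ccont r) by (apply ccont_mult; [apply qz_ccont|apply ccont_mult; assumption]).
  assert (Bp : forall x, 0 < x <= 1 -> Cmod (p x) <= K / x).
  { intros x Hx. unfold p. rewrite Cmod_mult. destruct (B x Hx) as [_ [_ [B3 _]]]. assert (Bq := qz_bound x Hx).
    apply Rle_trans with (2504 / (x * x * x) * (k * (x * x))).
    - apply Rmult_le_compat; try apply Cmod_ge_0; assumption.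
    - replace (2504 / (x * x * x) * (k * (x * x))) with (2504 * k / x) by (field; lra).
      apply Rmult_le_compat_r; [left; apply Rinv_0_lt_compat; lra|unfold K; lra]. }
  assert (Br : forall x, 0 < x <= 1 -> Cmod (r x) <= K / x).
  { intros x Hx. unfold r. rewrite !Cmod_mult. destruct (B x Hx) as [B1 _]. assert (Bq := qz_bound x Hx).
    specialize (Hq x Hx).
    apply Rle_trans with (2504 / (x * x * x) * (F * (x * x) * k)).
    - apply Rmult_le_compat; try apply Cmod_ge_0; trivial.
      + apply Rmult_le_pos; apply Cmod_ge_0.
      + apply Rmult_le_compat; try apply Cmod_ge_0; assumption.
    - replace (2504 / (x * x * x) * (F * (x * x) * k)) with (2504 * (F * k) / x) by (field; lra).
      apply Rmult_le_compat_r; [left; apply Rinv_0_lt_compat; lra|unfold K; lra]. }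
  assert (Bbr : forall (g : C) s x, 0 < s <= x -> x <= 1 -> Cmod g <= k ->
    Cmod (Cmult (Cmult g (Cinv (fz l mu x))) (r s)) <= K * exp (- (mu / 2) * (/ (s * s) - / (x * x))) / (s * s * s)).
  { intros g s x Hs Hx Bg. unfold r. rewrite !Cmod_mult, Cmod_inv by (apply fz_neq_0; lra).
    destruct (B s ltac:(lra)) as [B1 _]. assert (Bq := qz_bound s ltac:(lra)).
    specialize (Hg s x Hs Hx).
    assert (Hfx : 0 < Cmod (fz l mu x)) by (apply Cmod_gt_0, fz_neq_0; lra).
    set (e := exp (- (mu / 2) * (/ (s * s) - / (x * x)))) in *. assert (He : 0 < e) by apply exp_pos.
    assert (Hs3 : 0 < s * s * s) by (apply Rmult_lt_0_compat; nra).
    assert (Hr : / Cmod (fz l mu x) * Cmod (fz l mu s) <= E * e).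
    { apply (Rmult_le_reg_l (Cmod (fz l mu x))); [exact Hfx|]. rewrite <- Rmult_assoc, Rinv_r by lra. lra. }
    replace (Cmod g * / Cmod (fz l mu x) * (Cmod (qz s) * (Cmod (fz l mu s) * Cmod (m11 (H (zc s))))))
      with (Cmod g * Cmod (m11 (H (zc s))) * Cmod (qz s) * (/ Cmod (fz l mu x) * Cmod (fz l mu s))) by ring.
    apply Rle_trans with (k * k * (2504 / (s * s * s)) * (E * e)).
    - assert (G0 := Cmod_ge_0 g). assert (G1 := Cmod_ge_0 (m11 (H (zc s)))). assert (G2 := Cmod_ge_0 (qz s)).
      assert (G3 := Cmod_ge_0 (fz l mu s)).
      apply Rmult_le_compat; trivial.
      + apply Rmult_le_pos; [apply Rmult_le_pos|]; assumption.
      + apply Rmult_le_pos; [left; apply Rinv_0_lt_compat, Hfx|exact G3].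
      + apply Rmult_le_compat; trivial; [apply Rmult_le_pos; assumption|apply Rmult_le_compat; assumption].
    - replace (k * k * (2504 / (s * s * s)) * (E * e)) with ((k * k * 2504 * E) * e / (s * s * s)) by (field; lra).
      apply Rmult_le_compat_r; [left; apply Rinv_0_lt_compat, Hs3|].
      apply Rmult_le_compat_r; [lra|]. unfold K; lra. }
  assert (HK : 0 < K) by (unfold K; lra).
  assert (Hsq : forall x, 0 < x <= 1 -> k * (x * x) <= k) by (intros x Hx; assert (x * x <= 1) by nra; nra).
  split; split; trivial; try lra.
  - apply ccont_opp, C21.
  - apply ccont_mult; assumption.
  - intros x Hx. rewrite Cmod_opp. destruct (B x Hx) as [_ [_ [_ B4]]]. specialize (Hsq x Hx). unfold K; lra.
  - intros s x Hs Hx. apply Bbr; trivial. apply B; lra.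
  - apply ccont_opp, C11.
  - apply ccont_mult; assumption.
  - intros x Hx. rewrite Cmod_opp. destruct (B x Hx) as [B1 _]. unfold K; lra.
  - intros s x Hs Hx. apply Bbr; trivial. eapply Rle_trans; [apply B; lra|apply Hsq; lra].
Qed.

(* Variation of constants: the first column at mu + d is the first column at mu plus d times a
   Volterra operator, built from the normalization at mu, applied to the (2,1) entry. *)
Lemma gauge_variation (omega : R) (l : nat) (mu d : R) (H0 H1 : C -> mat2) (x : R) :
  0 < omega -> 0 < mu -> gauge_solution omega l mu H0 -> gauge_solution omega l (mu + d) H1 -> 0 < x ->
  let p x := Cmult (qz x) (m12 (H0 (zc x))) in
  let r x := Cmult (qz x) (Cmult (fz l mu x) (m11 (H0 (zc x)))) in
  let eta x := m21 (H1 (zc x)) in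
  eta x = Cplus (m21 (H0 (zc x))) (Cmult (RtoC d) (vop (fun x => Copp (m21 (H0 (zc x))))
      (fun x => Cmult (m22 (H0 (zc x))) (Cinv (fz l mu x))) p r eta x)) /\
  m11 (H1 (zc x)) = Cplus (m11 (H0 (zc x))) (Cmult (RtoC d) (vop (fun x => Copp (m11 (H0 (zc x))))
      (fun x => Cmult (m12 (H0 (zc x))) (Cinv (fz l mu x))) p r eta x)).
Proof.
  intros Hom Hmu HG0 HG1 Hx p r eta.
  destruct (gauge_volterra omega l mu H0 Hom Hmu HG0) as [K [V _]]. fold p r in V.
  assert (Aeta : exists M, adm eta M).
  { destruct (gauge_zc_ccont omega l (mu + d) H1 Hom HG1) as [_ [_ [C21 _]]].
    destruct (gauge_zc_bounds omega l (mu + d) H1 Hom HG1) as [M [_ B]].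
    exists M. split; [exact C21|]. intros y Hy. apply B, Hy. }
  destruct Aeta as [M Aeta].
  assert (I1 := adm_integrand p eta K M (vo_cont_p _ _ _ _ _ _ V) Aeta (vo_p _ _ _ _ _ _ V)).
  assert (I2 := adm_integrand r eta K M (vo_cont_r _ _ _ _ _ _ V) Aeta (vo_r _ _ _ _ _ _ V)).
  destruct (gauge_lim0 _ _ _ _ _ _ HG0 zc_upper_curve) as [L11 [L12 [L21 L22]]].
  destruct (gauge_lim0 _ _ _ _ _ _ HG1 zc_upper_curve) as [N11 [_ [N21 _]]].
  assert (L11' : clim0 (fun x => m11 (H0 (zc x))) (RtoC 1)) by exact L11.
  assert (L12' : clim0 (fun x => m12 (H0 (zc x))) (RtoC 0)) by exact L12.
  assert (L21' : clim0 (fun x => m21 (H0 (zc x))) (RtoC 0)) by exact L21.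
  assert (L22' : clim0 (fun x => m22 (H0 (zc x))) (RtoC 1)) by exact L22.
  assert (N11' : clim0 (fun x => m11 (H1 (zc x))) (RtoC 1)) by exact N11.
  assert (N21' : clim0 eta (RtoC 0)) by exact N21.
  assert (Lf : clim0 (fz l mu) (RtoC 0)).
  { destruct (fz_quadratic l mu Hmu) as [F [HF Hq]].
    apply (lim0_Cmod (fz l mu) (RtoC 0) F 1 Rlt_0_1). intros y Hy.
    replace (Cminus (fz l mu y) (RtoC 0)) with (fz l mu y) by ring.
    eapply Rle_trans; [apply Hq; lra|]. apply Rmult_le_compat_l; nra. }
  (* Coordinates of the first column at mu + d in the basis of the columns at mu. Only the
     difference of the diagonal coefficients survives in their derivatives, whence the factor d; the
     second coordinate is multiplied by the scalar solution to remove its homogeneous term. *)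
  set (k1 := fun y => Cminus (Cmult (m22 (H0 (zc y))) (m11 (H1 (zc y)))) (Cmult (m12 (H0 (zc y))) (eta y))).
  set (k2 := fun y => Cminus (Cmult (m11 (H0 (zc y))) (eta y)) (Cmult (m21 (H0 (zc y))) (m11 (H1 (zc y))))).
  assert (Dk : forall y, 0 < y ->
    is_cderive k1 y (Copp (Cmult (RtoC d) (Cmult (p y) (eta y)))) /\
    is_cderive (fun t => Cmult (fz l mu t) (k2 t)) y (Cmult (RtoC d) (Cmult (r y) (eta y)))).
  { intros y Hy.
    destruct (gauge_on_zc omega l mu H0 y Hom HG0 Hy) as [A11 [A12 [A21 A22]]].
    destruct (gauge_on_zc omega l (mu + d) H1 y Hom HG1 Hy) as [B11 [_ [B21 _]]].
    rewrite dlog_shift in B21 by exact Hy. fold eta in B21. fold (eta y) in B11, B21.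
    split.
    - eapply is_cderive_eq; [exact (is_cderive_minus _ _ y _ _ (is_cderive_mult _ _ y _ _ A22 B11)
        (is_cderive_mult _ _ y _ _ A12 B21))|]. cbv beta. unfold p. fold (eta y). ring.
    - eapply is_cderive_eq; [exact (is_cderive_mult _ _ y _ _ (fz_derive l mu y Hy)
        (is_cderive_minus _ _ y _ _ (is_cderive_mult _ _ y _ _ A11 B21) (is_cderive_mult _ _ y _ _ A21 B11)))|].
      cbv beta. unfold r, k2. fold (eta y). ring. }
  (* The constants of integration come from the limits at 0: the first coordinate tends to 1, and
     the second times [fz] tends to 0 because [fz] is flat there. *)
  assert (E1 : cprim (fun s => Cmult (RtoC d) (Cmult (p s) (eta s))) x = Cminus (RtoC 1) (k1 x)).
  { apply (cprim_unique _ (fun y => Cminus (RtoC 1) (k1 y))); [| | |exact Hx].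
    - destruct I1 as [Ic [Im HI]]. split; [apply ccont_mult; [apply ccont_const|exact Ic]|].
      exists (Rabs d * Im). intros s Hs. rewrite Cmod_mult, Cmod_R, Rmult_assoc.
      apply Rmult_le_compat_l; [apply Rabs_pos|apply HI, Hs].
    - eapply clim0_eq; [exact (clim0_plus _ _ _ _ (clim0_const (RtoC 1)) (clim0_opp _ _
        (clim0_plus _ _ _ _ (clim0_mult _ _ _ _ L22' N11') (clim0_opp _ _ (clim0_mult _ _ _ _ L12' N21')))))|]. ring.
    - intros y Hy. eapply is_cderive_eq; [exact (is_cderive_minus _ _ y _ _ (is_cderive_const (RtoC 1) y) (proj1 (Dk y Hy)))|]. ring. }
  assert (E2 : cprim (fun s => Cmult (RtoC d) (Cmult (r s) (eta s))) x = Cmult (fz l mu x) (k2 x)).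
  { apply (cprim_unique _ (fun y => Cmult (fz l mu y) (k2 y))); [| | |exact Hx].
    - destruct I2 as [Ic [Im HI]]. split; [apply ccont_mult; [apply ccont_const|exact Ic]|].
      exists (Rabs d * Im). intros s Hs. rewrite Cmod_mult, Cmod_R, Rmult_assoc.
      apply Rmult_le_compat_l; [apply Rabs_pos|apply HI, Hs].
    - eapply clim0_eq; [exact (clim0_mult _ _ _ _ Lf
        (clim0_plus _ _ _ _ (clim0_mult _ _ _ _ L11' N21') (clim0_opp _ _ (clim0_mult _ _ _ _ L21' N11'))))|]. ring.
    - intros y Hy. exact (proj2 (Dk y Hy)). }
  assert (Z : integrand (fun _ => RtoC 0)).
  { split; [apply ccont_const|]. exists 0. intros s _. rewrite Cmod_0. lra. }
  assert (Z0 : cprim (fun _ => RtoC 0) x = RtoC 0).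
  { apply (cprim_unique _ (fun _ => RtoC 0)); [exact Z|apply clim0_const| |exact Hx]. intros y _; apply is_cderive_const. }
  rewrite (cprim_comb (RtoC d) (fun s => Cmult (RtoC d) (Cmult (p s) (eta s))) (fun _ => RtoC 0)
    (fun s => Cmult (p s) (eta s)) x Z I1), Z0 in E1 by (first [exact Hx|intros; ring]).
  rewrite (cprim_comb (RtoC d) (fun s => Cmult (RtoC d) (Cmult (r s) (eta s))) (fun _ => RtoC 0)
    (fun s => Cmult (r s) (eta s)) x Z I2), Z0 in E2 by (first [exact Hx|intros; ring]).
  assert (Hdet := gauge_det omega l mu H0 zc dzc x Hom HG0 zc_upper_curve Hx). unfold mdet in Hdet.
  assert (Hf := fz_neq_0 l mu x Hx).
  assert (E1' : Cmult (RtoC d) (cprim (fun s => Cmult (p s) (eta s)) x) = Cminus (RtoC 1) (k1 x)) by (rewrite <- E1; ring).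
  assert (E2' : Cmult (RtoC d) (cprim (fun s => Cmult (r s) (eta s)) x) = Cmult (fz l mu x) (k2 x)) by (rewrite <- E2; ring).
  unfold vop. set (P := cprim (fun s => Cmult (p s) (eta s)) x) in *. set (R := cprim (fun s => Cmult (r s) (eta s)) x) in *.
  split.
  - transitivity (Cplus (m21 (H0 (zc x))) (Cplus (Cmult (Copp (m21 (H0 (zc x)))) (Cmult (RtoC d) P))
      (Cmult (Cmult (m22 (H0 (zc x))) (Cinv (fz l mu x))) (Cmult (RtoC d) R)))); [|ring].
    rewrite E1', E2'. unfold k1, k2.
    transitivity (Cmult (Cminus (Cmult (m11 (H0 (zc x))) (m22 (H0 (zc x)))) (Cmult (m12 (H0 (zc x))) (m21 (H0 (zc x))))) (eta x));
      [rewrite Hdet; ring|field; exact Hf].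
  - transitivity (Cplus (m11 (H0 (zc x))) (Cplus (Cmult (Copp (m11 (H0 (zc x)))) (Cmult (RtoC d) P))
      (Cmult (Cmult (m12 (H0 (zc x))) (Cinv (fz l mu x))) (Cmult (RtoC d) R)))); [|ring].
    rewrite E1', E2'. unfold k1, k2.
    transitivity (Cmult (Cminus (Cmult (m11 (H0 (zc x))) (m22 (H0 (zc x)))) (Cmult (m12 (H0 (zc x))) (m21 (H0 (zc x))))) (m11 (H1 (zc x))));
      [rewrite Hdet; ring|field; exact Hf].
Qed.

Lemma gauge_entries_analytic (omega : R) (l : nat) (H : R -> C -> mat2) (mu : R) :
  0 < omega -> (forall m, 0 < m -> gauge_solution omega l m (H m)) -> 0 < mu ->
  (analytic_at (fun m => Re (m21 (H m (RtoC 1)))) mu /\ analytic_at (fun m => Im (m21 (H m (RtoC 1)))) mu) /\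
  (analytic_at (fun m => Re (m11 (H m (RtoC 1)))) mu /\ analytic_at (fun m => Im (m11 (H m (RtoC 1)))) mu).
Proof.
  intros Hom HG Hmu.
  destruct (gauge_volterra omega l mu (H mu) Hom Hmu (HG mu Hmu)) as [K [V V1]].
  assert (Hadm : forall m, 0 < m -> exists M, adm (fun x => m21 (H m (zc x))) M).
  { intros m Hm. destruct (gauge_zc_ccont omega l m (H m) Hom (HG m Hm)) as [_ [_ [C21 _]]].
    destruct (gauge_zc_bounds omega l m (H m) Hom (HG m Hm)) as [M [_ B]].
    exists M. split; [exact C21|]. intros y Hy. apply B, Hy. }
  destruct (Hadm mu Hmu) as [M0 A0].
  rewrite <- zc_1.
  apply (volterra_analytic (mu / 2) K M0 mu mu _ _ _ _ _ _ (fun x => m21 (H mu (zc x))) (m11 (H mu (zc 1)))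
    (fun m x => m21 (H m (zc x))) (fun m => m11 (H m (zc 1))) V V1 A0 Hmu).
  intros d Hd. apply Rabs_def2 in Hd.
  destruct (Hadm (mu + d) ltac:(lra)) as [M A]. exists M. split; [exact A|]. split.
  - intros x Hx. apply (gauge_variation omega l mu d (H mu) (H (mu + d)) x Hom Hmu (HG mu Hmu) (HG (mu + d) ltac:(lra)) Hx).
  - apply (gauge_variation omega l mu d (H mu) (H (mu + d)) 1 Hom Hmu (HG mu Hmu) (HG (mu + d) ltac:(lra)) Rlt_0_1).
Qed.

(** * Large parameter *)

(** The square of the negative part of [f] is nonincreasing and tends to 0 at 0, so it vanishes
    identically. *)
Lemma lim0_barrier (f df : R -> R) (b : R) : lim0 f 0 ->
  (forall x, 0 < x <= b -> is_derive f x (df x)) ->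
  (forall x, 0 < x <= b -> f x <= 0 -> 0 <= df x) -> forall x, 0 < x <= b -> 0 <= f x.
Proof.
  intros H0 Hd Hle x Hx. destruct (Rle_lt_dec 0 (f x)) as [|Hneg]; [assumption|exfalso].
  assert (Hm : forall t, 0 < t < x -> f x * f x <= f t * f t).
  { intros t Ht.
    assert (H : Rmin (f x) 0 * Rmin (f x) 0 <= Rmin (f t) 0 * Rmin (f t) 0).
    { apply (derive_nonpos_decr (fun y => Rmin (f y) 0 * Rmin (f y) 0)
        (fun y => 2 * Rmin (f y) 0 * df y)); [lra| |].
      - intros y Hy. exact (is_derive_Rcomp (fun z => Rmin z 0 * Rmin z 0) f y _ _
          (is_derive_negpart_sq (f y)) (Hd y ltac:(lra))).
      - intros y Hy. destruct (Rle_lt_dec (f y) 0) as [Hf|Hf].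
        + specialize (Hle y ltac:(lra) Hf). rewrite Rmin_left by exact Hf. nra.
        + rewrite Rmin_right by lra. lra. }
    rewrite (Rmin_left (f x)) in H by lra.
    destruct (Rle_lt_dec (f t) 0) as [Hf|Hf].
    - rewrite Rmin_left in H by exact Hf. exact H.
    - rewrite Rmin_right in H by lra. nra. }
  assert (Hl := lim0_le (fun t => f t * f t) (0 * 0) (f x * f x) x ltac:(lra) (lim0_mult _ _ _ _ H0 H0) Hm).
  nra.
Qed.

Lemma lim0_linear (f : R -> R) (K l : R) : lim0 f l -> lim0 (fun x => f x + K * x) l.
Proof.
  intros Hf. apply (lim0_eq _ (l + K * 0)); [|ring]. apply lim0_plus; [exact Hf|apply lim0_scal, lim0_id].
Qed.

Lemma lim0_neg (f : R -> R) : lim0 f 0 -> lim0 (fun x => - f x) 0.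
Proof.
  intros Hf. apply (lim0_ext (fun x => (-1) * f x)); [intros; ring|].
  apply (lim0_eq _ ((-1) * 0)); [apply lim0_scal, Hf|ring].
Qed.

(** The lines K x and - K x are barriers: beyond them, the damping together with the slope K
    outweighs the forcing. *)
Lemma damped_bound (m d f : R -> R) (K b : R) : lim0 m 0 ->
  (forall x, 0 < x <= b -> is_derive m x (d x * m x + f x)) ->
  (forall x, 0 < x <= b -> d x <= 0) ->
  (forall x, 0 < x <= b -> Rabs (f x) <= K - d x * (K * x)) ->
  forall x, 0 < x <= b -> Rabs (m x) <= K * x.
Proof.
  intros H0 Hm Hd Hf x Hx.
  assert (Hlin : forall y, is_derive (fun t => K * t) y K) by (intros y; auto_derive; [trivial|ring]).
  assert (A1 : 0 <= m x + K * x).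
  { apply (lim0_barrier (fun t => m t + K * t) (fun t => d t * m t + f t + K) b); [apply lim0_linear, H0| | |exact Hx].
    - intros y Hy. apply is_derive_Rplus; [apply Hm, Hy|apply Hlin].
    - intros y Hy Hneg. specialize (Hf y Hy). specialize (Hd y Hy). apply Rabs_le_between in Hf. nra. }
  assert (A2 : 0 <= - m x + K * x).
  { apply (lim0_barrier (fun t => - m t + K * t) (fun t => - (d t * m t + f t) + K) b);
      [apply lim0_linear, lim0_neg, H0| | |exact Hx].
    - intros y Hy. apply is_derive_Rplus; [apply is_derive_Ropp, Hm, Hy|apply Hlin].
    - intros y Hy Hneg. specialize (Hf y Hy). specialize (Hd y Hy). apply Rabs_le_between in Hf. nra. }
  apply Rabs_le. lra.
Qed.

Lemma lim0_decreasing_le (f df : R -> R) (l x : R) : lim0 f l -> 0 < x ->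
  (forall y, 0 < y <= x -> is_derive f y (df y)) -> (forall y, 0 < y <= x -> df y <= 0) -> f x <= l.
Proof.
  intros Hl Hx Hd Hle. apply (lim0_le f l (f x) x Hx Hl). intros t Ht.
  apply (derive_nonpos_decr f df); [lra| |]; intros y Hy; [apply Hd|apply Hle]; lra.
Qed.

Lemma lim0_deriv_bound (f df : R -> R) (l B x : R) : lim0 f l -> 0 < x -> 0 <= B ->
  (forall y, 0 < y <= x -> is_derive f y (df y)) -> (forall y, 0 < y <= x -> Rabs (df y) <= B) ->
  Rabs (f x - l) <= B * x.
Proof.
  intros Hl Hx HB Hd Hle.
  apply (lim0_derive_bound (fun y => f y - l) df (fun y => B * y) (fun _ => B) x Hx).
  - apply (lim0_ext (fun y => f y + - l)); [intros; ring|].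
    apply (lim0_eq _ (l + - l)); [apply lim0_plus; [exact Hl|apply lim0_const]|ring].
  - intros y Hy. eapply is_derive_eq; [apply is_derive_Rminus; [apply Hd, Hy|apply is_derive_Rconst]|ring].
  - intros y _. auto_derive; [trivial|ring].
  - intros y Hy. nra.
  - exact Hle.
Qed.

Lemma sq_sum_le_1 (a b : R) : a * a + b * b <= 1 -> Rabs a <= 1.
Proof. intros H. apply Rabs_le. nra. Qed.

Lemma pos_axis_estimate (omega : R) (l : nat) (mu : R) (H : C -> mat2) :
  0 < omega -> 0 < mu -> gauge_solution omega l mu H ->
  Rabs (Im (m12 (H (RtoC 1)))) <= kap omega / mu /\
  Rabs (Re (m22 (H (RtoC 1))) - 1) <= kap omega * kap omega / mu.
Proof.
  intros Hom Hmu HG. assert (Hk := kap_pos omega Hom). set (k := kap omega) in *.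
  assert (H11 : 1 * 1 = 1) by ring.
  destruct (gauge_lim0 _ _ _ _ _ _ HG (real_upper_curve 1 H11)) as [_ [[_ L4] [_ [L7 _]]]].
  set (m := fun t => Im (m12 (H (RtoC (1 * t))))). set (n := fun t => Re (m22 (H (RtoC (1 * t))))).
  set (D := fun t => - (INR l / t + mu * (1 + / (t * t)))).
  assert (Hder : forall t, 0 < t -> is_derive m t (D t * m t + - (k / t) * n t) /\ is_derive n t (k / t * m t)).
  { intros t Ht. destruct (gauge_real_axis omega l mu H 1 t Hom HG H11 Ht) as [_ [D2 [_ D4]]].
    destruct (gauge_pos_axis_reality omega l mu H (1 * t) Hom Hmu HG ltac:(lra)) as [R1 R2].
    split.
    - eapply is_derive_eq; [exact (proj2 D2)|]. unfold m, n, D. fold k.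
      unfold Re, Im in *. simpl. field. lra.
    - eapply is_derive_eq; [exact (proj1 D4)|]. unfold m. fold k. unfold Re, Im in *. simpl. field. lra. }
  assert (HD : forall t, 0 < t -> D t <= - (mu / (t * t)) /\ D t <= 0).
  { intros t Ht. unfold D. assert (0 <= INR l / t) by (apply Rdiv_le_0_compat; [apply pos_INR|exact Ht]).
    assert (0 < / (t * t)) by (apply Rinv_0_lt_compat; nra). unfold Rdiv in *. split; nra. }
  assert (HE : forall t, 0 < t -> n t * n t + m t * m t <= 1).
  { intros t Ht. apply (lim0_decreasing_le (fun y => n y * n y + m y * m y) (fun y => 2 * D y * (m y * m y)) 1 t); [|exact Ht| |].
    - apply (lim0_eq _ (1 * 1 + 0 * 0)); [|ring]. apply lim0_plus; apply lim0_mult; assumption.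
    - intros y Hy. destruct (Hder y ltac:(lra)) as [Dm Dn].
      eapply is_derive_eq; [exact (is_derive_Rplus _ _ y _ _ (is_derive_Rmult _ _ y _ _ Dn Dn) (is_derive_Rmult _ _ y _ _ Dm Dm))|].
      ring.
    - intros y Hy. destruct (HD y ltac:(lra)) as [_ HD0]. assert (A := Rle_0_sqr (m y)). unfold Rsqr in A. nra. }
  (* The slope k/mu balances the forcing, at most k/x, against the damping rate mu / x^2 acting on a
     quantity of size k x / mu. *)
  assert (Hm : forall x, 0 < x <= 1 -> Rabs (m x) <= k / mu * x).
  { apply (damped_bound m D (fun t => - (k / t) * n t) (k / mu) 1 L4).
    - intros x Hx. apply Hder; lra.
    - intros x Hx. apply HD; lra.
    - intros x Hx. rewrite Rabs_mult, Rabs_Ropp, (Rabs_pos_eq (k / x)) by (apply Rdiv_le_0_compat; lra).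
      assert (Hn := sq_sum_le_1 _ _ (HE x ltac:(lra))). destruct (HD x ltac:(lra)) as [HD1 _].
      assert (Hkm : 0 < k / mu) by (apply Rdiv_lt_0_compat; assumption).
      assert (Hkx : 0 < k / x) by (apply Rdiv_lt_0_compat; lra).
      apply Rle_trans with (k / x); [nra|].
      assert (E : k / x = mu / (x * x) * (k / mu * x)) by (field; lra).
      rewrite E. assert (0 < k / mu * x) by (apply Rmult_lt_0_compat; lra). nra. }
  assert (Hn : Rabs (n 1 - 1) <= k * (k / mu) * 1).
  { apply (lim0_deriv_bound n (fun t => k / t * m t) 1 (k * (k / mu)) 1 L7 Rlt_0_1).
    - apply Rmult_le_pos; [lra|]. apply Rdiv_le_0_compat; lra.
    - intros y Hy. apply Hder; lra.
    - intros y Hy. rewrite Rabs_mult, (Rabs_pos_eq (k / y)) by (apply Rdiv_le_0_compat; lra).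
      specialize (Hm y Hy). apply Rle_trans with (k / y * (k / mu * y)).
      + apply Rmult_le_compat_l; [apply Rdiv_le_0_compat; lra|exact Hm].
      + right. field. lra. }
  specialize (Hm 1 ltac:(lra)). unfold m, n in Hm, Hn. rewrite !Rmult_1_r in Hm, Hn.
  split; [exact Hm|]. eapply Rle_trans; [exact Hn|]. right. field. lra.
Qed.

(** The condition 2 l <= mu makes l/t at most half of mu / t^2 on (0, 1]. The remaining damping mu /
    (2 t^2) explains the factor 2 compared with the positive axis. *)
Lemma neg_axis_estimate (omega : R) (l : nat) (mu : R) (H : C -> mat2) :
  0 < omega -> 0 < mu -> 2 * INR l <= mu -> gauge_solution omega l mu H ->
  let h := H (RtoC (-1 * 1)) in
  Cmod (Cminus (m11 h) (RtoC 1)) <= 2 * kap omega * kap omega / mu /\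
  Cmod (m21 h) <= 2 * kap omega / mu.
Proof.
  intros Hom Hmu Hlmu HG h. assert (Hk := kap_pos omega Hom). set (k := kap omega) in *.
  assert (H11 : -1 * -1 = 1) by ring.
  destruct (gauge_lim0 _ _ _ _ _ _ HG (real_upper_curve (-1) H11)) as [[L1 _] [_ [[_ L6] _]]].
  set (a := fun t => Re (m11 (H (RtoC (-1 * t))))). set (b := fun t => Im (m21 (H (RtoC (-1 * t))))).
  set (D := fun t => INR l / t - mu * (1 + / (t * t))).
  assert (Hder : forall t, 0 < t -> is_derive b t (D t * b t + - (k / t) * a t) /\ is_derive a t (k / t * b t)).
  { intros t Ht. destruct (gauge_real_axis omega l mu H (-1) t Hom HG H11 Ht) as [D1 [_ [D3 _]]].
    destruct (gauge_neg_axis_reality omega l mu H t Hom Hmu HG Ht) as [R1 R2].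
    split.
    - eapply is_derive_eq; [exact (proj2 D3)|]. unfold a, b, D. fold k.
      unfold Re, Im in *. simpl. field. lra.
    - eapply is_derive_eq; [exact (proj1 D1)|]. unfold b. fold k. unfold Re, Im in *. simpl. field. lra. }
  assert (HD : forall t, 0 < t <= 1 -> D t <= - (mu / (2 * (t * t))) /\ D t <= 0).
  { intros t Ht. unfold D.
    assert (Hu : 1 <= / t) by (rewrite <- Rinv_1; apply Rinv_le_contravar; lra).
    assert (E1 : INR l / t <= mu / 2 * (/ t * / t)).
    { apply Rle_trans with (mu / 2 * / t); [unfold Rdiv; apply Rmult_le_compat_r; lra|].
      apply Rmult_le_compat_l; [lra|]. nra. }
    assert (E2 : mu / (2 * (t * t)) = mu / 2 * (/ t * / t)) by (field; lra).
    rewrite E2, Rinv_mult. assert (0 < mu * (/ t * / t)) by (apply Rmult_lt_0_compat; nra). lra. }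
  assert (HE : forall t, 0 < t <= 1 -> a t * a t + b t * b t <= 1).
  { intros t Ht. apply (lim0_decreasing_le (fun y => a y * a y + b y * b y) (fun y => 2 * D y * (b y * b y)) 1 t); [|lra| |].
    - apply (lim0_eq _ (1 * 1 + 0 * 0)); [|ring]. apply lim0_plus; apply lim0_mult; assumption.
    - intros y Hy. destruct (Hder y ltac:(lra)) as [Db Da].
      eapply is_derive_eq; [exact (is_derive_Rplus _ _ y _ _ (is_derive_Rmult _ _ y _ _ Da Da) (is_derive_Rmult _ _ y _ _ Db Db))|].
      ring.
    - intros y Hy. destruct (HD y ltac:(lra)) as [_ HD0]. assert (A := Rle_0_sqr (b y)). unfold Rsqr in A. nra. }
  assert (Hb : forall x, 0 < x <= 1 -> Rabs (b x) <= 2 * k / mu * x).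
  { apply (damped_bound b D (fun t => - (k / t) * a t) (2 * k / mu) 1 L6).
    - intros x Hx. apply Hder; lra.
    - intros x Hx. apply HD; lra.
    - intros x Hx. rewrite Rabs_mult, Rabs_Ropp, (Rabs_pos_eq (k / x)) by (apply Rdiv_le_0_compat; lra).
      assert (Hn := sq_sum_le_1 _ _ (HE x ltac:(lra))). destruct (HD x ltac:(lra)) as [HD1 _].
      assert (Hkm : 0 < 2 * k / mu) by (apply Rdiv_lt_0_compat; lra).
      assert (Hkx : 0 < k / x) by (apply Rdiv_lt_0_compat; lra).
      apply Rle_trans with (k / x); [nra|].
      assert (E : k / x = mu / (2 * (x * x)) * (2 * k / mu * x)) by (field; lra).
      rewrite E. assert (0 < 2 * k / mu * x) by (apply Rmult_lt_0_compat; lra). nra. }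
  assert (Ha : Rabs (a 1 - 1) <= k * (2 * k / mu) * 1).
  { apply (lim0_deriv_bound a (fun t => k / t * b t) 1 (k * (2 * k / mu)) 1 L1 Rlt_0_1).
    - apply Rmult_le_pos; [lra|]. apply Rdiv_le_0_compat; lra.
    - intros y Hy. apply Hder; lra.
    - intros y Hy. rewrite Rabs_mult, (Rabs_pos_eq (k / y)) by (apply Rdiv_le_0_compat; lra).
      specialize (Hb y Hy). apply Rle_trans with (k / y * (2 * k / mu * y)).
      + apply Rmult_le_compat_l; [apply Rdiv_le_0_compat; lra|exact Hb].
      + right. field. lra. }
  specialize (Hb 1 ltac:(lra)).
  destruct (gauge_neg_axis_reality omega l mu H 1 Hom Hmu HG Rlt_0_1) as [R1 R2].
  unfold a, b in Ha, Hb. fold h in Ha, Hb, R1, R2.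
  split.
  - eapply Rle_trans; [apply Cmod_le_sum|].
    assert (E1 : Re (Cminus (m11 h) (RtoC 1)) = Re (m11 h) - 1) by (unfold Re; simpl; ring).
    assert (E2 : Im (Cminus (m11 h) (RtoC 1)) = 0) by (unfold Im in *; simpl; lra).
    rewrite E1, E2, Rabs_R0, Rplus_0_r. eapply Rle_trans; [exact Ha|]. right. field. lra.
  - eapply Rle_trans; [apply Cmod_le_sum|]. rewrite R2, Rabs_R0, Rplus_0_l.
    eapply Rle_trans; [exact Hb|]. right. ring.
Qed.

(* A Wronskian of the two columns that vanishes at the singular point 0. *)
Lemma pos_axis_defect (omega : R) (l : nat) (mu : R) (H : C -> mat2) :
  0 < omega -> 0 < mu -> gauge_solution omega l mu H ->
  let h := H (RtoC 1) in
  Im (m11 h) * Re (m22 h) = Re (m21 h) * Im (m12 h).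
Proof.
  intros Hom Hmu HG h.
  assert (H11 : 1 * 1 = 1) by ring.
  destruct (gauge_lim0 _ _ _ _ _ _ HG (real_upper_curve 1 H11)) as [[_ L2] [[_ L4] [[L5 _] [L7 _]]]].
  set (A := fun t => Im (m11 (H (RtoC (1 * t))))). set (B := fun t => Re (m21 (H (RtoC (1 * t))))).
  set (m := fun t => Im (m12 (H (RtoC (1 * t))))). set (n := fun t => Re (m22 (H (RtoC (1 * t))))).
  assert (Hz : A 1 * n 1 + (-1) * (B 1 * m 1) = 0).
  { assert (Hl : lim0 (fun t => A t * n t + (-1) * (B t * m t)) 0).
    { apply (lim0_eq _ (0 * 1 + (-1) * (0 * 0))); [|ring].
      apply lim0_plus; [apply lim0_mult; assumption|apply lim0_scal, lim0_mult; assumption]. }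
    apply Rabs_eq_0. apply Rle_antisym; [|apply Rabs_pos].
    rewrite <- (Rminus_0_r (A 1 * n 1 + -1 * (B 1 * m 1))).
    eapply Rle_trans; [apply (lim0_deriv_bound _ (fun _ => 0) 0 0 1 Hl Rlt_0_1); [lra| |]|lra].
    - intros t Ht. destruct (gauge_real_axis omega l mu H 1 t Hom HG H11 ltac:(lra)) as [D1 [D2 [D3 D4]]].
      destruct (gauge_pos_axis_reality omega l mu H (1 * t) Hom Hmu HG ltac:(lra)) as [R1 R2].
      eapply is_derive_eq; [exact (is_derive_Rplus _ _ t _ _ (is_derive_Rmult _ _ t _ _ (proj2 D1) (proj1 D4))
        (is_derive_Rmult (fun _ => -1) _ t _ _ (is_derive_Rconst _ t) (is_derive_Rmult _ _ t _ _ (proj1 D3) (proj2 D2))))|].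
      unfold A, B, m, n, Re, Im in *. simpl. rewrite R1, R2. field. lra.
    - intros t _. rewrite Rabs_R0. lra. }
  unfold A, B, m, n in Hz. rewrite !Rmult_1_r in Hz. fold h in Hz. lra.
Qed.

(** * Fresnel integrals *)

Definition fresnel_int (p : R -> R) (y : R) : R := RInt (fun s => p (s * s)) 0 y.

Lemma fresnel_int_derive (p : R -> R) (y : R) : (forall t, continuous p t) ->
  is_derive (fresnel_int p) y (p (y * y)).
Proof.
  intros Hp. eapply is_derive_ext; [|apply (primitive_derive (fun s => p (s * s)) 0)].
  - intros t. apply Rplus_0_l.
  - intros t. apply (continuous_comp (fun s => s * s) p); [|apply Hp].
    apply (continuous_mult (fun s : R => s) (fun s => s) t); apply continuous_id.
Qed.

Lemma fresnel_int_0 (p : R -> R) : fresnel_int p 0 = 0.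
Proof. unfold fresnel_int. rewrite RInt_point. reflexivity. Qed.

Lemma fresnel_int_odd (p : R -> R) (y : R) : (forall t, continuous p t) ->
  fresnel_int p (- y) = - fresnel_int p y.
Proof.
  intros Hp.
  assert (Hpos : forall x, 0 <= x -> fresnel_int p (- x) = - fresnel_int p x).
  { intros x Hx.
    assert (E : fresnel_int p (- 0) + fresnel_int p 0 = fresnel_int p (- x) + fresnel_int p x).
    { apply (derive_zero_const (fun t => fresnel_int p (- t) + fresnel_int p t) (fun t => -1 * p (- t * - t) + p (t * t)) 0 x Hx).
      - intros t _. apply is_derive_Rplus; [|apply fresnel_int_derive, Hp].
        eapply is_derive_eq; [apply (is_derive_Rcomp (fresnel_int p) (fun t => - t) t (p (- t * - t)) (-1));
          [apply fresnel_int_derive, Hp|auto_derive; [trivial|ring]]|ring].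
      - intros t _. replace (- t * - t) with (t * t) by ring. ring. }
    rewrite Ropp_0, !fresnel_int_0 in E. lra. }
  destruct (Rle_lt_dec 0 y) as [Hy|Hy]; [apply Hpos, Hy|].
  assert (H := Hpos (- y) ltac:(lra)). rewrite Ropp_involutive in H. lra.
Qed.

(* Integration by parts: [q = p'], [q' = - p]; the boundary term [q (y^2) / (2 y)] makes the tail summable. *)
Lemma fresnel_parts_derive (p q : R -> R) (y : R) : 0 < y ->
  (forall t, is_derive p t (q t)) -> (forall t, is_derive q t (- p t)) ->
  is_derive (fun t => fresnel_int p t + q (t * t) * / (2 * t)) y (- q (y * y) / (2 * (y * y))).
Proof.
  intros Hy Hp Hq.
  assert (Hc : forall t, continuous p t) by (intros t; apply (ex_derive_continuous p); eexists; apply Hp).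
  assert (Hs : is_derive (fun t => t * t) y (2 * y)) by (auto_derive; [trivial|ring]).
  assert (Hi : is_derive (fun t => / (2 * t)) y (- / (2 * (y * y)))) by (auto_derive; [lra|field; lra]).
  eapply is_derive_eq; [exact (is_derive_Rplus _ _ y _ _ (fresnel_int_derive p y Hc)
    (is_derive_Rmult _ _ y _ _ (is_derive_Rcomp q (fun t => t * t) y _ _ (Hq (y * y)) Hs) Hi))|].
  cbv beta. field. lra.
Qed.

(** On [0, 1] the integral is at most 1 in modulus. Beyond 1, integration by parts leaves boundary
    terms and an absolutely convergent tail, together below 2. *)
Lemma fresnel_int_bound (p q : R -> R) (y : R) :
  (forall t, is_derive p t (q t)) -> (forall t, is_derive q t (- p t)) ->
  (forall t, Rabs (p t) <= 1) -> (forall t, Rabs (q t) <= 1) -> Rabs (fresnel_int p y) <= 3.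
Proof.
  intros Hp Hq Bp Bq.
  assert (Hc : forall t, continuous p t) by (intros t; apply (ex_derive_continuous p); eexists; apply Hp).
  assert (Hlip : forall x, Rabs (fresnel_int p x) <= Rabs x).
  { intros x. assert (H := derive_lipschitz (fresnel_int p) (fun t => p (t * t)) 1
      (fun t => fresnel_int_derive p t Hc) (fun t => Bp (t * t)) 0 x).
    rewrite fresnel_int_0, !Rminus_0_r in H. lra. }
  assert (Hpos : forall x, 0 <= x -> Rabs (fresnel_int p x) <= 3).
  { intros x Hx. destruct (Rle_lt_dec x 1) as [H1|H1].
    - eapply Rle_trans; [apply Hlip|]. rewrite Rabs_pos_eq; lra.
    - assert (Hd := fun t (Ht : 1 <= t <= x) => fresnel_parts_derive p q t ltac:(lra) Hp Hq).
      set (G := fun t => fresnel_int p t + q (t * t) * / (2 * t)) in *.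
      assert (Hi : forall t, 1 <= t <= x -> is_derive (fun t => - / (2 * t)) t (/ (2 * (t * t)))).
      { intros t Ht. auto_derive; [lra|field; lra]. }
      assert (Hb : forall t, 1 <= t <= x -> Rabs (- q (t * t) / (2 * (t * t))) <= / (2 * (t * t))).
      { intros t Ht. unfold Rdiv. rewrite Rabs_mult, Rabs_Ropp.
        assert (0 < / (2 * (t * t))) by (apply Rinv_0_lt_compat; nra).
        rewrite (Rabs_pos_eq (/ (2 * (t * t)))) by lra. specialize (Bq (t * t)). nra. }
      assert (A1 : G x - G 1 <= - / (2 * x) - - / (2 * 1)).
      { apply (derive_le_compare G (fun t => - / (2 * t)) _ _ 1 x ltac:(lra) Hd Hi).
        intros t Ht. specialize (Hb t Ht). apply Rabs_le_between in Hb. lra. }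
      assert (A2 : - G x - - G 1 <= - / (2 * x) - - / (2 * 1)).
      { apply (derive_le_compare (fun t => - G t) (fun t => - / (2 * t)) (fun t => - (- q (t * t) / (2 * (t * t)))) _ 1 x ltac:(lra)
          (fun t Ht => is_derive_Ropp G t _ (Hd t Ht)) Hi).
        intros t Ht. specialize (Hb t Ht). apply Rabs_le_between in Hb. lra. }
      assert (Hx1 : 0 < / (2 * x)) by (apply Rinv_0_lt_compat; lra).
      assert (Hx2 : / (2 * x) <= / 2) by (apply Rinv_le_contravar; lra).
      assert (B1 := Bq (x * x)). assert (B2 := Bq (1 * 1)). assert (B3 := Hlip 1).
      rewrite Rabs_R1 in B3.
      unfold G in A1, A2.
      apply Rabs_le_between in B1. apply Rabs_le_between in B2. apply Rabs_le_between in B3.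
      replace (1 * 1) with 1 in * by ring. replace (2 * 1) with 2 in * by ring.
      apply Rabs_le. split; nra. }
  destruct (Rle_lt_dec 0 y) as [Hy|Hy]; [apply Hpos, Hy|].
  rewrite <- (Ropp_involutive y), fresnel_int_odd, Rabs_Ropp by exact Hc. apply Hpos. lra.
Qed.

Lemma sin_cos_taylor (x : R) : 0 <= x -> 1 - x * x / 2 <= cos x /\ x - x * x * x / 6 <= sin x.
Proof.
  intros Hx0.
  assert (S1 : forall y, 0 <= y -> sin y <= y).
  { intros y Hy. assert (H := derive_le_compare sin (fun t => t) cos (fun _ => 1) 0 y Hy
      (fun t _ => is_derive_sin t) (fun t _ => is_derive_id (K := R_AbsRing) t)
      (fun t _ => proj2 (COS_bound t))). rewrite sin_0 in H. lra. }
  assert (C1 : forall y, 0 <= y -> 1 - y * y / 2 <= cos y).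
  { intros y Hy. assert (H : (1 - y * y / 2) - (1 - 0 * 0 / 2) <= cos y - cos 0).
    { apply (derive_le_compare (fun t => 1 - t * t / 2) cos (fun t => - t) (fun t => - sin t) 0 y Hy).
      - intros t _. auto_derive; [trivial|field].
      - intros t _. apply is_derive_cos.
      - intros t Ht. specialize (S1 t ltac:(lra)). lra. }
    rewrite cos_0 in H. lra. }
  split; [apply C1, Hx0|].
  assert (H : (x - x * x * x / 6) - (0 - 0 * 0 * 0 / 6) <= sin x - sin 0).
  { apply (derive_le_compare (fun t => t - t * t * t / 6) sin (fun t => 1 - t * t / 2) cos 0 x Hx0).
    - intros t _. auto_derive; [trivial|field].
    - intros t _. apply is_derive_sin.
    - intros t Ht. apply C1. lra. }
  rewrite sin_0 in H. lra.
Qed.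

(** On [0, 1] the bound sin x >= x - x^3/6 gives 1/3 - 1/42. Past 1, integration by parts loses at
    most (1 - cos 1)/2 <= 1/4, and 13/42 - 1/4 = 5/84. *)
Lemma fresnel_sin_lower (y : R) : 1 <= y -> 5 / 84 <= fresnel_int sin y.
Proof.
  intros Hy.
  assert (Hq : forall t, is_derive cos t (- sin t)) by (intros; apply is_derive_cos).
  assert (Hc : forall t, continuous sin t) by (intros; apply continuous_sin).
  assert (H1 : 1 / 3 - 1 / 42 <= fresnel_int sin 1).
  { assert (H : (1 ^ 3 / 3 - 1 ^ 7 / 42) - (0 ^ 3 / 3 - 0 ^ 7 / 42) <= fresnel_int sin 1 - fresnel_int sin 0).
    { apply (derive_le_compare (fun t => t ^ 3 / 3 - t ^ 7 / 42) (fresnel_int sin)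
        (fun t => t * t - t * t * (t * t) * (t * t) / 6) (fun t => sin (t * t)) 0 1 ltac:(lra)).
      - intros t _. auto_derive; [trivial|simpl; field].
      - intros t _. apply fresnel_int_derive, Hc.
      - intros t _. apply sin_cos_taylor. apply (Rle_0_sqr t). }
    rewrite fresnel_int_0 in H. simpl in H. lra. }
  assert (H2 : (fresnel_int sin 1 + cos (1 * 1) * / (2 * 1)) - / (2 * 1) <=
     (fresnel_int sin y + cos (y * y) * / (2 * y)) - / (2 * y)).
  { apply (derive_nonneg_incr (fun t => (fresnel_int sin t + cos (t * t) * / (2 * t)) - / (2 * t))
      (fun t => - cos (t * t) / (2 * (t * t)) - - / (2 * (t * t))) 1 y Hy).
    - intros t Ht. apply is_derive_Rminus.
      + exact (fresnel_parts_derive sin cos t ltac:(lra) is_derive_sin Hq).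
      + auto_derive; [lra|field; lra].
    - intros t Ht. assert (0 < / (2 * (t * t))) by (apply Rinv_0_lt_compat; nra).
      assert (B := COS_bound (t * t)). unfold Rdiv. nra. }
  assert (C1 := proj1 (sin_cos_taylor (1 * 1) ltac:(lra))).
  assert (B := COS_bound (y * y)). assert (0 < / (2 * y)) by (apply Rinv_0_lt_compat; lra). nra.
Qed.

(** * Stationary phase on the upper half circle *)

Definition psi (w : R) : R := w / 2 - PI / 4.

Lemma psi_derive (w : R) : is_derive psi w (/ 2).
Proof. unfold psi. auto_derive; [trivial|field]. Qed.

Lemma cos_half_bound (x : R) : - (PI / 4) <= x <= PI / 4 -> / 2 <= cos x.
Proof.
  intros Hx. assert (Hp := PI_RGT_0).
  assert (Hpos : forall y, 0 <= y <= PI / 4 -> / 2 <= cos y).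
  { intros y Hy. assert (E := cos_PI3). replace (1 / 2) with (/ 2) in E by lra. rewrite <- E.
    apply cos_decr_1; lra. }
  destruct (Rle_lt_dec 0 x) as [H|H]; [apply Hpos; lra|]. rewrite <- cos_neg. apply Hpos; lra.
Qed.

Lemma Rinv_half_bound (c : R) : / 2 <= c -> 0 < / c <= 2.
Proof.
  intros Hc. split; [apply Rinv_0_lt_compat; lra|].
  apply (Rmult_le_reg_r c); [lra|]. rewrite Rinv_l by lra. lra.
Qed.

(* The amplitude exp(2 i l psi) splits as cos psi plus a multiple of sin psi: the first part is an
   exact derivative of a Fresnel integral, the second one of the oscillating exponential. *)
Lemma amplitude_split (l : nat) : exists (beta dbeta : R -> C) (K : R), 0 < K /\ forall w, 0 <= w <= PI ->
  is_cderive beta w (dbeta w) /\ Cmod (beta w) <= K /\ Cmod (dbeta w) <= K /\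
  Cmult (RtoC (sin (psi w) * cos (psi w))) (beta w) = Cminus (cexp (0, 2 * INR l * psi w)) (RtoC (cos (psi w))).
Proof.
  assert (Hpi := PI_RGT_0).
  assert (Hr : forall w, 0 <= w <= PI -> - (PI / 4) <= psi w <= PI / 4) by (intros w Hw; unfold psi; lra).
  induction l as [|l [beta [dbeta [K [HK IH]]]]].
  (* For l = 0 the quotient (1 - cos psi) / (sin psi cos psi) equals tan (psi/2) / cos psi, which is
     smooth because |psi| <= pi/4. *)
  - exists (fun w => RtoC (sin (psi w / 2) / cos (psi w / 2) / cos (psi w))).
    set (T := fun w => sin (psi w / 2) / cos (psi w / 2)).
    exists (fun w => RtoC ((1 + T w * T w) / 4 / cos (psi w) + T w * sin (psi w) / (2 * (cos (psi w) * cos (psi w))))), 7.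
    split; [lra|]. intros w Hw. specialize (Hr w Hw).
    assert (C1 := cos_half_bound (psi w) Hr). assert (C2 := cos_half_bound (psi w / 2) ltac:(lra)).
    assert (S1 := SIN_bound (psi w)). assert (S2 := SIN_bound (psi w / 2)).
    assert (HT : Rabs (T w) <= 2).
    { unfold T, Rdiv. rewrite Rabs_mult. rewrite (Rabs_pos_eq (/ _)) by (left; apply Rinv_0_lt_compat; lra).
      assert (HI := Rinv_half_bound _ C2).
      assert (Rabs (sin (psi w / 2)) <= 1) by (apply Rabs_le; lra).
      assert (A := Rabs_pos (sin (psi w / 2))). unfold Rdiv in *. nra. }
    assert (HT2 : T w * T w <= 4).
    { apply Rabs_le_between in HT. nra. }
    destruct (Rinv_half_bound _ C1) as [Hic0 Hic].
    assert (DT : is_derive T w ((1 + T w * T w) / 4)).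
    { assert (Dh : is_derive (fun w => psi w / 2) w (/ 4)) by (unfold psi; auto_derive; [trivial|field]).
      eapply is_derive_eq; [exact (is_derive_div (fun w => sin (psi w / 2)) (fun w => cos (psi w / 2)) w _ _
        (is_derive_Rcomp sin (fun w => psi w / 2) w _ _ (is_derive_sin _) Dh)
        (is_derive_Rcomp cos (fun w => psi w / 2) w _ _ (is_derive_cos _) Dh) ltac:(lra))|].
      unfold T. field. lra. }
    split; [|split; [|split]].
    + apply is_cderive_RtoC.
      assert (Dc : is_derive (fun w => cos (psi w)) w (- sin (psi w) * / 2)).
      { exact (is_derive_Rcomp cos psi w _ _ (is_derive_cos (psi w)) (psi_derive w)). }
      eapply is_derive_eq; [exact (is_derive_div T (fun w => cos (psi w)) w _ _ DT Dc ltac:(lra))|].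
      simpl. field. lra.
    + rewrite Cmod_R. fold (T w). unfold Rdiv at 1. rewrite Rabs_mult, (Rabs_pos_eq (/ cos (psi w))) by lra.
      assert (A := Rabs_pos (T w)). nra.
    + rewrite Cmod_R. eapply Rle_trans; [apply Rabs_triang|].
      assert (A1 : Rabs ((1 + T w * T w) / 4 / cos (psi w)) <= 5 / 4 * 2).
      { unfold Rdiv at 1. rewrite Rabs_mult, (Rabs_pos_eq (/ cos (psi w))) by lra.
        assert (0 <= T w * T w) by apply (Rle_0_sqr (T w)). rewrite Rabs_pos_eq by lra. nra. }
      assert (A2 : Rabs (T w * sin (psi w) / (2 * (cos (psi w) * cos (psi w)))) <= 2 * 1 * / 2 * (2 * 2)).
      { replace (T w * sin (psi w) / (2 * (cos (psi w) * cos (psi w)))) with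
          (T w * sin (psi w) * / 2 * (/ cos (psi w) * / cos (psi w))) by (field; lra).
        rewrite !Rabs_mult. rewrite (Rabs_pos_eq (/ cos (psi w))), (Rabs_pos_eq (/ 2)) by lra.
        assert (Rabs (sin (psi w)) <= 1) by (apply Rabs_le; lra).
        assert (A := Rabs_pos (T w)). assert (A' := Rabs_pos (sin (psi w))).
        apply Rmult_le_compat; [|nra| |nra]; [apply Rmult_le_pos; [apply Rmult_le_pos|]; lra|].
        apply Rmult_le_compat_r; [lra|]. apply Rmult_le_compat; lra. }
      lra.
    + replace (2 * INR 0 * psi w) with 0 by (simpl; ring). rewrite cexp_im, cos_0, sin_0.
      assert (E1 : sin (psi w) = 2 * sin (psi w / 2) * cos (psi w / 2)).
      { rewrite <- sin_2a. f_equal. field. }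
      assert (E2 : cos (psi w) = 1 - 2 * sin (psi w / 2) * sin (psi w / 2)).
      { rewrite <- cos_2a_sin. f_equal. field. }
      apply injective_projections; simpl; [|ring].
      transitivity (sin (psi w) * (sin (psi w / 2) / cos (psi w / 2))); [field; split; lra|].
      rewrite E1. rewrite E2. field. lra.
  (* Raising l multiplies the amplitude by exp (2 i psi), and exp (2 i psi) - 1 = 2 i sin psi exp (i
     psi) supplies the correction. *)
  - exists (fun w => Cplus (Cmult (cexp (0, 2 * psi w)) (beta w)) (Cmult (0, 2) (cexp (0, psi w)))),
      (fun w => Cplus (Cplus (Cmult (Cmult (0, 1) (cexp (0, 2 * psi w))) (beta w)) (Cmult (cexp (0, 2 * psi w)) (dbeta w)))
        (Cmult (0, 2) (Cmult (0, / 2) (cexp (0, psi w))))), (2 * K + 2).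
    split; [lra|]. intros w Hw. destruct (IH w Hw) as [D [B1 [B2 E]]].
    assert (M1 : forall x, Cmod (cexp (0, x)) = 1) by (intros x; rewrite Cmod_cexp; unfold Re; simpl; apply exp_0).
    assert (M2 : forall x, 0 <= x -> Cmod ((0, x) : C) = x).
    { intros x Hx. unfold Cmod; simpl. replace (0 * (0 * 1) + x * (x * 1)) with (x * x) by ring. apply sqrt_square, Hx. }
    assert (DE : forall c, is_cderive (fun w => cexp (0, c * psi w)) w (Cmult (0, c * / 2) (cexp (0, c * psi w)))).
    { intros c. apply (is_cderive_cexp (fun w => (0, c * psi w))). split; [exact (is_derive_Rconst 0 w)|].
      eapply is_derive_eq; [exact (is_derive_Rmult (fun _ => c) psi w _ _ (is_derive_Rconst c w) (psi_derive w))|].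
      simpl. ring. }
    assert (DE1 : is_cderive (fun w => cexp (0, psi w)) w (Cmult (0, / 2) (cexp (0, psi w)))).
    { apply (is_cderive_cexp (fun w => (0, psi w))). split; [exact (is_derive_Rconst 0 w)|exact (psi_derive w)]. }
    assert (DE2 := DE 2).
    split; [|split; [|split]].
    + eapply is_cderive_eq; [exact (is_cderive_plus _ _ w _ _ (is_cderive_mult _ _ w _ _ DE2 D)
        (is_cderive_mult _ _ w _ _ (is_cderive_const (0, 2) w) DE1))|].
      cbv beta. replace (2 * / 2) with 1 by field. ring.
    + eapply Rle_trans; [apply Cmod_triangle|]. rewrite !Cmod_mult, !M1, M2 by lra. lra.
    + eapply Rle_trans; [apply Cmod_triangle|].
      eapply Rle_trans; [apply Rplus_le_compat_r, Cmod_triangle|].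
      rewrite !Cmod_mult, !M1, !M2 by lra. lra.
    + rewrite S_INR. replace (2 * (INR l + 1) * psi w) with (2 * psi w + 2 * INR l * psi w) by ring.
      replace ((0, 2 * psi w + 2 * INR l * psi w) : C) with (Cplus (0, 2 * psi w) (0, 2 * INR l * psi w))
        by (apply injective_projections; simpl; ring).
      rewrite cexp_plus.
      transitivity (Cplus (Cmult (cexp (0, 2 * psi w)) (Cmult (RtoC (sin (psi w) * cos (psi w))) (beta w)))
        (Cmult (RtoC (cos (psi w))) (Cmult (Cmult (0, 2) (RtoC (sin (psi w)))) (cexp (0, psi w))))).
      { rewrite RtoC_mult. ring. }
      rewrite E.
      assert (E2 : Cmult (Cmult (0, 2) (RtoC (sin (psi w)))) (cexp (0, psi w)) = Cminus (cexp (0, 2 * psi w)) (RtoC 1)).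
      { rewrite !cexp_im, sin_2a, cos_2a_sin. apply injective_projections; simpl; ring. }
      rewrite E2. ring.
Qed.

(** The angle is reversed, t = pi - w, so that the path starts at -1, where the first column is
    known, and ends at 1. *)
Definition circ_phase (l : nat) (mu w : R) : C :=
  cexp (0, - (INR l * (PI - w) + 2 * mu * sin (PI - w))).

Definition fresnelC (y : R) : C := (fresnel_int cos y, fresnel_int sin y).

(** Upper limit of the Fresnel integral: the value of 2 sqrt mu sin (psi w) at the endpoint w =
    pi. *)
Definition stat_point (mu : R) : R := 2 * sqrt mu * sin (PI / 4).

(* Value of the phase factor at its stationary point z = i of the unit circle. *)
Definition stat_phase (l : nat) (mu : R) : C := cexp (0, - (INR l * (PI / 2) + 2 * mu)).

Lemma fresnelC_derive (y : R) : is_cderive fresnelC y (cexp (0, y * y)).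
Proof.
  rewrite cexp_im. split.
  - apply fresnel_int_derive. intros; apply continuous_cos.
  - apply fresnel_int_derive. intros; apply continuous_sin.
Qed.

Lemma fresnelC_bound (y : R) : Cmod (fresnelC y) <= 6.
Proof.
  assert (Bc : forall t, Rabs (cos t) <= 1) by (intros; apply Rabs_le; assert (H := COS_bound t); lra).
  assert (Bs : forall t, Rabs (sin t) <= 1) by (intros; apply Rabs_le; assert (H := SIN_bound t); lra).
  eapply Rle_trans; [apply Cmod_le_sum|]. unfold Re, Im, fresnelC; simpl.
  assert (A1 : Rabs (fresnel_int sin y) <= 3).
  { apply (fresnel_int_bound sin cos); trivial; intros; [apply is_derive_sin|apply is_derive_cos]. }
  assert (A2 : Rabs (fresnel_int cos y) <= 3).
  { apply (fresnel_int_bound cos (fun t => - sin t)); trivial; intros.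
    - apply is_derive_cos.
    - apply is_derive_Ropp, is_derive_sin.
    - rewrite Rabs_Ropp. apply Bs. }
  lra.
Qed.

Lemma fresnelC_odd (y : R) : fresnelC (- y) = Copp (fresnelC y).
Proof.
  unfold fresnelC. rewrite !fresnel_int_odd; [reflexivity| |]; intros; [apply continuous_sin|apply continuous_cos].
Qed.

Lemma Cmod_cexp_im (x : R) : Cmod (cexp (0, x)) = 1.
Proof. rewrite Cmod_cexp. unfold Re; simpl. apply exp_0. Qed.

(** Since 1 - sin w = 2 sin^2 psi, the oscillating part of the phase is exactly quadratic in sin
    psi. The substitution y = 2 sqrt mu sin psi leads to Fresnel integrals with no remainder in the
    phase. *)
Lemma circ_phase_factor (l : nat) (mu w : R) : circ_phase l mu w =
  Cmult (stat_phase l mu) (Cmult (cexp (0, 2 * INR l * psi w)) (cexp (0, 4 * mu * (sin (psi w) * sin (psi w))))).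
Proof.
  unfold circ_phase, stat_phase. rewrite <- !cexp_plus. f_equal. apply injective_projections; simpl; [ring|].
  assert (E : 2 * (sin (psi w) * sin (psi w)) = 1 - sin w).
  { assert (E1 := cos_2a_sin (psi w)). replace (2 * psi w) with (- (PI / 2 - w)) in E1 by (unfold psi; field).
    rewrite cos_neg, cos_shift in E1. lra. }
  replace (4 * mu * (sin (psi w) * sin (psi w))) with (2 * mu * (2 * (sin (psi w) * sin (psi w)))) by ring.
  rewrite E, sin_PI_x. unfold psi. field.
Qed.

(** The cosine part of the amplitude integrates exactly to a Fresnel integral of size 1/sqrt mu. The
    other part is a derivative of the oscillating exponential divided by mu, up to the error [Rm].
    The two endpoints contribute opposite Fresnel values, whence the factor 2. *)
Lemma approx_primitive (l : nat) : exists K, 0 < K /\ forall mu, 1 <= mu ->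
  exists G Rm : R -> C,
    (forall w, 0 <= w <= PI -> is_cderive G w (Cplus (circ_phase l mu w) (Rm w)) /\
       Cmod (Rm w) <= K / mu /\ Cmod (G w) <= K / sqrt mu) /\
    Cmod (Cplus (Cminus (G 0) (G PI))
      (Cmult (RtoC (2 / sqrt mu)) (Cmult (stat_phase l mu) (fresnelC (stat_point mu))))) <= K / mu.
Proof.
  destruct (amplitude_split l) as [beta [dbeta [K [HK Hb]]]].
  exists (6 + K). split; [lra|]. intros mu Hmu.
  assert (Hpi := PI_RGT_0).
  assert (Hsq : 1 <= sqrt mu) by (rewrite <- sqrt_1; apply sqrt_le_1_alt, Hmu).
  assert (Hss : sqrt mu * sqrt mu = mu) by (apply sqrt_sqrt; lra).
  set (a := stat_phase l mu).
  set (E := fun w => cexp (0, 4 * mu * (sin (psi w) * sin (psi w)))).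
  set (Ph := fun w => fresnelC (2 * sqrt mu * sin (psi w))).
  (* This is 1/(4 i mu), the inverse of the factor 4 i mu produced by differentiating [E]. *)
  set (ci := (0, - / (4 * mu)) : C).
  set (G := fun w => Cmult a (Cplus (Cmult (RtoC (/ sqrt mu)) (Ph w)) (Cmult ci (Cmult (beta w) (E w))))).
  set (Rm := fun w => Cmult a (Cmult ci (Cmult (dbeta w) (E w)))).
  assert (Ma : Cmod a = 1) by apply Cmod_cexp_im.
  assert (ME : forall w, Cmod (E w) = 1) by (intros; apply Cmod_cexp_im).
  assert (Mc : Cmod ci = / (4 * mu)).
  { unfold ci, Cmod; simpl. replace (0 * (0 * 1) + - / (4 * mu) * (- / (4 * mu) * 1)) with (/ (4 * mu) * / (4 * mu)) by ring.
    apply sqrt_square. left; apply Rinv_0_lt_compat; lra. }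
  assert (Ds : forall w, is_derive (fun w => sin (psi w)) w (cos (psi w) * / 2)).
  { intros w. exact (is_derive_Rcomp sin psi w _ _ (is_derive_sin (psi w)) (psi_derive w)). }
  assert (DPh : forall w, is_cderive Ph w (Cmult (RtoC (sqrt mu * cos (psi w))) (E w))).
  { intros w. assert (Dl : is_derive (fun w => 2 * sqrt mu * sin (psi w)) w (sqrt mu * cos (psi w))).
    { eapply is_derive_eq; [exact (is_derive_Rmult (fun _ => 2 * sqrt mu) _ w _ _ (is_derive_Rconst _ w) (Ds w))|]. cbv beta. field. }
    eapply is_cderive_eq; [exact (is_cderive_comp fresnelC _ w _ _ (fresnelC_derive _) Dl)|].
    unfold E. do 3 f_equal. replace (4 * mu) with (4 * (sqrt mu * sqrt mu)) by (rewrite Hss; ring). ring. }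
  assert (DE : forall w, is_cderive E w (Cmult (0, 4 * mu * (sin (psi w) * cos (psi w))) (E w))).
  { intros w. apply (is_cderive_cexp (fun w => (0, 4 * mu * (sin (psi w) * sin (psi w))))).
    split; [exact (is_derive_Rconst 0 w)|].
    eapply is_derive_eq; [exact (is_derive_Rmult (fun _ => 4 * mu) _ w _ _ (is_derive_Rconst _ w)
      (is_derive_Rmult _ _ w _ _ (Ds w) (Ds w)))|]. simpl. field. }
  assert (Hinv : / (4 * mu) <= / mu) by (apply Rinv_le_contravar; lra).
  assert (Hinv0 : 0 < / (4 * mu)) by (apply Rinv_0_lt_compat; lra).
  assert (Hmu0 : 0 < / mu) by (apply Rinv_0_lt_compat; lra).
  assert (Hsm : / mu <= / sqrt mu) by (apply Rinv_le_contravar; nra).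
  assert (MB : forall w, 0 <= w <= PI -> Cmod (Cmult ci (Cmult (beta w) (E w))) <= / (4 * mu) * K).
  { intros w Hw. destruct (Hb w Hw) as [_ [B1 _]]. rewrite !Cmod_mult, Mc, ME, Rmult_1_r.
    apply Rmult_le_compat_l; lra. }
  exists G, Rm. split.
  - intros w Hw. destruct (Hb w Hw) as [Db [B1 [B2 Eb]]]. split; [|split].
    + eapply is_cderive_eq; [exact (is_cderive_mult _ _ w _ _ (is_cderive_const a w)
        (is_cderive_plus _ _ w _ _ (is_cderive_mult _ _ w _ _ (is_cderive_const (RtoC (/ sqrt mu)) w) (DPh w))
          (is_cderive_mult _ _ w _ _ (is_cderive_const ci w) (is_cderive_mult _ _ w _ _ Db (DE w)))))|].
      cbv beta. rewrite circ_phase_factor. fold a. fold (E w). unfold Rm.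
      assert (E1 : Cmult (RtoC (/ sqrt mu)) (RtoC (sqrt mu * cos (psi w))) = RtoC (cos (psi w))).
      { rewrite <- RtoC_mult. f_equal. field. lra. }
      assert (E2 : Cmult ci (0, 4 * mu * (sin (psi w) * cos (psi w))) = RtoC (sin (psi w) * cos (psi w))).
      { unfold ci. apply injective_projections; simpl; field; lra. }
      transitivity (Cmult a (Cplus (Cmult (Cmult (RtoC (/ sqrt mu)) (RtoC (sqrt mu * cos (psi w)))) (E w))
        (Cplus (Cmult (Cmult (Cmult ci (0, 4 * mu * (sin (psi w) * cos (psi w)))) (beta w)) (E w))
          (Cmult ci (Cmult (dbeta w) (E w)))))); [ring|].
      rewrite E1, E2, Eb. ring.
    + unfold Rm. rewrite !Cmod_mult, Ma, Mc, ME, Rmult_1_l, Rmult_1_r.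
      unfold Rdiv. rewrite Rmult_comm. apply Rmult_le_compat; try lra. apply Cmod_ge_0.
    + unfold G. rewrite Cmod_mult, Ma, Rmult_1_l.
      eapply Rle_trans; [apply Cmod_triangle|].
      assert (A := MB w Hw). rewrite Cmod_mult, Cmod_R, Rabs_pos_eq by (left; apply Rinv_0_lt_compat; lra).
      assert (A2 := fresnelC_bound (2 * sqrt mu * sin (psi w))). fold (Ph w) in A2.
      assert (Hs0 : 0 < / sqrt mu) by (apply Rinv_0_lt_compat; lra).
      unfold Rdiv. nra.
  - assert (P0 : psi 0 = - (PI / 4)) by (unfold psi; field).
    assert (P1 : psi PI = PI / 4) by (unfold psi; field).
    assert (F0 : Ph 0 = Copp (fresnelC (stat_point mu))).
    { unfold Ph. rewrite P0, sin_neg. unfold stat_point. rewrite <- fresnelC_odd. f_equal. ring. }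
    assert (F1 : Ph PI = fresnelC (stat_point mu)) by (unfold Ph; rewrite P1; reflexivity).
    replace (Cplus (Cminus (G 0) (G PI)) (Cmult (RtoC (2 / sqrt mu)) (Cmult a (fresnelC (stat_point mu)))))
      with (Cmult a (Cminus (Cmult ci (Cmult (beta 0) (E 0))) (Cmult ci (Cmult (beta PI) (E PI))))).
    + rewrite Cmod_mult, Ma, Rmult_1_l. unfold Cminus. eapply Rle_trans; [apply Cmod_triangle|].
      rewrite Cmod_opp. assert (A1 := MB 0 ltac:(lra)). assert (A2 := MB PI ltac:(lra)).
      assert (E4 : / (4 * mu) = / 4 * / mu) by (field; lra). rewrite E4 in A1, A2.
      unfold Rdiv. nra.
    + unfold G. rewrite F0, F1. replace (RtoC (2 / sqrt mu)) with (Cplus (RtoC (/ sqrt mu)) (RtoC (/ sqrt mu)))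
        by (rewrite <- RtoC_plus; f_equal; field; lra). ring.
Qed.

(** * The first column along the half circle for large mu *)

Lemma Cmod_sq_normsq (z : C) : normsq z = Cmod z * Cmod z.
Proof. symmetry. apply Cmod_sqr. Qed.

Lemma circle_reversed (omega : R) (l : nat) (mu : R) (H : C -> mat2) (w : R) :
  0 < omega -> gauge_solution omega l mu H -> 0 <= w <= PI ->
  let g w := m11 (H (circ (PI - w))) in
  let V w := Cmult (circ_phase l mu w) (m21 (H (circ (PI - w)))) in
  is_cderive g w (Copp (Cmult (RtoC (kap omega)) (m21 (H (circ (PI - w)))))) /\
  is_cderive V w (Copp (Cmult (RtoC (kap omega)) (Cmult (circ_phase l mu w) (g w)))).
Proof.
  intros Hom HG Hw g V.
  assert (Ht : 0 <= PI - w <= PI) by lra.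
  destruct (gauge_on_circle omega l mu H (PI - w) Hom HG Ht) as [D1 D3].
  assert (Dw : is_derive (fun w => PI - w) w (-1)) by (auto_derive; [trivial|ring]).
  assert (Dg := is_cderive_comp (fun t => m11 (H (circ t))) (fun w => PI - w) w (-1) _ D1 Dw).
  assert (Dk := is_cderive_comp (fun t => m21 (H (circ t))) (fun w => PI - w) w (-1) _ D3 Dw).
  assert (Df : is_cderive (circ_phase l mu) w (Cmult (0, INR l + 2 * mu * cos (PI - w)) (circ_phase l mu w))).
  { apply (is_cderive_cexp (fun w => (0, - (INR l * (PI - w) + 2 * mu * sin (PI - w))))).
    split; [exact (is_derive_Rconst 0 w)|]. simpl.
    eapply is_derive_eq; [exact (is_derive_Ropp _ w _ (is_derive_Rplus _ _ w _ _
      (is_derive_Rmult (fun _ => INR l) _ w _ _ (is_derive_Rconst _ w) Dw)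
      (is_derive_Rmult (fun _ => 2 * mu) _ w _ _ (is_derive_Rconst _ w)
        (is_derive_Rcomp sin (fun w => PI - w) w _ _ (is_derive_sin _) Dw))))|]. cbv beta. ring. }
  split.
  - eapply is_cderive_eq; [exact Dg|]. apply injective_projections; simpl; ring.
  - eapply is_cderive_eq; [exact (is_cderive_mult _ _ w _ _ Df Dk)|].
    cbv beta. unfold g.
    replace ((0, - (INR l + 2 * mu * cos (PI - w))) : C) with (Copp ((0, INR l + 2 * mu * cos (PI - w)) : C))
      by (apply injective_projections; simpl; ring).
    replace (RtoC (-1)) with (Copp (RtoC 1)) by (apply injective_projections; simpl; ring). ring.
Qed.

Lemma Cmod_le_1_sq (z : C) : Cmod z <= 1 + normsq z.
Proof.
  rewrite Cmod_sq_normsq. assert (A := Rle_0_sqr (Cmod z - 1)). unfold Rsqr in A.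
  assert (P := Cmod_ge_0 z). nra.
Qed.

Lemma normsq_half_ip (a b : C) (k : R) : 0 <= k ->
  2 * (Re a * Re (Copp (Cmult (RtoC k) b)) + Im a * Im (Copp (Cmult (RtoC k) b))) <= k * (normsq a + normsq b).
Proof.
  intros Hk. unfold normsq, Re, Im; simpl.
  assert (A := Rle_0_sqr (fst a + fst b)). assert (B := Rle_0_sqr (snd a + snd b)). unfold Rsqr in *.
  assert (C1 : 0 <= k * ((fst a + fst b) * (fst a + fst b) + (snd a + snd b) * (snd a + snd b))) by (apply Rmult_le_pos; lra).
  lra.
Qed.

(** The fast phase is unimodular, so the growth of the energy is governed by [kap] alone. The bound
    depends on mu only through the values at -1. *)
Lemma circle_bound (omega : R) (l : nat) (mu : R) (H : C -> mat2) :
  0 < omega -> gauge_solution omega l mu H ->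
  let S0 := normsq (m11 (H (circ PI))) + normsq (m21 (H (circ PI))) in
  forall w, 0 <= w <= PI ->
    Cmod (m11 (H (circ (PI - w)))) <= 1 + S0 * exp (2 * kap omega * PI) /\
    Cmod (m21 (H (circ (PI - w)))) <= 1 + S0 * exp (2 * kap omega * PI).
Proof.
  intros Hom HG S0 w Hw. assert (Hk := kap_pos omega Hom). set (k := kap omega) in *.
  set (g := fun w => m11 (H (circ (PI - w)))).
  set (V := fun w => Cmult (circ_phase l mu w) (m21 (H (circ (PI - w))))).
  assert (Nf : forall w, normsq (circ_phase l mu w) = 1) by (intros; apply normsq_cexp_im).
  assert (NV : forall w, normsq (V w) = normsq (m21 (H (circ (PI - w))))).
  { intros t. unfold V. rewrite normsq_mult, Nf. ring. }
  assert (HS := gronwall_decay (fun t => normsq (g t) + normsq (V t))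
    (fun t => 2 * (Re (g t) * Re (Copp (Cmult (RtoC k) (m21 (H (circ (PI - t)))))) + Im (g t) * Im (Copp (Cmult (RtoC k) (m21 (H (circ (PI - t)))))))
      + 2 * (Re (V t) * Re (Copp (Cmult (RtoC k) (Cmult (circ_phase l mu t) (g t)))) + Im (V t) * Im (Copp (Cmult (RtoC k) (Cmult (circ_phase l mu t) (g t))))))
    (2 * k) 0 w (proj1 Hw)).
  assert (HS' : normsq (g w) + normsq (V w) <= S0 * exp (2 * k * PI)).
  { eapply Rle_trans; [apply HS|].
    - intros t Ht. destruct (circle_reversed omega l mu H t Hom HG ltac:(lra)) as [[A1 A2] [A3 A4]].
      fold g V k in A1, A2, A3, A4. unfold normsq.
      eapply is_derive_eq; [exact (is_derive_Rplus _ _ t _ _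
        (is_derive_Rplus _ _ t _ _ (is_derive_Rmult _ _ t _ _ A1 A1) (is_derive_Rmult _ _ t _ _ A2 A2))
        (is_derive_Rplus _ _ t _ _ (is_derive_Rmult _ _ t _ _ A3 A3) (is_derive_Rmult _ _ t _ _ A4 A4)))|]. unfold g, V. cbv beta. ring.
    - intros t Ht. assert (B1 := normsq_half_ip (g t) (m21 (H (circ (PI - t)))) k ltac:(lra)).
      assert (B2 := normsq_half_ip (V t) (Cmult (circ_phase l mu t) (g t)) k ltac:(lra)).
      rewrite <- NV in B1. rewrite normsq_mult, Nf in B2. lra.
    - rewrite NV. unfold g. rewrite !Rminus_0_r. fold S0.
      apply Rmult_le_compat_l; [unfold S0; assert (P1 := normsq_pos (m11 (H (circ PI)))); assert (P2 := normsq_pos (m21 (H (circ PI)))); lra|].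
      assert (Hle : 2 * k * w <= 2 * k * PI) by nra.
      destruct Hle as [Hle|Hle]; [left; apply exp_increasing, Hle|rewrite Hle; lra]. }
  rewrite NV in HS'. unfold g in HS'.
  assert (P1 := normsq_pos (m11 (H (circ (PI - w))))). assert (P2 := normsq_pos (m21 (H (circ (PI - w))))).
  split; (eapply Rle_trans; [apply Cmod_le_1_sq|]); lra.
Qed.

(** Two passes: a uniform bound on the column first shows that [m21] is of order 1/sqrt mu, and this
    information, put back into the same identity, leaves an error of order 1/mu. *)
Lemma circle_asymptotics (omega : R) (l : nat) : 0 < omega -> exists K mu1, 0 < K /\ 1 <= mu1 /\
  forall mu H, mu1 <= mu -> gauge_solution omega l mu H ->
  let h := H (RtoC 1) in
  Cmod (Cminus (m11 h) (RtoC 1)) <= K / sqrt mu /\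
  Cmod (Cplus (m21 h) (Cmult (RtoC (2 * kap omega / sqrt mu))
    (Cmult (stat_phase l mu) (fresnelC (stat_point mu))))) <= K / mu.
Proof.
  intros Hom. assert (Hk := kap_pos omega Hom). set (k := kap omega) in *.
  assert (Hpi := PI_RGT_0).
  destruct (approx_primitive l) as [K [HK Hap]].
  set (Kb := 1 + 5 * exp (2 * k * PI)).
  assert (HKb : 1 < Kb) by (unfold Kb; assert (P := exp_pos (2 * k * PI)); lra).
  set (C1 := 2 * PI * ((k + k * k) * K * Kb) + 2 * k + 2 * (k * K * Kb)).
  set (C2 := k * K * Kb + k * k * K * C1).
  set (C3 := 2 * PI * (k * C1) + 2 * k * k).
  assert (Hkk : 0 < k * k) by nra.
  assert (HKK : 0 < K * Kb) by nra.
  assert (HkKK : 0 < k * K * Kb) by (rewrite Rmult_assoc; nra).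
  assert (HkkKK : 0 < (k + k * k) * K * Kb) by (rewrite Rmult_assoc; apply Rmult_lt_0_compat; lra).
  assert (HC1 : 0 < C1) by (unfold C1; nra).
  assert (HkC1 : 0 < k * C1) by nra.
  assert (HC2 : 0 < C2) by (unfold C2; assert (0 < k * k * K) by nra; nra).
  assert (HC3 : 0 < C3) by (unfold C3; nra).
  assert (HkK : 0 < k * K) by nra.
  assert (HkKC3 : 0 < k * K * C3) by nra.
  (* The threshold guarantees 2 l <= mu and makes the deviations 2 k / mu and 2 k^2 / mu at -1 at
     most 1. *)
  exists (C3 + 2 * PI * C2 + 2 * k + 2 * (k * K * C3) + k * K), (1 + 2 * INR l + 2 * k + 2 * k * k).
  assert (Hl := pos_INR l).
  split; [nra|]. split; [nra|].
  intros mu H Hmu HG h.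
  assert (Hmu1 : 1 <= mu) by nra.
  assert (Hsq1 : 1 <= sqrt mu) by (rewrite <- sqrt_1; apply sqrt_le_1_alt, Hmu1).
  assert (Hss : sqrt mu * sqrt mu = mu) by (apply sqrt_sqrt; lra).
  set (r := / sqrt mu).
  assert (Hr : 0 < r) by (apply Rinv_0_lt_compat; lra).
  assert (Hr1 : r <= 1) by (unfold r; rewrite <- Rinv_1; apply Rinv_le_contravar; lra).
  assert (Hrr : / mu = r * r) by (unfold r; rewrite <- Rinv_mult, Hss; reflexivity).
  destruct (neg_axis_estimate omega l mu H Hom ltac:(lra) ltac:(nra) HG) as [N1 N2].
  fold k in N1, N2.
  assert (HcPI : circ PI = RtoC (-1 * 1)).
  { unfold circ. rewrite cos_PI, sin_PI. apply injective_projections; simpl; ring. }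
  rewrite <- HcPI in N1, N2.
  unfold Rdiv in N1, N2. rewrite Hrr in N1, N2.
  assert (Hsmall : 2 * k * (r * r) <= 1 /\ 2 * k * k * (r * r) <= 1).
  { rewrite <- Hrr. split; apply (Rmult_le_reg_r mu); try lra; rewrite Rmult_assoc, Rinv_l by lra; nra. }
  set (g := fun w => m11 (H (circ (PI - w)))).
  set (kk := fun w => m21 (H (circ (PI - w)))).
  set (V := fun w => Cmult (circ_phase l mu w) (kk w)).
  assert (Mf : forall w, Cmod (circ_phase l mu w) = 1) by (intros; apply Cmod_cexp_im).
  assert (MV : forall w, Cmod (V w) = Cmod (kk w)) by (intros; unfold V; rewrite Cmod_mult, Mf; ring).
  assert (g0 : g 0 = m11 (H (circ PI))) by (unfold g; rewrite Rminus_0_r; reflexivity).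
  assert (k0 : kk 0 = m21 (H (circ PI))) by (unfold kk; rewrite Rminus_0_r; reflexivity).
  assert (Bg0 : Cmod (g 0) <= 2).
  { rewrite g0. replace (m11 (H (circ PI))) with (Cplus (RtoC 1) (Cminus (m11 (H (circ PI))) (RtoC 1))) by ring.
    eapply Rle_trans; [apply Cmod_triangle|]. rewrite Cmod_1. lra. }
  assert (HB : forall w, 0 <= w <= PI -> Cmod (g w) <= Kb /\ Cmod (kk w) <= Kb).
  { intros w Hw. destruct (circle_bound omega l mu H Hom HG w Hw) as [B1 B2]. fold k in B1, B2.
    assert (S5 : normsq (m11 (H (circ PI))) + normsq (m21 (H (circ PI))) <= 5).
    { rewrite !Cmod_sq_normsq. rewrite <- g0. assert (P1 := Cmod_ge_0 (g 0)). assert (P2 := Cmod_ge_0 (m21 (H (circ PI)))). nra. }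
    assert (P := exp_pos (2 * k * PI)). unfold Kb. split; (eapply Rle_trans; [eassumption|]); nra. }
  destruct (Hap mu Hmu1) as [G [Rm [HG1 HG2]]].
  unfold Rdiv in HG1, HG2. fold r in HG1, HG2. rewrite Hrr in HG2.
  assert (HGb : forall w, 0 <= w <= PI -> Cmod (Rm w) <= K * (r * r) /\ Cmod (G w) <= K * r).
  { intros w Hw. destruct (HG1 w Hw) as [_ [B1 B2]]. rewrite Hrr in B1. split; assumption. }
  (* Integration by parts in differential form: adding k G g replaces the oscillating derivative of
     [V], of order 1, by terms containing [Rm] or [G]. *)
  set (Z := fun w => Cplus (V w) (Cmult (RtoC k) (Cmult (G w) (g w)))).
  assert (DZ : forall w, 0 <= w <= PI -> is_cderive Z w
    (Cminus (Cmult (RtoC k) (Cmult (Rm w) (g w))) (Cmult (RtoC (k * k)) (Cmult (G w) (kk w))))).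
  { intros w Hw. destruct (circle_reversed omega l mu H w Hom HG Hw) as [Dg DV].
    destruct (HG1 w Hw) as [DG _]. fold k in Dg, DV.
    eapply is_cderive_eq; [exact (is_cderive_plus _ _ w _ _ DV (is_cderive_mult _ _ w _ _ (is_cderive_const (RtoC k) w)
      (is_cderive_mult _ _ w _ _ DG Dg)))|].
    cbv beta. unfold g, kk. rewrite RtoC_mult. ring. }
  assert (Hrr1 : r * r <= r) by nra.
  assert (BZ1 : forall w, 0 <= w <= PI -> Cmod (Cminus (Z w) (Z 0)) <= 2 * ((k + k * k) * K * Kb * r) * (w - 0)).
  { intros w Hw. apply (cderive_bound Z _ _ 0 w ltac:(lra) (fun t Ht => DZ t ltac:(lra))).
    intros t Ht. destruct (HGb t ltac:(lra)) as [B1 B2]. destruct (HB t ltac:(lra)) as [B3 B4].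
    unfold Cminus. eapply Rle_trans; [apply Cmod_triangle|]. rewrite Cmod_opp, !Cmod_mult, !Cmod_R.
    rewrite (Rabs_pos_eq k), (Rabs_pos_eq (k * k)) by lra.
    assert (E1 : Cmod (Rm t) * Cmod (g t) <= K * r * Kb).
    { apply Rmult_le_compat; try apply Cmod_ge_0; nra. }
    assert (E2 : Cmod (G t) * Cmod (kk t) <= K * r * Kb).
    { apply Rmult_le_compat; try apply Cmod_ge_0; lra. }
    apply Rle_trans with (k * (K * r * Kb) + k * k * (K * r * Kb)); [|right; ring].
    apply Rplus_le_compat; apply Rmult_le_compat_l; lra. }
  assert (BV0 : Cmod (V 0) <= 2 * k * (r * r)) by (rewrite MV, k0; exact N2).
  assert (BV : forall w, 0 <= w <= PI -> Cmod (V w) <= C1 * r).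
  { intros w Hw. specialize (BZ1 w Hw). destruct (HGb w Hw) as [_ B2]. destruct (HB w Hw) as [B3 _].
    destruct (HGb 0 ltac:(lra)) as [_ B2']. destruct (HB 0 ltac:(lra)) as [B3' _].
    replace (V w) with (Cplus (Cplus (Cminus (Z w) (Z 0)) (V 0))
      (Cplus (Cmult (RtoC k) (Cmult (G 0) (g 0))) (Copp (Cmult (RtoC k) (Cmult (G w) (g w)))))) by (unfold Z; ring).
    eapply Rle_trans; [apply Cmod_triangle|].
    eapply Rle_trans; [apply Rplus_le_compat; apply Cmod_triangle|].
    rewrite Cmod_opp, !Cmod_mult, Cmod_R, (Rabs_pos_eq k) by lra.
    assert (E1 : Cmod (G w) * Cmod (g w) <= K * r * Kb) by (apply Rmult_le_compat; try apply Cmod_ge_0; lra).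
    assert (E2 : Cmod (G 0) * Cmod (g 0) <= K * r * Kb) by (apply Rmult_le_compat; try apply Cmod_ge_0; lra).
    assert (E3 : k * (Cmod (G w) * Cmod (g w)) <= k * (K * r * Kb)) by (apply Rmult_le_compat_l; lra).
    assert (E4 : k * (Cmod (G 0) * Cmod (g 0)) <= k * (K * r * Kb)) by (apply Rmult_le_compat_l; lra).
    assert (E5 : 2 * ((k + k * k) * K * Kb * r) * (w - 0) <= 2 * ((k + k * k) * K * Kb * r) * PI).
    { apply Rmult_le_compat_l; [|lra]. assert (0 < (k + k * k) * K * Kb * r) by (apply Rmult_lt_0_compat; lra). lra. }
    assert (E6 : 2 * k * (r * r) <= 2 * k * r) by nra.
    replace (C1 * r) with (2 * ((k + k * k) * K * Kb * r) * PI + 2 * k * r + (k * (K * r * Kb) + k * (K * r * Kb)))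
      by (unfold C1; ring). lra. }
  (* Second pass: [G] and [kk] are now both of order r, so their product gains a factor r over the
     first estimate. *)
  assert (BZ2 : Cmod (Cminus (Z PI) (Z 0)) <= 2 * (C2 * (r * r)) * (PI - 0)).
  { apply (cderive_bound Z _ _ 0 PI ltac:(lra) DZ).
    intros t Ht. destruct (HGb t Ht) as [B1 B2]. destruct (HB t Ht) as [B3 _]. specialize (BV t Ht). rewrite MV in BV.
    unfold Cminus. eapply Rle_trans; [apply Cmod_triangle|]. rewrite Cmod_opp, !Cmod_mult, !Cmod_R.
    rewrite (Rabs_pos_eq k), (Rabs_pos_eq (k * k)) by lra.
    assert (E1 : Cmod (Rm t) * Cmod (g t) <= K * (r * r) * Kb) by (apply Rmult_le_compat; try apply Cmod_ge_0; lra).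
    assert (E2 : Cmod (G t) * Cmod (kk t) <= K * r * (C1 * r)) by (apply Rmult_le_compat; try apply Cmod_ge_0; lra).
    apply Rle_trans with (k * (K * (r * r) * Kb) + k * k * (K * r * (C1 * r))); [|right; unfold C2; ring].
    apply Rplus_le_compat; apply Rmult_le_compat_l; lra. }
  assert (Bgw : forall w, 0 <= w <= PI -> Cmod (Cminus (g w) (RtoC 1)) <= C3 * r).
  { intros w Hw.
    assert (Bd : Cmod (Cminus (g w) (g 0)) <= 2 * (k * (C1 * r)) * (w - 0)).
    { apply (cderive_bound g (fun t => Copp (Cmult (RtoC k) (kk t))) _ 0 w ltac:(lra)).
      - intros t Ht. apply (circle_reversed omega l mu H t Hom HG ltac:(lra)).
      - intros t Ht. rewrite Cmod_opp, Cmod_mult, Cmod_R, Rabs_pos_eq by lra. rewrite <- MV.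
        apply Rmult_le_compat_l; [lra|]. apply BV. lra. }
    replace (Cminus (g w) (RtoC 1)) with (Cplus (Cminus (g w) (g 0)) (Cminus (g 0) (RtoC 1))) by ring.
    eapply Rle_trans; [apply Cmod_triangle|]. rewrite <- g0 in N1.
    assert (E5 : 2 * (k * (C1 * r)) * (w - 0) <= 2 * (k * (C1 * r)) * PI).
    { apply Rmult_le_compat_l; [|lra]. assert (0 < k * C1 * r) by (apply Rmult_lt_0_compat; lra). lra. }
    assert (E6 : 2 * k * k * (r * r) <= 2 * k * k * r) by nra.
    replace (C3 * r) with (2 * (k * (C1 * r)) * PI + 2 * k * k * r) by (unfold C3; ring). lra. }
  assert (Hc1 : circ (PI - PI) = RtoC 1).
  { rewrite Rminus_diag. unfold circ. rewrite cos_0, sin_0. reflexivity. }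
  assert (gPI : g PI = m11 h) by (unfold g, h; rewrite Hc1; reflexivity).
  assert (VPI : V PI = m21 h).
  { unfold V, kk, circ_phase. rewrite Hc1. fold h. rewrite Rminus_diag, sin_0.
    replace (- (INR l * 0 + 2 * mu * 0)) with 0 by ring. change ((0, 0) : C) with (RtoC 0). rewrite cexp_0. ring. }
  set (T := C3 + 2 * PI * C2 + 2 * k + 2 * (k * K * C3) + k * K).
  assert (HT : 0 < 2 * PI * C2) by nra.
  split.
  - rewrite <- gPI. eapply Rle_trans; [apply Bgw; lra|]. unfold Rdiv. fold r.
    apply Rmult_le_compat_r; [lra|]. unfold T. lra.
  - set (S := Cmult (stat_phase l mu) (fresnelC (stat_point mu))) in *.
    replace (Cplus (m21 h) (Cmult (RtoC (2 * k / sqrt mu)) S)) with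
      (Cplus (Cplus (Cminus (Z PI) (Z 0)) (V 0))
        (Cplus (Cplus (Copp (Cmult (RtoC k) (Cmult (G PI) (Cminus (g PI) (RtoC 1)))))
          (Cmult (RtoC k) (Cmult (G 0) (Cminus (g 0) (RtoC 1)))))
          (Cmult (RtoC k) (Cplus (Cminus (G 0) (G PI)) (Cmult (RtoC (2 * r)) S))))).
    2: { rewrite <- VPI. unfold Z. replace (RtoC (2 * k / sqrt mu)) with (Cmult (RtoC k) (RtoC (2 * r))).
      - ring.
      - rewrite <- RtoC_mult. f_equal. unfold r. field. lra. }
    eapply Rle_trans; [apply Cmod_triangle|].
    eapply Rle_trans; [apply Rplus_le_compat; apply Cmod_triangle|].
    eapply Rle_trans; [apply Rplus_le_compat_l, Rplus_le_compat_r, Cmod_triangle|].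
    rewrite Cmod_opp, !Cmod_mult, !Cmod_R, (Rabs_pos_eq k) by lra.
    destruct (HGb 0 ltac:(lra)) as [_ B2]. destruct (HGb PI ltac:(lra)) as [_ B3].
    assert (B4 := Bgw 0 ltac:(lra)). assert (B5 := Bgw PI ltac:(lra)).
    assert (E1 : Cmod (G PI) * Cmod (Cminus (g PI) (RtoC 1)) <= K * r * (C3 * r)) by (apply Rmult_le_compat; try apply Cmod_ge_0; lra).
    assert (E2 : Cmod (G 0) * Cmod (Cminus (g 0) (RtoC 1)) <= K * r * (C3 * r)) by (apply Rmult_le_compat; try apply Cmod_ge_0; lra).
    assert (E3 : k * (Cmod (G PI) * Cmod (Cminus (g PI) (RtoC 1))) <= k * (K * r * (C3 * r))) by (apply Rmult_le_compat_l; lra).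
    assert (E4 : k * (Cmod (G 0) * Cmod (Cminus (g 0) (RtoC 1))) <= k * (K * r * (C3 * r))) by (apply Rmult_le_compat_l; lra).
    assert (E5 : k * Cmod (Cplus (Cminus (G 0) (G PI)) (Cmult (RtoC (2 * r)) S)) <= k * (K * (r * r))) by (apply Rmult_le_compat_l; lra).
    unfold Rdiv. rewrite Hrr.
    apply Rle_trans with (2 * (C2 * (r * r)) * (PI - 0) + 2 * k * (r * r) + (k * (K * r * (C3 * r)) + k * (K * r * (C3 * r)) + k * (K * (r * r)))).
    + lra.
    + replace (2 * (C2 * (r * r)) * (PI - 0) + 2 * k * (r * r) + (k * (K * r * (C3 * r)) + k * (K * r * (C3 * r)) + k * (K * (r * r))))
        with ((T - C3) * (r * r)) by (unfold T; ring).
      apply Rmult_le_compat_r; [nra|]. lra.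
Qed.

(** * Incompatibility with reality for large mu *)

Lemma Im_le_Cmod_sq (z : C) : Rabs (Im (Cmult z z)) <= Cmod z * Cmod z.
Proof. rewrite <- Cmod_mult. apply Im_le_Cmod. Qed.

(** Here u and v are the entries of the first column at 1, and m and n those of the second. The
    Wronskian relation makes the imaginary part of u of order r^3, and reality of the sum of squares
    transfers this order to Re v Im v, although v^2 is only bounded at order r^2. *)
Lemma defect_product (uR uI vR vI m n k D r : R) : 0 < k -> 0 < D -> 0 < r ->
  Rabs m <= k * (r * r) -> Rabs (n - 1) <= / 2 -> Rabs uR <= 2 -> Rabs vR <= D * r ->
  uI * n = vR * m -> uR * uI + vR * vI = 0 ->
  Rabs (vR * vI) <= 4 * D * k * (r * r * r).
Proof.
  intros Hk HD Hr Hm Hn Hu Hv E Z.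
  replace (vR * vI) with (- (uR * uI)) by lra. rewrite Rabs_Ropp, Rabs_mult.
  assert (Hn2 : / 2 <= n) by (apply Rabs_le_between in Hn; lra).
  assert (Eabs : Rabs uI * n = Rabs vR * Rabs m) by (rewrite <- !Rabs_mult, <- E, Rabs_mult, (Rabs_pos_eq n) by lra; reflexivity).
  assert (P1 := Rabs_pos uI).
  assert (B1 : Rabs vR * Rabs m <= (D * r) * (k * (r * r))) by (apply Rmult_le_compat; try apply Rabs_pos; assumption).
  assert (B2 : Rabs uI <= 2 * ((D * r) * (k * (r * r)))) by nra.
  replace (4 * D * k * (r * r * r)) with (2 * (2 * ((D * r) * (k * (r * r))))) by ring.
  apply Rmult_le_compat; try apply Rabs_pos; assumption.
Qed.

(** The squared main term of h21 is 4 k^2 r^2 p^2 with r = 1/sqrt mu. An imaginary part of order r^3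
    therefore becomes of order r after division by 4 k^2 r^2. *)
Lemma stationary_term_almost_real (omega : R) (l : nat) : 0 < omega -> exists K mu1, 0 < K /\ 1 <= mu1 /\
  forall mu H, mu1 <= mu -> gauge_solution omega l mu H ->
  let h := H (RtoC 1) in
  Im (Cplus (Cmult (m11 h) (m11 h)) (Cmult (m21 h) (m21 h))) = 0 ->
  let p := Cmult (stat_phase l mu) (fresnelC (stat_point mu)) in
  Rabs (Im (Cmult p p)) <= K / sqrt mu.
Proof.
  intros Hom. assert (Hk := kap_pos omega Hom).
  destruct (circle_asymptotics omega l Hom) as [K [mu0 [HK [Hmu0 HA]]]].
  set (k := kap omega) in *. set (D := 12 * k + K).
  assert (HD : 0 < D) by (unfold D; lra).
  assert (Hkk : 0 < k * k) by nra.
  assert (HDk : 0 < D * k) by nra. assert (HDK : 0 < D * K) by nra.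
  set (T := 8 * D * k + 2 * (D * K) + K * K).
  assert (HT : 0 < T) by (unfold T; nra).
  exists (T / (4 * (k * k))), (mu0 + 2 * (k * k) + K * K).
  split; [apply Rdiv_lt_0_compat; lra|]. split; [nra|].
  intros mu H Hmu HG h HZ p.
  destruct (HA mu H ltac:(nra) HG) as [A1 A2]. fold h p k in A1, A2.
  destruct (pos_axis_estimate omega l mu H Hom ltac:(nra) HG) as [B1 B2]. fold h k in B1, B2.
  assert (B3 := pos_axis_defect omega l mu H Hom ltac:(nra) HG). cbv zeta in B3. fold h in B3.
  assert (Hmu1 : 1 <= mu) by nra.
  assert (Hsq1 : 1 <= sqrt mu) by (rewrite <- sqrt_1; apply sqrt_le_1_alt, Hmu1).
  assert (Hss : sqrt mu * sqrt mu = mu) by (apply sqrt_sqrt; lra).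
  unfold Rdiv in A1, A2, B1, B2 |- *.
  set (r := / sqrt mu) in *.
  assert (Hr : 0 < r) by (apply Rinv_0_lt_compat; lra).
  assert (Hr1 : r <= 1) by (unfold r; rewrite <- Rinv_1; apply Rinv_le_contravar; lra).
  assert (Hrr : / mu = r * r) by (unfold r; rewrite <- Rinv_mult, Hss; reflexivity).
  rewrite Hrr in A2, B1, B2.
  assert (Hrr1 : r * r <= r) by nra.
  assert (Bn : k * k * (r * r) <= / 2).
  { rewrite <- Hrr. apply (Rmult_le_reg_r mu); [lra|]. rewrite Rmult_assoc, Rinv_l by lra. nra. }
  assert (BK : K * r <= 1).
  { assert (K <= sqrt mu).
    { apply Rsqr_incr_0_var; [unfold Rsqr; rewrite Hss; nra|lra]. }
    unfold r. apply (Rmult_le_reg_r (sqrt mu)); [lra|]. rewrite Rmult_assoc, Rinv_l by lra. lra. }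
  assert (Bp : Cmod p <= 6).
  { unfold p, stat_phase. rewrite Cmod_mult, Cmod_cexp_im, Rmult_1_l. apply fresnelC_bound. }
  set (e := Cplus (m21 h) (Cmult (RtoC (2 * k * r)) p)) in *.
  assert (Ev : m21 h = Cminus e (Cmult (RtoC (2 * k * r)) p)) by (unfold e; ring).
  assert (Bv : Cmod (m21 h) <= D * r).
  { rewrite Ev. unfold Cminus. eapply Rle_trans; [apply Cmod_triangle|].
    assert (Hkr : 0 < 2 * k * r) by nra.
    rewrite Cmod_opp, Cmod_mult, Cmod_R, Rabs_pos_eq by lra. unfold D. assert (P := Cmod_ge_0 p). nra. }
  assert (Bu : Rabs (Re (m11 h)) <= 2).
  { eapply Rle_trans; [apply Re_le_Cmod|].
    replace (m11 h) with (Cplus (RtoC 1) (Cminus (m11 h) (RtoC 1))) by ring.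
    eapply Rle_trans; [apply Cmod_triangle|]. rewrite Cmod_1. lra. }
  assert (Bvv : Rabs (Re (m21 h) * Im (m21 h)) <= 4 * D * k * (r * r * r)).
  { apply (defect_product (Re (m11 h)) (Im (m11 h)) _ _ (Im (m12 h)) (Re (m22 h))); trivial.
    - lra.
    - eapply Rle_trans; [apply Re_le_Cmod|exact Bv].
    - unfold Re, Im in *. simpl in HZ. lra. }
  (* This is the imaginary part of (h21 - e)^2, expanded with one factor [m21 h] kept in the cross
     term. *)
  assert (Epp : 4 * (k * k) * (r * r) * Im (Cmult p p) =
    2 * (Re (m21 h) * Im (m21 h)) - 2 * Im (Cmult (m21 h) e) + Im (Cmult e e)).
  { rewrite Ev. unfold Re, Im; simpl. ring. }
  assert (Bve : Rabs (Im (Cmult (m21 h) e)) <= D * r * (K * (r * r))).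
  { eapply Rle_trans; [apply Im_le_Cmod|]. rewrite Cmod_mult. apply Rmult_le_compat; try apply Cmod_ge_0; assumption. }
  assert (Bee : Rabs (Im (Cmult e e)) <= K * (r * r) * (K * (r * r))).
  { eapply Rle_trans; [apply Im_le_Cmod_sq|]. apply Rmult_le_compat; try apply Cmod_ge_0; assumption. }
  assert (Bee2 : K * (r * r) * (K * (r * r)) <= K * K * (r * r * r)).
  { replace (K * (r * r) * (K * (r * r))) with (K * K * (r * r * r) * r) by ring.
    assert (0 < r * r * r) by (repeat apply Rmult_lt_0_compat; lra).
    assert (0 < K * K * (r * r * r)) by (apply Rmult_lt_0_compat; nra). nra. }
  assert (Hrrp : 0 < r * r) by nra.
  assert (Hpos : 0 < 4 * (k * k) * (r * r)) by nra.
  apply (Rmult_le_reg_l (4 * (k * k) * (r * r))); [exact Hpos|].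
  replace (4 * (k * k) * (r * r) * (T * / (4 * (k * k)) * r)) with (T * (r * r * r)) by (field; lra).
  rewrite <- (Rabs_pos_eq (4 * (k * k) * (r * r))) at 1 by lra.
  rewrite <- Rabs_mult, Epp. unfold T.
  apply Rabs_le_between in Bvv. apply Rabs_le_between in Bve. apply Rabs_le_between in Bee. apply Rabs_le. lra.
Qed.

Lemma sin_PI4_half : / 2 <= sin (PI / 4) <= 1.
Proof.
  assert (Hp := PI_RGT_0). rewrite <- cos_shift. replace (PI / 2 - PI / 4) with (PI / 4) by field.
  split; [apply cos_half_bound; lra|apply COS_bound].
Qed.

Lemma stat_point_shift (mu d : R) : 1 <= mu -> 0 <= d -> 0 <= stat_point (mu + d) - stat_point mu <= 2 * d / sqrt mu.
Proof.
  intros Hmu Hd. unfold stat_point. destruct sin_PI4_half as [S1 S2].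
  assert (Hsq1 : 1 <= sqrt mu) by (rewrite <- sqrt_1; apply sqrt_le_1_alt, Hmu).
  assert (Hss : sqrt mu * sqrt mu = mu) by (apply sqrt_sqrt; lra).
  assert (Hss' : sqrt (mu + d) * sqrt (mu + d) = mu + d) by (apply sqrt_sqrt; lra).
  assert (Hle : sqrt mu <= sqrt (mu + d)) by (apply sqrt_le_1_alt; lra).
  set (x := sqrt mu) in *. set (y := sqrt (mu + d)) in *.
  assert (Hxy : y - x <= d / x).
  { apply (Rmult_le_reg_r x); [lra|]. unfold Rdiv. rewrite Rmult_assoc, Rinv_l by lra. nra. }
  split; [nra|].
  replace (2 * d / x) with (2 * (d / x)) by (unfold Rdiv; ring). nra.
Qed.

Lemma stat_phase_shift (l : nat) (mu : R) :
  Cmult (stat_phase l (mu + PI / 8)) (stat_phase l (mu + PI / 8)) =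
  Cmult (0, -1) (Cmult (stat_phase l mu) (stat_phase l mu)).
Proof.
  unfold stat_phase. rewrite <- !cexp_plus.
  replace ((0, -1) : C) with (cexp (0, - (PI / 2))).
  - rewrite <- cexp_plus. f_equal. apply injective_projections; simpl; [ring|field].
  - rewrite cexp_im, cos_neg, sin_neg, cos_PI2, sin_PI2. reflexivity.
Qed.

(* Shifting mu by pi/8 multiplies the squared stationary phase by -i, so the squared stationary
   contribution cannot be almost real for both parameters. *)
Lemma connection_not_real (omega : R) (l : nat) (H : R -> C -> mat2) : 0 < omega ->
  (forall m, 0 < m -> gauge_solution omega l m (H m)) ->
  forall N, exists M, N < M /\ let h := H M (RtoC 1) in
    Im (Cplus (Cmult (m11 h) (m11 h)) (Cmult (m21 h) (m21 h))) <> 0.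
Proof.
  intros Hom HG N. apply NNPP. intros Hno.
  assert (Hz : forall M, N < M -> let h := H M (RtoC 1) in
    Im (Cplus (Cmult (m11 h) (m11 h)) (Cmult (m21 h) (m21 h))) = 0).
  { intros M HM h. apply NNPP. intros Hn. apply Hno. exists M. split; assumption. }
  destruct (stationary_term_almost_real omega l Hom) as [K [mu1 [HK [Hmu1 HA]]]].
  assert (Hp := PI_RGT_0). assert (Hp4 := PI_4).
  (* Chosen so that sqrt mu > [E] contradicts (5/84)^2 sqrt mu <= 2 K + 24, where 5/84 is the lower
     bound for the sine Fresnel integral. *)
  set (E := (2 * K + 24) * ((84 / 5) * (84 / 5))).
  assert (HE : 0 < E) by (unfold E; lra).
  set (mu := mu1 + Rabs N + 1 + E * E).
  assert (HN : N <= Rabs N) by apply Rle_abs. assert (HN0 := Rabs_pos N).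
  assert (Hmu : 1 <= mu) by (unfold mu; nra).
  assert (HmuN : N < mu) by (unfold mu; nra). assert (Hmu1' : mu1 <= mu) by (unfold mu; nra).
  assert (A1 := HA mu (H mu) Hmu1' (HG mu ltac:(lra)) (Hz mu HmuN)).
  assert (A2 := HA (mu + PI / 8) (H (mu + PI / 8)) ltac:(lra) (HG (mu + PI / 8) ltac:(lra)) (Hz (mu + PI / 8) ltac:(lra))).
  cbv zeta in A1, A2.
  assert (Hsq1 : 1 <= sqrt mu) by (rewrite <- sqrt_1; apply sqrt_le_1_alt, Hmu).
  assert (Hss : sqrt mu * sqrt mu = mu) by (apply sqrt_sqrt; lra).
  assert (Hle : sqrt mu <= sqrt (mu + PI / 8)) by (apply sqrt_le_1_alt; lra).
  destruct (stat_point_shift mu (PI / 8) Hmu ltac:(lra)) as [Y1 Y2].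
  assert (HF : Cmod (Cminus (fresnelC (stat_point (mu + PI / 8))) (fresnelC (stat_point mu))) <=
    2 * 1 * (stat_point (mu + PI / 8) - stat_point mu)).
  { apply (cderive_bound fresnelC (fun y => cexp (0, y * y))); [lra| |].
    - intros; apply fresnelC_derive.
    - intros; rewrite Cmod_cexp_im; lra. }
  unfold Rdiv in A1, A2, Y2. set (r := / sqrt mu) in *.
  assert (Hr : 0 < r) by (apply Rinv_0_lt_compat; lra).
  assert (Hr' : / sqrt (mu + PI * / 8) <= r) by (apply Rinv_le_contravar; unfold Rdiv in Hle; lra).
  assert (HY1 : 1 <= stat_point mu).
  { unfold stat_point. destruct sin_PI4_half as [S1 _]. nra. }
  assert (HL := fresnel_sin_lower (stat_point mu) HY1).
  assert (Hb := fresnelC_bound (stat_point mu)). assert (Hb' := fresnelC_bound (stat_point (mu + PI / 8))).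
  assert (Hph := stat_phase_shift l mu).
  assert (Hm1 : Cmod (Cmult (stat_phase l mu) (stat_phase l mu)) = 1).
  { rewrite Cmod_mult. unfold stat_phase. rewrite Cmod_cexp_im. ring. }
  change (mu + PI * / 8) with (mu + PI / 8) in *.
  set (F := fresnelC (stat_point mu)) in *. set (F' := fresnelC (stat_point (mu + PI / 8))) in *.
  set (q := Cmult (stat_phase l mu) (stat_phase l mu)) in *.
  replace (Cmult (Cmult (stat_phase l mu) F) (Cmult (stat_phase l mu) F)) with (Cmult q (Cmult F F)) in A1 by (unfold q; ring).
  replace (Cmult (Cmult (stat_phase l (mu + PI / 8)) F') (Cmult (stat_phase l (mu + PI / 8)) F')) with
    (Cmult (0, -1) (Cmult q (Cmult F' F'))) in A2 by (rewrite Cmult_assoc, <- Hph; ring).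
  assert (A2' : Im (Cmult (0, -1) (Cmult q (Cmult F' F'))) = - Re (Cmult q (Cmult F' F'))).
  { unfold Re, Im; simpl. ring. }
  rewrite A2', Rabs_Ropp in A2.
  (* The shift changes the Fresnel value by at most pi r / 2 <= 2 r, and the sum of the two values
     is at most 12 in modulus. *)
  assert (HFd : Cmod (Cmult q (Cminus (Cmult F' F') (Cmult F F))) <= 24 * r).
  { rewrite Cmod_mult, Hm1, Rmult_1_l.
    replace (Cminus (Cmult F' F') (Cmult F F)) with (Cmult (Cminus F' F) (Cplus F' F)) by ring.
    rewrite Cmod_mult. assert (T := Cmod_triangle F' F).
    replace (24 * r) with (2 * r * 12) by ring.
    apply Rmult_le_compat; try apply Cmod_ge_0; [|lra]. nra. }
  assert (HRe : Rabs (Re (Cmult q (Cmult F F))) <= K * r + 24 * r).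
  { replace (Cmult q (Cmult F F)) with (Cminus (Cmult q (Cmult F' F')) (Cmult q (Cminus (Cmult F' F') (Cmult F F)))) by ring.
    unfold Cminus at 1. change (Re (Cplus ?a ?b)) with (Re a + Re b).
    eapply Rle_trans; [apply Rabs_triang|]. apply Rplus_le_compat.
    - eapply Rle_trans; [exact A2|]. apply Rmult_le_compat_l; lra.
    - eapply Rle_trans; [apply Re_le_Cmod|]. rewrite Cmod_opp. exact HFd. }
  assert (HM : Cmod F * Cmod F <= (2 * K + 24) * r).
  { assert (Em : Cmod F * Cmod F = Cmod (Cmult q (Cmult F F))) by (rewrite !Cmod_mult, Hm1; ring).
    rewrite Em. eapply Rle_trans; [apply Cmod_le_sum|]. lra. }
  assert (HFl : 5 / 84 <= Cmod F).
  { eapply Rle_trans; [exact HL|]. eapply Rle_trans; [apply Rle_abs|]. exact (Im_le_Cmod F). }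
  assert (Hc : 5 / 84 * (5 / 84) <= (2 * K + 24) * r) by nra.
  assert (HEs : E < sqrt mu).
  { apply Rsqr_incrst_0; [|lra|lra]. unfold Rsqr. rewrite Hss. unfold mu. lra. }
  assert (Hc2 : 5 / 84 * (5 / 84) * sqrt mu <= 2 * K + 24).
  { replace (2 * K + 24) with ((2 * K + 24) * r * sqrt mu) by (unfold r; field; lra).
    apply Rmult_le_compat_r; lra. }
  unfold E in HEs. lra.
Qed.

Theorem mainTheorem15 (omega : R) (l : nat) (Homega : 0 < omega) :
  (forall mu : R, 0 < mu ->
     forall (alpha beta : R) (H : C -> mat2) (Q : mat2),
       sector_params alpha beta ->
       Hplus omega l mu alpha beta H ->
       transition l mu alpha H Q ->
       (* Q = [[-a, b], [-c, a]] : b = m12 Q, c = - m21 Q *)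
       Re (m12 Q) = 0 /\
       (constriction omega (omega * INR l) (2 * omega * mu) -> Re (Copp (m21 Q)) = 0)) /\
  ((1 <= l)%nat ->
     forall c : R -> C,
       (forall mu : R, 0 < mu ->
          exists (alpha beta : R) (H : C -> mat2) (Q : mat2),
            sector_params alpha beta /\ Hplus omega l mu alpha beta H /\
            transition l mu alpha H Q /\ c mu = Copp (m21 Q)) ->
       discrete_pos (fun mu => 0 < mu /\ Re (c mu) = 0)).
Proof.
  assert (ReCi : forall z, Re (Cmult Ci z) = - Im z) by (intros; unfold Re, Im; simpl; ring).
  split.
  - intros mu Hmu alpha beta H Q Hs HH HQ.
    assert (HG := Hplus_gauge_solution omega l mu alpha beta H Hs HH).
    destruct (transition_entries omega l mu alpha beta H Q Homega Hs HG HQ) as [E12 E21].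
    split.
    + rewrite E12, ReCi.
      destruct (gauge_pos_axis_reality omega l mu H 1 Homega Hmu HG Rlt_0_1) as [R1 R2].
      unfold Re, Im in *. simpl. rewrite R1, R2. ring.
    + intros Hc. destruct (constriction_translation _ _ _ Homega Hc) as [k Hk].
      replace (omega * INR l / omega) with (INR l) in Hk by (field; lra).
      replace (2 * omega * mu / omega) with (2 * mu) in Hk by (field; lra).
      rewrite E21, ReCi, (trivial_monodromy_real omega l mu H k Homega Hmu HG Hk). ring.
  - intros _ c Hc.
    (* One normalization is selected for each mu, so that c becomes a function of the entries at 1.
       The constant identity matrix fills in for nonpositive mu. *)
    assert (Hex : forall mu, exists H : C -> mat2, 0 < mu -> gauge_solution omega l mu H /\
      let h := H (RtoC 1) in Re (c mu) = - Im (Cplus (Cmult (m11 h) (m11 h)) (Cmult (m21 h) (m21 h)))).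
    { intros mu. destruct (classic (0 < mu)) as [Hmu|Hmu].
      - destruct (Hc mu Hmu) as [alpha [beta [H [Q [Hs [HH [HQ E]]]]]]].
        assert (HG := Hplus_gauge_solution omega l mu alpha beta H Hs HH).
        destruct (transition_entries omega l mu alpha beta H Q Homega Hs HG HQ) as [_ E21].
        exists H. intros _. split; [exact HG|]. intros h. rewrite E, E21, ReCi. reflexivity.
      - exists (fun _ => mId). intros Hp. contradiction. }
    set (H := fun mu => proj1_sig (constructive_indefinite_description _ (Hex mu))).
    assert (HH : forall mu, 0 < mu -> gauge_solution omega l mu (H mu) /\
      let h := H mu (RtoC 1) in Re (c mu) = - Im (Cplus (Cmult (m11 h) (m11 h)) (Cmult (m21 h) (m21 h))))
      by (intros mu; exact (proj2_sig (constructive_indefinite_description _ (Hex mu)))).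
    clearbody H.
    assert (HG : forall mu, 0 < mu -> gauge_solution omega l mu (H mu)) by (intros mu Hmu; apply HH, Hmu).
    (* Half the imaginary part of h11^2 + h21^2, written as products of real functions that are each
       analytic in mu. *)
    set (g := fun mu => Re (m11 (H mu (RtoC 1))) * Im (m11 (H mu (RtoC 1))) +
                        Re (m21 (H mu (RtoC 1))) * Im (m21 (H mu (RtoC 1)))).
    assert (Eg : forall mu, let h := H mu (RtoC 1) in
      Im (Cplus (Cmult (m11 h) (m11 h)) (Cmult (m21 h) (m21 h))) = 2 * g mu)
      by (intros mu h; unfold g, h, Re, Im; simpl; ring).
    assert (Hd : discrete_pos (fun mu => 0 < mu /\ g mu = 0)).
    { apply analytic_discrete.
      - intros mu Hmu. destruct (gauge_entries_analytic omega l H mu Homega HG Hmu) as [[A1 A2] [A3 A4]].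
        exact (analytic_plus _ _ _ (analytic_mult _ _ _ A3 A4) (analytic_mult _ _ _ A1 A2)).
      - intros N. destruct (connection_not_real omega l H Homega HG N) as [M [HM Hn]].
        exists M. split; [exact HM|]. intros Z. apply Hn. rewrite (Eg M), Z. ring. }
    intros m0 Hm0. destruct (Hd m0 Hm0) as [e [He Hm]]. exists e. split; [exact He|].
    intros m [Hmp Hmc] Hlt. apply Hm; [|exact Hlt]. split; [exact Hmp|].
    destruct (HH m Hmp) as [_ E]. cbv zeta in E. rewrite Hmc, (Eg m) in E. lra.
Qed.
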